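(* Let $(X_n)_{n\in\mathbb N}$ be a sequence of independent, identically distributed random variables such that $X_1$ is bounded and has a bounded density, and let $S_k = X_1+\dots+X_k$. For $a\in[0,1]$ put $f_a(x) = I\{\{x\}\le a\} - a$, where $\{x\}$ denotes the fractional part of $x$. Fix $x\neq 0$ and let $F_n(s)=F_n(s,x)$ be the empirical distribution function of the sample $\{S_1x\},\dots,\{S_nx\}$. Let $U$ be a uniform $(0,1)$ random variable independent of $(X_n)_{n\in\mathbb N}$, and define $$\Gamma(s,t) = \min(s,t) - st + \sum_{\varrho=1}^\infty \mathbb E\, f_s(U) f_t(U+S_\varrho x) + \sum_{\varrho=1}^\infty \mathbb E\, f_t(U) f_s(U+S_\varrho x), \qquad s,t\in[0,1].$$ Then, after suitably enlarging the probability space, there exist mean zero Gaussian processes $K_n(s)$, $s\in[0,1]$, with covariance functions $\Gamma_n(s,t)$, such that $$\sup_{(s,t)\in[0,1]^2} |\Gamma_n(s,t)-\Gamma(s,t)| = O(n^{-\alpha}) \quad\text{for all } \alpha<1/8,$$ and $$\sup_{0\le s\le 1} \bigl|\sqrt n\,(F_n(s)-s) - K_n(s)\bigr| = O(n^{-\gamma}) \quad \text{almost surely, for all } \gamma<1/16.$$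
   Context: Indicator $I\{\cdot\}$ of an event. The functions $f_a$ are 1-periodic; $\{y\}$ is the fractional part of $y$. *)

(* Defs.v *)
From HB Require Import structures.
From mathcomp Require Import all_boot all_order all_algebra finmap.
From mathcomp Require Import all_classical all_reals all_analysis.
Set Implicit Arguments. Unset Strict Implicit. Unset Printing Implicit Defensive.
Import Order.TTheory GRing.Theory Num.Theory.
Import numFieldNormedType.Exports.
Local Open Scope classical_set_scope.
Local Open Scope ring_scope.

Section Defs.
Context {R : realType} {d : measure_display} {T : measurableType d}.
Variable P : probability T R.

Definition frac (y : R) : R := y - (Num.floor y)%:~R.

Definition fa (a y : R) : R := (if frac y <= a then 1 else 0) - a.

Definition expect (f : T -> R) : R := fine (\int[P]_w (f w)%:E)%E.

Definition mutual_indep (I : choiceType) (Y : I -> T -> R) : Prop :=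
  forall (J : {fset I}) (B : I -> set R),
    (forall i, i \in J -> measurable (B i)) ->
    P (\bigcap_(i in [set i | i \in J]) (Y i @^-1` B i)) =
    (\prod_(i <- J) P (Y i @^-1` B i))%E.

Definition has_bounded_density (Y : T -> R) : Prop :=
  exists g : R -> R,
    measurable_fun setT g /\ (forall y, 0 <= g y) /\
    (exists M : R, forall y, g y <= M) /\
    forall B, measurable B ->
      P (Y @^-1` B) = (\int[lebesgue_measure]_(y in B) (g y)%:E)%E.

Definition is_uniform01 (Y : T -> R) : Prop :=
  forall B, measurable B ->
    P (Y @^-1` B) = lebesgue_measure (B `&` `[0%R, 1%R]%classic).

Definition centered_gaussian (Z : T -> R) : Prop :=
  measurable_fun setT Z /\
  exists v : R, 0 <= v /\
    if v == 0 then P [set w | Z w = 0] = 1%E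
    else forall B, measurable B ->
      P (Z @^-1` B) = normal_prob 0 (Num.sqrt v) B.

Definition gaussian_process (K : R -> T -> R) : Prop :=
  (forall s, 0 <= s <= 1 -> measurable_fun setT (K s)) /\
  forall (ss cs : seq R), all (fun s => 0 <= s <= 1) ss ->
    centered_gaussian (fun w => \sum_(i < size ss) cs`_i * K ss`_i w).

(* covariance function of a mean zero process *)
Definition covariance_fun (K : R -> T -> R) (s t : R) : R :=
  expect (fun w => K s w * K t w).

(* partial sums S_k = X_1 + ... + X_k, with X_{i+1} represented by X i *)
Definition Ssum (X : nat -> T -> R) (k : nat) (w : T) : R :=
  \sum_(i < k) X i w.

Definition Femp (X : nat -> T -> R) (x : R) (n : nat) (s : R) (w : T) : R :=
  (n%:R)^-1 * \sum_(1 <= k < n.+1) (if frac (Ssum X k w * x) <= s then 1 else 0).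

Definition Gamma (X : nat -> T -> R) (U : T -> R) (x s t : R) : R :=
  Num.min s t - s * t
  + limn (fun N => \sum_(1 <= r < N)
        expect (fun w => fa s (U w) * fa t (U w + Ssum X r w * x)))
  + limn (fun N => \sum_(1 <= r < N)
        expect (fun w => fa t (U w) * fa s (U w + Ssum X r w * x))).

End Defs.

(* Main.v *)
(** The walk [Y_k = S_k x] modulo 1 is a Markov chain whose step has a density,
    so its transition operator contracts geometrically towards the uniform law,
    and [f_s] has a bounded solution [g_s] of the Poisson equation.  Up to a
    bounded error, [sqrt n (F_n(s) - s)] is then [n^(-1/2)] times a martingale
    with bounded differences [D_s], and [E D_s D_t] under the stationary law is
    [Gamma s t].

    For [k^8 <= n < (k+1)^8] the martingale is frozen at time [N = k^8] and at
    the [k] grid points [i/k]; the remaining fluctuations are [O(k^(-1/2))] up to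
    logarithms, by exponential inequalities over a fine grid and by monotonicity
    of the empirical distribution function in [s].  The frozen [k]-dimensional
    vector, divided by [sigma = l/sqrt k] with [l] of order [log k], is smoothed
    by an independent standard normal vector; a Lindeberg replacement for the
    smoothed law gives a total variation distance [O(1/(k l^2))] to the Gaussian
    vector with covariance [Gamma(i/k,j/k)/sigma^2 + delta_ij].  This is summable
    over [k], so a maximal coupling and Borel-Cantelli yield the almost sure bound
    [O(l^2/sqrt k)], while the covariance error is [O(l^2/k)].

    No enlargement of the probability space is needed: the normal variables and
    the acceptance variables of the coupling are quantile transforms of the
    steps [X_N, X_(N+1), ...], which are independent of the first [N] ones. *)

From HB Require Import structures.
From mathcomp Require Import all_boot all_order all_algebra finmap.
From mathcomp Require Import all_classical all_reals all_analysis.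
From mathcomp Require Import measurable_realfun ring lra zify.
Set Implicit Arguments. Unset Strict Implicit. Unset Printing Implicit Defensive.
Import Order.TTheory GRing.Theory Num.Theory.
Import numFieldNormedType.Exports.
Local Open Scope classical_set_scope.
Local Open Scope ring_scope.
Require Import Defs.

(** * Integrals with respect to probability measures *)

Section Rintegral_theory.
Context {d : measure_display} {T : measurableType d} {R : realType}.
Variable P : probability T R.
Implicit Types f g : T -> R.

Definition intg f := P.-integrable setT (EFin \o f).

Lemma intg_bounded f (M : R) : measurable_fun setT f ->
  (forall x, `|f x| <= M) -> intg f.
Proof.
move=> mf fM; apply: (@le_integrable _ _ _ P setT measurableT _ (EFin \o cst M)).
- exact/measurable_EFinP.
- by move=> x _ /=; rewrite lee_fin (le_trans (fM x))// ler_norm.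
- exact: finite_measure_integrable_cst.
Qed.

Lemma intg_dom f g : measurable_fun setT f -> (forall x, `|f x| <= g x) ->
  intg g -> intg f.
Proof.
move=> mf fg; apply: le_integrable => //; first exact/measurable_EFinP.
by move=> x _ /=; rewrite lee_fin (le_trans (fg x))// ler_norm.
Qed.

Lemma intg_cst (c : R) : intg (fun=> c).
Proof. exact: finite_measure_integrable_cst. Qed.

Lemma intgD f g : intg f -> intg g -> intg (fun x => f x + g x).
Proof.
move=> fi gi; have := integrableD measurableT fi gi.
by apply: eq_integrable => // x _.
Qed.

Lemma intgZl (c : R) f : intg f -> intg (fun x => c * f x).
Proof.
move=> fi; have := integrableZl measurableT c fi.
by apply: eq_integrable => // x _.
Qed.

Lemma intgN f : intg f -> intg (fun x => - f x).
Proof. by move=> /(intgZl (-1)); under eq_fun do rewrite mulN1r. Qed.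

Lemma intgB f g : intg f -> intg g -> intg (fun x => f x - g x).
Proof. by move=> fi gi; apply: intgD => //; exact: intgN. Qed.

Lemma intg_norm f : intg f -> intg (fun x => `|f x|).
Proof.
move=> fi; have := integrable_abse fi.
by apply: eq_integrable => // x _.
Qed.

Lemma intg_sum (I : Type) (s : seq I) (f : I -> T -> R) :
  (forall i, intg (f i)) -> intg (fun x => \sum_(i <- s) f i x).
Proof.
move=> fi; elim: s => [|i s ih].
  by under eq_fun do rewrite big_nil; exact: intg_cst.
by under eq_fun do rewrite big_cons; apply: intgD.
Qed.

Lemma intg_meas f : intg f -> measurable_fun setT f.
Proof. by move/measurable_int/measurable_EFinP. Qed.

Lemma RintD f g : intg f -> intg g ->
  \int[P]_x (f x + g x) = \int[P]_x f x + \int[P]_x g x.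
Proof. by move=> fi gi; rewrite RintegralD. Qed.

Lemma RintB f g : intg f -> intg g ->
  \int[P]_x (f x - g x) = \int[P]_x f x - \int[P]_x g x.
Proof. by move=> fi gi; rewrite RintegralB. Qed.

Lemma RintZl (c : R) f : intg f -> \int[P]_x (c * f x) = c * \int[P]_x f x.
Proof. by move=> fi; rewrite RintegralZl. Qed.

Lemma Rint_cst (c : R) : \int[P]_x c = c.
Proof. by rewrite Rintegral_cst// [X in fine X](@probability_setT _ _ _ P) mulr1. Qed.

Lemma Rint_sum (I : Type) (s : seq I) (f : I -> T -> R) :
  (forall i, intg (f i)) ->
  \int[P]_x (\sum_(i <- s) f i x) = \sum_(i <- s) \int[P]_x f i x.
Proof.
move=> fi; elim: s => [|i s ih].
  by under eq_Rintegral do rewrite big_nil; rewrite big_nil Rint_cst.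
under eq_Rintegral do rewrite big_cons.
by rewrite big_cons RintD ?ih//; exact: intg_sum.
Qed.

Lemma Rint_le f g : intg f -> intg g -> (forall x, f x <= g x) ->
  \int[P]_x f x <= \int[P]_x g x.
Proof. by move=> fi gi fg; apply: le_Rintegral => // x _. Qed.

Lemma Rint_ge0 f : (forall x, 0 <= f x) -> 0 <= \int[P]_x f x.
Proof. by move=> f0; apply: Rintegral_ge0 => x _. Qed.

Lemma Rint_abs_le f g : measurable_fun setT f -> intg g ->
  (forall x, `|f x| <= g x) -> `|\int[P]_x f x| <= \int[P]_x g x.
Proof.
move=> mf gi fg; have fi := intg_dom mf fg gi.
rewrite (le_trans (le_normr_Rintegral measurableT fi))//.
by apply: Rint_le => //; exact: intg_norm.
Qed.

Lemma Rint_abs_bound f (M : R) : measurable_fun setT f ->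
  (forall x, `|f x| <= M) -> `|\int[P]_x f x| <= M.
Proof.
by move=> mf fM; rewrite -[leRHS]Rint_cst; apply: Rint_abs_le => //; exact: intg_cst.
Qed.

Lemma EFin_Rint f : intg f -> (\int[P]_x f x)%:E = (\int[P]_x (f x)%:E)%E.
Proof. by move=> fi; rewrite /Rintegral fineK//; exact: integrable_fin_num. Qed.

Lemma Rint_indic A : measurable A -> \int[P]_x (\1_A x) = fine (P A).
Proof. by move=> mA; rewrite /Rintegral integral_indic// setIT. Qed.

Lemma intg_ge0_fin f (M : R) : measurable_fun setT f -> (forall x, 0 <= f x) ->
  (\int[P]_x (f x)%:E <= M%:E)%E -> intg f /\ \int[P]_x f x <= M.
Proof.
move=> mf f0 fM; have fi : intg f.
  apply/integrableP; split; first exact/measurable_EFinP.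
  apply: le_lt_trans (ltry M); apply: le_trans fM; apply: ge0_le_integral => //.
  - by apply/measurable_EFinP; exact: measurableT_comp.
  - exact/measurable_EFinP.
  - by move=> x _ /=; rewrite lee_fin ger0_norm.
by split => //; rewrite -lee_fin EFin_Rint.
Qed.

Lemma markov_exp f (l : R) (M : R) : measurable_fun setT f ->
  (\int[P]_x (expR (f x))%:E <= M%:E)%E ->
  (P [set x | (l <= f x)%R] <= (M * expR (- l))%:E)%E.
Proof.
move=> mf fM.
have mA : measurable [set x | l <= f x].
  by rewrite -[X in measurable X]setTI; exact: measurable_fun_le.
have : ((expR l)%:E * P [set x | (l <= f x)%R] <= M%:E)%E.
  apply: le_trans fM; rewrite -[X in P X]setIT -integral_indic//.
  rewrite -ge0_integralZl_EFin//; last first.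
    exact/measurable_EFinP/measurable_indic.
  apply: ge0_le_integral => //.
  - by apply/measurable_EFinP/measurable_funM => //; exact/measurable_indic.
  - exact/measurable_EFinP/measurableT_comp.
  - move=> x _; rewrite -EFinM lee_fin indicE.
    have [|] := boolP (x \in _); last by rewrite mulr0 expR_ge0.
    by rewrite inE /= mulr1 ler_expR.
rewrite -[P _]fineK ?fin_num_measure//.
by rewrite -EFinM !lee_fin mulrC expRN ler_pdivlMr// expR_gt0.
Qed.

End Rintegral_theory.

Lemma measurable_Rint_param {d1 d2} {T1 : measurableType d1} {T2 : measurableType d2}
    {R : realType} (P2 : probability T2 R) (f : T1 * T2 -> R) (G : T2 -> R) :
  measurable_fun setT f -> (forall x y, `|f (x, y)| <= G y) -> intg P2 G ->
  measurable_fun setT (fun x => \int[P2]_y f (x, y)).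
Proof.
move=> mf fG iG; have mG := intg_meas iG.
have ix x : intg P2 (fun y => f (x, y)).
  by apply: intg_dom (fG x) iG; exact: measurableT_comp.
pose F (z : T1 * T2) := ((f z + G z.2)%:E)%E.
have mF : measurable_fun setT F.
  by apply/measurable_EFinP/measurable_funD => //; exact: measurableT_comp.
have F0 z : (0 <= F z)%E.
  case: z => x y; rewrite lee_fin -lerBlDr sub0r; exact: (lerNnormlW (fG x y)).
have mI := measurable_fun_fubini_tonelli_F (m2 := P2) F mF F0.
apply/measurable_EFinP.
have -> : (EFin \o fun x => \int[P2]_y f (x, y)) =
    (fun x => fubini_F P2 F x - (\int[P2]_y G y)%:E)%E.
  apply/funext => x; rewrite /fubini_F /F /= -EFin_Rint; last exact: intgD.
  by rewrite RintD//= -EFinB addrK.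
by apply: emeasurable_funB => //; exact: measurable_cst.
Qed.

Section fubini_dominated.
Context {d1 d2 : measure_display} {T1 : measurableType d1} {T2 : measurableType d2}
  {R : realType}.
Variables (P1 : probability T1 R) (P2 : probability T2 R).
Variables (f : T1 * T2 -> R) (G : T2 -> R).
Hypotheses (mf : measurable_fun setT f) (fG : forall x y, `|f (x, y)| <= G y)
  (iG : intg P2 G).

Lemma intg_section x : intg P2 (fun y => f (x, y)).
Proof.
apply: intg_dom (fG x) iG; exact: measurableT_comp.
Qed.

Lemma intg_section2 y : intg P1 (fun x => f (x, y)).
Proof.
by apply: (@intg_bounded _ _ _ _ _ (G y)) => //; exact: measurableT_comp.
Qed.

Lemma intg_prod : (P1 \x P2)%E.-integrable setT (EFin \o f).
Proof.
apply/integrable12ltyP; first exact/measurable_EFinP.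
apply: (@le_lt_trans _ _ (\int[P1]_x (\int[P2]_y G y)%:E)%E).
  apply: ge0_le_integral => //.
  - by move=> x _; exact: integral_ge0.
  - apply: (measurable_fun_fubini_tonelli_F (m2 := P2) (fun z => `|(f z)%:E|%E)) => //.
    by apply: measurableT_comp => //; exact/measurable_EFinP.
  - move=> x _; rewrite EFin_Rint//; apply: ge0_le_integral => //.
    + by apply/measurable_EFinP; do 2 apply: measurableT_comp => //.
    + exact/measurable_EFinP/intg_meas/iG.
    + by move=> y _; rewrite lee_fin.
by rewrite integral_cst// [X in (_ * X)%E](@probability_setT _ _ _ P1) mule1 ltry.
Qed.

Lemma measurable_Rint_section : measurable_fun setT (fun x => \int[P2]_y f (x, y)).
Proof. exact: measurable_Rint_param iG. Qed.

Lemma intg_Rint_section : intg P1 (fun x => \int[P2]_y f (x, y)).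
Proof.
apply: (@intg_bounded _ _ _ _ _ (\int[P2]_y G y)); first exact: measurable_Rint_section.
move=> x; apply: Rint_abs_le => //; exact: measurableT_comp.
Qed.

Lemma measurable_Rint_section2 : measurable_fun setT (fun y => \int[P1]_x f (x, y)).
Proof.
have := measurable_fubini_G intg_prod => mF.
apply/measurable_EFinP; apply: eq_measurable_fun mF => x _.
by rewrite /fubini_G /= EFin_Rint//; exact: intg_section2.
Qed.

Lemma intg_Rint_section2 : intg P2 (fun y => \int[P1]_x f (x, y)).
Proof.
apply: intg_dom iG; first exact: measurable_Rint_section2.
by move=> y; apply: Rint_abs_bound => //; exact: measurableT_comp.
Qed.

Lemma Rint_fubini : \int[P1]_x \int[P2]_y f (x, y) = \int[P2]_y \int[P1]_x f (x, y).
Proof.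
apply: EFin_inj; rewrite !EFin_Rint; last 2 first.
  exact: intg_Rint_section2.
  exact: intg_Rint_section.
transitivity (\int[P1]_x \int[P2]_y (f (x, y))%:E)%E.
  by apply: eq_integral => x _; rewrite EFin_Rint//; exact: intg_section.
rewrite (Fubini intg_prod).
by apply: eq_integral => y _; rewrite EFin_Rint//; exact: intg_section2.
Qed.

End fubini_dominated.

Lemma ge0_integral_density {d} {T : measurableType d} {R : realType}
    (mu nu : {measure set T -> \bar R}) (g : T -> R) (f : T -> \bar R) :
  measurable_fun setT g -> (forall x, 0 <= g x) ->
  (forall A, measurable A -> nu A = (\int[mu]_(x in A) (g x)%:E)%E) ->
  measurable_fun setT f -> (forall x, (0 <= f x)%E) ->
  (\int[nu]_x f x = \int[mu]_x (f x * (g x)%:E))%E.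
Proof.
Import HBNNSimple.
move=> mg g0 nuE mf f0; pose h := nnsfun_approx measurableT mf.
have hf x : (EFin \o h n) x @[n --> \oo] --> f x.
  by apply: cvg_nnsfun_approx => // y _.
transitivity (lim ((\int[nu]_x (EFin \o h n) x)%E @[n --> \oo])).
  rewrite -monotone_convergence//.
  - by apply: eq_integral => x _; apply/esym/cvg_lim.
  - by move=> n; exact/measurable_EFinP.
  - by move=> n x _; rewrite lee_fin.
  - by move=> x _ m n mn; rewrite lee_fin; exact/lefP/nd_nnsfun_approx.
transitivity (lim ((\int[mu]_x ((EFin \o h n) x * (g x)%:E))%E @[n --> \oo])); last first.
  rewrite -monotone_convergence//.
  - apply: eq_integral => x _; apply/cvg_lim => //.
    by apply: cvgeZr => //.
  - by move=> n; apply: emeasurable_funM; exact/measurable_EFinP.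
  - by move=> n x _; rewrite mule_ge0// lee_fin.
  - move=> x _ m n mn; rewrite lee_wpmul2r ?lee_fin//.
    exact/lefP/nd_nnsfun_approx.
apply: congr_lim; apply/funext => n.
under eq_integral do rewrite /= fimfunE -fsumEFin//.
under [RHS]eq_integral => x _.
  rewrite /= fimfunE -fsumEFin//.
  rewrite ge0_mule_fsuml; last by move=> r; rewrite EFinM nnfun_muleindic_ge0.
  over.
rewrite !ge0_integral_fsum//; last 4 first.
- move=> r; apply: emeasurable_funM; last exact/measurable_EFinP.
  by apply/measurable_EFinP; apply: measurableT_comp.
- by move=> r x _; rewrite mule_ge0 ?lee_fin// -lee_fin EFinM nnfun_muleindic_ge0.
- by move=> r; apply/measurable_EFinP; apply: measurableT_comp.
- by move=> r x _; rewrite EFinM nnfun_muleindic_ge0.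
apply: eq_fsbigr => r _; have [r0|r0] := leP 0 r; last first.
  rewrite preimage_nnfun0//; under eq_integral do rewrite indic0 mulr0.
  under [RHS]eq_integral do rewrite indic0 mulr0 mul0e.
  by rewrite !integral0.
under eq_integral do rewrite EFinM.
under [RHS]eq_integral do rewrite EFinM -muleA.
rewrite !ge0_integralZl_EFin//; last 3 first.
- by move=> x _; rewrite mule_ge0 ?lee_fin.
- by apply: emeasurable_funM; exact/measurable_EFinP.
- exact/measurable_EFinP.
congr (_ * _)%E; rewrite integral_indic// setIT nuE//.
rewrite integral_mkcond; apply: eq_integral => x _.
rewrite patchE indicE; case: ifPn => _; by rewrite ?mul1e ?mul0e.
Qed.

(** * Independence from the past *)

Section past.
Context {d : measure_display} {T : measurableType d} {R : realType}.
Variables (P : probability T R) (xi : nat -> T -> R).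

Definition indep_seq := forall n (B : nat -> set R),
  (forall i, measurable (B i)) ->
  P (\bigcap_(i in `I_n) (xi i @^-1` B i)) = (\prod_(i < n) P (xi i @^-1` B i))%E.

Definition boxes n : set (set T) :=
  [set A | exists2 B : nat -> set R, (forall i, measurable (B i)) &
     A = \bigcap_(i in `I_n) (xi i @^-1` B i)].

Definition past n := g_sigma_algebraType (boxes n).

Hypothesis mxi : forall n, measurable_fun setT (xi n).

Let mxiB i (B : set R) : measurable B -> measurable (xi i @^-1` B).
Proof. by move=> mB; rewrite -[X in measurable X]setTI; exact: mxi. Qed.

Lemma boxes_measurable n : boxes n `<=` measurable.
Proof. by move=> A [B mB ->]; apply: fin_bigcap_measurable => // i _; exact: mxiB. Qed.

Lemma past_measurable n (A : set T) : (measurable : set (set (past n))) A ->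
  measurable A.
Proof.
apply: smallest_sub; [exact: sigma_algebra_measurable|exact: boxes_measurable].
Qed.

Lemma measurable_past n {d'} {T' : measurableType d'} (f : T -> T') :
  measurable_fun [set: past n] (f : past n -> T') -> measurable_fun setT f.
Proof. by move=> mf mT B mB; apply: (@past_measurable n); exact: mf. Qed.

Lemma boxesS n : boxes n `<=` boxes n.+1.
Proof.
move=> A [B mB ->]; exists (fun i => if (i < n)%N then B i else setT).
  by move=> i; case: ifP.
rewrite eqEsubset; split => w /= Bw i /= ilt.
  by case: ifP => // ilt'; exact: Bw.
by have := Bw i (ltnW ilt : (i < n.+1)%N); rewrite ilt.
Qed.

Lemma past_sub n m (A : set T) : (n <= m)%N ->
  (measurable : set (set (past n))) A -> (measurable : set (set (past m))) A.
Proof.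
move=> nm mA; suff : (boxes n `<=` boxes m).
  by move=> nmb; exact: (sub_sigma_algebra2 nmb mA).
elim: m nm => [|m ih]; first by rewrite leqn0 => /eqP ->.
by rewrite leq_eqVlt => /predU1P[->//|/ih]; move/subset_trans; apply; exact: boxesS.
Qed.

Lemma measurable_past_le n m {d'} {T' : measurableType d'} (f : T -> T') :
  (n <= m)%N -> measurable_fun [set: past n] (f : past n -> T') ->
  measurable_fun [set: past m] (f : past m -> T').
Proof. by move=> nm mf mT B mB; apply: past_sub nm _; exact: mf. Qed.

Lemma measurable_past_xi n i : (i < n)%N ->
  measurable_fun [set: past n] (xi i : past n -> R).
Proof.
move=> ilt _ B mB; rewrite setTI; apply: sub_sigma_algebra.
exists (fun j => if j == i then B else setT); first by move=> j; case: ifP.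
rewrite eqEsubset; split => w /=; last by move=> /(_ i ilt); rewrite eqxx.
by move=> Bw j /= jn; case: ifP => // /eqP ->.
Qed.

Hypothesis Hind : indep_seq.

Lemma past_indep n (A : set T) (B : set R) :
  (measurable : set (set (past n))) A -> measurable B ->
  P (A `&` (xi n @^-1` B)) = (P A * P (xi n @^-1` B))%E.
Proof.
move=> mA mB; have mD := mxiB n mB.
have fD : P (xi n @^-1` B) \is a fin_num by exact: fin_num_measure.
pose m1 := mrestr P mD.
pose m2 := mscale (NngNum (fine_ge0 (measure_ge0 P (xi n @^-1` B)))) P.
have : m1 A = m2 A.
  apply: (g_sigma_algebra_measure_unique (boxes n) _ (fun=> setT)) => //.
  - exact: boxes_measurable.
  - by move=> _; exists (fun=> setT) => //; rewrite eqEsubset; split => // w _ i.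
  - by rewrite bigcup_const//; exists 0%N.
  - move=> _ _ [B1 mB1 ->] [B2 mB2 ->]; exists (fun i => B1 i `&` B2 i).
      by move=> i; exact: measurableI.
    by rewrite -bigcapI; apply: eq_bigcapr => i _; rewrite preimage_setI.
  - move=> _ [C mC ->]; rewrite /m1 /m2 /mrestr /mscale /=.
    pose C' i := if (i < n)%N then C i else B.
    have mC' i : measurable (C' i) by rewrite /C'; case: ifP.
    have := @Hind n.+1 _ mC'; rewrite big_ord_recr /= {3}/C' ltnn.
    have -> : \bigcap_(i < n.+1) xi i @^-1` C' i =
        \bigcap_(i in `I_n) xi i @^-1` C i `&` xi n @^-1` B.
      rewrite eqEsubset; split => w /=.
        move=> Cw; split; last by have := Cw n (ltnSn n); rewrite /= /C' ltnn.
        by move=> i /= ilt; have := Cw i (ltnW ilt : (i < n.+1)%N); rewrite /= /C' ilt.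
      move=> [Cw Bw] i /=; rewrite ltnS leq_eqVlt /C' => /predU1P[->|ilt].
        by rewrite ltnn.
      by rewrite ilt; exact: Cw.
    rewrite {1}/mrestr => ->; rewrite /mscale /= muleC fineK//; congr (_ * _)%E.
    by rewrite Hind//; apply: eq_bigr => i _; rewrite /C' ltn_ord.
  - move=> k; apply: (@le_lt_trans _ _ 1%E); last exact: ltry.
    by apply: probability_le1; exact: measurableI.
by rewrite /m1 /m2 /mrestr /mscale /= fineK// muleC.
Qed.

Variables (n : nat) (mu : probability R R).
Hypothesis muE : forall B, measurable B -> P (xi n @^-1` B) = mu B.

Let mid : measurable_fun [set: T] (id : T -> past n).
Proof. by move=> _ B mB; rewrite setTI; exact: (@past_measurable n). Qed.

Let mpair : measurable_fun [set: T] (fun w => (w : past n, xi n w)).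
Proof.
apply: (measurable_fun_pair (f := (id : T -> past n)) (g := xi n)) => //.
Qed.

Lemma past_integral (f : past n * R -> \bar R) :
  measurable_fun setT f -> (forall x, (0 <= f x)%E) ->
  (\int[P]_w f ((w : past n), xi n w) = \int[P]_w \int[mu]_z f ((w : past n), z))%E.
Proof.
move=> mf f0.
pose fid : {mfun T >-> past n} :=
  HB.pack (id : T -> past n) (isMeasurableFun.Build _ _ _ _ _ mid).
pose fpair : {mfun T >-> (past n * R)%type} :=
  HB.pack (fun w : T => (w : past n, xi n w)) (isMeasurableFun.Build _ _ _ _ _ mpair).
pose Pn : probability (past n) R := distribution P fid.
pose m' : probability (past n * R)%type R := distribution P fpair.
have eqm A : measurable A -> (Pn \x mu)%E A = m' A.
  apply: product_measure_unique => A1 A2 mA1 mA2.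
  by rewrite /m' /distribution /pushforward /= -muE// -past_indep.
transitivity (\int[m']_z f z)%E.
  by rewrite ge0_integral_distribution.
transitivity (\int[(Pn \x mu)%E]_z f z)%E.
  by apply: eq_measure_integral => A mA _; exact/esym/eqm.
rewrite fubini_tonelli1// ge0_integral_distribution//.
  exact: measurable_fun_fubini_tonelli_F.
by move=> w; apply: integral_ge0 => z _.
Qed.

Lemma past_Rint (f : past n * R -> R) (M : R) :
  measurable_fun setT f -> (forall x, `|f x| <= M) ->
  \int[P]_w f ((w : past n), xi n w) = \int[P]_w \int[mu]_z f ((w : past n), z).
Proof.
move=> mf fM.
have mfw : measurable_fun setT (fun w : T => f ((w : past n), xi n w)).
  by apply: (measurableT_comp mf); exact: mpair.
have iw : intg P (fun w : T => f ((w : past n), xi n w)) by exact: intg_bounded.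
have mfz (w : past n) : measurable_fun setT (fun z => f (w, z)).
  exact: measurableT_comp.
have iz (w : past n) : intg mu (fun z => f (w, z)) by exact: intg_bounded.
have mF : measurable_fun setT (fun w : past n => \int[mu]_z f (w, z)).
  exact: (@measurable_Rint_param _ _ _ _ _ _ _ (fun=> M) _ _ (intg_cst _ _)).
have iF : intg P (fun w : T => \int[mu]_z f ((w : past n), z)).
  apply: (@intg_bounded _ _ _ _ _ M); first exact: measurable_past mF.
  by move=> w; apply: Rint_abs_bound.
have iwM : intg P (fun w : T => f ((w : past n), xi n w) + M).
  by apply: intgD => //; exact: intg_cst.
have iFM : intg P (fun w : T => \int[mu]_z f ((w : past n), z) + M).
  by apply: intgD => //; exact: intg_cst.
have : \int[P]_w (f ((w : past n), xi n w) + M) =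
    \int[P]_w ((\int[mu]_z f ((w : past n), z)) + M).
  apply: EFin_inj; rewrite !EFin_Rint//.
  apply: eq_trans; first apply: (@past_integral (fun x => (f x + M)%:E)).
  - by apply/measurable_EFinP/measurable_funD.
  - by move=> x; rewrite lee_fin -lerBlDr sub0r (lerNnormlW (fM x)).
  - apply: eq_integral => w _.
    rewrite -EFin_Rint; last by apply: intgD; [exact: iz|exact: intg_cst].
    by rewrite (RintD (iz w) (intg_cst _ _)) Rint_cst.
rewrite (RintD iw (intg_cst _ _)) (RintD iF (intg_cst _ _)) !Rint_cst.
exact: addIr.
Qed.

End past.

(** * Gaussian vectors *)

(* The library's [lebesgue_measure] lives on the alias [measurableTypeR R]. *)
Definition lebR {R : realType} : set R -> \bar R := @lebesgue_measure R.

Section lebR.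
Context {R : realType}.

Let lebR0 : @lebR R set0 = 0%E. Proof. exact: measure0. Qed.

Let lebR_ge0 (A : set R) : (0 <= lebR A)%E. Proof. exact: measure_ge0. Qed.

Let lebR_additive : semi_sigma_additive (@lebR R).
Proof. exact: (@measure_semi_sigma_additive _ _ _ (@lebesgue_measure R)). Qed.

HB.instance Definition _ := isMeasure.Build _ R R (@lebR R) lebR0 lebR_ge0 lebR_additive.

Let lebR_sigma_finite : sigma_finite setT (@lebR R).
Proof. exact: (@sigma_finiteT _ _ _ (@lebesgue_measure R)). Qed.

HB.instance Definition _ := Measure_isSigmaFinite.Build _ R R (@lebR R) lebR_sigma_finite.

End lebR.

Definition measurableTypeR_id {R : realType} : {mfun measurableTypeR R >-> R} :=
  HB.pack (id : measurableTypeR R -> R) (isMeasurableFun.Build _ _ _ _ _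
    (@measurable_id _ (measurableTypeR R) setT :
       measurable_fun _ (id : measurableTypeR R -> R))).

Lemma ge0_integral_lebR {R : realType} (D : set R) (f : R -> \bar R) : measurable D ->
  measurable_fun D f -> (forall x, 0 <= f x)%E ->
  (\int[lebR]_(x in D) f x = \int[@lebesgue_measure R]_(x in D) f x)%E.
Proof.
move=> mD mf f0.
transitivity (\int[pushforward (@lebesgue_measure R) measurableTypeR_id]_(x in D) f x)%E.
  by apply: eq_measure_integral.
by rewrite ge0_integral_pushforward// => x _.
Qed.

Section lebesgue_affine.
Context {R : realType}.
Notation mu := (@lebR R).

Lemma lebR_unique (m : {measure set R -> \bar R}) :
  (forall a b, a < b -> lebR `]a, b]%classic = m `]a, b]%classic) ->
  forall A, measurable A -> lebR A = m A.
Proof.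
move=> mE; pose m0 : set (measurableTypeR R) -> \bar R := m.
have m0E : m0 set0 = 0%E by exact: measure0.
have m0_ge0 A : (0 <= m0 A)%E by exact: measure_ge0.
have m0_add : semi_sigma_additive m0 by exact: (@measure_semi_sigma_additive _ _ _ m).
pose m1 : {measure set (measurableTypeR R) -> \bar R} :=
  HB.pack m0 (isMeasure.Build _ _ _ m0 m0E m0_ge0 m0_add).
apply: (@lebesgue_measure_unique _ m1) => _ [[u v] _ <-].
have [uv|vu] := ltP u v; first exact: mE.
by rewrite set_itv_ge ?bnd_simp -?leNgt// !measure0.
Qed.

Lemma lebesgue_affine_preimage (a c : R) (A : set R) : a != 0 -> measurable A ->
  mu A = (`|a|%:E * mu ((fun x => (a * x + c)%R) @^-1` A))%E.
Proof.
move=> a0 mA.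
have mf : measurable_fun [set: R] (fun x : R => a * x + c).
  by apply: measurable_funD => //; exact: measurable_funM.
pose f : {mfun R >-> R} :=
  HB.pack (fun x : R => a * x + c) (isMeasurableFun.Build _ _ _ _ _ mf).
pose m : {measure set (R) -> \bar R} :=
  mscale (NngNum (normr_ge0 a)) (pushforward mu f).
suff -> : mu A = m (measurable_funP f) A by [].
apply: lebR_unique => // u v uv.
change (mu `]u, v]%classic =
  (`|a|%:E * mu ((fun x => (a * x + c)%R) @^-1` `]u, v]%classic))%E).
have [a_gt0|] := ltP 0 a.
  rewrite (_ : _ @^-1` _ = `](u - c) / a, (v - c) / a]%classic).
    rewrite /lebR !lebesgue_measure_itv/= !lte_fin uv ltr_pM2r ?invr_gt0// ltrD2r uv.
    by rewrite gtr0_norm// -!EFinB -EFinM; congr _%:E; field.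
  apply/seteqP; split => x; rewrite /= !in_itv/=.
    by rewrite ltr_pdivrMr// ler_pdivlMr// ltrBlDr lerBrDr mulrC.
  by rewrite ltr_pdivrMr// ler_pdivlMr// ltrBlDr lerBrDr mulrC.
rewrite le_eqVlt (negbTE a0) /= => a_lt0.
rewrite (_ : _ @^-1` _ = `[(v - c) / a, (u - c) / a[%classic).
  rewrite /lebR !lebesgue_measure_itv/= !lte_fin uv ltr_nM2r ?invr_lt0// ltrD2r uv.
  by rewrite ltr0_norm// -!EFinB -EFinM; congr _%:E; field.
apply/seteqP; split => x; rewrite /= !in_itv/=.
  by rewrite ltr_ndivlMr// ler_ndivrMr// ltrBlDr lerBrDr mulrC andbC.
by rewrite ltr_ndivlMr// ler_ndivrMr// ltrBlDr lerBrDr mulrC andbC.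
Qed.

Lemma ge0_integral_affine (a c : R) (f : R -> \bar R) : a != 0 ->
  measurable_fun setT f -> (forall x, 0 <= f x)%E ->
  (\int[mu]_x f x = `|a|%:E * \int[mu]_x f (a * x + c)%R)%E.
Proof.
move=> a0 mf f0.
have mg : measurable_fun [set: R] (fun x : R => a * x + c).
  by apply: measurable_funD => //; exact: measurable_funM.
pose g : {mfun R >-> R} :=
  HB.pack (fun x : R => a * x + c) (isMeasurableFun.Build _ _ _ _ _ mg).
rewrite (eq_measure_integral (mscale (NngNum (normr_ge0 a)) (pushforward mu g))); last first.
  by move=> A mA _; exact: lebesgue_affine_preimage.
by rewrite ge0_integral_mscale//= ge0_integral_pushforward.
Qed.

End lebesgue_affine.

Section standard_normal.
Context {R : realType}.
Notation mu := (@lebR R).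

Definition gam1 : probability R R := distribution (normal_prob 0 1) measurableTypeR_id.
Definition phi (x : R) : R := normal_peak 1 * expR (- (x ^+ 2 / 2)).

Lemma normal_pdf01 x : normal_pdf 0 1 x = phi x.
Proof.
rewrite normal_pdfE ?oner_eq0// /phi /normal_fun; congr (_ * expR _).
by rewrite subr0 expr1n mulNr.
Qed.

Lemma phi_gt0 x : 0 < phi x.
Proof. by rewrite mulr_gt0 ?expR_gt0// normal_peak_gt0// oner_eq0. Qed.

Lemma measurable_phi : measurable_fun setT phi.
Proof.
by have := @measurable_normal_pdf R 0 1; apply: eq_measurable_fun => x _; rewrite normal_pdf01.
Qed.

Lemma integral_phi : (\int[mu]_x (phi x)%:E = 1)%E.
Proof.
rewrite ge0_integral_lebR//; last 2 first.
- by apply/measurable_EFinP; exact: measurable_phi.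
- by move=> x; rewrite lee_fin ltW// phi_gt0.
by rewrite -(integral_normal_pdf 0 1); apply: eq_integral => x _; rewrite normal_pdf01.
Qed.

Lemma integral_gam1 (f : R -> \bar R) : measurable_fun setT f ->
  (forall x, 0 <= f x)%E -> (\int[gam1]_x f x = \int[mu]_x (f x * (phi x)%:E))%E.
Proof.
move=> mf f0; rewrite ge0_integral_distribution// ge0_integral_lebR//; last 2 first.
- by apply: emeasurable_funM => //; apply/measurable_EFinP; exact: measurable_phi.
- by move=> x; rewrite mule_ge0// lee_fin ltW// phi_gt0.
apply: (@ge0_integral_density _ (measurableTypeR R) _ (@lebesgue_measure R) (normal_prob 0 1) phi f) => //.
- exact: measurable_phi.
- by move=> x; exact/ltW/phi_gt0.
- by move=> A mA; apply: eq_integral => x _; rewrite normal_pdf01.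
Qed.

Lemma phi_shift (a x : R) : phi (x - a) = expR (a * x - a ^+ 2 / 2) * phi x.
Proof. by rewrite /phi mulrCA -expRD; congr (_ * expR _); field. Qed.

Lemma gam1_shift (a : R) (f : R -> \bar R) : measurable_fun setT f ->
  (forall x, 0 <= f x)%E ->
  (\int[gam1]_x f (x + a)%R = \int[gam1]_x (f x * (expR (a * x - a ^+ 2 / 2))%:E))%E.
Proof.
move=> mf f0.
have mfa : measurable_fun setT (fun x : R => f (x + a)).
  by apply: (measurableT_comp mf); exact: measurable_funD.
have mE : measurable_fun setT (fun x : R => expR (a * x - a ^+ 2 / 2)).
  by apply: measurableT_comp => //; apply: measurable_funB => //; exact: measurable_funM.
rewrite !integral_gam1//; last 2 first.
- by apply: emeasurable_funM => //; exact/measurable_EFinP.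
- by move=> x; rewrite mule_ge0// lee_fin expR_ge0.
rewrite (@ge0_integral_affine _ 1 a (fun x => f x * _ * _)%E) ?oner_eq0//; last 2 first.
- apply: emeasurable_funM; last by apply/measurable_EFinP; exact: measurable_phi.
  by apply: emeasurable_funM => //; exact/measurable_EFinP.
- by move=> x; rewrite !mule_ge0// lee_fin ?expR_ge0// ltW// phi_gt0.
rewrite normr1 mul1e; apply: eq_integral => x _.
by rewrite mul1r -muleA -EFinM -phi_shift addrK.
Qed.

Lemma gam1_opp (f : R -> \bar R) : measurable_fun setT f ->
  (forall x, 0 <= f x)%E -> (\int[gam1]_x f (- x)%R = \int[gam1]_x f x)%E.
Proof.
move=> mf f0; rewrite !integral_gam1//; last first.
  by apply: (measurableT_comp mf); exact: oppr_measurable.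
rewrite [RHS](@ge0_integral_affine _ (-1) 0) ?oppr_eq0 ?oner_eq0//; last 2 first.
- by apply: emeasurable_funM => //; apply/measurable_EFinP; exact: measurable_phi.
- by move=> x; rewrite mule_ge0// lee_fin ltW// phi_gt0.
rewrite normrN1 mul1e; apply: eq_integral => x _.
by rewrite addr0 mulN1r /phi sqrrN.
Qed.

Lemma phi_sum (al be s y r : R) : al != 0 -> r ^+ 2 = al ^+ 2 + be ^+ 2 -> r != 0 ->
  phi ((s - be * y) / al) * phi y =
  phi (s / r) * phi (r / al * y - be * s / (r * al)).
Proof.
move=> al0 rE r0; rewrite /phi mulrACA [RHS]mulrACA -!expRD; congr (_ * expR _).
have beE : be ^+ 2 = r ^+ 2 - al ^+ 2 by rewrite rE addrAC subrr add0r.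
have -> : ((s - be * y) / al) ^+ 2 =
    (s ^+ 2 - 2 * s * be * y + be ^+ 2 * y ^+ 2) / al ^+ 2 by field.
have -> : (r / al * y - be * s / (r * al)) ^+ 2 =
    r ^+ 2 * y ^+ 2 / al ^+ 2 - 2 * s * be * y / al ^+ 2
    + be ^+ 2 * s ^+ 2 / (r ^+ 2 * al ^+ 2) by field; rewrite r0 al0.
by rewrite beE; field; rewrite r0 al0.
Qed.

Lemma gam1_sum (al be r : R) (f : R -> \bar R) : 0 <= r ->
  r ^+ 2 = al ^+ 2 + be ^+ 2 -> measurable_fun setT f -> (forall x, 0 <= f x)%E ->
  (\int[gam1]_x \int[gam1]_y f (al * x + be * y)%R = \int[gam1]_x f (r * x)%R)%E.
Proof.
move=> r_ge0 rE mf f0.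
have [al0|al0] := eqVneq al 0.
  have mfr (c : R) : measurable_fun setT (fun x : R => f (c * x)%R).
    by apply: (measurableT_comp mf); exact: measurable_funM.
  transitivity (\int[gam1]_x f (be * x)%R)%E.
    transitivity (\int[gam1]_x (cst (\int[gam1]_y f (be * y)%R) x))%E.
      by apply: eq_integral => x _; apply: eq_integral => y _; rewrite al0 mul0r add0r.
    by rewrite integral_cst//= [X in (_ * X)%E](@probability_setT _ _ _ gam1) mule1.
  have : r = `|be|.
    apply/eqP; rewrite -(@eqrXn2 _ 2)// rE al0 expr0n add0r real_normK//.
    exact: num_real.
  have [be0|be0] := leP 0 be; first by rewrite ger0_norm// => ->.
  rewrite ltr0_norm// => ->; rewrite -gam1_opp//.
  by apply: eq_integral => x _; rewrite mulrN mulNr.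
have r0 : r != 0.
  apply: contraNneq al0 => r0; have := rE; rewrite r0 expr0n/= => /esym/eqP.
  by rewrite paddr_eq0 ?sqr_ge0// sqrf_eq0 => /andP[].
have al0' : `|al| != 0 by rewrite normr_eq0.
pose F (z : R * R) := (f z.1 * (phi ((z.1 - be * z.2) / al) / `|al|)%:E)%E.
have mphi2 : measurable_fun setT (fun z : R * R => phi ((z.1 - be * z.2) / al)).
  apply: (measurableT_comp measurable_phi); apply: measurable_funM => //.
  apply: measurable_funB => //.
  by apply: measurable_funM => //; exact: measurable_snd.
have mF : measurable_fun setT F.
  apply: emeasurable_funM; first exact: (measurableT_comp mf measurable_fst).
  by apply/measurable_EFinP; exact: measurable_funM.
have F0 z : (0 <= F z)%E.
  by rewrite mule_ge0// lee_fin divr_ge0// ltW// phi_gt0.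
transitivity (\int[gam1]_y \int[mu]_s F (s, y))%E.
  rewrite [LHS](@fubini_tonelli _ _ _ _ _ gam1 gam1 (fun z => f (al * z.1 + be * z.2)%R))//.
    apply: eq_integral => y _; rewrite integral_gam1//=; last first.
      by apply: (measurableT_comp mf); apply: measurable_funD => //; exact: measurable_funM.
    rewrite [RHS](@ge0_integral_affine _ al (be * y))//; last first.
      exact: (measurableT_comp mF (pair2_measurable _)).
    rewrite -ge0_integralZl_EFin//; last first.
      apply: (measurableT_comp mF); apply/measurable_fun_pairP; split => //=.
        by apply: measurable_funD => //; exact: measurable_funM.
      exact: measurable_cst.
    apply: eq_integral => x _; rewrite /F /= addrK [(al * x)%R / al]mulrC mulKf//.
    by rewrite muleCA -EFinM mulrCA divff// mulr1.
  apply: (measurableT_comp mf); apply: measurable_funD.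
    by apply: measurable_funM => //; exact: measurable_fst.
  by apply: measurable_funM => //; exact: measurable_snd.
rewrite -[LHS](fubini_tonelli (m1 := mu) (m2 := gam1) F)//.
transitivity (\int[mu]_s (f s * (phi (s / r) / r)%:E))%E.
  apply: eq_integral => s _; rewrite /F /=.
  rewrite ge0_integralZl//; last 2 first.
    apply/measurable_EFinP; exact: (measurableT_comp (measurable_funM mphi2 (measurable_cst _)) (pair1_measurable _)).
    by move=> y _; rewrite lee_fin divr_ge0// ltW// phi_gt0.
  congr (_ * _)%E; rewrite integral_gam1; last 2 first.
    apply/measurable_EFinP; exact: (measurableT_comp (measurable_funM mphi2 (measurable_cst _)) (pair1_measurable _)).
    by move=> y; rewrite lee_fin divr_ge0// ltW// phi_gt0.
  have mp : measurable_fun setT (fun y : R => phi (r / al * y - be * s / (r * al))).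
    apply: (measurableT_comp measurable_phi); apply: measurable_funB => //; exact: measurable_funM.
  transitivity (\int[mu]_y ((phi (s / r) / `|al|)%:E * (phi (r / al * y - be * s / (r * al)))%:E))%E.
    apply: eq_integral => y _; rewrite -!EFinM mulrAC (phi_sum s y al0 rE r0).
    by rewrite mulrAC.
  rewrite ge0_integralZl_EFin//; last 3 first.
    by move=> y _; rewrite lee_fin ltW// phi_gt0.
    exact/measurable_EFinP.
    by rewrite divr_ge0// ltW// phi_gt0.
  have ra0 : r / al != 0 by rewrite mulf_neq0// invr_eq0.
  have := @ge0_integral_affine _ (r / al) (- (be * s / (r * al))) (EFin \o phi) ra0.
  rewrite integral_phi => /(_ _ _)/esym/(congr1 (fun t => (`|r / al|^-1)%:E * t)%E).
  rewrite muleA -EFinM mulVf ?normr_eq0// mul1e mule1 => -> //.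
  - rewrite -EFinM normf_div (ger0_norm r_ge0) invf_div mulrA divfK//.
  - by apply/measurable_EFinP; exact: measurable_phi.
  - by move=> y; rewrite lee_fin ltW// phi_gt0.
rewrite integral_gam1//; last by apply: (measurableT_comp mf); exact: measurable_funM.
rewrite (@ge0_integral_affine _ r 0)//; last 2 first.
  apply: emeasurable_funM => //; apply/measurable_EFinP; apply: measurable_funM => //.
  by apply: (measurableT_comp measurable_phi); exact: measurable_funM.
  by move=> x; rewrite mule_ge0// lee_fin divr_ge0// ltW// phi_gt0.
rewrite -ge0_integralZl_EFin//; last 2 first.
- by move=> x _; rewrite mule_ge0// lee_fin divr_ge0// ltW// phi_gt0.
- apply: emeasurable_funM.
    by apply: (measurableT_comp mf); apply: measurable_funD => //; exact: measurable_funM.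
  apply/measurable_EFinP; apply: measurable_funM => //.
  apply: (measurableT_comp measurable_phi); apply: measurable_funM => //.
  by apply: measurable_funD => //; exact: measurable_funM.
apply: eq_integral => x _; rewrite addr0 muleCA -EFinM (ger0_norm r_ge0).
have -> : (r * (phi (r * x / r) / r))%R = phi x; last by [].
by rewrite [(r * x)%R]mulrC mulfK// mulrCA divff// mulr1.
Qed.

End standard_normal.

Section gaussian_vector.
Context {R : realType}.

Definition consT n (z : R * n.-tuple R) : n.+1.-tuple R := [tuple of z.1 :: z.2].

Lemma measurable_consT n : measurable_fun [set: R * n.-tuple R] (@consT n).
Proof. exact: (measurable_cons (f := fst) (g := snd)). Qed.

Definition consT_mfun n : {mfun (R * n.-tuple R)%type >-> (n.+1.-tuple R)} :=
  HB.pack (@consT n) (isMeasurableFun.Build _ _ _ _ _ (@measurable_consT n)).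

Fixpoint gam (n : nat) : probability (n.-tuple R) R :=
  match n with
  | 0%N => dirac [tuple] : probability _ R
  | n'.+1 => distribution ((gam1 \x gam n')%E : probability _ R) (consT_mfun n')
  end.

Lemma measurable_mktuple {d} {T : measurableType d} n (F : 'I_n -> T -> R) :
  (forall i, measurable_fun setT (F i)) ->
  measurable_fun setT (fun w => [tuple F i w | i < n]).
Proof.
move=> mF; apply/measurable_fun_tnthP => i.
by apply: eq_measurable_fun (mF i) => w _ /=; rewrite tnth_mktuple.
Qed.

Lemma measurable_tnth_comp {d} {T : measurableType d} n (F : T -> n.-tuple R) i :
  measurable_fun setT F -> measurable_fun setT (fun w => tnth (F w) i).
Proof. by move=> mF; exact: (measurableT_comp (@measurable_tnth _ _ n i) mF). Qed.

Lemma measurable_consT_comp {d} {T : measurableType d} n (F : T -> R)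
    (G : T -> n.-tuple R) :
  measurable_fun setT F -> measurable_fun setT G ->
  measurable_fun setT (fun w => consT (F w, G w)).
Proof. exact: measurable_cons. Qed.

Definition dot n (a z : n.-tuple R) : R := \sum_(i < n) tnth a i * tnth z i.

Definition vlin n (al be : R) (s t : n.-tuple R) : n.-tuple R :=
  [tuple al * tnth s i + be * tnth t i | i < n].

Definition vnorm n (a : n.-tuple R) : R := Num.sqrt (dot a a).

Lemma tnth_vlin n al be (s t : n.-tuple R) i :
  tnth (vlin al be s t) i = al * tnth s i + be * tnth t i.
Proof. by rewrite tnth_mktuple. Qed.

Lemma tnth_consT0 n x (t : n.-tuple R) : tnth (consT (x, t)) ord0 = x.
Proof. by []. Qed.

Lemma tnth_consTS n x (t : n.-tuple R) i : tnth (consT (x, t)) (lift ord0 i) = tnth t i.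
Proof. by rewrite tnthS. Qed.

Lemma consT_eta n (t : n.+1.-tuple R) : t = consT (thead t, [tuple of behead t]).
Proof. exact: tuple_eta. Qed.

Lemma dot_consT n x y (s t : n.-tuple R) :
  dot (consT (x, s)) (consT (y, t)) = x * y + dot s t.
Proof.
rewrite /dot big_ord_recl !tnth_consT0; congr (_ + _).
by apply: eq_bigr => i _; rewrite !tnth_consTS.
Qed.

Lemma vlin_consT n al be x y (s t : n.-tuple R) :
  vlin al be (consT (x, s)) (consT (y, t)) = consT (al * x + be * y, vlin al be s t).
Proof.
apply: eq_from_tnth => i; rewrite tnth_vlin.
case: (unliftP ord0 i) => [j|] ->; last by rewrite !tnth_consT0.
by rewrite !tnth_consTS tnth_vlin.
Qed.

Lemma dot_ge0 n (a : n.-tuple R) : 0 <= dot a a.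
Proof. by apply: sumr_ge0 => i _; rewrite -expr2 sqr_ge0. Qed.

Lemma vnorm_ge0 n (a : n.-tuple R) : 0 <= vnorm a. Proof. exact: sqrtr_ge0. Qed.

Lemma sqr_vnorm n (a : n.-tuple R) : vnorm a ^+ 2 = dot a a.
Proof. by rewrite sqr_sqrtr// dot_ge0. Qed.

Lemma measurable_dot {d} {T : measurableType d} n (F G : T -> n.-tuple R) :
  measurable_fun setT F -> measurable_fun setT G ->
  measurable_fun setT (fun w => dot (F w) (G w)).
Proof.
move=> mF mG; apply: measurable_sum => i.
by apply: measurable_funM; exact: measurable_tnth_comp.
Qed.

Lemma measurable_vlin {d} {T : measurableType d} n al be (F G : T -> n.-tuple R) :
  measurable_fun setT F -> measurable_fun setT G ->
  measurable_fun setT (fun w => vlin al be (F w) (G w)).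
Proof.
move=> mF mG; apply: measurable_mktuple => i.
by apply: measurable_funD; apply: measurable_funM => //; exact: measurable_tnth_comp.
Qed.

Local Open Scope ereal_scope.

Lemma integral_gam0 (f : 0.-tuple R -> \bar R) : \int[gam 0]_t f t = f [tuple].
Proof.
rewrite (_ : f = cst (f [tuple])); last by apply/funext => t; rewrite tuple0.
by rewrite integral_cst//= diracT mule1.
Qed.

Lemma integral_gamS n (f : n.+1.-tuple R -> \bar R) :
  measurable_fun setT f -> (forall t, 0 <= f t) ->
  \int[gam n.+1]_t f t = \int[gam1]_x \int[gam n]_t f (consT (x, t)).
Proof.
move=> mf f0; rewrite ge0_integral_distribution//.
rewrite (@fubini_tonelli1 _ _ _ _ _ gam1 (gam n) (f \o consT_mfun n))//.
  exact: (measurableT_comp mf (@measurable_consT n)).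
by move=> z; exact: f0.
Qed.

Lemma integral_gam_dot n (a : n.-tuple R) (f : R -> \bar R) :
  measurable_fun setT f -> (forall x, 0 <= f x) ->
  \int[gam n]_z f (dot a z) = \int[gam1]_x f (vnorm a * x)%R.
Proof.
elim: n => [|n ih] in a f *; move=> mf f0.
  rewrite integral_gam0 /vnorm /dot !big_ord0 sqrtr0.
  under eq_integral do rewrite mul0r.
  by rewrite integral_cst//= [X in _ * X](@probability_setT _ _ _ gam1) mule1.
rewrite (consT_eta a); set a0 := thead a; set a' := [tuple of behead a].
rewrite integral_gamS//; last by apply: (measurableT_comp mf); exact: measurable_dot.
transitivity (\int[gam1]_x \int[gam1]_y f (a0 * x + vnorm a' * y)%R).
  apply: eq_integral => x _; under eq_integral do rewrite dot_consT.
  by rewrite (ih a' (fun y => f (a0 * x + y)%R))//; apply: (measurableT_comp mf); exact: measurable_funD.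
rewrite (gam1_sum (r := vnorm (consT (a0, a')))) ?vnorm_ge0//.
by rewrite !sqr_vnorm dot_consT expr2.
Qed.

Lemma integral_gam_shift n (u : n.-tuple R) (f : n.-tuple R -> \bar R) :
  measurable_fun setT f -> (forall x, 0 <= f x) ->
  \int[gam n]_z f (vlin 1 1 z u) =
  \int[gam n]_z (f z * (expR (dot u z - dot u u / 2))%:E).
Proof.
elim: n => [|n ih] in u f *; move=> mf f0.
  rewrite !integral_gam0 /dot !big_ord0 mul0r subr0 expR0 mule1; congr f.
  by apply: eq_from_tnth => -[].
have mE : measurable_fun setT (fun z : n.+1.-tuple R => expR (dot u z - dot u u / 2)).
  by apply: measurableT_comp => //; apply: measurable_funB => //; exact: measurable_dot.
rewrite !integral_gamS//; last 3 first.
- by apply: emeasurable_funM => //; exact/measurable_EFinP.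
- by move=> t; rewrite mule_ge0// lee_fin expR_ge0.
- by apply: (measurableT_comp mf); exact: measurable_vlin.
rewrite (consT_eta u); set a0 := thead u; set a' := [tuple of behead u].
pose F x := \int[gam n]_t (f (consT (x, t)) * (expR (dot a' t - dot a' a' / 2))%:E).
transitivity (\int[gam1]_x F (x + a0)%R).
  apply: eq_integral => x _; rewrite /F -ih//; last first.
    by apply: (measurableT_comp mf); exact: measurable_consT_comp.
  by apply: eq_integral => t _; rewrite vlin_consT !mul1r.
have mE' : measurable_fun setT (fun z : R * n.-tuple R => (expR (dot a' z.2 - dot a' a' / 2))%:E).
  apply/measurable_EFinP; apply: measurableT_comp => //.
  by apply: measurable_funB => //; exact: measurable_dot.
rewrite [LHS](@gam1_shift _ a0 F); last 2 first.
- apply: (measurable_fun_fubini_tonelli_F (m2 := gam n)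
    (fun z => f (consT z) * (expR (dot a' z.2 - dot a' a' / 2))%:E)) => //.
    by apply: emeasurable_funM => //; exact: (measurableT_comp mf (@measurable_consT n)).
  by move=> z; rewrite mule_ge0// lee_fin expR_ge0.
- by move=> x; apply: integral_ge0 => t _; rewrite mule_ge0// lee_fin expR_ge0.
apply: eq_integral => x _; rewrite /F muleC -ge0_integralZl_EFin ?expR_ge0//; last 2 first.
- by move=> t _; rewrite mule_ge0// lee_fin expR_ge0.
- apply: emeasurable_funM.
    by apply: (measurableT_comp mf); exact: measurable_consT_comp.
  exact: (measurableT_comp mE' (pair1_measurable _)).
apply: eq_integral => t _; rewrite muleCA -EFinM -expRD !dot_consT.
by congr (_ * (expR _)%:E); rewrite expr2; field.
Qed.

Lemma integral_gam_rot n (al be r : R) (f : n.-tuple R -> \bar R) : (0 <= r)%R ->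
  (r ^+ 2 = al ^+ 2 + be ^+ 2)%R -> measurable_fun setT f -> (forall x, 0 <= f x) ->
  \int[gam n]_s \int[gam n]_t f (vlin al be s t) = \int[gam n]_t f (vlin r 0 t t).
Proof.
move=> r0 rE; elim: n => [|n ih] in f *; move=> mf f0.
  by rewrite !integral_gam0; congr f; apply: eq_from_tnth => -[].
have mfv : measurable_fun setT (fun z : n.+1.-tuple R * n.+1.-tuple R => f (vlin al be z.1 z.2)).
  by apply: (measurableT_comp mf); exact: measurable_vlin.
have mfv1 s : measurable_fun setT (fun t : n.+1.-tuple R => f (vlin al be s t)).
  by apply: (measurableT_comp mf); exact: measurable_vlin.
rewrite integral_gamS; last 2 first.
- exact: (measurable_fun_fubini_tonelli_F (m2 := gam n.+1) _ mfv).
- by move=> s; exact: integral_ge0.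
rewrite [RHS](@integral_gamS n (fun t => f (vlin r 0 t t))); last 2 first.
- by apply: (measurableT_comp mf); exact: measurable_vlin.
- by move=> t; exact: f0.
pose G (x : R) (y : R) (s t : n.-tuple R) := f (consT (al * x + be * y, vlin al be s t))%R.
transitivity (\int[gam1]_x \int[gam n]_s \int[gam1]_y \int[gam n]_t G x y s t).
  apply: eq_integral => x _; apply: eq_integral => s _; rewrite (integral_gamS (mfv1 _))//.
  by apply: eq_integral => y _; apply: eq_integral => t _; rewrite vlin_consT.
transitivity (\int[gam1]_x \int[gam1]_y \int[gam n]_t f (consT (al * x + be * y, vlin r 0 t t))%R).
  apply: eq_integral => x _.
  rewrite (@fubini_tonelli _ _ _ _ _ (gam n) gam1 (fun z => \int[gam n]_t G x z.2 z.1 t)).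
  - apply: eq_integral => y _; rewrite -(ih (fun v => f (consT (al * x + be * y, v)%R)))//.
    by apply: (measurableT_comp mf); exact: measurable_consT_comp.
  - apply: (measurable_fun_fubini_tonelli_F (m2 := gam n) (fun z => G x z.1.2 z.1.1 z.2)) => //.
    apply: (measurableT_comp mf); apply: measurable_consT_comp.
      apply: measurable_funD => //; apply: measurable_funM => //.
      exact: (measurableT_comp measurable_snd measurable_fst).
    by apply: measurable_vlin => //; exact: (measurableT_comp measurable_fst measurable_fst).
    by move=> z; exact: f0.
  - by move=> z; apply: integral_ge0 => t _; exact: f0.
pose H (w : R) := \int[gam n]_t f (consT (w, vlin r 0 t t)).
rewrite -[LHS]/(\int[gam1]_x \int[gam1]_y H (al * x + be * y)%R).
rewrite (gam1_sum (r := r))//.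
- by apply: eq_integral => x _; apply: eq_integral => t _; rewrite vlin_consT mul0r addr0.
- apply: (measurable_fun_fubini_tonelli_F (m2 := gam n) (fun z => f (consT (z.1, vlin r 0 z.2 z.2)))) => //.
  apply: (measurableT_comp mf); apply: measurable_consT_comp => //; exact: measurable_vlin.
- by move=> x; exact: integral_ge0.
Qed.

End gaussian_vector.

Section exp_bounds.
Context {R : realType}.
Implicit Types t x b c : R.

Lemma expR_le_norm t : expR t <= expR `|t|.
Proof. by rewrite ler_expR ler_norm. Qed.

Lemma expR_abs_ge1 t : 1 <= expR `|t|.
Proof. by rewrite -expR0 ler_expR. Qed.

Lemma expR_sub1_bounds t : 0 <= expR t - 1 - t <= t ^+ 2 * expR `|t|.
Proof.
have h1 := expR_ge1Dx t; have h2 := expR_ge1Dx (- t).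
rewrite expRN in h2; have e0 := expR_gt0 t.
have h3 : expR t - 1 <= t * expR t.
  have := ler_wpM2r (ltW e0) h2; rewrite mulrDl mul1r mulNr mulVf ?gt_eqF//; lra.
apply/andP; split; first lra.
have [t0|t0] := leP 0 t.
  rewrite ger0_norm// expr2 -mulrA.
  have : t * (expR t - 1) <= t * (t * expR t) by rewrite ler_wpM2l//.
  lra.
have ha := expR_abs_ge1 t.
have : - t * (1 - expR t) <= - t * (- t) by rewrite ler_wpM2l//; lra.
have : t ^+ 2 * 1 <= t ^+ 2 * expR `|t| by rewrite ler_wpM2l ?sqr_ge0.
rewrite expr2; lra.
Qed.

Lemma is_derive_expR_taylor2 t :
  is_derive t 1 (fun x : R => expR x - 1 - x - 2^-1 * x ^+ 2) (expR t - 1 - t).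
Proof.
have -> : (fun x : R => expR x - 1 - x - 2^-1 * x ^+ 2) =
    (((expR : R -> R) - cst 1) - id - (2^-1 : R) *: (id : R -> R) ^+ 2) :> (R -> R).
  by apply/funext => x; rewrite !fctE.
apply: is_derive_eq; rewrite /GRing.scale /= expr1 mulr1 -mulr_natr.
by field.
Qed.

Lemma expR_taylor3 t : `|expR t - 1 - t - 2^-1 * t ^+ 2| <= `|t| ^+ 3 * expR `|t|.
Proof.
pose f (x : R) : R := expR x - 1 - x - 2^-1 * x ^+ 2.
have fd x : is_derive x 1 f (expR x - 1 - x) by exact: is_derive_expR_taylor2.
have fc : continuous f.
  by move=> x; apply: differentiable_continuous; apply/derivable1_diffP; case: (fd x).
have f0 : f 0 = 0 by rewrite /f expR0; lra.
have key c : `|c| <= `|t| -> `|(expR c - 1 - c) * t| <= `|t| ^+ 3 * expR `|t|.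
  move=> ct; have /andP[c0 c1] := expR_sub1_bounds c.
  rewrite normrM (ger0_norm c0) exprSr mulrAC ler_wpM2r//.
  apply: (le_trans c1); rewrite -(real_normK (num_real c)).
  by apply: ler_pM; rewrite ?expR_ge0 ?sqr_ge0 ?ler_expR// ler_sqr ?nnegrE.
have [t0|t0|->] := ltgtP t 0; last first.
- by rewrite expR0 !subrr sub0r expr0n/= mulr0 oppr0 normr0 expr0n/= mul0r.
- have [c /[!in_itv]/= /andP[c1 c2]] := MVT t0 (fun x _ => fd x) (@continuous_subspaceT _ _ _ _ fc).
  rewrite f0 !subr0; rewrite -/(f t) => ->.
  by apply: key; rewrite !gtr0_norm// ltW.
- have [c /[!in_itv]/= /andP[c1 c2]] := MVT t0 (fun x _ => fd x) (@continuous_subspaceT _ _ _ _ fc).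
  rewrite f0 sub0r sub0r mulrN => /oppr_inj; rewrite -/(f t) => ->.
  by apply: key; rewrite !ltr0_norm// lerN2 ltW.
Qed.

Lemma pow3_le_expR x : 0 <= x -> x ^+ 3 <= 6 * expR x.
Proof.
move=> x0; have := expR_ge1Dxn 2 x0; rewrite (_ : (2.+1)`!%:R = 6 :> R)//.
by move: (expR x) (x ^+ 3) => e y; lra.
Qed.

Lemma pow4_le_expR x : 0 <= x -> x ^+ 4 <= 24 * expR x.
Proof.
move=> x0; have := expR_ge1Dxn 3 x0; rewrite (_ : (3.+1)`!%:R = 24 :> R)//.
by move: (expR x) (x ^+ 4) => e y; lra.
Qed.

Lemma expR_abs_le c x : 0 <= c -> expR (c * `|x|) <= expR (c * x) + expR (- c * x).
Proof.
move=> c0; have [x0|x0] := leP 0 x.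
  by rewrite ger0_norm// lerDl expR_ge0.
by rewrite ltr0_norm// mulrN mulNr lerDr expR_ge0.
Qed.

Definition rem3 b y := expR (y - b ^+ 2 / 2) - 1 - y - 2^-1 * (y ^+ 2 - b ^+ 2).

Lemma rem3_le_small b x : 0 <= b <= 1 ->
  `|rem3 b (b * x)| <= b ^+ 3 * (6 * expR 2 + 1) * expR (2 * `|x|).
Proof.
move=> /andP[b0 b1]; set t := b * x - b ^+ 2 / 2.
have -> : rem3 b (b * x) = (expR t - 1 - t - 2^-1 * t ^+ 2) +
    (b ^+ 4 / 8 - b ^+ 3 * x / 2) by rewrite /rem3 /t; field.
have x0 := normr_ge0 x.
have e1 := expR_ge1Dx (2 * `|x|).
have b3 : 0 <= b ^+ 3 by rewrite exprn_ge0.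
have tb : `|t| <= b * (`|x| + 1).
  rewrite (le_trans (ler_normB _ _))// normrM (ger0_norm b0) mulrDr lerD2l.
  by rewrite ger0_norm ?divr_ge0 ?sqr_ge0// expr2 mulr1; nra.
have tb1 : `|t| <= `|x| + 1 by rewrite (le_trans tb)// ler_piMl// addr_ge0.
have h1 : `|t| ^+ 3 * expR `|t| <= b ^+ 3 * (6 * expR 2 * expR (2 * `|x|)).
  apply: (@le_trans _ _ ((b * (`|x| + 1)) ^+ 3 * expR (`|x| + 1))).
    apply: ler_pM; rewrite ?exprn_ge0 ?expR_ge0 ?ler_expR//.
    by rewrite ler_pXn2r ?nnegrE// mulr_ge0// addr_ge0.
  rewrite exprMn -[leLHS]mulrA ler_wpM2l//.
  have -> : expR 2 = expR 1 * expR 1 :> R by rewrite -expRD; congr expR; lra.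
  have -> : expR (2 * `|x|) = expR `|x| * expR `|x| by rewrite -expRD; congr expR; lra.
  have := pow3_le_expR (addr_ge0 x0 ler01); rewrite !expRD => h.
  have := ler_wpM2r (mulr_ge0 (expR_ge0 `|x|) (expR_ge0 (1 : R))) h.
  by move: (expR `|x|) (expR 1) => e f; lra.
have h2 : `|b ^+ 4 / 8 - b ^+ 3 * x / 2| <= b ^+ 3 * expR (2 * `|x|).
  have -> : b ^+ 4 / 8 - b ^+ 3 * x / 2 = b ^+ 3 * (b / 8 - x / 2) by field.
  rewrite normrM (ger0_norm b3) ler_wpM2l// (le_trans (ler_normB _ _))//.
  have -> : `|b / 8| = b / 8 by rewrite ger0_norm ?divr_ge0.
  have -> : `|x / 2| = `|x| / 2 by rewrite normrM (@ger0_norm _ 2^-1) ?invr_ge0.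
  by move: e1; move: (expR _) => e; lra.
rewrite (le_trans (ler_normD _ _))//.
have := le_trans (expR_taylor3 t) h1; move: h2.
by move: (`|_|) (`|_|) (expR (2 * _)) (expR 2) => u v e f; lra.
Qed.

Lemma rem3_le_large b x : 0 <= b ->
  `|rem3 b (b * x)| <= expR (b * x - b ^+ 2 / 2) + 1 + (b + b ^+ 2) * expR `|x| + b ^+ 2 / 2.
Proof.
move=> b0; have x0 := normr_ge0 x; have b20 := sqr_ge0 b.
have ex1 : `|x| <= expR `|x| by have := expR_ge1Dx `|x|; lra.
have ex2 : `|x| ^+ 2 <= 2 * expR `|x|.
  have := expR_ge1Dxn 1 x0; rewrite (_ : (1.+1)`!%:R = 2 :> R)//.
  by move: (expR _) (_ ^+ 2) => e y; lra.
rewrite /rem3 -!addrA (le_trans (ler_normD _ _))// ger0_norm ?expR_ge0// lerD2l.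
rewrite (le_trans (ler_normD _ _))// normrN normr1 lerD2l.
rewrite (le_trans (ler_normD _ _))// normrN normrM (ger0_norm b0).
rewrite mulrDl -addrA; apply: lerD; first by rewrite ler_wpM2l.
rewrite normrN exprMn -(real_normK (num_real x)) mulrBr (le_trans (ler_normB _ _))//.
have p1 : 0 <= 2^-1 * (b ^+ 2 * `|x| ^+ 2) by rewrite !mulr_ge0 ?invr_ge0 ?sqr_ge0.
have p2 : 0 <= 2^-1 * b ^+ 2 by rewrite mulr_ge0 ?invr_ge0.
rewrite (ger0_norm p1) (ger0_norm p2) [b ^+ 2 / 2]mulrC lerD2r.
have := ler_wpM2l b20 ex2; move: (b ^+ 2) (expR _) (_ ^+ 2) => u v w; lra.
Qed.

End exp_bounds.

Section normal_moments.
Context {R : realType}.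
Local Open Scope ereal_scope.

Lemma gam1_mgf (c : R) : \int[gam1]_x (expR (c * x))%:E = (expR (c ^+ 2 / 2))%:E.
Proof.
have := @gam1_shift R c (cst 1) (measurable_cst _) (fun=> lee01).
rewrite integral_cst//= [X in _ * X](@probability_setT _ _ _ gam1) mule1.
move=> /(congr1 (fun t => (expR (c ^+ 2 / 2))%:E * t)); rewrite mule1 => ->.
rewrite -ge0_integralZl_EFin ?expR_ge0//.
- by apply: eq_integral => x _; rewrite mul1e -EFinM -expRD addrC subrK.
- apply/emeasurable_funM => //; apply/measurable_EFinP; apply: measurableT_comp => //.
  by apply: measurable_funB => //; exact: measurable_funM.
Qed.

Lemma measurable_expRM (c : R) : measurable_fun setT (fun x : R => expR (c * x)).
Proof. by apply: measurableT_comp => //; exact: measurable_funM. Qed.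

Lemma gam1_dom (f : R -> R) (K c : R) : measurable_fun setT f ->
  (forall x, 0 <= f x)%R -> (0 <= K)%R -> (0 <= c)%R ->
  (forall x, f x <= K * expR (c * `|x|))%R ->
  \int[gam1]_x (f x)%:E <= (K * (2 * expR (c ^+ 2 / 2)))%:E.
Proof.
move=> mf f0 K0 c0 fK.
have mE e : measurable_fun setT (fun x : R => (expR (e * x))%:E).
  by apply/measurable_EFinP; exact: measurable_expRM.
apply: (@le_trans _ _ (\int[gam1]_x (K%:E * ((expR (c * x))%:E + (expR (- c * x))%:E)))).
  apply: ge0_le_integral => //.
  - by move=> x _; rewrite lee_fin.
  - exact/measurable_EFinP.
  - by apply: measurable_funeM; exact: emeasurable_funD.
  - move=> x _; rewrite -EFinD -EFinM lee_fin (le_trans (fK x))// ler_wpM2l//.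
    exact: expR_abs_le.
rewrite ge0_integralZl_EFin//; last 2 first.
- by move=> x _; rewrite adde_ge0// lee_fin expR_ge0.
- exact: emeasurable_funD.
rewrite ge0_integralD//.
by rewrite !gam1_mgf sqrrN -EFinD -EFinM lee_fin mulr2n mulrDl mul1r.
Qed.

Lemma gam1_dom_intg (f : R -> R) (K c : R) : measurable_fun setT f ->
  (0 <= K)%R -> (0 <= c)%R -> (forall x, `|f x| <= K * expR (c * `|x|))%R ->
  intg gam1 f /\ (\int[gam1]_x `|f x| <= K * (2 * expR (c ^+ 2 / 2)))%R.
Proof.
move=> mf K0 c0 fK.
have mf' : measurable_fun setT (fun x => `|f x|%R) by exact: measurableT_comp.
have [|h1 h2] := intg_ge0_fin mf' (fun x => normr_ge0 (f x)) (gam1_dom mf' _ K0 c0 fK).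
  by [].
by split => //; apply: (intg_dom mf _ h1).
Qed.

Lemma measurable_rem3 (b : R) : measurable_fun setT (rem3 b).
Proof.
apply: measurable_funB; last first.
  by apply: measurable_funM => //; apply: measurable_funB => //; exact: measurable_funX.
apply: measurable_funB => //; apply: measurable_funB => //.
by apply: measurableT_comp => //; exact: measurable_funB.
Qed.

Definition C3 : R := ((6 * expR 2 + 1) * (2 * expR 2) + 7 * expR 2^-1 + 1)%R.

Lemma gam1_rem3 (b : R) : (0 <= b)%R ->
  \int[gam1]_x (`|rem3 b (b * x)|)%:E <= (C3 * b ^+ 3)%:E.
Proof.
move=> b0; have e2 : (0 < expR 2 :> R)%R := expR_gt0 _.
have e1 : (0 < expR 2^-1 :> R)%R := expR_gt0 _.
have mr : measurable_fun setT (fun x : R => `|rem3 b (b * x)|%R).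
  by apply: measurableT_comp => //; apply: (measurableT_comp (measurable_rem3 b)); exact: measurable_funM.
have b3 : (0 <= b ^+ 3)%R by rewrite exprn_ge0.
have [b1|b1] := leP b 1%R.
  apply: (le_trans (gam1_dom (K := b ^+ 3 * (6 * expR 2 + 1)) (c := 2) mr _ _ _ _)) => //.
  - by rewrite mulr_ge0// addr_ge0// mulr_ge0// ltW.
  - by move=> x; apply: rem3_le_small; rewrite b0.
  - rewrite lee_fin /C3 expr2 mulfK//.
    have : (0 <= b ^+ 3 * (7 * expR 2^-1 + 1))%R by rewrite mulr_ge0//; lra.
    by move: (b ^+ 3)%R (expR 2) (expR 2^-1) => u v w; nra.
have mE : measurable_fun setT (fun x : R => (expR (b * x - b ^+ 2 / 2))%:E).
  by apply/measurable_EFinP; apply: measurableT_comp => //; apply: measurable_funB.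
have mA : measurable_fun setT (fun x : R => ((b + b ^+ 2) * expR `|x| + (1 + b ^+ 2 / 2))%:E).
  apply/measurable_EFinP; apply: measurable_funD => //; apply: measurable_funM => //.
  by apply: measurableT_comp => //; exact: measurableT_comp.
have A0 (x : R) : (0 <= (b + b ^+ 2) * expR `|x| + (1 + b ^+ 2 / 2))%R.
  by rewrite !addr_ge0// ?mulr_ge0 ?addr_ge0 ?sqr_ge0 ?expR_ge0.
apply: (@le_trans _ _ (\int[gam1]_x ((expR (b * x - b ^+ 2 / 2))%:E +
    ((b + b ^+ 2) * expR `|x| + (1 + b ^+ 2 / 2))%:E))).
  apply: ge0_le_integral => //.
  - exact/measurable_EFinP.
  - exact: emeasurable_funD.
  - move=> x _; rewrite -EFinD lee_fin (le_trans (rem3_le_large x b0))//.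
    by move: (expR _) ((b + _) * _)%R => u v; lra.
rewrite ge0_integralD//.
have -> : \int[gam1]_x (expR (b * x - b ^+ 2 / 2))%:E = 1.
  have := @gam1_shift R b (cst 1) (measurable_cst _) (fun=> lee01).
  rewrite integral_cst//= [X in _ * X](@probability_setT _ _ _ gam1) mule1 => ->.
  by apply: eq_integral => x _; rewrite mul1e.
apply: (@le_trans _ _ (1 + ((1 + b ^+ 2 / 2 + (b + b ^+ 2)) * (2 * expR (1 ^+ 2 / 2)))%:E)).
  rewrite leeD2l//; apply: gam1_dom => //.
  - exact/measurable_EFinP.
  - by rewrite !addr_ge0 ?divr_ge0 ?sqr_ge0.
  - move=> x; rewrite mul1r [leRHS]mulrDl addrC lerD2r ler_peMr//.
      by rewrite addr_ge0// divr_ge0// sqr_ge0.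
    exact: expR_abs_ge1.
rewrite -EFinD lee_fin expr1n mul1r /C3.
have b2b : (b ^+ 2 <= b ^+ 3)%R by rewrite ler_eXn2l// ltW.
have bb : (b <= b ^+ 3)%R by rewrite -[leLHS]expr1 ler_eXn2l// ltW.
have b13 : (1 <= b ^+ 3)%R by rewrite exprn_ege1// ltW.
have h : (0 <= (6 * expR 2 + 1) * (2 * expR 2) :> R)%R.
  by rewrite mulr_ge0// ?addr_ge0// ?mulr_ge0// ltW.
have hm : (1 + b ^+ 2 / 2 + (b + b ^+ 2) <= 7 / 2 * b ^+ 3)%R.
  by move: b2b bb b13; move: (b ^+ 2)%R (b ^+ 3)%R => u v; lra.
have := ler_wpM2r (ltW e1) hm; have := ler_wpM2r b3 h.
move: b13; move: (1 + _ + _)%R (b ^+ 3)%R (expR 2^-1) ((_ + 1) * _)%R => u v w z.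
  by lra.
by move=> x _; rewrite lee_fin.
Qed.

Local Open Scope ring_scope.

Lemma C3_ge0 : 0 <= C3.
Proof. by rewrite !addr_ge0// ?mulr_ge0 ?addr_ge0 ?mulr_ge0 ?expR_ge0. Qed.

Lemma abs_le_expR (x : R) : `|x| <= 1 * expR (1 * `|x|).
Proof. by rewrite !mul1r; have := expR_ge1Dx `|x|; lra. Qed.

Lemma sqr_le_expR (x : R) : `|x ^+ 2| <= 2 * expR (1 * `|x|).
Proof.
rewrite mul1r normrX; have := expR_ge1Dxn 1 (normr_ge0 x).
by rewrite (_ : (1.+1)`!%:R = 2 :> R)//; move: (expR _) (_ ^+ 2) => e y; lra.
Qed.

Lemma pow4_le_expR_norm (x : R) : `|x ^+ 4| <= 24 * expR (1 * `|x|).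
Proof. by rewrite mul1r normrX; exact: pow4_le_expR. Qed.

Lemma intg_gam1_id : intg (@gam1 R) (fun x : R => x).
Proof. by apply: (gam1_dom_intg _ _ _ abs_le_expR).1. Qed.

Lemma intg_gam1_sqr : intg (@gam1 R) (fun x : R => x ^+ 2).
Proof. by apply: (gam1_dom_intg _ _ _ sqr_le_expR).1 => //; exact: measurable_funX. Qed.

Lemma gam1_mean : \int[@gam1 R]_x x = 0.
Proof.
have ia := intg_norm intg_gam1_id.
have mp : measurable_fun setT (fun x : R => (`|x| + x)%:E).
  by apply/measurable_EFinP; apply: measurable_funD => //; exact: measurableT_comp.
have p0 (x : R) : (0 <= (`|x| + x)%:E)%E.
  by rewrite lee_fin -lerBlDr sub0r ler_normr lexx orbT.
have := gam1_opp mp p0.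
have -> : (\int[@gam1 R]_x (`|- x| + - x)%:E = (\int[@gam1 R]_x `|x| - \int[@gam1 R]_x x)%:E)%E.
  rewrite -(RintB ia intg_gam1_id) EFin_Rint; last exact: intgB intg_gam1_id.
  by apply: eq_integral => x _; rewrite normrN.
rewrite -EFin_Rint; last exact: intgD intg_gam1_id.
rewrite (RintD ia intg_gam1_id) => -[]; lra.
Qed.

Lemma gam1_var : \int[@gam1 R]_x (x ^+ 2) = 1.
Proof.
set m := \int[gam1]_x _.
pose C : R := 12 * (2 * expR 2) + 1.
have key (l : R) : 0 < l <= 1 -> `|1 - m| <= C * l.
  move=> /andP[l0 l1].
  pose D (x : R) := expR (l * x) + expR (- l * x) - (2 + l ^+ 2 * x ^+ 2).
  have ie (c : R) : intg gam1 (fun x : R => expR (c * x)).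
    apply: (@gam1_dom_intg _ 1 `|c| _ _ _ _).1 => //; first exact: measurable_expRM.
    move=> x; rewrite mul1r ger0_norm ?expR_ge0// -normrM; exact: expR_le_norm.
  have Ie (c : R) : \int[gam1]_x expR (c * x) = expR (c ^+ 2 / 2).
    by rewrite /Rintegral gam1_mgf.
  have i2 : intg gam1 (fun x : R => 2 + l ^+ 2 * x ^+ 2).
    by apply: intgD; [exact: intg_cst|apply: intgZl; exact: intg_gam1_sqr].
  have DE : \int[gam1]_x D x = 2 * expR (l ^+ 2 / 2) - (2 + l ^+ 2 * m).
    rewrite RintB//; last exact: intgD.
    rewrite RintD// !Ie sqrrN RintD//; last 2 first.
      exact: intg_cst.
      by apply: intgZl; exact: intg_gam1_sqr.
    by rewrite Rint_cst (RintZl _ intg_gam1_sqr) mulrDl mul1r.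
  have mD : measurable_fun setT D.
    exact: (intg_meas (intgB (intgD (ie l) (ie (- l))) i2)).
  have Db (x : R) : `|D x| <= 12 * l ^+ 3 * expR (2 * `|x|).
    have -> : D x = (expR (l * x) - 1 - l * x - 2^-1 * (l * x) ^+ 2)
        + (expR (- l * x) - 1 - (- l * x) - 2^-1 * (- l * x) ^+ 2) by rewrite /D; field.
    rewrite (le_trans (ler_normD _ _))//.
    have x0 := normr_ge0 x.
    have hb c : `|c| = l -> `|c * x| ^+ 3 * expR `|c * x| <= 6 * l ^+ 3 * expR (2 * `|x|).
      move=> cl; rewrite normrM cl exprMn.
      have e2 : expR (2 * `|x|) = expR `|x| * expR `|x| by rewrite -expRD; congr expR; lra.
      have h1 := pow3_le_expR x0.
      have h2 : expR (l * `|x|) <= expR `|x| by rewrite ler_expR ler_piMl.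
      have h3 : `|x| ^+ 3 * expR (l * `|x|) <= 6 * expR `|x| * expR `|x|.
        by apply: ler_pM; rewrite ?exprn_ge0 ?expR_ge0.
      have := ler_wpM2l (exprn_ge0 3 (ltW l0)) h3; rewrite e2.
      by move: (l ^+ 3) (expR _) (_ ^+ 3) (expR _) => u v w z; lra.
    have := le_trans (expR_taylor3 (l * x)) (hb l (gtr0_norm l0)).
    have := le_trans (expR_taylor3 (- l * x)) (hb (- l) _).
    rewrite normrN gtr0_norm// => /(_ erefl).
    by move: (`|_|) (`|_|) (l ^+ 3 ) (expR _) => u v w z; lra.
  have l3 : 0 <= l ^+ 3 by rewrite exprn_ge0// ltW.
  have [iD ID] := gam1_dom_intg mD (mulr_ge0 (ler0n _ 12) l3) (ler0n _ 2) Db.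
  have : `|\int[gam1]_x D x| <= 12 * l ^+ 3 * (2 * expR (2 ^+ 2 / 2)).
    by apply: le_trans ID; apply: Rint_abs_le => //; exact: intg_norm.
  rewrite DE; have -> : 2 ^+ 2 / 2 = 2 :> R by lra.
  have l20 : 0 < l ^+ 2 by rewrite exprn_gt0.
  have nq : `|l ^+ 2 / 2| = l ^+ 2 / 2 by rewrite ger0_norm// divr_ge0// ltW.
  have /andP[] := expR_sub1_bounds (l ^+ 2 / 2); rewrite nq.
  have : expR (l ^+ 2 / 2) <= 2.
    have := ler_wpM2r (expR_ge0 (l ^+ 2 / 2)) (expR_ge1Dx (- (l ^+ 2 / 2))).
    rewrite expRN mulVf ?gt_eqF ?expR_gt0//.
    have : l ^+ 2 <= 1 by rewrite expr_le1// ltW.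
    by have := expR_gt0 (l ^+ 2 / 2); move: (l ^+ 2) (expR _) => y e; nra.
  move=> e2 d0 d1 d2; rewrite -(ler_pM2l l20).
  have -> : l ^+ 2 * (C * l) = C * l ^+ 3 by ring.
  rewrite -[X in X * `|_|](gtr0_norm l20) -normrM.
  have -> : l ^+ 2 * (1 - m) = (2 * expR (l ^+ 2 / 2) - (2 + l ^+ 2 * m))
     - 2 * (expR (l ^+ 2 / 2) - 1 - l ^+ 2 / 2) by field.
  have d3 : `|2 * (expR (l ^+ 2 / 2) - 1 - l ^+ 2 / 2)| <= l ^+ 3.
    rewrite ger0_norm ?mulr_ge0//.
    have h4 : (l ^+ 2 / 2) ^+ 2 * expR (l ^+ 2 / 2) <= (l ^+ 2 / 2) ^+ 2 * 2.
      by rewrite ler_wpM2l ?sqr_ge0.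
    have h5 : (l ^+ 2) ^+ 2 <= l ^+ 3.
      have -> : (l ^+ 2) ^+ 2 = l * l ^+ 3 by ring.
      by rewrite ler_piMl.
    move: d1 h4 h5; rewrite expr_div_n.
    have := ler_wpM2l (sqr_ge0 (l ^+ 2)) e2.
    by move: ((l ^+ 2) ^+ 2) (l ^+ 3) (expR _) => u v e; lra.
  apply: (le_trans (ler_normB _ _)); apply: (le_trans (lerD d2 d3)); rewrite /C.
  by move: (l ^+ 3) (expR 2) => u v; lra.
apply/eqP; rewrite eq_sym -subr_eq0 -normr_eq0 eq_le normr_ge0 andbT.
have C1 : 1 <= C by rewrite lerDr !mulr_ge0 ?expR_ge0.
rewrite leNgt; apply/negP => m0.
pose l := Num.min 1 (`|1 - m| / (2 * C)).
have C0 : 0 < C by lra.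
have l0 : 0 < l by rewrite lt_min ltr01 divr_gt0// mulr_gt0.
have /key : 0 < l <= 1 by rewrite l0 ge_min lexx.
have : C * l <= `|1 - m| / 2.
  have : l <= `|1 - m| / (2 * C) by rewrite ge_min lexx orbT.
  move/(ler_wpM2l (ltW C0)) => /le_trans; apply.
  by rewrite invfM mulrCA [C * _]mulrCA mulfV ?gt_eqF// mulr1 mulrC.
lra.
Qed.

End normal_moments.

Section gaussian_vector_Rint.
Context {R : realType} (n : nat).
Implicit Types (a u w z v : n.-tuple R).

Lemma Rint_gam_dot a (f : R -> R) : measurable_fun setT f ->
  \int[gam n]_z f (dot a z) = \int[gam1]_x f (vnorm a * x).
Proof.
move=> mf; rewrite /Rintegral; congr fine.
have mF : measurable_fun setT (EFin \o f) by exact/measurable_EFinP.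
rewrite integralE [RHS]integralE; congr (_ - _)%E.
- transitivity (\int[gam n]_z ((EFin \o f)^\+%E (dot a z)))%E.
    by apply: eq_integral => z _; rewrite !funeposE.
  rewrite integral_gam_dot//; last exact: measurable_funepos.
  by apply: eq_integral => z _; rewrite !funeposE.
- transitivity (\int[gam n]_z ((EFin \o f)^\-%E (dot a z)))%E.
    by apply: eq_integral => z _; rewrite !funenegE.
  rewrite integral_gam_dot//; last exact: measurable_funeneg.
  by apply: eq_integral => z _; rewrite !funenegE.
Qed.

Lemma intg_gam_dot a (f : R -> R) : measurable_fun setT f ->
  intg gam1 (fun x => f (vnorm a * x)) -> intg (gam n) (fun z => f (dot a z)).
Proof.
move=> mf /integrableP[_ fi]; apply/integrableP; split.
  by apply/measurable_EFinP; apply: (measurableT_comp mf); exact: measurable_dot.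
rewrite (integral_gam_dot a (f := fun y => `|(f y)%:E|%E))//.
by apply: measurableT_comp => //; exact/measurable_EFinP.
Qed.

Definition cmd u z : R := expR (dot u z - dot u u / 2).

Lemma measurable_cmd {d} {T : measurableType d} (F G : T -> n.-tuple R) :
  measurable_fun setT F -> measurable_fun setT G ->
  measurable_fun setT (fun t => cmd (F t) (G t)).
Proof.
move=> mF mG; apply: measurableT_comp => //; apply: measurable_funB.
  exact: measurable_dot.
by apply: measurable_funM => //; exact: measurable_dot.
Qed.

Lemma cmd_gt0 u z : 0 < cmd u z. Proof. exact: expR_gt0. Qed.

Lemma Rint_gam_shift u (f : n.-tuple R -> R) : measurable_fun setT f ->
  \int[gam n]_z f (vlin 1 1 z u) = \int[gam n]_z (f z * cmd u z).
Proof.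
move=> mf; rewrite /Rintegral; congr fine.
have mF : measurable_fun setT (EFin \o f) by exact/measurable_EFinP.
rewrite integralE [RHS]integralE; congr (_ - _)%E.
- transitivity (\int[gam n]_z ((EFin \o f)^\+%E (vlin 1 1 z u)))%E.
    by apply: eq_integral => z _; rewrite !funeposE.
  rewrite (integral_gam_shift u (f := (EFin \o f)^\+%E))//; last exact: measurable_funepos.
  apply: eq_integral => z _; rewrite !funeposE /= -!EFin_max -EFinM; congr EFin.
  by rewrite maxr_pMl ?mul0r ?ltW ?cmd_gt0.
- transitivity (\int[gam n]_z ((EFin \o f)^\-%E (vlin 1 1 z u)))%E.
    by apply: eq_integral => z _; rewrite !funenegE.
  rewrite (integral_gam_shift u (f := (EFin \o f)^\-%E))//; last exact: measurable_funeneg.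
  apply: eq_integral => z _; rewrite !funenegE /= -!EFin_max -EFinM; congr EFin.
  by rewrite maxr_pMl ?mul0r ?mulNr ?ltW ?cmd_gt0.
Qed.

Lemma dot_vlin a al be (s t : n.-tuple R) :
  dot a (vlin al be s t) = al * dot a s + be * dot a t.
Proof.
rewrite /dot !mulr_sumr -big_split /=; apply: eq_bigr => i _.
by rewrite tnth_vlin; ring.
Qed.

Lemma dotC a u : dot a u = dot u a.
Proof. by apply: eq_bigr => i _; rewrite mulrC. Qed.

Lemma dot_CS w u (be c : R) : 0 < be -> 0 < c -> dot w w <= be ^+ 2 ->
  dot u u <= c ^+ 2 -> `|dot w u| <= be * c.
Proof.
move=> be0 c0 hw hu; rewrite /dot (le_trans (ler_norm_sum _ _ _))//.
apply: (@le_trans _ _ (\sum_(i < n) ((c / be) / 2 * (tnth w i * tnth w i)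
    + (be / c) / 2 * (tnth u i * tnth u i)))).
  apply: ler_sum => i _; set x := tnth w i; set y := tnth u i.
  have [s0 sE] : 0 < c / be /\ be / c = (c / be)^-1.
    by rewrite divr_gt0// invf_div.
  rewrite sE; set s := c / be in s0 *.
  have : 0 <= (s * `|x| - `|y|) ^+ 2 / s / 2 by rewrite !divr_ge0 ?sqr_ge0 ?ltW.
  have -> : (s * `|x| - `|y|) ^+ 2 / s / 2 =
      s / 2 * `|x| ^+ 2 + s^-1 / 2 * `|y| ^+ 2 - `|x| * `|y| by field; rewrite gt_eqF.
  by rewrite !real_normK ?num_real// normrM -!expr2; lra.
rewrite big_split -!mulr_sumr /= -/(dot w w) -/(dot u u).
have h1 : c / be / 2 * dot w w <= c / be / 2 * be ^+ 2.
  by rewrite ler_wpM2l// !divr_ge0 ?ltW.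
have h2 : be / c / 2 * dot u u <= be / c / 2 * c ^+ 2.
  by rewrite ler_wpM2l// !divr_ge0 ?ltW.
have -> : be * c = c / be / 2 * be ^+ 2 + be / c / 2 * c ^+ 2 by field; rewrite !gt_eqF.
exact: lerD.
Qed.

Lemma Rint_dot_sqr a : \int[gam n]_z (dot a z) ^+ 2 = dot a a.
Proof.
rewrite (Rint_gam_dot a (f := fun y => y ^+ 2)); last exact: measurable_funX.
under eq_Rintegral do rewrite exprMn.
by rewrite RintZl ?gam1_var ?mulr1 ?sqr_vnorm//; exact: intg_gam1_sqr.
Qed.

Lemma intg_dot_sqr a : intg (gam n) (fun z => (dot a z) ^+ 2).
Proof.
apply: (@intg_gam_dot a (fun y => y ^+ 2)); first exact: measurable_funX.
by under eq_fun do rewrite exprMn; apply: intgZl; exact: intg_gam1_sqr.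
Qed.

Lemma Rint_dot a : \int[gam n]_z (dot a z) = 0.
Proof.
rewrite (Rint_gam_dot a (f := id))// RintZl ?gam1_mean ?mulr0//.
exact: intg_gam1_id.
Qed.

Lemma intg_dot a : intg (gam n) (fun z => dot a z).
Proof. by apply: (@intg_gam_dot a id) => //; apply: intgZl; exact: intg_gam1_id. Qed.

Lemma dot_polar a u z : dot a z * dot u z =
  2^-1 * ((dot (vlin 1 1 a u) z) ^+ 2 - (dot a z) ^+ 2 - (dot u z) ^+ 2).
Proof. by rewrite [dot (vlin _ _ _ _) _]dotC dot_vlin !(dotC z); field. Qed.

Lemma intg_dotM a u : intg (gam n) (fun z => dot a z * dot u z).
Proof.
under eq_fun do rewrite dot_polar.
by apply: intgZl; apply: intgB; [apply: intgB|]; exact: intg_dot_sqr.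
Qed.

Lemma Rint_dotM a u : \int[gam n]_z (dot a z * dot u z) = dot a u.
Proof.
under eq_Rintegral do rewrite dot_polar.
rewrite RintZl; last by apply: intgB; [apply: intgB|]; exact: intg_dot_sqr.
rewrite RintB; [|apply: intgB|]; try exact: intg_dot_sqr.
rewrite RintB; try exact: intg_dot_sqr.
rewrite !Rint_dot_sqr dot_vlin !(dotC (vlin _ _ _ _)) !dot_vlin (dotC u a).
by field.
Qed.

Lemma Rint_cmd u : \int[gam n]_z cmd u z = 1.
Proof.
have := Rint_gam_shift u (f := cst 1) (measurable_cst _).
by rewrite /= Rint_cst => ->; apply: eq_Rintegral => z _; rewrite mul1r.
Qed.

Lemma intg_expR_dot (c b : R) u : intg (gam n) (fun z => expR (c * dot u z + b)).
Proof.
apply: (@intg_gam_dot u (fun y => expR (c * y + b))).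
  by apply: measurableT_comp => //; apply: measurable_funD.
apply: (gam1_dom_intg _ (expR_ge0 b) (normr_ge0 (c * vnorm u)) _).1.
  by apply: measurableT_comp => //; apply: measurable_funD => //; do 2 apply: measurable_funM => //.
move=> x; rewrite ger0_norm ?expR_ge0// addrC expRD ler_wpM2l ?expR_ge0//.
by rewrite -normrM mulrA expR_le_norm.
Qed.

Lemma cmdE u z : cmd u z = expR (1 * dot u z + (- (dot u u / 2))).
Proof. by rewrite mul1r. Qed.

Lemma intg_cmd u : intg (gam n) (cmd u).
Proof.
rewrite (_ : cmd u = fun z => expR (1 * dot u z + (- (dot u u / 2)))).
  exact: intg_expR_dot.
by apply/funext => z; exact: cmdE.
Qed.

Lemma cmd_sqr u z : cmd u z ^+ 2 = expR (dot u u) * cmd (vlin 2 0 u u) z.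
Proof.
rewrite /cmd expr2 -!expRD; congr expR.
by rewrite !(dotC (vlin _ _ _ _)) !dot_vlin !(dotC (vlin _ _ _ _)) !dot_vlin (dotC z u); field.
Qed.

Lemma intg_cmd_sqr u : intg (gam n) (fun z => cmd u z ^+ 2).
Proof. by under eq_fun do rewrite cmd_sqr; apply: intgZl; exact: intg_cmd. Qed.

Lemma Rint_cmd_sqr u : \int[gam n]_z cmd u z ^+ 2 = expR (dot u u).
Proof.
under eq_Rintegral do rewrite cmd_sqr.
by rewrite RintZl ?Rint_cmd ?mulr1//; exact: intg_cmd.
Qed.

End gaussian_vector_Rint.

Section smoothing.
Context {R : realType} (n : nat).
Variable g : n.-tuple R -> R.
Hypotheses (mg : measurable_fun setT g) (g01 : forall z, 0 <= g z <= 1).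
Implicit Types (u w z v : n.-tuple R).

Lemma norm_g_le1 z : `|g z| <= 1.
Proof. by have /andP[g0 g1] := g01 z; rewrite ger0_norm. Qed.

Lemma measurable_shift v : measurable_fun setT (fun z => g (vlin 1 1 v z)).
Proof. by apply: (measurableT_comp mg); exact: measurable_vlin. Qed.

Lemma Rint_g_le (v : n.-tuple R) (f F : n.-tuple R -> R) : measurable_fun setT f ->
  intg (gam n) F -> (forall z, `|f z| <= F z) ->
  `|\int[gam n]_z (g (vlin 1 1 v z) * f z)| <= \int[gam n]_z F z.
Proof.
move=> mf iF fF; apply: Rint_abs_le => //.
  by apply: measurable_funM => //; exact: measurable_shift.
move=> z; rewrite normrM (le_trans _ (fF z))// ler_piMl//.
exact: norm_g_le1.
Qed.

Lemma intg_g (v : n.-tuple R) (f : n.-tuple R -> R) : intg (gam n) f ->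
  intg (gam n) (fun z => g (vlin 1 1 v z) * f z).
Proof.
move=> fi; apply: (intg_dom _ _ (intg_norm fi)).
  by apply: measurable_funM; [exact: measurable_shift|exact: intg_meas fi].
by move=> z; rewrite normrM ler_piMl//; exact: norm_g_le1.
Qed.

(* [smooth1] and [smooth2] are the first and second derivatives of the Gaussian
   convolution [smooth], in closed form (the derivatives fall on the density). *)
Definition smooth v := \int[gam n]_z g (vlin 1 1 v z).
Definition smooth1 v w := \int[gam n]_z (g (vlin 1 1 v z) * dot w z).
Definition smooth2 v w := \int[gam n]_z (g (vlin 1 1 v z) * (dot w z ^+ 2 - dot w w)).

Lemma intg_H2 w : intg (gam n) (fun z => dot w z ^+ 2 - dot w w).
Proof. by apply: intgB; [exact: intg_dot_sqr|exact: intg_cst]. Qed.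

Lemma vlinA v w z : vlin 1 1 (vlin 1 1 v w) z = vlin 1 1 v (vlin 1 1 z w).
Proof. by apply: eq_from_tnth => i; rewrite !tnth_vlin; ring. Qed.

Lemma smooth_shift v w :
  smooth (vlin 1 1 v w) = \int[gam n]_z (g (vlin 1 1 v z) * cmd w z).
Proof.
rewrite /smooth -(Rint_gam_shift w (f := fun z => g (vlin 1 1 v z))); last exact: measurable_shift.
by apply: eq_Rintegral => z _; rewrite vlinA.
Qed.

Lemma smooth2_le v w : `|smooth2 v w| <= 2 * dot w w.
Proof.
have -> : 2 * dot w w = \int[gam n]_z (dot w z ^+ 2 + dot w w).
  by rewrite RintD ?Rint_dot_sqr ?Rint_cst ?mulr2n ?mulrDl ?mul1r//;
    [exact: intg_dot_sqr|exact: intg_cst].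
apply: Rint_g_le; first exact: intg_meas (intg_H2 w).
  by apply: intgD; [exact: intg_dot_sqr|exact: intg_cst].
move=> z; rewrite (le_trans (ler_normB _ _))// ger0_norm ?sqr_ge0//.
by rewrite ger0_norm// dot_ge0.
Qed.

Lemma smooth_taylor v w :
  `|smooth (vlin 1 1 v w) - smooth v - smooth1 v w - 2^-1 * smooth2 v w|
    <= C3 * vnorm w ^+ 3.
Proof.
have ie := intg_g v (intg_cmd w).
have i1 := intg_g v (intg_dot w).
have i2 := intg_g v (intg_H2 w).
have i0 : intg (gam n) (fun z => g (vlin 1 1 v z)).
  by apply: (@intg_bounded _ _ _ _ _ 1); [exact: measurable_shift|move=> z; exact: norm_g_le1].
have -> : smooth (vlin 1 1 v w) - smooth v - smooth1 v w - 2^-1 * smooth2 v w =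
    \int[gam n]_z (g (vlin 1 1 v z) * rem3 (vnorm w) (dot w z)).
  rewrite smooth_shift /smooth /smooth1 /smooth2 -RintZl// -!RintB//; last 3 first.
  - by apply: intgB => //; exact: intgB.
  - exact: intgZl.
  - exact: intgB.
  apply: eq_Rintegral => z _; rewrite /rem3 sqr_vnorm /cmd.
  by ring.
have mr : measurable_fun setT (fun z => rem3 (vnorm w) (dot w z)).
  by apply: (measurableT_comp (measurable_rem3 _)); exact: measurable_dot.
have [iR IR] : intg gam1 (fun x => `|rem3 (vnorm w) (vnorm w * x)|) /\
    \int[gam1]_x `|rem3 (vnorm w) (vnorm w * x)| <= C3 * vnorm w ^+ 3.
  apply: intg_ge0_fin; last exact: gam1_rem3 (vnorm_ge0 w).
    by apply: measurableT_comp => //; apply: (measurableT_comp (measurable_rem3 _)).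
  by [].
have mr' : measurable_fun setT (fun x => `|rem3 (vnorm w) x|).
  by apply: measurableT_comp => //; exact: measurable_rem3.
have iRw := @intg_gam_dot R n w _ mr' iR.
apply: le_trans IR; rewrite -(Rint_gam_dot w mr').
exact: Rint_g_le.
Qed.

Definition C2 : R := 25 * (2 * expR (1 ^+ 2 / 2)).

Lemma gam1_quartic : intg gam1 (fun x : R => (x ^+ 2 - 1) ^+ 2) /\
  \int[gam1]_x ((x ^+ 2 - 1) ^+ 2 : R) <= C2.
Proof.
have mq : measurable_fun setT (fun x : R => (x ^+ 2 - 1) ^+ 2).
  by apply: measurable_funX; apply: measurable_funB => //; exact: measurable_funX.
have q0 (x : R) : 0 <= (x ^+ 2 - 1) ^+ 2 by exact: sqr_ge0.
apply: intg_ge0_fin => //; apply: gam1_dom => // x.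
have := pow4_le_expR_norm x; have := expR_abs_ge1 x; rewrite mul1r.
rewrite (@ger0_norm _ (x ^+ 4)) ?exprn_even_ge0//.
have -> : (x ^+ 2 - 1) ^+ 2 = x ^+ 4 - 2 * x ^+ 2 + 1 by ring.
by have := sqr_ge0 x; move: (expR _) (x ^+ 4) (x ^+ 2) => e y q; lra.
Qed.

Lemma H2_sqr w : intg (gam n) (fun z => (dot w z ^+ 2 - dot w w) ^+ 2) /\
  \int[gam n]_z ((dot w z ^+ 2 - dot w w) ^+ 2) <= dot w w ^+ 2 * C2.
Proof.
have [iq Iq] := gam1_quartic.
have mf : measurable_fun setT (fun y : R => (y ^+ 2 - dot w w) ^+ 2).
  by apply: measurable_funX; apply: measurable_funB => //; exact: measurable_funX.
have fE (x : R) : ((vnorm w * x) ^+ 2 - dot w w) ^+ 2 = dot w w ^+ 2 * (x ^+ 2 - 1) ^+ 2.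
  by rewrite exprMn sqr_vnorm; ring.
split.
  apply: (@intg_gam_dot _ _ w (fun y => (y ^+ 2 - dot w w) ^+ 2)) => //.
  by under eq_fun do rewrite fE; exact: intgZl.
rewrite (Rint_gam_dot w mf); under eq_Rintegral do rewrite fE.
by rewrite RintZl// ler_wpM2l// sqr_ge0.
Qed.

Lemma cmd_sub1_sqr u : dot u u <= 1 ->
  intg (gam n) (fun z => (cmd u z - 1) ^+ 2) /\
  \int[gam n]_z ((cmd u z - 1) ^+ 2) <= (1 + expR 1) * dot u u.
Proof.
move=> u1; have u0 := dot_ge0 u.
have fE z : (cmd u z - 1) ^+ 2 = cmd u z ^+ 2 + (1 - 2 * cmd u z) by ring.
have i1 := intg_cmd_sqr u.
have i2 : intg (gam n) (fun z => 1 - 2 * cmd u z).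
  by apply: intgB; [exact: intg_cst|apply: intgZl; exact: intg_cmd].
split; first by under eq_fun do rewrite fE; exact: intgD.
under eq_Rintegral do rewrite fE.
rewrite RintD// RintB; [|exact: intg_cst|by apply: intgZl; exact: intg_cmd].
rewrite Rint_cmd_sqr Rint_cst RintZl ?Rint_cmd; last exact: intg_cmd.
have /andP[_] := expR_sub1_bounds (dot u u); rewrite ger0_norm//.
have h : dot u u ^+ 2 * expR (dot u u) <= dot u u * expR 1.
  by rewrite ler_pM ?sqr_ge0 ?expR_ge0 ?ler_expR// expr2 ler_piMl.
by move: h u0 u1; move: (expR (dot u u)) (expR 1) => a b; move: (dot u u) => c; lra.
Qed.

Definition C5 : R := C2 + 5 * expR 1 + 5.

Lemma smooth2_shift v u w (be c : R) : 0 < be -> 0 < c <= 1 ->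
  dot w w <= be ^+ 2 -> dot u u <= c ^+ 2 ->
  `|smooth2 (vlin 1 1 v u) w - smooth2 v w| <= C5 * be ^+ 2 * c.
Proof.
move=> be0 /andP[c0 c1] hw hu.
have om := dot_CS be0 c0 hw hu; set o := dot w u in om.
have W0 := dot_ge0 w; set W := dot w w in hw W0.
pose F z := (dot w z - o) ^+ 2 - W.
have mF : measurable_fun setT F.
  apply: measurable_funB => //; apply: measurable_funX; apply: measurable_funB => //.
  exact: measurable_dot.
have i2 := intg_g v (intg_H2 w).
have iH : intg (gam n) (fun z => (dot w z ^+ 2 - W) ^+ 2) by case: (H2_sqr w).
have u1 : dot u u <= 1 by rewrite (le_trans hu)// expr_le1// ltW.
have [ie Ie] := cmd_sub1_sqr u1.
have c2 : c ^+ 2 <= 1 by rewrite expr_le1// ltW.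
pose B1 z := c / be ^+ 2 / 2 * (dot w z ^+ 2 - W) ^+ 2.
pose B2 z := be ^+ 2 / c / 2 * (cmd u z - 1) ^+ 2.
pose B3 z := c * dot w z ^+ 2 + c * be ^+ 2 * cmd u z ^+ 2.
pose B4 z := (be * c) ^+ 2 * cmd u z.
pose B z := B1 z + B2 z + (B3 z + B4 z).
have iB1 : intg (gam n) B1 by exact: intgZl.
have iB2 : intg (gam n) B2 by exact: intgZl.
have iB31 : intg (gam n) (fun z => c * dot w z ^+ 2).
  by apply: intgZl; exact: intg_dot_sqr.
have iB32 : intg (gam n) (fun z => c * be ^+ 2 * cmd u z ^+ 2).
  by apply: intgZl; exact: intg_cmd_sqr.
have iB3 : intg (gam n) B3 by exact: intgD.
have iB4 : intg (gam n) B4 by apply: intgZl; exact: intg_cmd.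
have iB : intg (gam n) B by apply: intgD; exact: intgD.
have Bb z : `|F z * cmd u z - (dot w z ^+ 2 - W)| <= B z.
  rewrite /F /B /B1 /B2 /B3 /B4; have := cmd_gt0 u z.
  set e := cmd u z; set p := dot w z => e0.
  have -> : ((p - o) ^+ 2 - W) * e - (p ^+ 2 - W) =
    (p ^+ 2 - W) * (e - 1) + ((- 2 * p * o) * e + o ^+ 2 * e) by ring.
  apply: (le_trans (ler_normD _ _)); apply: lerD.
    rewrite normrM; set x := p ^+ 2 - W; set y := e - 1.
    rewrite -(real_normK (num_real x)) -(real_normK (num_real y)).
    have s0 : 0 < c / be ^+ 2 by rewrite divr_gt0// exprn_gt0.
    have -> : be ^+ 2 / c = (c / be ^+ 2)^-1 by rewrite invf_div.
    move: (c / be ^+ 2) s0 => s s0.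
    rewrite -subr_ge0 (_ : _ - _ = (s * `|x| - `|y|) ^+ 2 / s / 2).
      by rewrite !divr_ge0 ?sqr_ge0 ?ltW.
    by field; rewrite gt_eqF.
  apply: (le_trans (ler_normD _ _)); apply: lerD.
    rewrite !normrM normrN (ger0_norm (ltW e0)) (ger0_norm (ler0n _ 2)).
    apply: (@le_trans _ _ (2 * `|p| * (be * c) * e)).
      by rewrite ler_wpM2r ?(ltW e0)// ler_wpM2l// mulr_ge0.
    rewrite -subr_ge0 -(real_normK (num_real p)).
    have -> : c * `|p| ^+ 2 + c * be ^+ 2 * e ^+ 2 - 2 * `|p| * (be * c) * e =
      c * (`|p| - be * e) ^+ 2 by ring.
    by rewrite mulr_ge0 ?sqr_ge0 ?(ltW c0).
  rewrite normrM (ger0_norm (ltW e0)) ler_wpM2r ?(ltW e0)// ger0_norm ?sqr_ge0//.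
  by rewrite -(real_normK (num_real o)) ler_pXn2r ?nnegrE// mulr_ge0// ltW.
have mG : measurable_fun setT (fun z => F z * cmd u z - (dot w z ^+ 2 - W)).
  apply: measurable_funB; last exact: intg_meas (intg_H2 w).
  by apply: measurable_funM => //; exact: measurable_cmd.
have iG := intg_dom mG Bb iB.
have iFc : intg (gam n) (fun z => F z * cmd u z).
  by have := intgD iG (intg_H2 w); under eq_fun do rewrite subrK.
have -> : smooth2 (vlin 1 1 v u) w - smooth2 v w =
    \int[gam n]_z (g (vlin 1 1 v z) * (F z * cmd u z - (dot w z ^+ 2 - W))).
  rewrite /smooth2; under [RHS]eq_Rintegral do rewrite mulrBr.
  rewrite RintB; [|exact: intg_g|exact: i2].
  congr (_ - _); under [RHS]eq_Rintegral do rewrite mulrA.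
  rewrite -(Rint_gam_shift u (f := fun z => g (vlin 1 1 v z) * F z)); last first.
    by apply: measurable_funM => //; exact: measurable_shift.
  by apply: eq_Rintegral => z _; rewrite vlinA /F dot_vlin !mul1r addrK.
apply: (le_trans (Rint_g_le v mG iB Bb)).
rewrite /B RintD; [|exact: intgD|exact: intgD].
rewrite (RintD iB1 iB2) (RintD iB3 iB4) (RintD iB31 iB32) /B1 /B2 /B4.
rewrite (RintZl _ iH) (RintZl _ ie) (RintZl _ (intg_cmd u)) Rint_cmd.
rewrite (RintZl _ (intg_dot_sqr w)) (RintZl _ (intg_cmd_sqr u)).
rewrite Rint_dot_sqr Rint_cmd_sqr.
have [_ h1] := H2_sqr w.
have be2 : 0 < be ^+ 2 by rewrite exprn_gt0.
have e1 : 1 <= expR 1 :> R by rewrite -[X in X <= _]expR0 ler_expR.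
have C20 : 0 <= C2 by rewrite !mulr_ge0// expR_ge0.
have k1 : c / be ^+ 2 / 2 * \int[gam n]_z ((dot w z ^+ 2 - W) ^+ 2) <= be ^+ 2 * c * C2.
  have q00 : 0 <= c / be ^+ 2 / 2 by rewrite !divr_ge0 ?ltW.
  apply: (le_trans (ler_wpM2l q00 h1)).
  have : W ^+ 2 <= (be ^+ 2) ^+ 2 by rewrite ler_pXn2r ?nnegrE// (ltW be2).
  have q0 : 0 <= c / be ^+ 2 / 2 * C2 by rewrite mulr_ge0.
  move/(ler_wpM2l q0); rewrite -/W.
  have -> : c / be ^+ 2 / 2 * C2 * (be ^+ 2) ^+ 2 = be ^+ 2 * c * C2 / 2.
    by field; rewrite gt_eqF.
  have : 0 <= be ^+ 2 * c * C2 by apply: mulr_ge0 => //; apply: mulr_ge0; exact: ltW.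
  move: (be ^+ 2 * c * C2) => z z0 hz.
  have -> : c / be ^+ 2 / 2 * (W ^+ 2 * C2) = c / be ^+ 2 / 2 * C2 * W ^+ 2 by ring.
  by lra.
have k2 : be ^+ 2 / c / 2 * \int[gam n]_z ((cmd u z - 1) ^+ 2) <= be ^+ 2 * c * (1 + expR 1).
  have q0 : 0 <= be ^+ 2 / c / 2 by rewrite !divr_ge0 ?ltW.
  have q1 : 0 <= 1 + expR 1 :> R by rewrite addr_ge0 ?expR_ge0.
  apply: (le_trans (ler_wpM2l q0 (le_trans Ie (ler_wpM2l q1 hu)))).
  have -> : be ^+ 2 / c / 2 * ((1 + expR 1) * c ^+ 2) = be ^+ 2 * c * (1 + expR 1) / 2.
    by field; rewrite gt_eqF.
  have : 0 <= be ^+ 2 * c * (1 + expR 1) by apply: mulr_ge0 => //; apply: mulr_ge0; exact: ltW.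
  by lra.
have k3 : c * W <= be ^+ 2 * c by rewrite mulrC ler_wpM2r// (ltW c0).
have k4 : c * be ^+ 2 * expR (dot u u) <= be ^+ 2 * c * expR 1.
  by rewrite [c * _]mulrC ler_wpM2l ?ler_expR// mulr_ge0// ltW.
have k5 : (be * c) ^+ 2 <= be ^+ 2 * c.
  by rewrite exprMn ler_wpM2l ?(ltW be2)// expr2 ler_piMl// (ltW c0).
have q : 0 <= be ^+ 2 * c by rewrite mulr_ge0 ?ltW.
apply: (le_trans (lerD (lerD k1 k2) (lerD (lerD k3 k4) (_ : _ <= be ^+ 2 * c)))).
  by rewrite mulr1.
have q' : be ^+ 2 * c <= be ^+ 2 * c * expR 1 by rewrite ler_peMr.
rewrite (_ : C5 * be ^+ 2 * c = C5 * (be ^+ 2 * c)); last by rewrite mulrA.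
rewrite /C5; move: q q'; move: (be ^+ 2 * c) (expR 1) C2 => x y z; lra.
Qed.

End smoothing.

(** * Geometric mixing of the walk modulo 1 *)

Section overlap.
Context {R : realType}.
Variables (mu : probability R R) (g : R -> R).
Hypotheses (mg : measurable_fun setT g) (g0 : forall z, 0 <= g z).
Hypothesis muE : forall B, measurable B -> mu B = (\int[lebR]_(z in B) (g z)%:E)%E.

Let mge (c : R) : measurable [set z | c < g z].
Proof. by rewrite -[X in measurable X]setTI; exact: measurable_fun_ltr. Qed.

Lemma density_level_pos : exists2 c, 0 < c & (0 < lebR [set z | (c < g z)%R])%E.
Proof.
apply: contrapT => /forall2NP h.
have h0 n : lebR [set z | (n.+1%:R^-1 < g z)%R] = 0%E.
  have [h1|/negP] := h n.+1%:R^-1.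
    by exfalso; apply: h1; rewrite invr_gt0 ltr0n.
  by rewrite -leNgt => h1; apply/eqP; rewrite eq_le h1 measure_ge0.
have h1 : lebR [set z | (0 < g z)%R] = 0%E.
  apply/eqP; rewrite eq_le measure_ge0 andbT.
  have -> : [set z | 0 < g z] = \bigcup_n [set z | n.+1%:R^-1 < g z].
    apply/seteqP; split => z /=; last first.
      by move=> [n _ /=]; apply: lt_trans; rewrite invr_gt0.
    move=> gz; exists (Num.truncn (g z)^-1) => //=.
    by rewrite -[X in _ < X]invrK ltf_pV2 ?posrE ?invr_gt0// truncnS_gt.
  apply: (le_trans (measure_sigma_subadditive _ _ _ (@subset_refl _ _))) => //.
    by apply: bigcupT_measurable => n; exact: mge.
  by rewrite (eq_eseriesr (fun n _ => h0 n)) eseries0.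
have : mu setT = 0%E.
  rewrite muE//.
  rewrite -(setUv [set z | 0 < g z]) ge0_integral_setU//=; last 4 first.
  - exact: measurableC.
  - by rewrite setUv; apply/measurable_EFinP.
  - by move=> z _; rewrite lee_fin.
  - by rewrite disj_set2E setICr.
  rewrite null_set_integral//; last by apply/measurable_EFinP/measurable_funTS.
  rewrite add0e; apply: integral0_eq => z /= /negP; rewrite -leNgt => h2.
  by congr EFin; apply/eqP; rewrite eq_le h2 g0.
move=> h2; have h3 : (0 : \bar R) = 1%E := etrans (esym h2) (@probability_setT _ _ _ mu).
by case: h3 => /esym/eqP; rewrite oner_eq0.
Qed.

Lemma density_point (A : set R) : measurable A -> (0 < lebR A)%E ->
  exists x0 r : R, 0 < r /\ ((3 / 2 * r)%:E <= lebR (A `&` ball x0 r))%E.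
Proof.
move=> mA A0.
have [N [mN N0 hN]] := lebesgue_density mA.
have [x0 [Ax0 Nx0]] : exists x0, A x0 /\ ~ N x0.
  apply: contrapT => /forallNP h.
  have : (lebR A <= lebR N)%E.
    by apply: le_measure; rewrite ?inE// => z Az; apply: contrapT => Nz; exact: (h z).
  by rewrite leNgt /lebR N0 -/lebR A0.
have : (lebesgue_measure (A `&` ball x0 r) * (lebesgue_measure (ball x0 r))^-1)%E @[r --> 0^'+] -->
   (\1_A x0)%:E.
  by apply: contrapT => h; apply: Nx0; apply: hN.
rewrite /= indicE mem_set// => /fine_cvgP[hf /cvgrPdist_lt /(_ 4^-1)].
rewrite invr_gt0 ltr0n => /(_ isT) hd.
have [r [[r0 /= fr] hr]] := filter_ex (filterI (filterI (nbhs_right_gt 0) hf) hd).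
exists x0, r; split => //.
move: fr hr; rewrite /= lebesgue_measure_ball ?(ltW r0)// -/lebR.
have mB : measurable (A `&` ball x0 r) by apply: measurableI => //; exact: measurable_ball.
have fB : lebR (A `&` ball x0 r) \is a fin_num.
  rewrite ge0_fin_numE//; apply: (le_lt_trans (measureIr _ _ _)) => //.
    exact: measurable_ball.
  by rewrite /= /lebR lebesgue_measure_ball ?(ltW r0)// ltry.
rewrite -(fineK fB) inver mulrn_eq0/= gt_eqF//= => _; set a := fine _.
rewrite ltr_norml => /andP[_ h]; rewrite lee_fin.
have e : a = a / (r *+ 2) * (r *+ 2) by rewrite divfK// mulrn_eq0/= gt_eqF.
have : 3 / 4 * (r *+ 2) <= a / (r *+ 2) * (r *+ 2).
  by apply: ler_wpM2r; [rewrite mulrn_wge0// ltW|move: h; lra].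
by rewrite -e -mulr_natr; lra.
Qed.

Lemma density_overlap : exists c1 r m : R, [/\ 0 < c1, 0 < r, 0 < m &
  forall u, `|u| <= r -> exists E : set R, [/\ measurable E, (m%:E <= lebR E)%E &
    forall z, E z -> c1 <= g z /\ c1 <= g (z - u)]].
Proof.
have [c1 c10 hc] := density_level_pos.
have mA := mge c1.
have [x0 [r [r0 hr]]] := density_point mA hc.
exists c1, (r / 4), (r / 2); split; rewrite ?divr_gt0// => u hu.
set A := [set z | c1 < g z] in mA hr.
set A1 := A `&` ball x0 r.
have mA1 : measurable A1 by apply: measurableI => //; exact: measurable_ball.
set A2 := [set z | A1 (z - u)].
have mA2 : measurable A2.
  have h : measurable_fun [set: R] (fun z : R => z - u) by exact: measurable_funB.
  by rewrite -[A2]setTI; exact: h.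
have lA2 : lebR A2 = lebR A1.
  rewrite (@lebesgue_affine_preimage _ 1 (- u) A1)// normr1 mul1e /A2.
  by congr (lebR _); apply/seteqP; split => z /=; rewrite mul1r.
set J : set R := `[x0 - r - r / 4, x0 + r + r / 4]%classic.
have lJ : lebR J = (5 / 2 * r)%:E.
  rewrite /J /lebR lebesgue_measure_itv/= lte_fin ifT; last by lra.
  by rewrite -EFinB; congr EFin; field.
have mJ : measurable J by exact: measurable_itv.
have uJ : A1 `|` A2 `<=` J.
  move: hu; rewrite ler_norml => /andP[u1 u2].
  by move=> z [[_]|[_]]; rewrite /ball/= ltr_norml /J /= in_itv/= => /andP[h1 h2];
    apply/andP; split; lra.
have fin (B : set R) : measurable B -> B `<=` J -> lebR B \is a fin_num.
  move=> mB BJ; rewrite ge0_fin_numE//; apply: (@le_lt_trans _ _ (lebR J)).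
    by apply: le_measure; rewrite ?inE.
  by rewrite lJ ltry.
exists (A1 `&` A2); split; first exact: measurableI.
- have fA1 := fin _ mA1 (subset_trans (@subsetUl _ _ A2) uJ).
  have mI : measurable (A1 `&` A2) by exact: measurableI.
  have fI : lebR (A1 `&` A2) \is a fin_num.
    by apply: fin => // z [hz _]; apply: uJ; left.
  have fA2 : (lebR A2 < +oo)%E by rewrite lA2 ltey_eq fA1.
  have hU : lebR (A1 `|` A2) = (lebR A1 + lebR A1 - lebR (A1 `&` A2))%E.
    by rewrite -[X in (_ = _ + X - _)%E]lA2; exact: (@measureUfinr _ _ _ lebR).
  have hJ : (lebR (A1 `|` A2) <= (5 / 2 * r)%:E)%E.
    by rewrite -lJ; apply: le_measure; rewrite ?inE//; exact: measurableU.
  move: hJ; rewrite hU.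
  move: hr; rewrite -/A1; case: (lebR A1) fA1 => [p1||]// _; case: (lebR _) fI => [p2||]// _.
  by rewrite !lee_fin /=; lra.
- by move=> z [[/= h1 _] [/= h2 _]]; split; exact: ltW.
Qed.

Lemma overlap_contraction : exists c0 eta : R, [/\ 0 < c0, c0 <= 1, 0 < eta &
  forall (F1 F2 : R -> R) (be kap u : R), measurable_fun setT F1 -> measurable_fun setT F2 ->
    (forall z, 0 <= F1 z <= be) -> (forall z, 0 <= F2 z <= be) ->
    (forall z, F1 z <= F2 z + kap) -> 0 <= kap <= be -> `|u| <= eta ->
    \int[mu]_z F1 z - \int[mu]_z F2 (z + u) <= (1 - c0) * be + c0 * kap].
Proof.
have [c1 [r [m [c10 r0 m0 hE]]]] := density_overlap.
exists (Num.min 1 (c1 * m)), r; split => //.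
- by rewrite lt_min ltr01 mulr_gt0.
- by rewrite ge_min lexx.
move=> F1 F2 be kap u mF1 mF2 F1b F2b F12 /andP[kap0 kapbe] ur.
have [E [mE mEE Ec]] := hE u ur.
have be0 : 0 <= be by exact: le_trans kapbe.
pose o z := c1 * \1_E z : R.
have o0 z : 0 <= o z by rewrite mulr_ge0// ltW.
have og z : o z <= g z.
  rewrite /o indicE; case: (boolP (z \in E)) => [|_]; last by rewrite mulr0.
  by rewrite inE => /Ec[h _]; rewrite mulr1.
have ogu z : o z <= g (z - u).
  rewrite /o indicE; case: (boolP (z \in E)) => [|_]; last by rewrite mulr0.
  by rewrite inE => /Ec[_ h]; rewrite mulr1.
have mo : measurable_fun setT o by apply: measurable_funM => //; exact: measurable_indic.
have iF1 : intg mu F1 by apply: (@intg_bounded _ _ _ _ _ be) => // z; rewrite ger0_norm; case/andP: (F1b z).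
have madd (c : R) : measurable_fun [set: R] (fun z : R => z + c) by exact: measurable_funD.
have mF2u : measurable_fun [set: R] (fun z : R => F2 (z + u)).
  exact: (measurableT_comp mF2 (madd u)).
have mgu : measurable_fun [set: R] (fun z : R => g (z - u)).
  exact: (measurableT_comp mg (madd (- u))).
have iF2 : intg mu (fun z => F2 (z + u)).
  by apply: (@intg_bounded _ _ _ _ _ be) => // z; rewrite ger0_norm; case/andP: (F2b (z + u)).
have dens (f : R -> R) : measurable_fun setT f -> (forall z, 0 <= f z) ->
    (\int[mu]_z (f z)%:E = \int[lebR]_z (f z * g z)%:E)%E.
  move=> mf f0; rewrite (@ge0_integral_density _ _ _ lebR mu g (EFin \o f))//.
  exact/measurable_EFinP.
have eF1 := EFin_Rint iF1; have eF2 := EFin_Rint iF2.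
rewrite dens// in eF1; last by move=> z; case/andP: (F1b z).
rewrite dens// in eF2; last by move=> z; case/andP: (F2b (z + u)).
have g1 : (\int[lebR]_z (g z)%:E = 1)%E.
  by rewrite -muE//; exact: (@probability_setT _ _ _ mu).
have shift : (\int[lebR]_z (F2 (z + u) * g z)%:E = \int[lebR]_z (F2 z * g (z - u))%:E)%E.
  rewrite [RHS](@ge0_integral_affine _ 1 u)//.
  - by rewrite normr1 mul1e; apply: eq_integral => z _; rewrite mul1r addrK.
  - by apply/measurable_EFinP; exact: measurable_funM.
  - by move=> z; rewrite lee_fin mulr_ge0//; case/andP: (F2b z).
have oE : (\int[lebR]_z (o z)%:E = c1%:E * lebR E)%E.
  under eq_integral do rewrite /o EFinM.
  rewrite ge0_integralZl_EFin//; last 2 first.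
  - by apply/measurable_EFinP; exact: measurable_indic.
  - exact: ltW.
  by rewrite integral_indic// setIT.
have o1 : (\int[lebR]_z (o z)%:E <= 1)%E.
  rewrite -g1; apply: ge0_le_integral => //.
  - by move=> z _; rewrite lee_fin.
  - exact/measurable_EFinP.
  - exact/measurable_EFinP.
  - by move=> z _; rewrite lee_fin.
have [mo' oE' mo1] : exists2 mo' : R, (\int[lebR]_z (o z)%:E = mo'%:E)%E & Num.min 1 (c1 * m) <= mo'.
  exists (fine (\int[lebR]_z (o z)%:E)).
    rewrite fineK// ge0_fin_numE; first exact: le_lt_trans (ltry 1).
    by apply: integral_ge0 => z _; rewrite lee_fin.
  rewrite ge_min; apply/orP; right; rewrite -lee_fin fineK.
    by rewrite oE EFinM lee_wpmul2l// lee_fin ltW.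
  rewrite ge0_fin_numE; first exact: le_lt_trans (ltry 1).
  by apply: integral_ge0 => z _; rewrite lee_fin.
clearbody o.
have key : (\int[lebR]_z ((F1 z * g z)%:E + (be * o z)%:E) <=
    \int[lebR]_z ((F2 z * g (z - u))%:E + (kap * o z)%:E + (be * g z)%:E))%E.
  apply: ge0_le_integral => //.
  - by move=> z _; rewrite lee_fin addr_ge0// mulr_ge0//; case/andP: (F1b z).
  - by apply/measurable_EFinP; apply: measurable_funD; exact: measurable_funM.
  - by apply/measurable_EFinP; apply: measurable_funD; [apply: measurable_funD|]; exact: measurable_funM.
  - move=> z _; rewrite lee_fin.
    case/andP: (F1b z) => f10 f11; case/andP: (F2b z) => f20 f21.
    have := F12 z; have := o0 z; have := og z; have := ogu z => h1 h2 h3 h4.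
    have : F1 z * (g z - o z) <= be * (g z - o z) by rewrite ler_wpM2r// subr_ge0.
    have : F1 z * o z <= (F2 z + kap) * o z by rewrite ler_wpM2r.
    have : F2 z * o z <= F2 z * g (z - u) by rewrite ler_wpM2l.
    by lra.
have pos1 z : 0 <= F1 z * g z by rewrite mulr_ge0//; case/andP: (F1b z).
have pos2 z : 0 <= F2 z * g (z - u) by rewrite mulr_ge0//; case/andP: (F2b z).
have mZ (a : R) (f : R -> R) : measurable_fun setT f -> measurable_fun setT (fun z => (a * f z)%:E).
  by move=> mf; apply/measurable_EFinP; exact: measurable_funM.
have mM (f h : R -> R) : measurable_fun setT f -> measurable_fun setT h -> measurable_fun setT (fun z => (f z * h z)%:E).
  by move=> mf mh; apply/measurable_EFinP; exact: measurable_funM.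
have iZ (a : R) (f : R -> R) : 0 <= a -> measurable_fun setT f -> (forall z, 0 <= f z) ->
   (\int[lebR]_z (a * f z)%:E = a%:E * \int[lebR]_z (f z)%:E)%E.
  move=> a0 mf f0; under eq_integral do rewrite EFinM.
  by rewrite ge0_integralZl_EFin//; [move=> z _; rewrite lee_fin|exact/measurable_EFinP].
move: key; rewrite ge0_integralD//; last 4 first.
- by move=> z _; rewrite lee_fin.
- exact: mM.
- by move=> z _; rewrite lee_fin mulr_ge0.
- exact: mZ.
rewrite ge0_integralD//; last 4 first.
- by move=> z _; rewrite lee_fin addr_ge0// mulr_ge0.
- by apply: emeasurable_funD; [exact: mM|exact: mZ].
- by move=> z _; rewrite lee_fin mulr_ge0.
- exact: mZ.
rewrite ge0_integralD//; last 4 first.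
- by move=> z _; rewrite lee_fin.
- exact: mM.
- by move=> z _; rewrite lee_fin mulr_ge0.
- exact: mZ.
rewrite !iZ//.
set I1 := integral _ _ _ ; set I2 := integral _ _ _; set I3 := integral _ _ _; set I4 := integral _ _ _.
have -> : I1 = (\int[mu]_x F1 x)%:E by [].
have -> : I2 = mo'%:E by [].
have -> : I3 = (\int[mu]_x F2 (x + u))%:E by rewrite eF2 shift.
have -> : I4 = 1%E by [].
rewrite mule1 -!EFinM -!EFinD lee_fin.
have : Num.min 1 (c1 * m) * (be - kap) <= mo' * (be - kap) by rewrite ler_wpM2r// subr_ge0.
set c0 := Num.min _ _; lra.
Qed.

End overlap.

Section mixing.
Context {R : realType}.
Variables (mu : probability R R) (x : R).
Hypothesis x0 : x != 0.
Implicit Types f : R -> R.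

Definition Pop (f : R -> R) (y : R) : R := \int[mu]_z f (y + x * z).
Definition periodic1 (f : R -> R) := forall y, f (y + 1) = f y.

Lemma measurable_affine_pair : measurable_fun [set: R * R] (fun p : R * R => p.1 + x * p.2).
Proof. by apply: measurable_funD => //; exact: measurable_funM. Qed.

Lemma measurable_affine (y : R) : measurable_fun [set: R] (fun z : R => y + x * z).
Proof. by apply: measurable_funD => //; exact: measurable_funM. Qed.

Lemma intg_Pop f M y : measurable_fun setT f -> (forall y, `|f y| <= M) ->
  intg mu (fun z => f (y + x * z)).
Proof.
move=> mf fM; apply: (@intg_bounded _ _ _ _ _ M) => //.
exact: (measurableT_comp mf (measurable_affine y)).
Qed.

Lemma measurable_Pop f M : measurable_fun setT f -> (forall y, `|f y| <= M) ->
  measurable_fun setT (Pop f).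
Proof.
move=> mf fM; have mF := measurableT_comp mf measurable_affine_pair.
exact: (measurable_Rint_section mF (fun y z => fM (y + x * z)) (intg_cst mu M)).
Qed.

Lemma Pop_bounds f a b : measurable_fun setT f -> (forall y, a <= f y <= b) ->
  forall y, a <= Pop f y <= b.
Proof.
move=> mf fb y.
have fM y' : `|f y'| <= `|a| + `|b|.
  case/andP: (fb y') => h1 h2; rewrite ler_norml; apply/andP; split.
    by have := ler_norm (- a); rewrite normrN; have := normr_ge0 b; lra.
  by have := ler_norm b; have := normr_ge0 a; lra.
have ig := intg_Pop y mf fM.
apply/andP; split.
  rewrite -(Rint_cst mu a); apply: Rint_le => //; first exact: intg_cst.
  by move=> z; case/andP: (fb (y + x * z)).
rewrite -(Rint_cst mu b); apply: Rint_le => //; first exact: intg_cst.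
by move=> z; case/andP: (fb (y + x * z)).
Qed.

Lemma Pop_abs f M : measurable_fun setT f -> (forall y, `|f y| <= M) ->
  forall y, `|Pop f y| <= M.
Proof. by move=> mf fM y; apply: Rint_abs_bound => //; exact: (measurableT_comp mf (measurable_affine y)). Qed.

Lemma periodic_Pop f : periodic1 f -> periodic1 (Pop f).
Proof. by move=> pf y; rewrite /Pop; apply: eq_Rintegral => z _; rewrite addrAC pf. Qed.

Lemma periodic_int f (n : int) y : periodic1 f -> f (y + n%:~R) = f y.
Proof.
move=> pf; have pn (m : nat) y' : f (y' + m%:R) = f y'.
  by elim: m y' => [|m ih] y'; rewrite ?addr0// -natr1 addrA pf ih.
case: n => n; first exact: pn.
by rewrite NegzE rmorphN /= -(pn n.+1 (y - _)) subrK.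
Qed.

Lemma iter_Pop_meas f M r : measurable_fun setT f -> (forall y, `|f y| <= M) ->
  measurable_fun setT (iter r Pop f) /\ (forall y, `|iter r Pop f y| <= M).
Proof.
move=> mf fM; elim: r => [//|r [ih1 ih2]] /=; split; [exact: measurable_Pop ih2|exact: Pop_abs].
Qed.

Lemma iter_Pop_periodic f r : periodic1 f -> periodic1 (iter r Pop f).
Proof. by move=> pf; elim: r => //= r; exact: periodic_Pop. Qed.

Lemma osc_range f be : (forall y y', f y - f y' <= be) -> exists a, forall y, a <= f y <= a + be.
Proof.
move=> h; have hne : range f !=set0 by exists (f 0), 0.
have hlb : has_lbound (range f).
  by exists (f 0 - be) => _ [y _ <-]; have := h 0 y; lra.
exists (inf (range f)) => y; apply/andP; split.
  by apply: ge_inf => //; exists y.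
rewrite -lerBlDr; apply: lb_le_inf => // _ [y' _ <-]; have := h y y'; lra.
Qed.

Lemma frac_itv (y : R) : 0 <= frac y < 1.
Proof.
by rewrite /frac; have := floor_itv y; rewrite intrD => /andP[h1 h2]; apply/andP; split; lra.
Qed.

Lemma periodic_frac f y : periodic1 f -> f (frac y) = f y.
Proof. by move=> pf; rewrite /frac -rmorphN periodic_int. Qed.

Lemma iter_PopB f M a r y : measurable_fun setT f -> (forall y, `|f y| <= M) ->
  iter r Pop (fun y => f y - a) y = iter r Pop f y - a.
Proof.
move=> mf fM; elim: r y => [//|r ih] y /=.
have [mr br] := iter_Pop_meas r mf fM.
have -> : iter r Pop (fun y => f y - a) = (fun y => iter r Pop f y - a).
  by apply/funext => z; exact: ih.
rewrite /Pop RintB ?Rint_cst//; [exact: (intg_Pop y mr br)|exact: intg_cst].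
Qed.

Section chain.
Variables (c0 eta : R).
Hypotheses (c00 : 0 < c0) (c01 : c0 <= 1) (eta0 : 0 < eta).
Hypothesis contr : forall (F1 F2 : R -> R) (be kap u : R),
    measurable_fun setT F1 -> measurable_fun setT F2 ->
    (forall z, 0 <= F1 z <= be) -> (forall z, 0 <= F2 z <= be) ->
    (forall z, F1 z <= F2 z + kap) -> 0 <= kap <= be -> `|u| <= eta ->
    \int[mu]_z F1 z - \int[mu]_z F2 (z + u) <= (1 - c0) * be + c0 * kap.

Lemma chain_contraction f be j y y' : measurable_fun setT f -> (forall y, 0 <= f y <= be) ->
  `|y - y'| <= j%:R * (eta * `|x|) ->
  iter j Pop f y - iter j Pop f y' <= (1 - c0 ^+ j) * be.
Proof.
move=> mf fb; have be0 : 0 <= be by case/andP: (fb 0) => h1 h2; exact: le_trans h2.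
have fM z : `|f z| <= be by case/andP: (fb z) => h1 h2; rewrite ger0_norm.
have Fb k z : 0 <= iter k Pop f z <= be.
  elim: k z => [|k ih] z; first exact: fb.
  by apply: Pop_bounds => //; have [] := iter_Pop_meas k mf fM.
elim: j y y' => [|j ih] y y'.
  by rewrite mul0r normr_le0 subr_eq0 => /eqP->; rewrite expr0 /=; lra.
move=> hy; pose u := (y' - y) / x / j.+1%:R.
have j0 : 0 < j.+1%:R :> R by rewrite ltr0n.
have nx0 : 0 < `|x| by rewrite normr_gt0.
have [mFj _] := iter_Pop_meas j mf fM.
have := @contr (fun z => iter j Pop f (y + x * z)) (fun z => iter j Pop f (y' - x * u + x * z))
  be ((1 - c0 ^+ j) * be) u.
have cj : 0 <= c0 ^+ j <= 1 by rewrite exprn_ge0 ?exprn_ile1// ltW.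
have H1 : measurable_fun setT (fun z => iter j Pop f (y + x * z)).
  exact: (measurableT_comp mFj (measurable_affine _)).
have H2 : measurable_fun setT (fun z => iter j Pop f (y' - x * u + x * z)).
  exact: (measurableT_comp mFj (measurable_affine _)).
move=> /(_ H1 H2 (fun z => Fb j _) (fun z => Fb j _)).
have H3 z : iter j Pop f (y + x * z) <= iter j Pop f (y' - x * u + x * z) + (1 - c0 ^+ j) * be.
  rewrite -lerBlDl; apply: ih.
  have -> : y + x * z - (y' - x * u + x * z) = (y - y') * (j%:R / j.+1%:R).
    by rewrite /u -natr1; field; rewrite x0 natr1 lt0r_neq0.
  rewrite normrM (@ger0_norm _ (_ / _)) ?divr_ge0//.
  apply: le_trans (ler_wpM2r _ hy) _; first by rewrite divr_ge0.
  by rewrite le_eqVlt; apply/orP; left; apply/eqP; field; rewrite lt0r_neq0.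
have H4 : 0 <= (1 - c0 ^+ j) * be <= be.
  by case/andP: cj => h1 h2; apply/andP; split; nra.
have H5 : `|u| <= eta.
  rewrite /u !normrM !normfV (ger0_norm (ltW j0)) ler_pdivrMr// ler_pdivrMr//.
  by rewrite distrC mulrAC mulrC.
move=> /(_ H3 H4 H5).
have -> : \int[mu]_z iter j Pop f (y' - x * u + x * (z + u)) = Pop (iter j Pop f) y'.
  by apply: eq_Rintegral => z _; congr (iter _ _ _ _); ring.
rewrite /= /Pop => h; apply: (le_trans h); rewrite exprS; lra.
Qed.


Let m0 := (Num.truncn (eta * `|x|)^-1).+1.
Let eps := c0 ^+ m0.

Lemma osc_block f M be : measurable_fun setT f -> (forall y, `|f y| <= M) -> periodic1 f ->
  (forall y y', f y - f y' <= be) ->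
  forall y y', iter m0 Pop f y - iter m0 Pop f y' <= (1 - eps) * be.
Proof.
move=> mf fM pf /osc_range[a fa] y y'.
have pm := iter_Pop_periodic m0 pf.
rewrite -(periodic_frac y pm) -(periodic_frac y' pm).
have -> : iter m0 Pop f (frac y) - iter m0 Pop f (frac y') =
    iter m0 Pop (fun y => f y - a) (frac y) - iter m0 Pop (fun y => f y - a) (frac y').
  by rewrite !(@iter_PopB f M)//; lra.
apply: chain_contraction.
- exact: measurable_funB.
- by move=> z; have /andP[h1 h2] := fa z; apply/andP; split; lra.
- have e0 : 0 < eta * `|x| by rewrite mulr_gt0// normr_gt0.
  apply: (@le_trans _ _ 1).
    have /andP[h1 h2] := frac_itv y; have /andP[h3 h4] := frac_itv y'.
    by rewrite ler_norml; apply/andP; split; lra.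
  by rewrite -ler_pdivrMr// div1r ltW// /m0 truncnS_gt.
Qed.

Lemma osc_iter f M be k : measurable_fun setT f -> (forall y, `|f y| <= M) -> periodic1 f ->
  (forall y y', f y - f y' <= be) ->
  forall y y', iter (k * m0) Pop f y - iter (k * m0) Pop f y' <= (1 - eps) ^+ k * be.
Proof.
move=> mf fM pf ob; elim: k => [|k ih]; first by move=> y y'; rewrite expr0 mul1r.
have [mk bk] := iter_Pop_meas (k * m0) mf fM.
move=> y y'; rewrite mulSn !iterD exprS -mulrA; apply: osc_block => //.
exact: iter_Pop_periodic.
Qed.

Lemma mixing_range : exists C rho : R, [/\ 0 <= C, 0 < rho, rho < 1 &
  forall f M be r, measurable_fun setT f -> (forall y, `|f y| <= M) -> periodic1 f ->
  (forall y y', f y - f y' <= be) ->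
  exists a, forall y, a <= iter r Pop f y <= a + C * rho ^+ r * be].
Proof.
have e01 : 0 < eps <= 1 by rewrite exprn_gt0// exprn_ile1// ltW.
have m00 : 0 < m0%:R :> R by rewrite ltr0n.
pose rho := 1 - eps / (2 * m0%:R).
have hq : 0 < eps / (2 * m0%:R) <= 2^-1.
  case/andP: e01 => h1 h2; rewrite divr_gt0 ?mulr_gt0//=.
  rewrite ler_pdivrMr ?mulr_gt0// mulrA mulVf// mul1r.
  by apply: (le_trans h2); rewrite ler1n.
have r0 : 0 < rho by rewrite /rho; lra.
have r1 : rho < 1 by rewrite /rho; lra.
have bern n : 1 - n%:R * (1 - rho) <= rho ^+ n.
  elim: n => [|n ih]; first by rewrite mul0r subr0 expr0.
  rewrite exprS -natr1; have : rho * (1 - n%:R * (1 - rho)) <= rho * rho ^+ n by rewrite ler_wpM2l// ltW.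
  have n0 : 0 <= n%:R :> R by [].
  have : 0 <= n%:R * (1 - rho) * (1 - rho) by rewrite !mulr_ge0// subr_ge0 ltW.
  by nra.
have rm : 1 - eps <= rho ^+ m0.
  apply: le_trans (bern m0); rewrite /rho.
  have -> : m0%:R * (1 - (1 - eps / (2 * m0%:R))) = eps / 2 by field; rewrite lt0r_neq0.
  by lra.
exists (rho ^+ m0)^-1, rho; split => //; first by rewrite invr_ge0 exprn_ge0// ltW.
move=> f M be r mf fM pf ob.
have be0 : 0 <= be by have := ob 0 0; rewrite subrr.
have [a ha] := osc_range (@osc_iter f M be (r %/ m0) mf fM pf ob).
exists a => y; have [mk bk] := iter_Pop_meas (r %/ m0 * m0) mf fM.
rewrite [X in iter X](divn_eq r m0) addnC iterD.
have hr j : forall y, a <= iter j Pop (iter (r %/ m0 * m0) Pop f) y <=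
    a + (1 - eps) ^+ (r %/ m0) * be.
  elim: j => [//|j ih]; apply: Pop_bounds => //.
  by have [] := iter_Pop_meas j mk bk.
have /andP[h1 h2] := hr (r %% m0)%N y; rewrite h1 (le_trans h2)// lerD2l ler_wpM2r//.
apply: (@le_trans _ _ ((rho ^+ m0) ^+ (r %/ m0))).
  by apply: lerXn2r; rewrite ?nnegrE ?subr_ge0//; [case/andP: e01|exact/exprn_ge0/ltW].
rewrite -exprM ler_pdivlMl ?exprn_gt0// -exprD; apply: ler_wiXn2l => //; [exact: ltW|exact: ltW|].
by rewrite {1}(divn_eq r m0) mulnC addnC leq_add2r ltnW// ltn_mod.
Qed.

End chain.


End mixing.

Section uniform_law.
Context {R : realType}.
Variables (nu : probability R R).
Hypothesis nuE : forall B, measurable B -> nu B = lebR (B `&` `[0, 1]%classic).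
Implicit Types f : R -> R.

Notation I01 := (`[0%R, 1%R[%classic : set R).
Let mI (a b : R) : measurable (`[a, b[%classic : set R). Proof. exact: measurable_itv. Qed.

Lemma unif_co B : measurable B -> nu B = lebR (I01 `&` B).
Proof.
move=> mB; rewrite nuE//.
have -> : B `&` `[0, 1]%classic = (I01 `&` B) `|` (B `&` [set 1]).
  apply/seteqP; split => u /=; rewrite /= !in_itv/=.
    move=> [Bu /andP[u0]]; rewrite le_eqVlt => /orP[/eqP e|u1]; [by right|left].
    by rewrite u0.
  move=> [[/andP[u0 u1] Bu]|[Bu e]]; split => //; first by rewrite u0 ltW.
  by rewrite e ler01 lexx.
have m1 : measurable ([set 1] : set R) by exact: measurable_set1.
have h0 : lebR (B `&` [set 1]) = 0%E.
  apply/eqP; rewrite eq_le measure_ge0 andbT -(@lebesgue_measure_set1 R 1).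
  by apply: (@le_measure _ _ _ lebR); rewrite ?inE//; exact: measurableI.
apply: (@measureU0 _ _ _ lebR) => //; [|exact: measurableI].
by apply: measurableI => //; exact: mI.
Qed.

Let nu_density B : measurable B -> nu B = (\int[lebR]_(u in B) (\1_I01 u)%:E)%E.
Proof. by move=> mB; rewrite unif_co// integral_indic//; exact: mI. Qed.

Lemma unif_shift_ge0 f c : measurable_fun setT f -> (forall y, 0 <= f y) -> periodic1 f ->
  (\int[nu]_u (f (u + c))%:E = \int[nu]_u (f u)%:E)%E.
Proof.
move=> mf f0 pf.
have madd (c' : R) : measurable_fun [set: R] (fun z : R => z + c') by exact: measurable_funD.
have mfc (c' : R) : measurable_fun [set: R] (fun z : R => f (z + c')) := measurableT_comp mf (madd c').
have mind (A : set R) : measurable A -> measurable_fun setT (\1_A : R -> R) by exact: measurable_indic.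
have dens (h : R -> R) : measurable_fun setT h -> (forall z, 0 <= h z) ->
    (\int[nu]_z (h z)%:E = \int[lebR]_z (h z * \1_I01 z)%:E)%E.
  move=> mh h0; rewrite (@ge0_integral_density _ _ _ lebR nu (\1_I01) (EFin \o h))//.
  - exact/measurable_EFinP.
have indI (a b z : R) : \1_(`[a, b[%classic) z = (a <= z < b)%R%:R :> R.
  by rewrite indicE mem_setE in_itv.
have shift (h : R -> R) (a : R) : measurable_fun setT h -> (forall z, 0 <= h z) ->
   (\int[lebR]_z (h z)%:E = \int[lebR]_z (h (z + a))%:E)%E.
  move=> mh h0; rewrite (@ge0_integral_affine _ 1 a)//; last exact/measurable_EFinP.
  by rewrite normr1 mul1e; apply: eq_integral => z _; rewrite mul1r.
have ind0 (A : set R) z : 0 <= \1_A z :> R by [].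
have /andP[c0 c1] := frac_itv c.
transitivity (\int[nu]_u (f (u + frac c))%:E)%E.
  apply: eq_integral => u _; rewrite -(periodic_int (- Num.floor c) (u + c) pf); congr (f _)%:E.
  by rewrite rmorphN /frac addrA.
rewrite dens// dens//.
rewrite (shift _ (- frac c)); last 2 first.
- by apply: measurable_funM => //; apply: mind; exact: mI.
- by move=> z; rewrite mulr_ge0.
transitivity (\int[lebR]_z ((f z * \1_`[frac c, 1[%classic z)%:E + (f z * \1_`[1, 1 + frac c[%classic z)%:E))%E.
  apply: eq_integral => z _; rewrite subrK -EFinD -mulrDr; congr (_ * _)%:E.
  rewrite !indI -natrD; congr (_%:R).
  case: (lerP 0 (z - frac c)) => h1; case: (ltrP (z - frac c) 1) => h2;
  case: (lerP (frac c) z) => h3; case: (ltrP z 1) => h4; case: (ltrP z (1 + frac c)) => h5 //=; exfalso; lra.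
rewrite ge0_integralD//; last 4 first.
- by move=> z _; rewrite lee_fin mulr_ge0.
- by apply/measurable_EFinP; apply: measurable_funM => //; apply: mind; exact: mI.
- by move=> z _; rewrite lee_fin mulr_ge0.
- by apply/measurable_EFinP; apply: measurable_funM => //; apply: mind; exact: mI.
rewrite [X in (_ + X)%E](shift _ 1); last 2 first.
- by apply: measurable_funM => //; apply: mind; exact: mI.
- by move=> z; rewrite mulr_ge0.
rewrite -ge0_integralD//; last 4 first.
- by move=> z _; rewrite lee_fin mulr_ge0.
- by apply/measurable_EFinP; apply: measurable_funM => //; apply: mind; exact: mI.
- by move=> z _; rewrite lee_fin mulr_ge0.
- apply/measurable_EFinP; apply: measurable_funM => //.
  by apply: (measurableT_comp _ (madd 1)); apply: mind; exact: mI.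
apply: eq_integral => z _; rewrite -EFinD pf -mulrDr; congr (_ * _)%:E.
rewrite !indI -natrD (addrC 1 (frac c)) ltrD2r lerDr; congr (_%:R).
by case: (lerP 0 z) => h1; case: (ltrP z 1) => h2; case: (lerP (frac c) z) => h3 //=; exfalso; lra.
Qed.

Lemma unif_shift f M c : measurable_fun setT f -> (forall y, `|f y| <= M) -> periodic1 f ->
  \int[nu]_u f (u + c) = \int[nu]_u f u.
Proof.
move=> mf fM pf.
have madd (c' : R) : measurable_fun [set: R] (fun z : R => z + c') by exact: measurable_funD.
have if1 c' : intg nu (fun u => f (u + c')).
  by apply: (@intg_bounded _ _ _ _ _ M) => //; exact: (measurableT_comp mf (madd c')).
have if2 : intg nu f by exact: intg_bounded fM.
apply: (@addIr _ M); rewrite -(Rint_cst nu M) -!RintD//; last 2 first.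
- exact: intg_cst.
- exact: intg_cst.
apply: EFin_inj; rewrite !EFin_Rint; last 2 first.
- by apply: intgD => //; exact: intg_cst.
- by apply: intgD => //; exact: intg_cst.
apply: (@unif_shift_ge0 (fun u => f u + M)).
- exact: measurable_funD.
- by move=> y; have := fM y; rewrite ler_norml => /andP[h _]; lra.
- by move=> y; rewrite pf.
Qed.

Lemma unif_Pop (mu : probability R R) x f M : measurable_fun setT f -> (forall y, `|f y| <= M) ->
  periodic1 f -> \int[nu]_u Pop mu x f u = \int[nu]_u f u.
Proof.
move=> mf fM pf; have mF := measurableT_comp mf (@measurable_affine_pair R x).
rewrite /Pop (@Rint_fubini _ _ _ _ _ nu mu _ _ mF (fun y z => fM (y + x * z)) (intg_cst mu M)) /=.
under eq_Rintegral => z _ do rewrite (@unif_shift f M)//.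
by rewrite Rint_cst.
Qed.

Lemma unif_iter_Pop (mu : probability R R) x f M r : measurable_fun setT f ->
  (forall y, `|f y| <= M) -> periodic1 f -> \int[nu]_u iter r (Pop mu x) f u = \int[nu]_u f u.
Proof.
move=> mf fM pf; elim: r => //= r <-; have [m1 m2] := @iter_Pop_meas _ mu x f M r mf fM.
by rewrite (@unif_Pop mu x _ M)//; exact: iter_Pop_periodic.
Qed.

Theorem mixing (mu : probability R R) (x : R) (g : R -> R) : x != 0 -> measurable_fun setT g ->
  (forall z, 0 <= g z) ->
  (forall B, measurable B -> mu B = (\int[lebR]_(z in B) (g z)%:E)%E) ->
  exists C rho : R, [/\ 0 <= C, 0 < rho, rho < 1 &
  forall f M r y, measurable_fun setT f -> (forall y, `|f y| <= M) -> periodic1 f ->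
  `|iter r (Pop mu x) f y - \int[nu]_u f u| <= C * rho ^+ r * M].
Proof.
move=> x0 mg g0 muE.
have [c0 [eta [c00 c01 eta0 hc]]] := overlap_contraction mg g0 muE.
have [C [rho [C0 r0 r1 hm]]] := mixing_range x0 c00 c01 eta0 hc.
exists (C * 2), rho; split => //; first by rewrite mulr_ge0.
move=> f M r y mf fM pf.
have ob y1 y2 : f y1 - f y2 <= 2 * M.
  have := fM y1; have := fM y2; rewrite !ler_norml => /andP[h1 h2] /andP[h3 h4]; lra.
have [a ha] := hm f M (2 * M) r mf fM pf ob.
have [mr br] := @iter_Pop_meas _ mu x f M r mf fM.
have ir : intg nu (iter r (Pop mu x) f) by exact: intg_bounded br.
rewrite -(unif_iter_Pop mu x r mf fM pf).
have h1 : a <= \int[nu]_u iter r (Pop mu x) f u.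
  rewrite -(Rint_cst nu a); apply: Rint_le => //; first exact: intg_cst.
  by move=> z; case/andP: (ha z).
have h2 : \int[nu]_u iter r (Pop mu x) f u <= a + C * rho ^+ r * (2 * M).
  rewrite -(Rint_cst nu (a + _)); apply: Rint_le => //; first exact: intg_cst.
  by move=> z; case/andP: (ha z).
have /andP[h3 h4] := ha y.
have -> : C * 2 * rho ^+ r * M = C * rho ^+ r * (2 * M) by ring.
by rewrite ler_norml; apply/andP; split; lra.
Qed.

End uniform_law.

Section fa_facts.
Context {R : realType}.
Implicit Types a s t y : R.

Lemma frac_periodic y : frac (y + 1) = frac y.
Proof. by rewrite /frac (_ : y + 1 = y + 1%:~R)// floorDrz// floor1 intrD; ring. Qed.

Lemma fa_periodic a : periodic1 (fa a).
Proof. by move=> y; rewrite /fa frac_periodic. Qed.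

Lemma measurable_frac : measurable_fun setT (@frac R).
Proof. apply: measurable_funB => //; apply: nondecreasing_measurable => // y1 y2 h.
by rewrite ler_int le_floor. Qed.

Lemma measurable_fa a : measurable_fun setT (fa a).
Proof.
apply: measurable_funB => //; apply: measurable_fun_ifT => //.
by apply: measurable_fun_ler => //; exact: measurable_frac.
Qed.

Lemma fa_bound a y : 0 <= a <= 1 -> `|fa a y| <= 1.
Proof. by move=> /andP[h1 h2]; rewrite /fa ler_norml; case: ifP => _; apply/andP; split; lra. Qed.

Lemma wrapped_density (mu : probability R R) x (g : R -> R) Mg M : x != 0 ->
  measurable_fun setT g -> (forall z, 0 <= g z <= Mg) ->
  (forall B, measurable B -> mu B = (\int[lebR]_(z in B) (g z)%:E)%E) ->
  mu [set z | (M < `|z|)%R] = 0%E ->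
  exists2 C : R, 0 <= C & forall s t y, s <= t ->
   \int[mu]_z ((if frac (y + x * z) <= t then 1 else 0) - (if frac (y + x * z) <= s then 1 else 0)) <= C * (t - s).
Proof.
move=> x0 mg gM muE M0.
have nx0 : 0 < `|x| by rewrite normr_gt0.
have Mg0 : 0 <= Mg by case/andP: (gM 0) => h1 h2; exact: le_trans h2.
pose N := Num.truncn (2 * `|x| * M + 1).
have mz : measurable_fun [set: R] (fun z : R => `|z|) by exact: normr_measurable.
exists (N.+1%:R * (Mg / `|x|)); first by rewrite mulr_ge0// divr_ge0// ltW.
move=> s t y st.
pose S (j : int) := [set z : R | s + j%:~R < y + x * z <= t + j%:~R].
pose B := [set z : R | M < `|z|].
have mB : measurable B by rewrite -[B]setTI; exact: measurable_fun_ltr.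
have mS j : measurable (S j).
  rewrite -[S j]setTI; apply: measurable_and => //; last 2 first.
    by apply: measurable_fun_ltr => //; exact: measurable_affine.
  by apply: measurable_fun_ler => //; exact: measurable_affine.
have muS j : fine (mu (S j)) <= Mg / `|x| * (t - s).
  have : (mu (S j) <= (Mg / `|x| * (t - s))%:E)%E.
    rewrite muE//; apply: (@le_trans _ _ (\int[lebR]_(z in S j) (cst Mg%:E z))%E).
      apply: ge0_le_integral => //.
      - by move=> z _; rewrite lee_fin; case/andP: (gM z).
      - exact/measurable_EFinP/measurable_funTS.
      - by move=> z _; rewrite lee_fin; case/andP: (gM z).
    rewrite integral_cst//.
    pose I := (`](s + j%:~R), (t + j%:~R)]%classic : set R).
    have h := @lebesgue_affine_preimage R x y I x0 (measurable_itv _).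
    have e : (fun z => x * z + y) @^-1` I = S j.
      by apply/seteqP; split => z; rewrite /I /= in_itv/= (addrC (x * z)).
    rewrite e in h.
    have l : (lebR I <= (t - s)%:E)%E.
      rewrite /I /lebR lebesgue_measure_itv/= lte_fin; case: ifP => _.
        by rewrite -EFinB lee_fin; lra.
      by rewrite lee_fin subr_ge0.
    have : (lebR (S j) <= ((t - s) / `|x|)%:E)%E.
      rewrite -(@lee_pmul2l _ `|x|%:E)// ?lte_fin// -EFinM -h.
      by rewrite mulrCA divff ?mulr1// gt_eqF.
    by move=> h2; rewrite mulrAC -mulrA EFinM; apply: lee_wpmul2l; rewrite ?lee_fin.
  move=> h; rewrite -lee_fin fineK//; exact: fin_num_measure.
pose j0 := Num.floor (y - `|x| * M).
have key z : (if frac (y + x * z) <= t then 1 else 0) - (if frac (y + x * z) <= s then 1 else 0)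
   <= \sum_(i <- iota 0 N.+1) \1_(S (j0 + i%:Z)) z + \1_B z :> R.
  have sum0 : 0 <= \sum_(i <- iota 0 N.+1) \1_(S (j0 + i%:Z)) z :> R by apply: sumr_ge0.
  have [zM|zM] := ltP M `|z|.
    rewrite [\1_B z]indicE mem_set//; case: ifP => _; case: ifP => _; rewrite /=; lra.
  have B0 : 0 <= \1_B z :> R by [].
  case: ifPn => [ht|_]; last by case: ifP => _; lra.
  case: ifPn => [hs|]; first by lra.
  rewrite -ltNge => hs.
  have xz : `|x * z| <= `|x| * M by rewrite normrM ler_wpM2l.
  pose i := `|Num.floor (y + x * z) - j0|%N.
  have fl : j0 <= Num.floor (y + x * z).
    by apply: le_floor; move: xz; rewrite ler_norml => /andP[h _]; lra.
  have iE : j0 + i%:Z = Num.floor (y + x * z) by rewrite /i gez0_abs ?subr_ge0//; ring.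
  have iN : (i < N.+1)%N.
    rewrite -(ltr_nat R); apply: le_lt_trans (truncnS_gt _).
    have -> : i%:R = (Num.floor (y + x * z))%:~R - j0%:~R :> R by rewrite -iE rmorphD /=; ring.
    have := floor_itv (y + x * z); have := floor_itv (y - `|x| * M); rewrite -/j0 !intrD.
    move: xz; rewrite ler_norml => /andP[h1 h2] /andP[h3 h4] /andP[h5 h6].
    by rewrite -mulrA; lra.
  have iN' : i \in iota 0 N.+1 by rewrite mem_iota.
  rewrite (bigD1_seq i)//; last exact: iota_uniq.
  have -> : \1_(S (j0 + i%:Z)) z = 1 :> R.
    rewrite indicE mem_set// /S/= iE; move: hs ht; rewrite /frac => h1 h2; apply/andP; split; lra.
  have : 0 <= \sum_(i0 <- iota 0 N.+1 | i0 != i) \1_(S (j0 + i0%:Z)) z :> R by apply: sumr_ge0.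
  by move=> h; rewrite /= subr0 -addrA lerDl addr_ge0.
have iS A : measurable A -> intg mu (\1_A).
  by move=> mA; apply: (@intg_bounded _ _ _ _ _ 1) => [|z]; [exact: measurable_indic|rewrite indicE ger0_norm//; case: (_ \in _)].
have iSum : intg mu (fun z => \sum_(i <- iota 0 N.+1) \1_(S (j0 + i%:Z)) z).
  by apply: intg_sum => i; exact: iS.
apply: (@le_trans _ _ (\int[mu]_z (\sum_(i <- iota 0 N.+1) \1_(S (j0 + i%:Z)) z + \1_B z))).
  apply: Rint_le => //; last by apply: intgD => //; exact: iS.
  have mi a : measurable_fun setT (fun z => if frac (y + x * z) <= a then 1 else 0 : R).
    apply: measurable_fun_ifT => //; apply: measurable_fun_ler => //.
    exact: (measurableT_comp measurable_frac (measurable_affine _ _)).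
  by apply: intgB; apply: (@intg_bounded _ _ _ _ _ 1) => // z; case: ifP => _; rewrite ?normr1 ?normr0.
rewrite RintD//; last exact: iS.
rewrite Rint_sum; last by move=> i; exact: iS.
rewrite (Rint_indic _ mB) M0 addr0.
apply: (@le_trans _ _ (\sum_(i <- iota 0 N.+1) (Mg / `|x| * (t - s)))).
  by apply: ler_sum => i _; rewrite Rint_indic.
by rewrite big_const_seq count_predT size_iota iter_addr_0 -[X in X <= _]mulr_natl mulrA.
Qed.

End fa_facts.

(** * The Poisson equation and the martingale differences *)

Section poisson.
Context {R : realType}.
Variables (mu nu : probability R R) (x C rho : R).
Hypotheses (C0 : 0 <= C) (rho0 : 0 < rho) (rho1 : rho < 1).
Hypothesis nuE : forall B, measurable B -> nu B = lebR (B `&` `[0, 1]%classic).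
Hypothesis hmix : forall (f : R -> R) (M : R) r y, measurable_fun setT f ->
  (forall y, `|f y| <= M) -> periodic1 f ->
  `|iter r (Pop mu x) f y - \int[nu]_u f u| <= C * rho ^+ r * M.
Notation Po := (Pop mu x).
Implicit Types f h : R -> R.

Definition nice f M := [/\ measurable_fun setT f, (forall y, `|f y| <= M) & periodic1 f].

Lemma nice_fa a : 0 <= a <= 1 -> nice (fa a) 1.
Proof. by move=> a01; split; [exact: measurable_fa|move=> y; exact: fa_bound|exact: fa_periodic]. Qed.

Lemma nice_ge0 f M : nice f M -> 0 <= M.
Proof. by move=> [_ fM _]; exact: le_trans (fM 0). Qed.

Lemma nice_iter f M r : nice f M -> nice (iter r Po f) M.
Proof.
move=> [mf fM pf]; have [m1 m2] := iter_Pop_meas mu x r mf fM; split => //.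
exact: iter_Pop_periodic.
Qed.

Lemma niceB f h M M' : nice f M -> nice h M' -> nice (fun y => f y - h y) (M + M').
Proof.
move=> [mf fM pf] [mh hM ph]; split; first exact: measurable_funB.
  by move=> y; rewrite (le_trans (ler_normB _ _))// lerD.
by move=> y; rewrite pf ph.
Qed.

Lemma niceD f h M M' : nice f M -> nice h M' -> nice (fun y => f y + h y) (M + M').
Proof.
move=> [mf fM pf] [mh hM ph]; split; first exact: measurable_funD.
  by move=> y; rewrite (le_trans (ler_normD _ _))// lerD.
by move=> y; rewrite pf ph.
Qed.

Lemma niceM f h M M' : nice f M -> nice h M' -> nice (fun y => f y * h y) (M * M').
Proof.
move=> [mf fM pf] [mh hM ph]; split; first exact: measurable_funM.
  by move=> y; rewrite normrM ler_pM.
by move=> y; rewrite pf ph.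
Qed.

Lemma intg_nice f M (P : probability R R) : nice f M -> intg P f.
Proof. by move=> [mf fM _]; exact: intg_bounded fM. Qed.

Definition gpart f N y : R := \sum_(0 <= r < N) iter r Po f y.
(* [gsol f] solves the Poisson equation [g - Po g = f]. *)
Definition gsol f y : R := limn (fun N => gpart f N y).
(* The differences are indexed by (position before the step, step). *)
Definition mdiff f (p : R * R) : R := gsol f (p.1 + x * p.2) - gsol f p.1 + f p.1.

Definition Cg : R := C / (1 - rho).

Lemma geom_sum n m : \sum_(n <= r < m) rho ^+ r <= rho ^+ n / (1 - rho).
Proof.
have h : 0 < 1 - rho by rewrite subr_gt0.
have [nm|mn] := leqP n m; last first.
  by rewrite big_geq ?(ltnW mn)// divr_ge0// ?exprn_ge0// ltW.
rewrite ler_pdivlMr// -(subnKC nm); elim: (m - n)%N => [|j ih].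
  by rewrite addn0 big_geq// mul0r exprn_ge0// ltW.
have e k : (\sum_(n <= r < n + k) rho ^+ r) * (1 - rho) = rho ^+ n - rho ^+ (n + k).
  elim: k => [|k ihk]; first by rewrite addn0 big_geq// mul0r subrr.
  by rewrite addnS big_nat_recr/= ?leq_addr// mulrDl ihk exprS; ring.
by rewrite e gerBl exprn_ge0// ltW.
Qed.

Section one.
Variables (f : R -> R) (M : R).
Hypotheses (nf : nice f M) (f0 : \int[nu]_u f u = 0).

Let M0 : 0 <= M := nice_ge0 nf.

Lemma iter_decay r y : `|iter r Po f y| <= C * rho ^+ r * M.
Proof. by have [mf fM pf] := nf; have := hmix r y mf fM pf; rewrite f0 subr0. Qed.

Lemma gpart_tail n m y : (n <= m)%N -> `|gpart f m y - gpart f n y| <= Cg * M * rho ^+ n.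
Proof.
move=> nm; rewrite /gpart (big_cat_nat (leq0n n) nm)/= addrAC subrr add0r.
apply: (le_trans (ler_norm_sum _ _ _)).
apply: (@le_trans _ _ (\sum_(n <= r < m) C * M * rho ^+ r)).
  by apply: ler_sum => r _; rewrite mulrAC; exact: iter_decay.
rewrite -mulr_sumr; apply: (@le_trans _ _ (C * M * (rho ^+ n / (1 - rho)))).
  by apply: ler_wpM2l (geom_sum _ _); rewrite mulr_ge0.
by rewrite /Cg le_eqVlt; apply/orP; left; apply/eqP; ring.
Qed.

Lemma rho_cvg0 (K : R) : K * rho ^+ n @[n --> \oo] --> 0.
Proof.
rewrite -(mulr0 K); apply: cvgM; first exact: cvg_cst.
by apply: cvg_expr; rewrite ger0_norm// ltW.
Qed.

Lemma gpart_cvg y : gpart f n y @[n --> \oo] --> gsol f y.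
Proof.
suff : cvgn (series (fun r => iter r Po f y)) by [].
apply: normed_cvg; apply: (@series_le_cvg _ _ (geometric (C * M) rho)).
- by move=> r; exact: normr_ge0.
- by move=> r; rewrite /geometric /= mulr_ge0 ?mulr_ge0 ?exprn_ge0// ltW.
- by move=> r; rewrite /geometric /= mulrAC; exact: iter_decay.
- by apply: is_cvg_geometric_series; rewrite ger0_norm// ltW.
Qed.

Lemma gsol_tail n y : `|gsol f y - gpart f n y| <= Cg * M * rho ^+ n.
Proof.
apply/ler_normlP; split.
  rewrite opprB lerBlDr -lerBlDl; apply: limr_ge; first by apply/cvg_ex; eexists; exact: gpart_cvg.
  by exists n => // m /= nm; have /ler_normlP[h1 h2] := gpart_tail y nm; lra.
rewrite lerBlDr; apply: limr_le; first by apply/cvg_ex; eexists; exact: gpart_cvg.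
by exists n => // m /= nm; have /ler_normlP[h1 h2] := gpart_tail y nm; lra.
Qed.

Lemma Cg_ge0 : 0 <= Cg.
Proof. by rewrite /Cg divr_ge0// subr_ge0 ltW. Qed.

Lemma nice_gsol : nice (gsol f) (Cg * M).
Proof.
have [mf fM pf] := nf; split.
- apply: (@measurable_fun_cvg _ _ _ _ (fun n y => gpart f n y)) => //; last first.
    by move=> y _; exact: gpart_cvg.
  by move=> n; apply: measurable_sum => r; have [] := nice_iter r nf.
- by move=> y; have := gsol_tail 0 y; rewrite /gpart big_geq// subr0 expr0 mulr1.
- move=> y; rewrite /gsol; congr (limn _); apply/funext => N.
  by rewrite /gpart; apply: eq_bigr => r _; have [_ _] := nice_iter r nf.
Qed.

Lemma nice_gpart N : nice (gpart f N) (N%:R * M).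
Proof.
elim: N => [|N ih].
  split; [|by move=> y; rewrite /gpart big_geq// normr0 mul0r|by move=> y; rewrite /gpart !big_geq].
  by rewrite /gpart (_ : (fun _ => _) = cst 0)//; apply/funext => y; rewrite big_geq.
have -> : gpart f N.+1 = (fun y => gpart f N y + iter N Po f y).
  by apply/funext => y; rewrite /gpart big_nat_recr.
by rewrite -natr1 mulrDl mul1r; apply: niceD => //; exact: nice_iter.
Qed.

Lemma Pop_gpart N y : Po (gpart f N) y = gpart f N.+1 y - f y.
Proof.
rewrite /gpart [in RHS]big_nat_recl//= addrAC subrr add0r.
by rewrite {1}/Pop Rint_sum// => r; have [m1 m2 _] := nice_iter r nf; exact: (intg_Pop mu x y m1 m2).
Qed.

Lemma le_geom0 (K a : R) : (forall n, `|a| <= K * rho ^+ n) -> a = 0.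
Proof.
move=> h; apply/eqP; rewrite -normr_eq0 eq_le normr_ge0 andbT.
have := rho_cvg0 K; move=> /[dup] /cvgP hc /cvg_lim <-//.
by apply: limr_ge => //; near=> n; exact: h.
Unshelve. all: by end_near. Qed.

Lemma Pop_gsol y : Po (gsol f) y = gsol f y - f y.
Proof.
apply/eqP; rewrite -subr_eq0; apply/eqP; apply: (@le_geom0 (Cg * M * 2)) => n.
have ng := nice_gsol; have np := nice_gpart n.
have h1 : `|Po (gsol f) y - Po (gpart f n) y| <= Cg * M * rho ^+ n.
  rewrite /Pop -RintB; last 2 first.
  - by have [m1 m2 _] := ng; exact: (intg_Pop mu x y m1 m2).
  - by have [m1 m2 _] := np; exact: (intg_Pop mu x y m1 m2).
  apply: Rint_abs_bound => [|z]; last exact: gsol_tail.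
  have [m1 _ _] := niceB ng np; exact: (measurableT_comp m1 (measurable_affine x y)).
have h2 := gsol_tail n.+1 y.
have h3 : Cg * M * rho ^+ n.+1 <= Cg * M * rho ^+ n.
  by apply: ler_wpM2l; [rewrite mulr_ge0// Cg_ge0|rewrite exprS ler_piMl ?exprn_ge0// ltW].
move: h1; rewrite Pop_gpart => h1.
have -> : Po (gsol f) y - (gsol f y - f y) =
  (Po (gsol f) y - (gpart f n.+1 y - f y)) - (gsol f y - gpart f n.+1 y) by ring.
apply: (le_trans (ler_normB _ _)); lra.
Qed.

Lemma measurable_mdiff : measurable_fun setT (mdiff f).
Proof.
have [mg _ _] := nice_gsol; have [mf _ _] := nf.
apply: measurable_funD; last exact: measurableT_comp.
apply: measurable_funB; last exact: measurableT_comp.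
exact: (measurableT_comp mg (measurable_affine_pair x)).
Qed.

Lemma mdiff_bound p : `|mdiff f p| <= (2 * Cg + 1) * M.
Proof.
have [_ gM _] := nice_gsol; have [_ fM _] := nf.
have := gM (p.1 + x * p.2); have := gM p.1; have := fM p.1.
by rewrite /mdiff !ler_norml => /andP[? ?] /andP[? ?] /andP[? ?]; apply/andP; split; lra.
Qed.

Lemma mdiff_periodic y z : mdiff f (y + 1, z) = mdiff f (y, z).
Proof.
have [_ _ pg] := nice_gsol; have [_ _ pf] := nf.
by rewrite /mdiff /= (addrAC y 1) !pg pf.
Qed.

Lemma mdiffE y z : mdiff f (y, z) = gsol f (y + x * z) - Po (gsol f) y.
Proof. by rewrite Pop_gsol /mdiff/=; ring. Qed.

Lemma intg_mdiff y : intg mu (fun z => mdiff f (y, z)).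
Proof.
apply: (@intg_bounded _ _ _ _ _ ((2 * Cg + 1) * M)); last by move=> z; exact: mdiff_bound.
exact: (measurableT_comp measurable_mdiff).
Qed.

Lemma Rint_mdiff y : \int[mu]_z mdiff f (y, z) = 0.
Proof.
have [mg gM _] := nice_gsol.
under eq_Rintegral do rewrite mdiffE.
by rewrite RintB ?Rint_cst ?subrr//; [exact: (intg_Pop mu x y mg gM)|exact: intg_cst].
Qed.

End one.

Section two.
Variables (f h : R -> R) (M M' : R).
Hypotheses (nf : nice f M) (nh : nice h M').
Hypotheses (f0 : \int[nu]_u f u = 0) (h0 : \int[nu]_u h u = 0).

Lemma gpart_cvg_Rint : \int[nu]_u (f u * gpart h N u) @[N --> \oo] --> \int[nu]_u (f u * gsol h u).
Proof.
have ng := nice_gsol nh h0.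
have M0 := nice_ge0 nf.
have hb N : `|\int[nu]_u (f u * gsol h u) - \int[nu]_u (f u * gpart h N u)| <= M * (Cg * M' * rho ^+ N).
  have np := nice_gpart nh N.
  rewrite -RintB; last 2 first.
  - exact: intg_nice (niceM nf ng).
  - exact: intg_nice (niceM nf np).
  apply: Rint_abs_bound => [|u].
    by have [m1 _ _] := niceB (niceM nf ng) (niceM nf np).
  by rewrite -mulrBr normrM ler_pM//; [have [_ -> _] := nf|exact: gsol_tail].
apply/cvgrPdist_le => e e0.
have /cvgrPdist_le /(_ e e0) := @rho_cvg0 (M * (Cg * M')).
apply: filterS => N hN; apply: le_trans (hb N) _; rewrite mulrA.
by move: hN; rewrite sub0r normrN; apply: le_trans; exact: ler_norm.
Qed.

Lemma mdiff_cov : \int[nu]_y \int[mu]_z (mdiff f (y, z) * mdiff h (y, z)) =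
  \int[nu]_u (f u * gsol h u) + \int[nu]_u (h u * gsol f u) - \int[nu]_u (f u * h u).
Proof.
have ngf := nice_gsol nf f0; have ngh := nice_gsol nh h0.
have nP : nice (fun y => gsol f y * gsol h y) _ := niceM ngf ngh.
have [mP bP pP] := nP.
have e y : \int[mu]_z (mdiff f (y, z) * mdiff h (y, z)) =
   Po (fun y => gsol f y * gsol h y) y - (gsol f y - f y) * (gsol h y - h y).
  have [mf1 bf1 _] := ngf; have [mh1 bh1 _] := ngh.
  transitivity (\int[mu]_z ((gsol f (y + x * z) * gsol h (y + x * z) -
     (gsol h y - h y) * mdiff f (y, z)) - (gsol f y - f y) * mdiff h (y, z) -
     (gsol f y - f y) * (gsol h y - h y))).
    by apply: eq_Rintegral => z _; rewrite /mdiff/=; ring.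
  have i1 : intg mu (fun z => gsol f (y + x * z) * gsol h (y + x * z)) by exact: (intg_Pop mu x y mP bP).
  have i2 : intg mu (fun z => (gsol h y - h y) * mdiff f (y, z)) by apply: intgZl; exact: intg_mdiff nf f0 y.
  have i3 : intg mu (fun z => (gsol f y - f y) * mdiff h (y, z)) by apply: intgZl; exact: intg_mdiff nh h0 y.
  rewrite RintB; [|by apply: intgB => //; exact: intgB|exact: intg_cst].
  rewrite RintB; [|exact: intgB|by []].
  rewrite RintB// Rint_cst !RintZl; [|exact: intg_mdiff nh h0 y|exact: intg_mdiff nf f0 y].
  by rewrite (Rint_mdiff nf f0) (Rint_mdiff nh h0) !mulr0 !subr0.
under eq_Rintegral do rewrite e.
have nG := niceM (niceB ngf nf) (niceB ngh nh).
rewrite RintB; last 2 first.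
- by apply: (intg_nice _ (M := Cg * M * (Cg * M'))); exact: (nice_iter 1 nP).
- exact: (intg_nice _ nG).
rewrite (unif_Pop nuE mu x mP bP pP).
have j1 := intg_nice nu (niceM nf ngh); have j2 := intg_nice nu (niceM nh ngf).
have j3 := intg_nice nu (niceM nf nh).
rewrite -RintB; [|exact: intg_nice nP|exact: intg_nice nG].
rewrite -RintD// -RintB//; last exact: intgD.
by apply: eq_Rintegral => u _; ring.
Qed.

End two.

Lemma Rint_frac_le a : 0 <= a <= 1 -> \int[nu]_u (if frac u <= a then 1 else 0) = a.
Proof.
move=> /andP[a0 a1]; have mA : measurable [set u : R | frac u <= a].
  rewrite -[X in measurable X]setTI; apply: measurable_fun_ler => //; exact: measurable_frac.
transitivity (\int[nu]_u \1_[set u : R | frac u <= a] u).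
  apply: eq_Rintegral => u _; rewrite indicE; case: ifPn => h; first by rewrite mem_set.
  by rewrite memNset//=; exact/negP.
rewrite Rint_indic// (unif_co nuE)//.
have fr u : 0 <= u < 1 -> frac u = u.
  by move=> h; rewrite /frac (@floor_def _ u 0) ?subr0// addr0n.
move: a1; rewrite le_eqVlt => /orP[/eqP a1|a1].
  have -> : `[0, 1[%classic `&` [set u : R | frac u <= a] = `[0, 1[%classic.
    apply/seteqP; split => u //= [] //=; rewrite in_itv/= => hu; split => //.
    by rewrite fr// a1 ltW//; case/andP: hu.
  by rewrite /lebR lebesgue_measure_itv/= lte_fin ltr01 a1 sube0.
have -> : `[0, 1[%classic `&` [set u : R | frac u <= a] = `[0, a]%classic.
  apply/seteqP; split => u /=; rewrite !in_itv/=.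
    by move=> [hu]; rewrite fr// => ->; case/andP: hu => ->.
  move=> /andP[u0 ua]; have hu : 0 <= u < 1 by rewrite u0 (le_lt_trans ua).
  by rewrite fr.
rewrite /lebR lebesgue_measure_itv/= lte_fin; case: ltP => h; first by rewrite sube0.
by apply/eqP; rewrite eq_le a0 h.
Qed.

Let ind a (u : R) : R := if frac u <= a then 1 else 0.

Lemma intg_ind (P : probability R R) a : intg P (ind a).
Proof.
apply: (@intg_bounded _ _ _ _ _ 1).
  by apply: measurable_fun_ifT => //; apply: measurable_fun_ler => //; exact: measurable_frac.
by move=> u; rewrite /ind; case: ifP => _; rewrite ?normr1 ?normr0.
Qed.

Lemma Rint_fa a : 0 <= a <= 1 -> \int[nu]_u fa a u = 0.
Proof.
move=> ha; rewrite /fa RintB ?Rint_cst ?Rint_frac_le ?subrr//; first exact: intg_ind.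
exact: intg_cst.
Qed.

Lemma Rint_fa_fa s t : 0 <= s <= 1 -> 0 <= t <= 1 ->
  \int[nu]_u (fa s u * fa t u) = Num.min s t - s * t.
Proof.
move=> hs ht; have hm : 0 <= Num.min s t <= 1.
  case/andP: hs => s0 s1; case/andP: ht => t0 t1.
  by rewrite le_min s0 t0 ge_min s1.
transitivity (\int[nu]_u (ind (Num.min s t) u - (s * ind t u + t * ind s u) + s * t)).
  apply: eq_Rintegral => u _; rewrite /fa /ind le_min.
  by case: (frac u <= s); case: (frac u <= t) => /=; ring.
have i1 a := intg_ind nu a.
rewrite RintD; [|apply: intgB => //; apply: intgD; exact: intgZl|exact: intg_cst].
rewrite RintB//; last by apply: intgD; exact: intgZl.
rewrite RintD; [|exact: intgZl|exact: intgZl].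
by rewrite Rint_cst !RintZl// /ind !Rint_frac_le//; ring.
Qed.

Lemma iter_PopB2 f h M M' r y : nice f M -> nice h M' ->
  iter r Po (fun y => f y - h y) y = iter r Po f y - iter r Po h y.
Proof.
move=> nf nh; elim: r y => [//|r ih] y /=.
have -> : iter r Po (fun y => f y - h y) = (fun y => iter r Po f y - iter r Po h y).
  by apply/funext => z; exact: ih.
have [m1 b1 _] := nice_iter r nf; have [m2 b2 _] := nice_iter r nh.
by rewrite {1}/Pop RintB//; [exact: (intg_Pop mu x y m1 b1)|exact: (intg_Pop mu x y m2 b2)].
Qed.

Lemma gsolB f h M M' y : nice f M -> nice h M' -> \int[nu]_u f u = 0 -> \int[nu]_u h u = 0 ->
  gsol (fun y => f y - h y) y = gsol f y - gsol h y.
Proof.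
move=> nf nh f0 h0; apply: cvg_lim => //.
have -> : (fun N => gpart (fun y => f y - h y) N y) = (fun N => gpart f N y - gpart h N y).
  apply/funext => N; rewrite /gpart -sumrB; apply: eq_bigr => r _; exact: (iter_PopB2 _ _ nf nh).
by apply: cvgB; [exact: gpart_cvg nf f0 y|exact: gpart_cvg nh h0 y].
Qed.

Lemma gsol_Pop f M y : nice f M -> \int[nu]_u f u = 0 ->
  gsol (Po f) y = gsol f y - f y.
Proof.
move=> nf f0; apply: cvg_lim => //.
have -> : (fun N => gpart (Po f) N y) = (fun N => gpart f N.+1 y - f y).
  apply/funext => N; rewrite /gpart big_nat_recl//= addrAC subrr add0r.
  by apply: eq_bigr => r _; rewrite -iterS iterSr.
apply: cvgB; last exact: cvg_cst.
have : gpart f n y @[n --> \oo] --> gsol f y by exact: (@gpart_cvg f M nf f0 y).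
by rewrite -(cvg_shiftS (fun N => gpart f N y)).
Qed.

Section increments.
Variable Cw : R.
Hypothesis Cw0 : 0 <= Cw.
Hypothesis hw : forall s t y, s <= t ->
   \int[mu]_z ((if frac (y + x * z) <= t then 1 else 0) - (if frac (y + x * z) <= s then 1 else 0)) <= Cw * (t - s).

Variables (s t : R).
Hypotheses (s0 : 0 <= s) (st : s <= t) (t1 : t <= 1).
Let hs : 0 <= s <= 1. Proof. by rewrite s0 (le_trans st). Qed.
Let ht : 0 <= t <= 1. Proof. by rewrite t1 (le_trans s0). Qed.
Let h0 (u : R) := fa t u - fa s u.

Lemma faBE u : h0 u = ind t u - ind s u - (t - s).
Proof. by rewrite /h0 /fa /ind; case: (_ <= s); case: (_ <= t); ring. Qed.

Lemma indB01 u : 0 <= ind t u - ind s u <= 1.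
Proof.
rewrite /ind; case: (leP (frac u) s) => h; first by rewrite (le_trans h st) subrr lexx ler01.
by case: ifP => _; rewrite subr0 ?lexx ?ler01.
Qed.

Let nh : nice h0 (1 + 1). Proof. exact: niceB (nice_fa ht) (nice_fa hs). Qed.
Let h00 : \int[nu]_u h0 u = 0.
Proof.
by rewrite RintB ?Rint_fa ?subr0//; [exact: intg_nice (nice_fa ht)|exact: intg_nice (nice_fa hs)].
Qed.

Let intg_indP y a : intg mu (fun z => ind a (y + x * z)).
Proof.
have mi : measurable_fun setT (ind a) := intg_meas (intg_ind mu a).
apply: (@intg_bounded _ _ _ _ _ 1); first exact: (measurableT_comp mi (measurable_affine x y)).
by move=> u; rewrite /ind; case: ifP => _; rewrite ?normr1 ?normr0.
Qed.

Let Ph_bound y : `|Po h0 y| <= (Cw + 1) * (t - s).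
Proof.
have -> : Po h0 y = \int[mu]_z (ind t (y + x * z) - ind s (y + x * z)) - (t - s).
  rewrite /Pop; under eq_Rintegral do rewrite faBE.
  by rewrite RintB ?Rint_cst//; [exact: intgB|exact: intg_cst].
have := hw y st; have := @Rint_ge0 _ _ _ mu _ (fun z => (andP (indB01 (y + x * z))).1).
rewrite -/(ind t) -/(ind s) => a1 a2.
have st0 : 0 <= t - s by rewrite subr_ge0.
have : 0 <= Cw * (t - s) by rewrite mulr_ge0.
by rewrite ler_norml; move: a1 a2; rewrite /ind => a1 a2 a3; apply/andP; split; lra.
Qed.

Definition Kd : R := Cg * (Cw + 1).

Let nPh : nice (Po h0) ((Cw + 1) * (t - s)).
Proof. by have [m1 _ p1] := nice_iter 1 nh; split => //; exact: Ph_bound. Qed.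

Let g_incr y : `|gsol h0 y - h0 y| <= Kd * (t - s).
Proof.
rewrite -(gsol_Pop y nh h00).
have Ph0 : \int[nu]_u Po h0 u = 0 by have [m1 m2 m3] := nh; rewrite (unif_Pop nuE mu x m1 m2 m3).
by have [_ + _] := nice_gsol nPh Ph0 => /(_ y); rewrite /Kd mulrA.
Qed.

Lemma mdiff_incr y z : `|mdiff (fa t) (y, z) - mdiff (fa s) (y, z)| <=
  (ind t (y + x * z) - ind s (y + x * z)) + (2 * Kd + 1) * (t - s).
Proof.
have e : mdiff (fa t) (y, z) - mdiff (fa s) (y, z) = mdiff h0 (y, z).
  rewrite /mdiff/= /h0 !(gsolB _ (nice_fa ht) (nice_fa hs) (Rint_fa ht) (Rint_fa hs)).
  by ring.
rewrite e /mdiff/=.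
have := g_incr y; have := g_incr (y + x * z); rewrite (faBE (y + x * z)).
have /andP[+ _] := indB01 (y + x * z); move: (ind t _ - ind s _) => I I0.
rewrite !ler_norml => /andP[a1 a2] /andP[a3 a4]; have st0 : 0 <= t - s by rewrite subr_ge0.
apply/andP; split; lra.
Qed.

Let intg_I y : intg mu (fun z => ind t (y + x * z) - ind s (y + x * z)).
Proof. exact: intgB. Qed.

Let mdd y : measurable_fun setT (fun z => mdiff (fa t) (y, z) - mdiff (fa s) (y, z)).
Proof.
apply: measurable_funB; apply: (measurableT_comp (measurable_mdiff _ _)) => //.
- exact: nice_fa ht.
- exact: Rint_fa.
- exact: nice_fa hs.
- exact: Rint_fa.
Qed.

Lemma mdiff_L1 y : \int[mu]_z `|mdiff (fa t) (y, z) - mdiff (fa s) (y, z)| <=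
  (Cw + (2 * Kd + 1)) * (t - s).
Proof.
have ii := intgD (intg_I y) (intg_cst mu ((2 * Kd + 1) * (t - s))).
apply: le_trans (Rint_le _ ii (mdiff_incr y)) _.
  apply: intg_dom ii; first by apply: measurableT_comp => //; exact: mdd.
  by move=> z; rewrite normr_id; exact: mdiff_incr.
rewrite RintD ?Rint_cst//; last exact: intg_cst.
by have := hw y st; rewrite -/(ind t) -/(ind s) mulrDl /ind; lra.
Qed.

Lemma mdiff_L2 y : \int[mu]_z (mdiff (fa t) (y, z) - mdiff (fa s) (y, z)) ^+ 2 <=
  (2 * Cw + 2 * (2 * Kd + 1) ^+ 2) * (t - s).
Proof.
have st1 : 0 <= t - s <= 1.
  by rewrite subr_ge0 st/= lerBlDl (le_trans t1)// lerDr.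
have ii : intg mu (fun z => 2 * (ind t (y + x * z) - ind s (y + x * z)) + 2 * (2 * Kd + 1) ^+ 2 * (t - s)).
  by apply: intgD; [exact: intgZl|exact: intg_cst].
have le z : (mdiff (fa t) (y, z) - mdiff (fa s) (y, z)) ^+ 2 <=
   2 * (ind t (y + x * z) - ind s (y + x * z)) + 2 * (2 * Kd + 1) ^+ 2 * (t - s).
  have := mdiff_incr y z; have := indB01 (y + x * z).
  move: (ind t _ - ind s _) (mdiff _ _ - mdiff _ _) => I d /andP[I0 I1] hd.
  rewrite -real_normK ?num_real//; apply: (@le_trans _ _ ((I + (2 * Kd + 1) * (t - s)) ^+ 2)).
    by rewrite lerXn2r ?nnegrE// (le_trans _ hd).
  have h1 : I ^+ 2 <= I by rewrite expr2 ler_piMl.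
  set w := (2 * Kd + 1) * (t - s).
  have h2 : w ^+ 2 <= (2 * Kd + 1) ^+ 2 * (t - s).
    case/andP: st1 => a1 a2; rewrite /w exprMn ler_wpM2l ?sqr_ge0// expr2 ler_piMl//.
  have h3 : (I + w) ^+ 2 <= 2 * I ^+ 2 + 2 * w ^+ 2.
    by rewrite -subr_ge0 (_ : _ - _ = (I - w) ^+ 2) ?sqr_ge0//; ring.
  apply: (le_trans h3); rewrite -mulrA; apply: lerD; exact: ler_wpM2l.
apply: le_trans (Rint_le _ ii le) _.
  apply: intg_dom ii; first by apply: measurable_funX; exact: mdd.
  by move=> z; rewrite ger0_norm ?sqr_ge0//; exact: le.
rewrite RintD ?Rint_cst ?RintZl//; [|exact: intgZl|exact: intg_cst].
by have := hw y st; rewrite -/(ind t) -/(ind s) /ind; lra.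
Qed.

End increments.

Lemma mdiff_cov_lip (Cw : R) : 0 <= Cw ->
  (forall s t y, s <= t ->
   \int[mu]_z ((if frac (y + x * z) <= t then 1 else 0) - (if frac (y + x * z) <= s then 1 else 0)) <= Cw * (t - s)) ->
  forall s t u, 0 <= s -> s <= t -> t <= 1 -> 0 <= u <= 1 ->
  `|\int[nu]_y \int[mu]_z (mdiff (fa t) (y, z) * mdiff (fa u) (y, z)) -
    \int[nu]_y \int[mu]_z (mdiff (fa s) (y, z) * mdiff (fa u) (y, z))| <=
  (2 * Cg + 1) * (Cw + (2 * Kd Cw + 1)) * (t - s).
Proof.
move=> Cw0 hw s t u s0 st t1 hu.
have hs : 0 <= s <= 1 by rewrite s0 (le_trans st).
have ht : 0 <= t <= 1 by rewrite t1 (le_trans s0).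
pose b := 2 * Cg + 1.
have mm v : 0 <= v <= 1 -> measurable_fun setT (mdiff (fa v)).
  by move=> hv; exact: measurable_mdiff (nice_fa hv) (Rint_fa hv).
have bm v p : 0 <= v <= 1 -> `|mdiff (fa v) p| <= b.
  by move=> hv; have := mdiff_bound (nice_fa hv) (Rint_fa hv) p; rewrite mulr1.
have b0 : 0 <= b by exact: le_trans (bm s (0, 0) hs).
have pm v p : 0 <= v <= 1 -> `|mdiff (fa v) p * mdiff (fa u) p| <= b * b.
  by move=> hv; rewrite normrM ler_pM ?bm.
have mp v : 0 <= v <= 1 -> measurable_fun setT (fun p => mdiff (fa v) p * mdiff (fa u) p).
  by move=> hv; apply: measurable_funM; exact: mm.
have i1 v y : 0 <= v <= 1 -> intg mu (fun z => mdiff (fa v) (y, z) * mdiff (fa u) (y, z)).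
  move=> hv; exact: (intg_section (mp v hv) (fun y z => pm v (y, z) hv) (intg_cst _ _)).
have i2 v : 0 <= v <= 1 -> intg nu (fun y => \int[mu]_z (mdiff (fa v) (y, z) * mdiff (fa u) (y, z))).
  move=> hv; exact: (intg_Rint_section nu (mp v hv) (fun y z => pm v (y, z) hv) (intg_cst _ _)).
rewrite -RintB; [|exact: i2|exact: i2].
apply: Rint_abs_bound => [|y]; first by have := intg_meas (intgB (i2 t ht) (i2 s hs)).
rewrite -RintB; [|exact: i1|exact: i1].
have idd : intg mu (fun z => `|mdiff (fa t) (y, z) - mdiff (fa s) (y, z)|).
  apply: intg_norm; apply: (@intg_bounded _ _ _ _ _ (b + b)).
    by apply: measurable_funB; apply: measurableT_comp => //; exact: mm.
  by move=> z; rewrite (le_trans (ler_normB _ _))// lerD// bm.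
rewrite -mulrA; apply: le_trans (ler_wpM2l b0 (mdiff_L1 Cw0 hw s0 st t1 y)).
rewrite -RintZl//; apply: Rint_abs_le; last first.
- by move=> z; rewrite -mulrBl normrM mulrC ler_wpM2r// bm.
- exact: intgZl.
- by have := intg_meas (intgB (i1 t y ht) (i1 s y hs)).
Qed.

End poisson.

(** * Lindeberg replacement *)

Lemma intgMr {d} {T : measurableType d} {R : realType} (P : probability T R) (c : R) (f : T -> R) :
  intg P f -> intg P (fun w => f w * c).
Proof. by move=> h; rewrite (_ : (fun w => f w * c) = fun w => c * f w); [exact: intgZl|apply/funext => w; rewrite mulrC]. Qed.

Lemma RintMr {d} {T : measurableType d} {R : realType} (P : probability T R) (c : R) (f : T -> R) :
  intg P f -> \int[P]_w (f w * c) = (\int[P]_w f w) * c.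
Proof. by move=> h; under eq_Rintegral do rewrite mulrC; rewrite RintZl// mulrC. Qed.

Lemma minnSl n q : minn n.+1 q = (minn n q + (n < q))%N.
Proof. by case: ltnP => h; lia. Qed.

Section smooth_tensors.
Context {R : realType} (D : nat).
Implicit Types (u z v : D.-tuple R).

Definition ebas (i : 'I_D) : D.-tuple R := [tuple (j == i)%:R | j < D].

Lemma dot_ebas i z : dot (ebas i) z = tnth z i.
Proof.
rewrite /dot (bigD1 i)//= tnth_mktuple eqxx mul1r big1 ?addr0// => j ji.
by rewrite tnth_mktuple (negbTE ji) mul0r.
Qed.

Lemma measurable_tupleP {d} {T : measurableType d} (F : T -> D.-tuple R) :
  (forall i, measurable_fun setT (fun w => tnth (F w) i)) -> measurable_fun setT F.
Proof.
move=> h; rewrite (_ : F = fun w => [tuple tnth (F w) i | i < D]); first exact: measurable_mktuple.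
by apply/funext => w; apply: eq_from_tnth => i; rewrite tnth_mktuple.
Qed.

Variable g : D.-tuple R -> R.
Hypotheses (mg : measurable_fun setT g) (g01 : forall z, 0 <= g z <= 1).

Definition Th1 i v := \int[gam D]_z (g (vlin 1 1 v z) * dot (ebas i) z).
Definition Th2 i j v :=
  \int[gam D]_z (g (vlin 1 1 v z) * (dot (ebas i) z * dot (ebas j) z - dot (ebas i) (ebas j))).

Lemma intg_Q2 i j : intg (gam D) (fun z => dot (ebas i) z * dot (ebas j) z - dot (ebas i) (ebas j)).
Proof. by apply: intgB; [exact: intg_dotM|exact: intg_cst]. Qed.

Lemma smooth1E v w : smooth1 g v w = \sum_(i < D) tnth w i * Th1 i v.
Proof.
have ig i : intg (gam D) (fun z => g (vlin 1 1 v z) * dot (ebas i) z).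
  by apply: intg_g => //; exact: intg_dot.
rewrite /smooth1 /Th1 -(eq_bigr _ (fun i _ => RintZl (tnth w i) (ig i))).
rewrite -Rint_sum; last by move=> i; exact: intgZl.
apply: eq_Rintegral => z _; rewrite {1}/dot mulr_sumr; apply: eq_bigr => i _.
by rewrite dot_ebas; ring.
Qed.

Lemma smooth2E v w : smooth2 g v w = \sum_(i < D) \sum_(j < D) tnth w i * tnth w j * Th2 i j v.
Proof.
have ig i j : intg (gam D) (fun z => g (vlin 1 1 v z) *
    (dot (ebas i) z * dot (ebas j) z - dot (ebas i) (ebas j))).
  by apply: intg_g => //; exact: intg_Q2.
transitivity (\int[gam D]_z (\sum_(i < D) \sum_(j < D) tnth w i * tnth w j * (g (vlin 1 1 v z) *
    (dot (ebas i) z * dot (ebas j) z - dot (ebas i) (ebas j))))).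
  apply: eq_Rintegral => z _; rewrite expr2 {1 2 3}/dot mulr_suml -sumrB mulr_sumr.
  apply: eq_bigr => i _.
  rewrite mulr_sumr [X in _ - X](_ : _ = \sum_(j < D) tnth w i * tnth w j * dot (ebas i) (ebas j)).
    rewrite -sumrB mulr_sumr; apply: eq_bigr => j _; rewrite !dot_ebas; ring.
  rewrite (bigD1 i)//= big1 ?addr0.
    by rewrite dot_ebas tnth_mktuple eqxx mulr1.
  by move=> j ji; rewrite dot_ebas tnth_mktuple eq_sym (negbTE ji) mulr0.
rewrite Rint_sum; last by move=> i; apply: intg_sum => j; exact: intgZl.
apply: eq_bigr => i _; rewrite Rint_sum; last by move=> j; exact: intgZl.
by apply: eq_bigr => j _; rewrite RintZl.
Qed.

Let mvlin : measurable_fun [set: D.-tuple R * D.-tuple R] (fun p => vlin 1 1 p.1 p.2).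
Proof. by apply: measurable_vlin. Qed.

Lemma measurable_smooth : measurable_fun setT (smooth g).
Proof.
have m := measurableT_comp mg mvlin.
exact: (measurable_Rint_section m (fun v z => norm_g_le1 g01 _) (intg_cst (gam D) 1)).
Qed.

Lemma smooth01 v : 0 <= smooth g v <= 1.
Proof.
apply/andP; split; first by apply: Rint_ge0 => z; case/andP: (g01 (vlin 1 1 v z)).
rewrite -(Rint_cst (gam D) 1); apply: Rint_le; [|exact: intg_cst|].
  apply: (@intg_bounded _ _ _ _ _ 1); first exact: measurable_shift.
  by move=> z; exact: norm_g_le1.
by move=> z; case/andP: (g01 (vlin 1 1 v z)).
Qed.

Lemma measurable_Th2 i j : measurable_fun setT (Th2 i j).
Proof.
have m : measurable_fun [set: D.-tuple R * D.-tuple R] (fun p => g (vlin 1 1 p.1 p.2) *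
    (dot (ebas i) p.2 * dot (ebas j) p.2 - dot (ebas i) (ebas j))).
  apply: measurable_funM; first exact: (measurableT_comp mg mvlin).
  by apply: measurable_funB => //; apply: measurable_funM; apply: measurable_dot.
have i2 := intg_norm (intg_Q2 i j).
apply: (measurable_Rint_section m _ i2) => v z /=.
by rewrite normrM ler_piMl// norm_g_le1.
Qed.

End smooth_tensors.

Section gauss_moment.
Context {R : realType} (D : nat).

Definition C4 : R := 2 * C2 + 2.

Lemma gam1_pow4 : intg gam1 (fun x : R => x ^+ 4) /\ \int[gam1]_x (x ^+ 4 : R) <= C4.
Proof.
have [iq hq] := @gam1_quartic R.
have i2 : intg gam1 (fun x : R => 2 * (x ^+ 2 - 1) ^+ 2 + 2) by apply: intgD; [exact: intgZl|exact: intg_cst].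
have le (x : R) : x ^+ 4 <= 2 * (x ^+ 2 - 1) ^+ 2 + 2.
  have := sqr_ge0 (x ^+ 2 - 2); have -> : x ^+ 4 = (x ^+ 2) ^+ 2 by rewrite -exprM.
  by move: (x ^+ 2) => y; rewrite !sqrrB; lra.
have i4 : intg gam1 (fun x : R => x ^+ 4).
  apply: intg_dom i2 => // x; rewrite ger0_norm// -[4%N]/(2 * 2)%N exprM sqr_ge0//.
split => //; apply: le_trans (Rint_le i4 i2 le) _.
by rewrite RintD ?Rint_cst ?RintZl//; [rewrite /C4; lra|exact: intgZl|exact: intg_cst].
Qed.

Lemma C4_ge0 : 0 <= C4.
Proof.
have [_ h] := gam1_pow4; apply: le_trans h; apply: Rint_ge0 => x.
by rewrite -[4%N]/(2 * 2)%N exprM sqr_ge0.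
Qed.

Variable a : 'I_D -> D.-tuple R.

Definition amul (t : D.-tuple R) : D.-tuple R := [tuple dot (a i) t | i < D].

Lemma measurable_amul {d} {T : measurableType d} (F : T -> D.-tuple R) :
  measurable_fun setT F -> measurable_fun setT (fun w => amul (F w)).
Proof. by move=> mF; apply: measurable_mktuple => i; exact: measurable_dot. Qed.

Lemma amul_vlin al be s t : amul (vlin al be s t) = vlin al be (amul s) (amul t).
Proof. by apply: eq_from_tnth => i; rewrite tnth_vlin !tnth_mktuple dot_vlin. Qed.

Lemma amul_pow4 (b B : R) : 0 <= b -> (forall i, dot (a i) (a i) <= b ^+ 2) -> B ^+ 2 = D%:R * b ^+ 2 ->
  intg (gam D) (fun t => dot (amul t) (amul t) ^+ 2) /\
  \int[gam D]_t (dot (amul t) (amul t) ^+ 2) <= C4 * B ^+ 4.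
Proof.
move=> b0 hb hB; have [i4 h4] := gam1_pow4.
have m4 : measurable_fun setT (fun y : R => y ^+ 4) by exact: measurable_funX.
have e4 (i : 'I_D) (x : R) : (vnorm (a i) * x) ^+ 4 = dot (a i) (a i) ^+ 2 * x ^+ 4.
  by rewrite exprMn -sqr_vnorm -exprM.
have ii i : intg (gam D) (fun t => dot (a i) t ^+ 4).
  apply: (intg_gam_dot m4); rewrite (_ : (fun _ => _) = fun x => dot (a i) (a i) ^+ 2 * x ^+ 4).
    exact: intgZl.
  by apply/funext => x; exact: e4.
have le t : dot (amul t) (amul t) ^+ 2 <= D%:R * \sum_(i < D) dot (a i) t ^+ 4.
  rewrite expr2 {1 2}/dot big_distrlr /=.
  apply: (@le_trans _ _ (\sum_(i < D) \sum_(j < D) (dot (a i) t ^+ 4 / 2 + dot (a j) t ^+ 4 / 2))).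
    apply: ler_sum => i _; apply: ler_sum => j _; rewrite !tnth_mktuple.
    have := sqr_ge0 (dot (a i) t ^+ 2 - dot (a j) t ^+ 2).
    by rewrite sqrrB -!exprM /= -!expr2; lra.
  rewrite (eq_bigr (fun i => D%:R * (dot (a i) t ^+ 4 / 2) + \sum_(j < D) dot (a j) t ^+ 4 / 2)).
    rewrite big_split/= -mulr_sumr [X in _ + X]sumr_const card_ord -[X in _ + X]mulr_natl.
    by rewrite -mulrDr -!mulr_suml -splitr.
  by move=> i _; rewrite big_split/= sumr_const card_ord -[X in X + _]mulr_natl.
have iS : intg (gam D) (fun t => D%:R * \sum_(i < D) dot (a i) t ^+ 4).
  by apply: intgZl; apply: intg_sum.
have i1 : intg (gam D) (fun t => dot (amul t) (amul t) ^+ 2).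
  apply: intg_dom iS; first by apply: measurable_funX; apply: measurable_dot; exact: measurable_amul.
  by move=> t; rewrite ger0_norm ?sqr_ge0//; exact: le.
split => //; apply: le_trans (Rint_le i1 iS le) _.
rewrite RintZl ?Rint_sum//; last exact: intg_sum.
apply: (@le_trans _ _ (D%:R * \sum_(i < D) C4 * b ^+ 4)).
  apply: ler_wpM2l => //; apply: ler_sum => i _.
  rewrite (Rint_gam_dot (a i) m4); under eq_Rintegral do rewrite e4.
  rewrite RintZl// mulrC ler_pM ?sqr_ge0//; first by apply: Rint_ge0 => x; rewrite -[4%N]/(2 * 2)%N exprM sqr_ge0.
  by rewrite -[4%N]/(2 * 2)%N exprM lerXn2r ?nnegrE ?dot_ge0 ?sqr_ge0.
rewrite sumr_const card_ord -mulr_natl.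
have -> : B ^+ 4 = (D%:R * b ^+ 2) ^+ 2 by rewrite -hB -exprM.
by rewrite le_eqVlt; apply/orP; left; apply/eqP; ring.
Qed.

End gauss_moment.

Lemma C5_ge0 {R : realType} : 0 <= C5 :> R.
Proof. by rewrite /C5 /C2 !addr_ge0 ?mulr_ge0 ?expR_ge0. Qed.

Lemma half_diff {R : realType} (a1 a2 b1 b2 K : R) : `|a1 - a2| <= K -> `|b1 - b2| <= K ->
  `|2^-1 * (a1 - b1) - 2^-1 * (a2 - b2)| <= K.
Proof. by rewrite !ler_norml => /andP[? ?] /andP[? ?]; apply/andP; split; lra. Qed.

Section lindeberg.
Context {R : realType} (D : nat).
Variables (mu nu : probability R R) (x C rho b B : R).
Hypotheses (C0 : 0 <= C) (rho0 : 0 < rho) (rho1 : rho < 1).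
Hypothesis hmix : forall (f : R -> R) (M : R) r y, measurable_fun setT f ->
  (forall y, `|f y| <= M) -> periodic1 f ->
  `|iter r (Pop mu x) f y - \int[nu]_u f u| <= C * rho ^+ r * M.
Variable u : R * R -> D.-tuple R.
Hypotheses (mu_ : forall i, measurable_fun setT (fun p => tnth (u p) i))
  (b0 : 0 <= b) (ub : forall p i, `|tnth (u p) i| <= b)
  (B0 : 0 < B) (B1 : B <= 1) (hB : B ^+ 2 = D%:R * b ^+ 2)
  (u0 : forall y i, \int[mu]_z tnth (u (y, z)) i = 0)
  (uper : forall y z, u (y + 1, z) = u (y, z)).
Variable a : 'I_D -> D.-tuple R.
Hypothesis ha : forall i j, dot (a i) (a j) = \int[nu]_y \int[mu]_z (tnth (u (y, z)) i * tnth (u (y, z)) j).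

Local Notation state := (D.-tuple R * R)%type.
Implicit Types (F G : state -> R) (v : D.-tuple R).

Definition Qop F (p : state) : R := \int[mu]_z F (vlin 1 1 p.1 (u (p.2, z)), p.2 + x * z).

Lemma measurable_u : measurable_fun setT u.
Proof. exact: measurable_tupleP. Qed.

Lemma measurable_step : measurable_fun [set: state * R]
  (fun q => (vlin 1 1 q.1.1 (u (q.1.2, q.2)), q.1.2 + x * q.2)).
Proof.
apply: measurable_fun_pair.
  apply: measurable_vlin; first exact: (measurableT_comp measurable_fst).
  apply: (measurableT_comp measurable_u); apply: measurable_fun_pair => //.
  exact: (measurableT_comp measurable_snd).
apply: measurable_funD; first exact: (measurableT_comp measurable_snd).
by apply: measurable_funM.
Qed.

Lemma measurable_Qop F M : measurable_fun setT F -> (forall p, `|F p| <= M) ->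
  measurable_fun setT (Qop F).
Proof.
move=> mF FM; have m := measurableT_comp mF measurable_step.
exact: (measurable_Rint_section m (fun p z => FM _) (intg_cst mu M)).
Qed.

Lemma intg_Qop F M p : measurable_fun setT F -> (forall p, `|F p| <= M) ->
  intg mu (fun z => F (vlin 1 1 p.1 (u (p.2, z)), p.2 + x * z)).
Proof.
move=> mF FM; have m := measurableT_comp mF measurable_step.
exact: (intg_section m (fun p z => FM _) (intg_cst mu M)).
Qed.

Lemma Qop_bound F M : measurable_fun setT F -> (forall p, `|F p| <= M) -> forall p, `|Qop F p| <= M.
Proof. by move=> mF FM p; apply: Rint_abs_bound (intg_meas (intg_Qop p mF FM)) _ => z. Qed.

Lemma QopB F G M M' p : measurable_fun setT F -> (forall p, `|F p| <= M) ->
  measurable_fun setT G -> (forall p, `|G p| <= M') ->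
  Qop (fun p => F p - G p) p = Qop F p - Qop G p.
Proof. by move=> mF FM mG GM; rewrite /Qop RintB//; [exact: intg_Qop FM|exact: intg_Qop GM]. Qed.

Lemma iter_Qop F M r : measurable_fun setT F -> (forall p, `|F p| <= M) ->
  measurable_fun setT (iter r Qop F) /\ (forall p, `|iter r Qop F p| <= M).
Proof.
move=> mF FM; elim: r => [//|r [h1 h2]] /=; split; [exact: measurable_Qop h2|exact: Qop_bound].
Qed.

Lemma iter_QopB F G M M' r p : measurable_fun setT F -> (forall p, `|F p| <= M) ->
  measurable_fun setT G -> (forall p, `|G p| <= M') ->
  iter r Qop (fun p => F p - G p) p = iter r Qop F p - iter r Qop G p.
Proof.
move=> mF FM mG GM; elim: r p => [//|r ih] p /=.
have -> : iter r Qop (fun p => F p - G p) = (fun p => iter r Qop F p - iter r Qop G p).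
  by apply/funext => q; exact: ih.
have [h1 h2] := iter_Qop r mF FM; have [h3 h4] := iter_Qop r mG GM.
exact: QopB h2 h3 h4.
Qed.

Lemma dot_u p : dot (u p) (u p) <= B ^+ 2.
Proof.
rewrite hB /dot mulr_natl -[in leRHS](card_ord D) -sumr_const; apply: ler_sum => i _.
by rewrite -expr2 -real_normK ?num_real// lerXn2r ?nnegrE.
Qed.

Section decay.
Variables (F : state -> R) (M L : R).
Hypotheses (mF : measurable_fun setT F) (bF : forall p, `|F p| <= M)
  (pF : forall v, periodic1 (fun y => F (v, y)))
  (lipF : forall v w y, dot w w <= B ^+ 2 -> `|F (vlin 1 1 v w, y) - F (v, y)| <= L)
  (F0 : forall v, \int[nu]_y F (v, y) = 0).

Lemma Qop_vs_Pop r v y : `|iter r Qop F (v, y) - iter r (Pop mu x) (fun y => F (v, y)) y| <= r%:R * L.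
Proof.
have mFv v' : measurable_fun setT (fun y => F (v', y)) by exact: (measurableT_comp mF).
have nF v' : nice (fun y => F (v', y)) M by split.
elim: r v y => [|r ih] v y; first by rewrite subrr normr0 mul0r.
have [m1 b1] := iter_Qop r mF bF.
have [m3 b3] := iter_Pop_meas mu x r (mFv v) (fun y => bF (v, y)).
have i1 := intg_Qop (v, y) m1 b1; have i2 := intg_Pop mu x y m3 b3.
have key z : `|iter r Qop F (vlin 1 1 v (u (y, z)), y + x * z) -
    iter r (Pop mu x) (fun y => F (v, y)) (y + x * z)| <= r.+1%:R * L.
  have hu := dot_u (y, z); move: (u (y, z)) (y + x * z) hu => w y' hw.
  have h1 := ih (vlin 1 1 v w) y'.
  have md : measurable_fun setT (fun y => F (vlin 1 1 v w, y) - F (v, y)) by exact: measurable_funB.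
  have [_ h2] := iter_Pop_meas mu x r md (fun y => lipF v y hw).
  have {}h2 := h2 y'; rewrite (iter_PopB2 mu x r y' (nF (vlin 1 1 v w)) (nF v)) in h2.
  rewrite -natr1 mulrDl mul1r; exact: (le_trans (ler_distD _ _ _) (lerD h1 h2)).
have -> : iter r.+1 Qop F (v, y) - iter r.+1 (Pop mu x) (fun y => F (v, y)) y =
  \int[mu]_z (iter r Qop F (vlin 1 1 v (u (y, z)), y + x * z) -
    iter r (Pop mu x) (fun y => F (v, y)) (y + x * z)).
  by rewrite (RintB i1 i2).
by apply: Rint_abs_bound => [|z]; [exact: (intg_meas (intgB i1 i2))|exact: key].
Qed.

Lemma iter_Qop_decay r k p : (r <= k)%N -> `|iter k Qop F p| <= r%:R * L + C * rho ^+ r * M.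
Proof.
move=> rk; have [m1 b1] := iter_Qop r mF bF.
rewrite -(subnKC rk) addnC iterD.
have h q : `|iter r Qop F q| <= r%:R * L + C * rho ^+ r * M.
  case: q => v y; have h1 := Qop_vs_Pop r v y.
  have mFv : measurable_fun setT (fun y => F (v, y)) by exact: (measurableT_comp mF).
  have := hmix r y mFv (fun y => bF (v, y)) (pF v).
  rewrite F0 subr0 => h2; rewrite -[X in `|X| <= _]subr0.
  apply: (le_trans (ler_distD (iter r (Pop mu x) (fun y => F (v, y)) y) _ _)).
  by rewrite subr0; exact: lerD h1 h2.
by have [_ +] := iter_Qop (k - r) m1 h; apply.
Qed.

End decay.

Section one_test.
Variable g : D.-tuple R -> R.
Hypotheses (mg : measurable_fun setT g) (g01 : forall z, 0 <= g z <= 1).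

Definition gstep (z : D.-tuple R) : R := \int[gam D]_t g (vlin 1 1 z (amul a t)).

Lemma measurable_gstep : measurable_fun setT gstep.
Proof.
have m : measurable_fun [set: D.-tuple R * D.-tuple R] (fun p => g (vlin 1 1 p.1 (amul a p.2))).
  by apply: (measurableT_comp mg); apply: measurable_vlin => //; exact: measurable_amul.
exact: (measurable_Rint_section m (fun v z => norm_g_le1 g01 _) (intg_cst (gam D) 1)).
Qed.

Lemma gstep01 z : 0 <= gstep z <= 1.
Proof.
apply/andP; split; first by apply: Rint_ge0 => t; case/andP: (g01 (vlin 1 1 z (amul a t))).
rewrite -(Rint_cst (gam D) 1); apply: Rint_le; [|exact: intg_cst|].
  apply: (@intg_bounded _ _ _ _ _ 1); last by move=> t; exact: norm_g_le1.
  by apply: (measurableT_comp mg); apply: measurable_vlin => //; exact: measurable_amul.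
by move=> t; case/andP: (g01 (vlin 1 1 z (amul a t))).
Qed.

Lemma smooth_gstep v : smooth gstep v = \int[gam D]_t smooth g (vlin 1 1 v (amul a t)).
Proof.
have m : measurable_fun [set: D.-tuple R * D.-tuple R]
    (fun p => g (vlin 1 1 (vlin 1 1 v p.1) (amul a p.2))).
  by apply: (measurableT_comp mg); apply: measurable_vlin; [exact: measurable_vlin|exact: measurable_amul].
have := @Rint_fubini _ _ _ _ _ (gam D) (gam D) _ _ m (fun v z => norm_g_le1 g01 _) (intg_cst (gam D) 1).
rewrite /smooth /gstep /= => ->; apply: eq_Rintegral => t _; apply: eq_Rintegral => z _.
by congr g; apply: eq_from_tnth => i; rewrite !tnth_vlin; ring.
Qed.

(* second-order error of replacing one step of the walk by a Gaussian step *)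
Definition Ferr (p : state) : R := 2^-1 * (\int[mu]_z smooth2 g p.1 (u (p.2, z)) -
  \int[nu]_y \int[mu]_z smooth2 g p.1 (u (y, z))).

Let smooth2_u v p : `|smooth2 g v (u p)| <= 2 * B ^+ 2.
Proof.
apply: le_trans (smooth2_le mg g01 v (u p)) _.
by rewrite ler_wpM2l// dot_u.
Qed.

Let m2 : measurable_fun [set: state * R] (fun q => smooth2 g q.1.1 (u (q.1.2, q.2))).
Proof.
rewrite (_ : (fun _ => _) = fun q : state * R => \sum_(i < D) \sum_(j < D)
   tnth (u (q.1.2, q.2)) i * tnth (u (q.1.2, q.2)) j * Th2 g i j q.1.1); last first.
  by apply/funext => q; rewrite smooth2E.
have mq i : measurable_fun [set: state * R] (fun q => tnth (u (q.1.2, q.2)) i).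
  apply: (measurableT_comp (mu_ i)); apply: measurable_fun_pair => //.
  exact: (measurableT_comp measurable_snd).
apply: measurable_sum => i; apply: measurable_sum => j; apply: measurable_funM.
  exact: measurable_funM.
exact: (measurableT_comp (measurable_Th2 mg g01 i j) (measurableT_comp measurable_fst measurable_fst)).
Qed.

Let S2 (p : state) : R := \int[mu]_z smooth2 g p.1 (u (p.2, z)).

Let mS2 : measurable_fun setT S2.
Proof. exact: (measurable_Rint_section m2 (fun p z => smooth2_u _ _) (intg_cst mu _)). Qed.

Let iS2 p : intg mu (fun z => smooth2 g p.1 (u (p.2, z))).
Proof. exact: (intg_section m2 (fun p z => smooth2_u _ _) (intg_cst mu _)). Qed.

Let S2_bound p : `|S2 p| <= 2 * B ^+ 2.
Proof. exact: Rint_abs_bound (intg_meas (iS2 p)) (fun z => smooth2_u _ _). Qed.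

Let iS2nu v : intg nu (fun y => S2 (v, y)).
Proof. exact: (intg_section mS2 (fun v y => S2_bound _) (intg_cst nu _)). Qed.

Lemma measurable_Ferr : measurable_fun setT Ferr.
Proof.
apply: measurable_funM => //; apply: measurable_funB => //.
apply: (measurableT_comp (f := fun v => \int[nu]_y S2 (v, y))) => //.
exact: (measurable_Rint_section mS2 (fun p z => S2_bound _) (intg_cst nu _)).
Qed.

Lemma Ferr_bound p : `|Ferr p| <= 2 * B ^+ 2.
Proof.
have h1 := S2_bound p.
have h2 : `|\int[nu]_y S2 (p.1, y)| <= 2 * B ^+ 2.
  exact: Rint_abs_bound (intg_meas (iS2nu p.1)) (fun z => S2_bound _).
have := @half_diff _ (S2 p) 0 (\int[nu]_y S2 (p.1, y)) 0 (2 * B ^+ 2).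
by rewrite !subr0 mulr0 subr0 => /(_ h1 h2).
Qed.

Lemma FerrE v y : Ferr (v, y) = 2^-1 * (\int[mu]_z smooth2 g v (u (y, z)) -
  \int[nu]_y \int[mu]_z smooth2 g v (u (y, z))).
Proof. reflexivity. Qed.

Lemma Ferr_periodic v : periodic1 (fun y => Ferr (v, y)).
Proof.
move=> y; rewrite !FerrE.
under eq_Rintegral do rewrite uper.
reflexivity.
Qed.

Lemma Rint_Ferr v : \int[nu]_y Ferr (v, y) = 0.
Proof.
rewrite /Ferr RintZl/=; last by apply: intgB; [exact: iS2nu|exact: intg_cst].
by rewrite RintB ?Rint_cst ?subrr ?mulr0//; [exact: iS2nu|exact: intg_cst].
Qed.

Lemma Ferr_lip v w y : dot w w <= B ^+ 2 ->
  `|Ferr (vlin 1 1 v w, y) - Ferr (v, y)| <= C5 * B ^+ 3.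
Proof.
move=> hw; have B01 : 0 < B <= 1 by rewrite B0.
have h p : `|smooth2 g (vlin 1 1 v w) (u p) - smooth2 g v (u p)| <= C5 * B ^+ 3.
  by rewrite [B ^+ 3]exprSr mulrA; exact: (smooth2_shift mg g01 v B0 B01 (dot_u p) hw).
have h2 y' : `|S2 (vlin 1 1 v w, y') - S2 (v, y')| <= C5 * B ^+ 3.
  rewrite /S2/= -RintB; [|exact: (iS2 (_, _))|exact: (iS2 (_, _))].
  apply: Rint_abs_bound => [|z]; last exact: h.
  exact: (intg_meas (intgB (iS2 (vlin 1 1 v w, y')) (iS2 (v, y')))).
have h3 : `|\int[nu]_y S2 (vlin 1 1 v w, y) - \int[nu]_y S2 (v, y)| <= C5 * B ^+ 3.
  rewrite -RintB//; apply: Rint_abs_bound => [|z]; last exact: h2.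
  exact: (intg_meas (intgB (iS2nu (vlin 1 1 v w)) (iS2nu v))).
by rewrite !FerrE; exact: half_diff (h2 y) h3.
Qed.

Lemma iter_Qop_Ferr r k p : (r <= k)%N ->
  `|iter k Qop Ferr p| <= r%:R * (C5 * B ^+ 3) + C * rho ^+ r * (2 * B ^+ 2).
Proof.
exact: (@iter_Qop_decay Ferr _ _ measurable_Ferr Ferr_bound Ferr_periodic Ferr_lip Rint_Ferr).
Qed.

Lemma step_error p : `|Qop (fun p => smooth g p.1) p - smooth gstep p.1 - Ferr p| <=
  C3 * (2 + C4) * B ^+ 3.
Proof.
case: p => v y /=.
pose rem (w : D.-tuple R) := smooth g (vlin 1 1 v w) - smooth g v - smooth1 g v w - 2^-1 * smooth2 g v w.
have hrem w : `|rem w| <= C3 * vnorm w ^+ 3 by exact: smooth_taylor.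
have mS := measurable_smooth mg g01; have bS v' : `|smooth g v'| <= 1.
  by rewrite ger0_norm; case/andP: (smooth01 mg g01 v').
have iu i : intg mu (fun z => tnth (u (y, z)) i).
  by apply: (@intg_bounded _ _ _ _ _ b) => [|z]; [exact: (measurableT_comp (mu_ i))|exact: ub].
have iuu y' i j : intg mu (fun z => tnth (u (y', z)) i * tnth (u (y', z)) j).
  apply: (@intg_bounded _ _ _ _ _ (b * b)) => [|z]; last by rewrite normrM ler_pM ?ub.
  by apply: measurable_funM; [exact: (measurableT_comp (mu_ i))|exact: (measurableT_comp (mu_ j))].
have e1 : \int[mu]_z smooth1 g v (u (y, z)) = 0.
  under eq_Rintegral do rewrite (smooth1E mg g01).
  rewrite Rint_sum => [|i]; last by apply: intgMr.
  by rewrite big1// => i _; rewrite RintMr// u0 mul0r.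
have i1 : intg mu (fun z => smooth1 g v (u (y, z))).
  under eq_fun do rewrite (smooth1E mg g01).
  by apply: intg_sum => i; exact: intgMr.
have iS0 : intg mu (fun z => smooth g (vlin 1 1 v (u (y, z)))).
  exact: (@intg_Qop (fun p => smooth g p.1) 1 (v, y) (measurableT_comp mS measurable_fst) (fun p => bS p.1)).
have A1 : \int[mu]_z rem (u (y, z)) =
    Qop (fun p => smooth g p.1) (v, y) - smooth g v - 2^-1 * S2 (v, y).
  rewrite /rem RintB; last 2 first.
  - apply: intgB => //; apply: intgB => //; exact: intg_cst.
  - by apply: intgZl; exact: (iS2 (v, y)).
  rewrite RintB//; last by apply: intgB => //; exact: intg_cst.
  rewrite RintB//; last exact: intg_cst.
  by rewrite Rint_cst e1 subr0 RintZl//; exact: (iS2 (v, y)).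
have B1' : `|\int[mu]_z rem (u (y, z))| <= C3 * B ^+ 3.
  have ir : intg mu (fun z => rem (u (y, z))).
    apply: intgB; first by apply: intgB => //; apply: intgB => //; exact: intg_cst.
    by apply: intgZl; exact: (iS2 (v, y)).
  apply: Rint_abs_bound (intg_meas ir) _ => z; apply: le_trans (hrem _) _.
  apply: ler_wpM2l; first exact: C3_ge0.
  rewrite lerXn2r ?nnegrE ?sqrtr_ge0 ?(ltW B0)//.
  by rewrite -(ger0_norm (ltW B0)) -sqrtr_sqr /vnorm ler_wsqrtr// dot_u.
have j0 : intg (gam D) (fun t => smooth g (vlin 1 1 v (amul a t))).
  apply: (@intg_bounded _ _ _ _ _ 1) => //; apply: (measurableT_comp mS).
  by apply: measurable_vlin => //; exact: measurable_amul.
have tE t i : tnth (amul a t) i = dot (a i) t by rewrite tnth_mktuple.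
have f1 : intg (gam D) (fun t => smooth1 g v (amul a t)) /\ \int[gam D]_t smooth1 g v (amul a t) = 0.
  have -> : (fun t => smooth1 g v (amul a t)) = (fun t => \sum_(i < D) dot (a i) t * Th1 g i v).
    by apply/funext => t; rewrite (smooth1E mg g01); apply: eq_bigr => i _; rewrite tE.
  split; first by apply: intg_sum => i; apply: intgMr; exact: intg_dot.
  rewrite Rint_sum => [|i]; last by apply: intgMr; exact: intg_dot.
  by rewrite big1// => i _; rewrite RintMr ?Rint_dot ?mul0r//; exact: intg_dot.
have f2 : intg (gam D) (fun t => smooth2 g v (amul a t)) /\
    \int[gam D]_t smooth2 g v (amul a t) = \sum_(i < D) \sum_(j < D) dot (a i) (a j) * Th2 g i j v.
  have -> : (fun t => smooth2 g v (amul a t)) =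
      (fun t => \sum_(i < D) \sum_(j < D) dot (a i) t * dot (a j) t * Th2 g i j v).
    apply/funext => t; rewrite (smooth2E mg g01).
    by apply: eq_bigr => i _; apply: eq_bigr => j _; rewrite !tE.
  have ij i j : intg (gam D) (fun t => dot (a i) t * dot (a j) t * Th2 g i j v).
    by apply: intgMr; exact: intg_dotM.
  split; first by apply: intg_sum => i; apply: intg_sum => j; exact: ij.
  rewrite Rint_sum => [|i]; last by apply: intg_sum => j; exact: ij.
  apply: eq_bigr => i _; rewrite Rint_sum//; apply: eq_bigr => j _.
  by rewrite RintMr ?Rint_dotM//; exact: intg_dotM.
have G2 : \int[nu]_y' S2 (v, y') = \sum_(i < D) \sum_(j < D) dot (a i) (a j) * Th2 g i j v.
  have iuu2 i j : intg nu (fun y' => \int[mu]_z (tnth (u (y', z)) i * tnth (u (y', z)) j)).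
    have mm : measurable_fun setT (fun p => tnth (u p) i * tnth (u p) j) by exact: measurable_funM.
    apply: (intg_Rint_section nu mm (G := cst (b * b))) => [y' z|]; last exact: intg_cst.
    by rewrite normrM ler_pM ?ub.
  transitivity (\int[nu]_y' (\sum_(i < D) \sum_(j < D)
     (\int[mu]_z (tnth (u (y', z)) i * tnth (u (y', z)) j)) * Th2 g i j v)).
    apply: eq_Rintegral => y' _; rewrite /S2 /=.
    under eq_Rintegral do rewrite (smooth2E mg g01).
    rewrite Rint_sum => [|i]; last by apply: intg_sum => j; exact: intgMr.
    apply: eq_bigr => i _; rewrite Rint_sum => [|j]; last exact: intgMr.
    by apply: eq_bigr => j _; rewrite RintMr.
  rewrite Rint_sum => [|i]; last by apply: intg_sum => j; exact: intgMr.
  apply: eq_bigr => i _; rewrite Rint_sum => [|j]; last exact: intgMr.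
  by apply: eq_bigr => j _; rewrite RintMr// ha.
have [f1i f1E] := f1; have [f2i f2E] := f2.
have A2 : \int[gam D]_t rem (amul a t) = smooth gstep v - smooth g v - 2^-1 * \int[nu]_y' S2 (v, y').
  rewrite /rem RintB; last 2 first.
  - by apply: intgB => //; apply: intgB => //; exact: intg_cst.
  - exact: intgZl.
  rewrite RintB//; last by apply: intgB => //; exact: intg_cst.
  rewrite RintB//; last exact: intg_cst.
  rewrite Rint_cst f1E subr0 (RintZl 2^-1 f2i) f2E G2.
  by rewrite (smooth_gstep v).
have irg : intg (gam D) (fun t => rem (amul a t)).
  apply: intgB; last exact: intgZl.
  by apply: intgB => //; apply: intgB => //; exact: intg_cst.
have ai i : dot (a i) (a i) <= b ^+ 2.
  rewrite ha; apply: le_trans (ler_norm _) _.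
  have mm : measurable_fun setT (fun p => tnth (u p) i * tnth (u p) i) by exact: measurable_funM.
  have bb y' z : `|tnth (u (y', z)) i * tnth (u (y', z)) i| <= b ^+ 2.
    by rewrite normrM expr2 ler_pM ?ub.
  apply: Rint_abs_bound => [|y'].
    exact: (measurable_Rint_section mm bb (intg_cst mu _)).
  by apply: Rint_abs_bound => // z; exact: (intg_meas (iuu y' i i)).
have [i4 h4] := amul_pow4 b0 ai hB.
have B2' : `|\int[gam D]_t rem (amul a t)| <= C3 * (1 + C4) * B ^+ 3.
  have ii : intg (gam D) (fun t => C3 * (B ^+ 3 + B^-1 * dot (amul a t) (amul a t) ^+ 2)).
    by apply: intgZl; apply: intgD; [exact: intg_cst|exact: intgZl].
  apply: (@le_trans _ _ (\int[gam D]_t (C3 * (B ^+ 3 + B^-1 * dot (amul a t) (amul a t) ^+ 2)))).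
    apply: Rint_abs_le (intg_meas irg) ii _ => t; apply: le_trans (hrem _) _.
    apply: ler_wpM2l; first exact: C3_ge0.
    rewrite -sqr_vnorm; have := sqrtr_ge0 (dot (amul a t) (amul a t)).
    rewrite -/(vnorm _); move: (vnorm _) => m m0.
    have [mB|Bm] := leP m B.
      apply: (@le_trans _ _ (B ^+ 3)); first by rewrite lerXn2r ?nnegrE// ltW.
      by rewrite lerDl mulr_ge0 ?invr_ge0 ?sqr_ge0// ltW.
    apply: (@le_trans _ _ (B^-1 * (m ^+ 2) ^+ 2)); last by rewrite lerDr exprn_ge0// ltW.
    rewrite ler_pdivlMl// (_ : (m ^+ 2) ^+ 2 = m * m ^+ 3); last by ring.
    by rewrite ler_wpM2r ?exprn_ge0// ltW.
  rewrite RintZl; last by apply: intgD; [exact: intg_cst|exact: intgZl].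
  rewrite RintD ?Rint_cst ?RintZl//; [|exact: intg_cst|exact: intgZl].
  rewrite -mulrA; apply: ler_wpM2l; first exact: C3_ge0.
  rewrite mulrDl mul1r lerD2l ler_pdivrMl//; apply: le_trans h4 _.
  by rewrite [B ^+ 4]exprS mulrCA.
have -> : Qop (fun p => smooth g p.1) (v, y) - smooth gstep v - Ferr (v, y) =
   \int[mu]_z rem (u (y, z)) - \int[gam D]_t rem (amul a t).
  by rewrite A1 A2 FerrE -/(S2 (v, y)) /S2; ring.
apply: le_trans (ler_normB _ _) _; apply: le_trans (lerD B1' B2') _.
by rewrite le_eqVlt; apply/orP; left; apply/eqP; ring.
Qed.

End one_test.

(* Error of one replacement: third-order Taylor remainder, freezing the smoothing
   argument during [q] steps, and mixing of the chain after [q] steps. *)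
Definition lind_err (q : nat) : R :=
  C3 * (2 + C4) * B ^+ 3 + (q%:R * (C5 * B ^+ 3) + C * rho ^+ q * (2 * B ^+ 2)).

Theorem lindeberg n q (g : D.-tuple R -> R) p : measurable_fun setT g -> (forall z, 0 <= g z <= 1) ->
  `|iter n Qop (fun p => smooth g p.1) p - smooth (iter n gstep g) p.1| <=
  n%:R * lind_err q + (minn n q)%:R * (2 * B ^+ 2).
Proof.
elim: n g p => [|n ih] g p mg g01; first by rewrite min0n subrr normr0 !mul0r addr0.
have [mg1 g11] := (measurable_gstep mg g01, gstep01 mg g01).
pose S (h : D.-tuple R -> R) (p : state) := smooth h p.1.
have mS (h : D.-tuple R -> R) : measurable_fun setT h -> (forall z, 0 <= h z <= 1) -> measurable_fun setT (S h).
  by move=> mh h01; exact: (measurableT_comp (measurable_smooth mh h01)).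
have bS (h : D.-tuple R -> R) : measurable_fun setT h -> (forall z, 0 <= h z <= 1) -> forall p, `|S h p| <= 1.
  by move=> mh h01 p'; rewrite ger0_norm; case/andP: (smooth01 mh h01 p'.1).
have [mS0 bS0] := (mS g mg g01, bS g mg g01); have [mS1 bS1] := (mS _ mg1 g11, bS _ mg1 g11).
have mQ := measurable_Qop mS0 bS0; have bQ := Qop_bound mS0 bS0.
pose E p := Qop (S g) p - S (gstep g) p - Ferr g p.
have mF := measurable_Ferr mg g01; have bF := Ferr_bound mg g01.
have mE : measurable_fun setT E by do 2 apply: measurable_funB => //.
have bE p' : `|E p'| <= C3 * (2 + C4) * B ^+ 3 by exact: step_error.
have mD : measurable_fun setT (fun p => Qop (S g) p - S (gstep g) p) by exact: measurable_funB.
have bD p' : `|Qop (S g) p' - S (gstep g) p'| <= 2.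
  by apply: le_trans (ler_normB _ _) _; rewrite -[2]/(1 + 1); exact: lerD.
rewrite iterSr (iterSr _ gstep).
have h1 : iter n Qop (Qop (S g)) p - iter n Qop (S (gstep g)) p = iter n Qop E p + iter n Qop (Ferr g) p.
  rewrite -(iter_QopB n p mQ bQ mS1 bS1) (iter_QopB n p mD bD mF bF).
  by rewrite subrK.
have h2 := ih _ p mg1 g11.
have [_ /(_ p) h3] := iter_Qop n mE bE.
have h4 : `|iter n Qop (Ferr g) p| <= q%:R * (C5 * B ^+ 3) + C * rho ^+ q * (2 * B ^+ 2) + (n < q)%:R * (2 * B ^+ 2).
  have [nq|qn] := ltnP n q; last first.
    by rewrite mul0r addr0; exact: iter_Qop_Ferr.
  rewrite mul1r; have [_ /(_ p) h4] := iter_Qop n mF bF.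
  apply: le_trans h4 _; rewrite lerDr addr_ge0 ?mulr_ge0 ?exprn_ge0 ?(ltW B0) ?(ltW rho0)//.
  exact: C5_ge0.
have -> : (minn n.+1 q)%:R = (minn n q)%:R + (n < q)%:R :> R.
  by rewrite minnSl natrD.
apply: le_trans (ler_distD (iter n Qop (S (gstep g)) p) _ _) _.
rewrite h1; apply: le_trans (lerD (ler_normD _ _) h2) _.
apply: le_trans (lerD (lerD h3 h4) (lexx _)) _.
by rewrite /lind_err -natr1 le_eqVlt; apply/orP; left; apply/eqP; ring.
Qed.
End lindeberg.

(** * Quantile transform *)

Section distribution_function.
Context {R : realType}.
Implicit Type mu : probability R R.

Definition dfun mu (x : R) : R := fine (mu [set y | y <= x]).

Lemma measurable_le_set (x : R) : measurable [set y : R | y <= x].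
Proof. by rewrite -[X in measurable X]setTI; apply: measurable_fun_ler. Qed.

Lemma dfunE mu x : mu [set y | y <= x] = (dfun mu x)%:E.
Proof. by rewrite fineK// fin_num_measure//; exact: measurable_le_set. Qed.

Lemma dfun_mono mu x y : x <= y -> dfun mu x <= dfun mu y.
Proof.
move=> xy; rewrite -lee_fin -!dfunE; apply: le_measure; rewrite ?inE; try exact: measurable_le_set.
by move=> z /= /le_trans; apply.
Qed.

Lemma dfun01 mu x : 0 <= dfun mu x <= 1.
Proof.
rewrite fine_ge0//= -lee_fin -dfunE; apply: probability_le1; exact: measurable_le_set.
Qed.

Lemma measurable_dfun mu : measurable_fun setT (dfun mu).
Proof. by apply: nondecreasing_measurable => // x y; exact: dfun_mono. Qed.

Lemma exhaust mu (A : nat -> set R) (u : R) : (forall n, measurable (A n)) ->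
  (forall n m, (n <= m)%N -> A n `<=` A m) -> \bigcup_n A n = setT -> u < 1 ->
  exists n, (u%:E < mu (A n))%E.
Proof.
move=> mA hA hU u1; apply: contrapT => /forallNP h.
have hc : mu (A n) @[n --> \oo] --> mu (\bigcup_n A n).
  apply: nondecreasing_cvg_mu => //; first exact: bigcup_measurable.
  by move=> n m nm; apply/subsetPset; exact: hA.
have : (mu (\bigcup_n A n) <= u%:E)%E.
  rewrite -(cvg_lim _ hc)//; apply: lime_le; first by apply/cvg_ex; eexists; exact: hc.
  by apply: nearW => n; rewrite leNgt; apply/negP; exact: h.
by rewrite hU [X in (X <= _)%E](@probability_setT _ _ _ mu) lee_fin leNgt u1.
Qed.

Lemma dfun_high mu u : u < 1 -> exists x, u < dfun mu x.
Proof.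
move=> u1; have [|||n hn] := @exhaust mu (fun n => [set y | y <= n%:R]) u _ _ _ u1.
- by move=> n; exact: measurable_le_set.
- by move=> n m nm y /= /le_trans; apply; rewrite ler_nat.
- apply/seteqP; split => // y _; exists (Num.truncn y).+1 => //=.
  by rewrite ltW// truncnS_gt.
by exists n%:R; rewrite -lte_fin -dfunE.
Qed.

Lemma dfun_low mu u : 0 < u -> exists x, dfun mu x < u.
Proof.
move=> u0; have m (n : nat) : measurable [set y : R | - n%:R < y].
  by rewrite -[X in measurable X]setTI; apply: measurable_fun_ltr.
have [|||n hn] := @exhaust mu (fun n => [set y | - n%:R < y]) (1 - u) m.
- by move=> n k nk y /=; apply: le_lt_trans; rewrite lerN2 ler_nat.
- apply/seteqP; split => // y _; exists (Num.truncn (- y)).+1 => //=.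
  by rewrite ltrNl truncnS_gt.
- by rewrite ltrBlDr ltrDl.
exists (- n%:R); rewrite -lte_fin -dfunE.
have -> : [set y | y <= - n%:R] = ~` [set y : R | - n%:R < y].
  by apply/seteqP; split => y /=; rewrite leNgt => /negP.
rewrite probability_setC//; move: hn; rewrite -[mu _](@fineK _ (mu _)) ?fin_num_measure//.
by rewrite -EFinB !lte_fin; lra.
Qed.

Section lipschitz.
Variables (mu : probability R R) (L : R).
Hypothesis L0 : 0 <= L.
Hypothesis lip : forall a b : R, a <= b -> (mu [set z | (a < z <= b)%R] <= (L * (b - a))%:E)%E.

Lemma dfun_lip a b : a <= b -> dfun mu b <= dfun mu a + L * (b - a).
Proof.
move=> ab; have m : measurable [set z : R | a < z <= b].
  rewrite -[X in measurable X]setTI; apply: measurable_and => //.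
    exact: measurable_fun_ltr.
  exact: measurable_fun_ler.
rewrite -lee_fin EFinD -!dfunE; apply: le_trans (leeD (lexx _) (lip ab)).
rewrite (_ : [set y | y <= b] = [set y | y <= a] `|` [set z | a < z <= b]).
  by apply: measureU2 => //; exact: measurable_le_set.
apply/seteqP; split => y /=; last by move=> [/le_trans|/andP[]//]; apply.
by move=> yb; case: (leP y a) => ya; [left|right].
Qed.

Lemma dfun_uniform u : 0 <= u <= 1 -> mu [set x | dfun mu x <= u] = u%:E.
Proof.
move=> /andP[u0]; rewrite le_eqVlt => /orP[/eqP->|u1].
  rewrite (_ : [set x | _] = setT); first exact: (@probability_setT _ _ _ mu).
  by apply/seteqP; split => // x _ /=; case/andP: (dfun01 mu x).
pose S := [set x | dfun mu x <= u].
have mS : measurable S.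
  rewrite -[S]setTI; apply: measurable_fun_ler => //; exact: measurable_dfun.
have [b hb] := dfun_high mu u1.
have Sb x : S x -> x <= b.
  by rewrite /S/= => hx; rewrite leNgt; apply/negP => /ltW/(dfun_mono mu); lra.
have [[x0 Sx0]|S0] := pselect (exists x, S x); last first.
  have -> : [set x | dfun mu x <= u] = set0.
    by apply/seteqP; split => // x hx; exfalso; apply: S0; exists x.
  rewrite measure0; congr EFin; apply/eqP; rewrite eq_le u0/= leNgt; apply/negP => u0'.
  by have [x hx] := dfun_low mu u0'; apply: S0; exists x; exact: ltW.
have hS : has_sup S by split; [exists x0|exists b => x; exact: Sb].
pose c := sup S.
have small (K : R) : (forall e, 0 < e -> K <= L * e) -> K <= 0.
  move=> h; rewrite leNgt; apply/negP => K0.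
  have L1 : 0 < L + 1 by rewrite ltr_wpDl.
  have := h (K / (2 * (L + 1))); rewrite divr_gt0 ?mulr_gt0// => /(_ isT).
  have e : K = 2 * (L + 1) * (K / (2 * (L + 1))) by rewrite mulrC divfK// mulf_neq0 ?pnatr_eq0//= gt_eqF.
  have : 0 < K / (2 * (L + 1)) by rewrite divr_gt0 ?mulr_gt0.
  move: (K / _) e => k e k0 h1; have : L * k <= (L + 1) * k by rewrite ler_wpM2r ?lerDl// ltW.
  by have : 0 < (L + 1) * k by [rewrite mulr_gt0]; lra.
have cu : dfun mu c <= u.
  rewrite -subr_le0; apply: small => e e0.
  have [x Sx xc] := sup_adherent e0 hS.
  have := dfun_lip (ltW (_ : c - e < c)); rewrite ltrBlDr ltrDl => /(_ e0).
  by have := dfun_mono mu (ltW xc); rewrite -/c; move: Sx; rewrite /S/=; lra.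
have uc : u <= dfun mu c.
  rewrite -subr_le0; apply: small => e e0.
  have ce : c < c + e by rewrite ltrDl.
  have := dfun_lip (ltW ce); have : u < dfun mu (c + e).
    by rewrite ltNge; apply/negP => h; have := ub_le_sup hS.2 h; rewrite -/c; lra.
  by lra.
have -> : [set x | dfun mu x <= u] = [set y | y <= c].
  apply/seteqP; split => y /=; first by move=> h; apply: ub_le_sup => //; exact: hS.2.
  by move=> /(dfun_mono mu) h; exact: le_trans cu.
by rewrite dfunE; congr EFin; apply/eqP; rewrite eq_le cu uc.
Qed.

End lipschitz.

Section transport.
Variables (mu la : probability R R) (L La : R).
Hypotheses (L0 : 0 <= L) (La0 : 0 <= La).
Hypothesis lip : forall a b : R, a <= b -> (mu [set z | (a < z <= b)%R] <= (L * (b - a))%:E)%E.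
Hypothesis lipa : forall a b : R, a <= b -> (la [set z | (a < z <= b)%R] <= (La * (b - a))%:E)%E.

(* Pushes an atomless [mu] to [la]: the quantile function of [la] after the
   distribution function of [mu]. *)
Definition transport (x : R) : R :=
  if 0 < dfun mu x < 1 then inf [set y | dfun mu x <= dfun la y] else 0.

Lemma transport_le x r : 0 < dfun mu x < 1 -> (transport x <= r) = (dfun mu x <= dfun la r).
Proof.
move=> /[dup] h /andP[h0 h1]; rewrite /transport h.
set S := [set y | _].
have [b hb] := dfun_high la h1; have [c hc] := dfun_low la h0.
have hS : has_inf S.
  split; [by exists b; exact: ltW|exists c => y]; rewrite /S/= => hy.
  by rewrite leNgt; apply/negP => /ltW/(dfun_mono la); lra.
apply/idP/idP => [hr|hr]; last by apply: ge_inf => //; exact: hS.2.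
rewrite leNgt; apply/negP => h2.
pose e := (dfun mu x - dfun la r) / (La + 1).
have L1 : 0 < La + 1 by rewrite ltr_wpDl.
have e0 : 0 < e by rewrite divr_gt0// subr_gt0.
have [y Sy yr] := inf_adherent e0 hS.
have yr' : y <= r + e by apply: ltW; apply: lt_le_trans yr _; rewrite lerD2r.
have re : r <= r + e by rewrite lerDl ltW.
have := dfun_lip lipa re; have := dfun_mono la yr'.
have : La * e < dfun mu x - dfun la r.
  by rewrite /e mulrCA gtr_pMr ?subr_gt0// ltr_pdivrMr// mul1r ltrDl.
by move: Sy; rewrite /S/= (addrC r) addrK; lra.
Qed.

Lemma measurable_transport : measurable_fun setT transport.
Proof.
pose A := [set x | 0 < dfun mu x < 1].
have md := measurable_dfun mu.
have mA : measurable A.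
  rewrite -[A]setTI; apply: measurable_and => //; exact: measurable_fun_ltr.
have e r : [set x | transport x <= r] =
    (A `&` [set x | dfun mu x <= dfun la r]) `|` (~` A `&` [set x | 0 <= r]).
  apply/seteqP; split => x /=.
    have [h|h] := boolP (0 < dfun mu x < 1); first by rewrite transport_le// => ?; left.
    by rewrite {1}/transport (negbTE h) => ?; right; split => //; apply/negP.
  move=> [[h]|[/negP/negbTE h]]; first by rewrite transport_le.
  by rewrite /transport h.
have m r : measurable [set x | transport x <= r].
  rewrite e; apply: measurableU; apply: measurableI => //.
  - by rewrite -[X in measurable X]setTI; apply: measurable_fun_ler.
  - exact: measurableC.
  - by rewrite -[X in measurable X]setTI; apply: measurable_fun_ler.
apply: (measurability _ (RGenOInfty.measurableE R)) => // _ [_ [r ->] <-].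
rewrite setTI (_ : _ @^-1` _ = ~` [set x | transport x <= r]); first exact: measurableC.
by apply/seteqP; split => x /=; rewrite in_itv/= andbT ltNge => /negP.
Qed.

Lemma transport_cdf r : mu [set x | transport x <= r] = la [set y | y <= r].
Proof.
pose A := [set x | 0 < dfun mu x < 1].
have md := measurable_dfun mu.
have m0 : measurable [set x | dfun mu x <= 0] by rewrite -[X in measurable X]setTI; apply: measurable_fun_ler.
have m1 : measurable [set x | 1 <= dfun mu x] by rewrite -[X in measurable X]setTI; apply: measurable_fun_ler.
have mr : measurable [set x | dfun mu x <= dfun la r] by rewrite -[X in measurable X]setTI; apply: measurable_fun_ler.
have z0 : mu [set x | dfun mu x <= 0] = 0%E by rewrite (dfun_uniform L0 lip)// lexx ler01.
have z1 : mu [set x | 1 <= dfun mu x] = 0%E.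
  apply/eqP; rewrite eq_le measure_ge0 andbT; apply/lee_addgt0Pr => e e0; rewrite add0e.
  have [e1|e1] := leP 1 e; first exact: le_trans (probability_le1 _ _) _.
  apply: (@le_trans _ _ (mu (~` [set x | dfun mu x <= 1 - e]))).
    apply: le_measure; rewrite ?inE//.
      by apply: measurableC; rewrite -[X in measurable X]setTI; apply: measurable_fun_ler.
    by move=> x /=; lra.
  rewrite probability_setC; last by rewrite -[X in measurable X]setTI; apply: measurable_fun_ler.
  rewrite (dfun_uniform L0 lip)//; last by apply/andP; split; lra.
  by rewrite -EFinB lee_fin; lra.
have e1 : [set x | transport x <= r] `<=` [set x | dfun mu x <= dfun la r] `|` ([set x | dfun mu x <= 0] `|` [set x | 1 <= dfun mu x]).
  move=> x /= hx; have [h|] := boolP (0 < dfun mu x < 1); first by left; rewrite -transport_le.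
  by rewrite negb_and -!leNgt => /orP[h|h]; right; [left|right].
have e2 : [set x | dfun mu x <= dfun la r] `<=` [set x | transport x <= r] `|` ([set x | dfun mu x <= 0] `|` [set x | 1 <= dfun mu x]).
  move=> x /= hx; have [h|] := boolP (0 < dfun mu x < 1); first by left; rewrite transport_le.
  by rewrite negb_and -!leNgt => /orP[h|h]; right; [left|right].
have mt : measurable [set x | transport x <= r].
  by rewrite -[X in measurable X]setTI; apply: measurable_fun_ler => //; exact: measurable_transport.
have nz (B : set R) : measurable B -> mu (B `|` ([set x | dfun mu x <= 0] `|` [set x | 1 <= dfun mu x])) = mu B.
  move=> mB; rewrite measureU0//; first exact: measurableU.
  by rewrite measureU0.
have := dfun_uniform L0 lip (dfun01 la r); rewrite dfunE => <-.
by apply/eqP; rewrite eq_le; apply/andP; split;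
  [rewrite -(nz _ mr)|rewrite -(nz _ mt)]; apply: le_measure; rewrite ?inE//; do ?apply: measurableU.
Qed.

Lemma prob_eq_cdf (m1 m2 : probability R R) :
  (forall r, m1 [set y | y <= r] = m2 [set y | y <= r]) -> forall B, measurable B -> m1 B = m2 B.
Proof.
move=> h; apply: (@measure_unique _ R R (@RGenOInfty.G R) (fun n => `]- n%:R, +oo[%classic)).
- exact: RGenOInfty.measurableE.
- move=> _ _ [a ->] [b ->]; exists (Num.max a b); apply/seteqP; split => y /=; rewrite !in_itv/= !andbT gt_max.
    by move=> [-> ->].
  by move=> /andP[].
- by move=> n; eexists.
- apply/seteqP; split => // y _; exists (Num.truncn (- y)).+1 => //=.
  by rewrite in_itv/= andbT ltrNl truncnS_gt.
- move=> _ [a ->]; rewrite (_ : `]a, +oo[%classic = ~` [set y | y <= a]); last first.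
    by apply/seteqP; split => y /=; rewrite in_itv/= andbT ltNge => /negP.
  have c (m : probability R R) : m (~` [set y | y <= a]) = (1 - m [set y | (y <= a)%R])%E.
    exact: probability_setC (measurable_le_set a).
  by apply: (etrans (c m1)); rewrite h; exact: esym (c m2).
- by move=> n; apply: le_lt_trans (probability_le1 _ _) (ltry _).
Qed.

Lemma transport_law B : measurable B -> mu (transport @^-1` B) = la B.
Proof.
pose tf : {mfun R >-> R} := HB.pack transport (isMeasurableFun.Build _ _ _ _ _ measurable_transport).
pose m1 : probability R R := distribution mu tf.
by apply: (@prob_eq_cdf m1 la) => r; exact: transport_cdf.
Qed.

End transport.

Lemma gam1_lip (a b : R) : a <= b ->
  (gam1 [set z | (a < z <= b)%R] <= (normal_peak 1 * (b - a))%:E)%E.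
Proof.
move=> ab; have m : measurable [set z : R | a < z <= b].
  rewrite -[X in measurable X]setTI; apply: measurable_and => //.
    exact: measurable_fun_ltr.
  exact: measurable_fun_ler.
have p0 : 0 <= normal_peak 1 :> R by exact: normal_peak_ge0.
have -> : gam1 [set z | a < z <= b] = (\int[gam1]_z (\1_[set z | a < z <= b] z)%:E)%E.
  by rewrite integral_indic// setIT.
rewrite integral_gam1//; last by apply/measurable_EFinP; exact: measurable_indic.
apply: (@le_trans _ _ (\int[lebR]_z ((normal_peak 1)%:E * (\1_[set z | a < z <= b] z)%:E))%E).
  apply: ge0_le_integral => //.
  - by move=> z _; rewrite -EFinM lee_fin mulr_ge0// ltW// phi_gt0.
  - apply/measurable_EFinP; apply: measurable_funM; first exact: measurable_indic.
    exact: measurable_phi.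
  - apply/measurable_EFinP; apply: measurable_funM => //; exact: measurable_indic.
  - move=> z _; rewrite -!EFinM lee_fin mulrC ler_wpM2r// /phi ler_piMr//.
    by rewrite -[leRHS]expR0 ler_expR oppr_le0 divr_ge0 ?sqr_ge0.
rewrite ge0_integralZl_EFin//; last by apply/measurable_EFinP; exact: measurable_indic.
have l : (lebR (`]a, b]%classic : set R) <= (b - a)%:E)%E.
  rewrite /lebR lebesgue_measure_itv/= lte_fin; case: ltP => h; first by rewrite -EFinB.
  by rewrite lee_fin subr_ge0.
rewrite integral_indic// setIT EFinM lee_wpmul2l// (_ : [set z | _] = `]a, b]%classic)//.
Qed.

Lemma density_lip (mu : probability R R) (g : R -> R) (M : R) : measurable_fun setT g ->
  (forall z, 0 <= g z <= M) ->
  (forall B, measurable B -> mu B = (\int[lebR]_(z in B) (g z)%:E)%E) ->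
  forall a b : R, a <= b -> (mu [set z | (a < z <= b)%R] <= (M * (b - a))%:E)%E.
Proof.
move=> mg gM muE a b ab.
have e : [set z | a < z <= b] = `]a, b]%classic by apply/seteqP; split => z /=; rewrite in_itv.
rewrite e muE; last exact: measurable_itv.
apply: (@le_trans _ _ (\int[lebR]_(z in `]a, b]) (cst M%:E z))%E).
  apply: ge0_le_integral => //.
  - by move=> z _; rewrite lee_fin; case/andP: (gM z).
  - exact/measurable_EFinP/measurable_funTS.
  - by move=> z _; rewrite lee_fin; case/andP: (gM z).
rewrite integral_cst//= /lebR lebesgue_measure_itv/= lte_fin; case: ltP => h.
  by rewrite -EFinB -EFinM.
by rewrite mule0 lee_fin mulr_ge0 ?subr_ge0//; case/andP: (gM 0) => h1 h2; exact: le_trans h2.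
Qed.

End distribution_function.

(** * Coupling with a Gaussian vector *)

Section blocks.
Context {d : measure_display} {T : measurableType d} {R : realType}.
Variables (P : probability T R) (xi : nat -> T -> R) (mu : probability R R) (tau : R -> R).
Hypothesis mxi : forall n, measurable_fun setT (xi n).
Hypothesis Hind : indep_seq P xi.
Hypothesis muE : forall n B, measurable B -> P (xi n @^-1` B) = mu B.
Hypothesis mtau : measurable_fun setT tau.
Hypothesis tauE : forall B, measurable B -> mu (tau @^-1` B) = gam1 B.

(* Standard normal vector read off the [L] steps that follow time [N]. *)
Definition zeta N L (w : T) : L.-tuple R := [tuple tau (xi (N + i) w) | i < L].

Lemma zetaS N L w : zeta N L.+1 w = consT (tau (xi N w), zeta N.+1 L w).
Proof.
apply: eq_from_tnth => i; rewrite tnth_mktuple.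
case: (unliftP ord0 i) => [j ->|->]; last by rewrite tnth_consT0 addn0.
by rewrite tnth_consTS tnth_mktuple lift0 addnS.
Qed.

Lemma measurable_zeta_past N L M : (N + L <= M)%N ->
  measurable_fun setT (zeta N L : past xi M -> L.-tuple R).
Proof.
move=> h; apply: measurable_mktuple => i; apply: (measurableT_comp mtau).
by apply: measurable_past_xi => //; apply: leq_trans h; rewrite ltn_add2l.
Qed.

Lemma integral_tau (f : R -> \bar R) : measurable_fun setT f -> (forall x, (0 <= f x)%E) ->
  (\int[mu]_x f (tau x) = \int[gam1]_x f x)%E.
Proof.
move=> mf f0.
pose tf : {mfun R >-> R} := HB.pack tau (isMeasurableFun.Build _ _ _ _ _ mtau).
transitivity (\int[distribution mu tf]_y f y)%E; first by rewrite ge0_integral_distribution.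
by apply: eq_measure_integral => B mB _; exact: tauE.
Qed.

Lemma block_integral N L (f : past xi N * L.-tuple R -> \bar R) :
  measurable_fun setT f -> (forall x, (0 <= f x)%E) ->
  (\int[P]_w f ((w : past xi N), zeta N L w) = \int[P]_w \int[gam L]_t f ((w : past xi N), t))%E.
Proof.
elim: L N f => [|L ih] N f mf f0.
  apply: eq_integral => w _; rewrite integral_gam0; congr (f (_, _)).
  by apply: eq_from_tnth => -[].
pose f' (q : past xi N.+1 * L.-tuple R) := f ((q.1 : past xi N), consT (tau (xi N q.1), q.2)).
have mid : measurable_fun setT (fun q : past xi N.+1 * L.-tuple R => (q.1 : past xi N)).
  apply: (measurableT_comp (f := (fun w : past xi N.+1 => (w : past xi N)))) => //.
  by apply: measurable_past_le (leqnSn N) _.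
have mf' : measurable_fun setT f'.
  apply: (measurableT_comp mf); apply: measurable_fun_pair => //.
  apply: measurable_consT_comp => //; apply: (measurableT_comp mtau).
  by apply: (measurableT_comp (f := (xi N : past xi N.+1 -> R))) => //; exact: measurable_past_xi.
transitivity (\int[P]_w f' ((w : past xi N.+1), zeta N.+1 L w))%E.
  by apply: eq_integral => w _; rewrite zetaS.
rewrite ih//; last by move=> q; exact: f0.
have mF : measurable_fun setT (fun q : past xi N * R * L.-tuple R => f (q.1.1, consT (q.1.2, q.2))).
  apply: (measurableT_comp mf); apply: measurable_fun_pair.
    exact: (measurableT_comp measurable_fst measurable_fst).
  apply: measurable_consT_comp => //; exact: (measurableT_comp measurable_snd measurable_fst).
pose F (q : past xi N * R) := (\int[gam L]_t f (q.1, consT (q.2, t)))%E.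
have mF1 : measurable_fun setT F.
  exact: (measurable_fun_fubini_tonelli_F (m2 := gam L) _ mF).
transitivity (\int[P]_w (fun q => F (q.1, tau q.2)) ((w : past xi N), xi N w))%E => //.
rewrite (@past_integral _ _ _ P xi mxi Hind N mu (muE N) (fun q => F (q.1, tau q.2))); last 2 first.
- apply: (measurableT_comp mF1); apply: measurable_fun_pair => //.
  exact: (measurableT_comp mtau).
- by move=> q; apply: integral_ge0.
apply: eq_integral => w _ /=.
rewrite (integral_tau (f := fun y => F ((w : past xi N), y))); last 2 first.
- exact: (measurableT_comp mF1).
- by move=> y; apply: integral_ge0.
rewrite integral_gamS//; exact: (measurableT_comp mf).
Qed.

End blocks.

Section density.
Context {d : measure_display} {T : measurableType d} {R : realType}.
Variables (P : probability T R) (D : nat) (W : T -> D.-tuple R).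
Hypothesis mW : measurable_fun setT W.

Definition dens (y : D.-tuple R) : R := fine (\int[P]_w (cmd (W w) y)%:E)%E.

Lemma dens_fin y : (\int[P]_w (cmd (W w) y)%:E)%E \is a fin_num.
Proof.
have m : measurable_fun setT (fun w => cmd (W w) y) by apply: measurable_cmd.
have : intg P (fun w => cmd (W w) y).
  apply: (@intg_bounded _ _ _ _ _ (expR (dot y y / 2))) => // w.
  rewrite ger0_norm ?expR_ge0// ler_expR.
  have := dot_ge0 (vlin 1 (-1) (W w) y); rewrite dot_vlin !(dotC (vlin _ _ _ _)) !dot_vlin (dotC y).
  by lra.
by move=> h; rewrite -EFin_Rint.
Qed.

Lemma dens_ge0 y : 0 <= dens y.
Proof. by apply: fine_ge0; apply: integral_ge0 => w _; rewrite lee_fin expR_ge0. Qed.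

Let mcmd : measurable_fun [set: D.-tuple R * T] (fun q => cmd (W q.2) q.1).
Proof. by apply: measurable_cmd => //; exact: (measurableT_comp mW). Qed.

Lemma measurable_dens : measurable_fun setT dens.
Proof.
apply: measurableT_comp => //.
apply: (measurable_fun_fubini_tonelli_F (m2 := P) (fun q : D.-tuple R * T => (cmd (W q.2) q.1)%:E)) => //.
  exact/measurable_EFinP.
by move=> q; rewrite lee_fin expR_ge0.
Qed.

Lemma densE (f : D.-tuple R -> \bar R) : measurable_fun setT f -> (forall y, (0 <= f y)%E) ->
  (\int[P]_w \int[gam D]_z f (vlin 1 1 (W w) z) = \int[gam D]_y (f y * (dens y)%:E))%E.
Proof.
move=> mf f0.
have ef : forall w, (\int[gam D]_z f (vlin 1 1 (W w) z) = \int[gam D]_z (f z * (cmd (W w) z)%:E))%E.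
  move=> w; rewrite -integral_gam_shift//; apply: eq_integral => z _; congr f.
  by apply: eq_from_tnth => i; rewrite !tnth_vlin !mul1r addrC.
under eq_integral do rewrite ef.
pose F (q : T * D.-tuple R) := (f q.2 * (cmd (W q.1) q.2)%:E)%E.
have mF : measurable_fun setT F.
  apply: emeasurable_funM; first exact: (measurableT_comp mf).
  by apply/measurable_EFinP; apply: measurable_cmd => //; exact: (measurableT_comp mW).
have F0 q : (0 <= F q)%E by rewrite mule_ge0// lee_fin expR_ge0.
rewrite (fubini_tonelli (m1 := P) (m2 := gam D) F)//; apply: eq_integral => y _.
rewrite /F /= /dens fineK ?dens_fin// ge0_integralZl//.
- by apply/measurable_EFinP; apply: measurable_cmd.
- by move=> w _; rewrite lee_fin expR_ge0.
Qed.

End density.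

Lemma measurable_inv_ge0 {d} {T : measurableType d} {R : realType} (f : T -> R) :
  (forall x, 0 <= f x) -> measurable_fun setT f -> measurable_fun setT (fun x => (f x)^-1).
Proof.
move=> f0 mf; rewrite (_ : (fun x => _) = (fun x => f x `^ (-1))).
  by apply: (measurableT_comp (measurable_powR (-1)) mf).
by apply/funext => x; rewrite powR_inv1.
Qed.

Section coupling.
Context {d : measure_display} {T : measurableType d} {R : realType}.
Variables (P : probability T R) (xi : nat -> T -> R) (mu : probability R R) (tau : R -> R).
Hypothesis mxi : forall n, measurable_fun setT (xi n).
Hypothesis Hind : indep_seq P xi.
Hypothesis muE : forall n B, measurable B -> P (xi n @^-1` B) = mu B.
Hypothesis mtau : measurable_fun setT tau.
Hypothesis tauE : forall B, measurable B -> mu (tau @^-1` B) = gam1 B.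
Local Notation zt := (zeta xi tau).
Variable D : nat.

Lemma past_mid N M : (N <= M)%N -> measurable_fun setT (id : past xi M -> past xi N).
Proof. by move=> NM; apply: measurable_past_le NM _. Qed.

Lemma measurable_past_set N (A : set T) : (measurable : set (set (past xi N))) A ->
  measurable_fun setT (fun w : past xi N => \1_A w : R).
Proof. by move=> mA; exact: (@measurable_indic _ (past xi N) R). Qed.

Lemma gam1_accept (al : R) : 0 <= al <= 1 -> (\int[gam1]_e ((dfun gam1 e <= al)%R%:R)%:E = al%:E)%E.
Proof.
move=> hal; rewrite -(dfun_uniform (mu := gam1) (normal_peak_ge0 1) gam1_lip hal).
have m : measurable [set e : R | dfun gam1 e <= al].
  by rewrite -[X in measurable X]setTI; apply: measurable_fun_ler => //; exact: measurable_dfun.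
rewrite -[in RHS](setIT [set x | _]) -integral_indic//; apply: eq_integral => e _; rewrite indicE.
case: (boolP (dfun gam1 e <= al)) => h; first by rewrite mem_set.
by rewrite memNset//=; exact/negP.
Qed.

Lemma measurable_acc {dS} {S : measurableType dS} (al : D.-tuple R -> R) (V : S -> D.-tuple R) (E : S -> R)
    (B : set (D.-tuple R)) : measurable B ->
  measurable_fun setT al -> measurable_fun setT V -> measurable_fun setT E ->
  measurable_fun setT (fun q => ((dfun gam1 (E q) <= al (V q))%R%:R * \1_B (V q))%:E : \bar R).
Proof.
move=> mB mal mV mE; apply/measurable_EFinP; apply: measurable_funM; last first.
  by apply: (measurableT_comp _ mV); exact: measurable_indic.
rewrite (_ : (fun _ => _) = (fun b : bool => b%:R : R) \o (fun q => dfun gam1 (E q) <= al (V q)))//.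
apply: measurableT_comp => //; apply: measurable_fun_ler; last exact: (measurableT_comp mal).
exact: (measurableT_comp (measurable_dfun gam1)).
Qed.

Lemma measurable_accept (c : R) : measurable_fun setT (fun e : R => (dfun gam1 e <= c)%R%:R : R).
Proof.
rewrite (_ : (fun _ => _) = (fun b : bool => b%:R : R) \o (fun e => dfun gam1 e <= c))//.
by apply: measurableT_comp => //; apply: measurable_fun_ler => //; exact: measurable_dfun.
Qed.

Section trial.
Variables (N M : nat).
Variables (V : past xi N -> M.-tuple R -> D.-tuple R) (al : D.-tuple R -> R) (A : set T) (B : set (D.-tuple R)).
Hypotheses (mV : measurable_fun setT (fun q : past xi N * M.-tuple R => V q.1 q.2))
  (mal : measurable_fun setT al) (al01 : forall v, 0 <= al v <= 1)
  (mA : (measurable : set (set (past xi N))) A) (mB : measurable B).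

Let val (w : T) := V (w : past xi N) (zt N M w).
Let ev (w : T) := tau (xi (N + M) w).

Lemma trial_prob : P (A `&` [set w | dfun gam1 (ev w) <= al (val w) /\ B (val w)]) =
  (\int[P]_w ((\1_A w)%:E * \int[gam M]_t (al (V w t) * \1_B (V w t))%:E))%E.
Proof.
have mval : measurable_fun setT (val : past xi (N + M) -> D.-tuple R).
  have h := measurableT_comp mV (measurable_fun_pair (past_mid (leq_addr M N))
    (measurable_zeta_past mtau (leqnn (N + M)))).
  exact: h.
have mevt : measurable_fun setT ev by exact: (measurableT_comp mtau).
have mv : measurable_fun setT val := measurable_past mxi mval.
have mAT := past_measurable mxi mA.
pose f (q : past xi (N + M) * 1.-tuple R) : \bar R :=
  ((\1_A (q.1 : T))%:E * ((dfun gam1 (tnth q.2 ord0) <= al (val q.1))%R%:R * \1_B (val q.1))%:E)%E.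
have mAp : (measurable : set (set (past xi (N + M)))) A by apply: past_sub mA; exact: leq_addr.
have mf : measurable_fun setT f.
  apply: emeasurable_funM.
    by apply/measurable_EFinP; apply: (measurableT_comp (measurable_past_set mAp)).
  apply: measurable_acc => //; first exact: (measurableT_comp mval).
  by apply: measurable_tnth_comp.
have f0 q : (0 <= f q)%E by rewrite mule_ge0// lee_fin mulr_ge0.
transitivity (\int[P]_w f ((w : past xi (N + M)), zt (N + M) 1 w))%E.
  have mE : measurable (A `&` [set w | dfun gam1 (ev w) <= al (val w) /\ B (val w)]).
    apply: measurableI => //; rewrite -[X in measurable X]setTI.
    rewrite (_ : [set w | _] = [set w | dfun gam1 (ev w) <= al (val w)] `&` (val @^-1` B)); last by [].
    rewrite setIA; apply: measurableI; last by rewrite -[X in measurable X]setTI; exact: mv.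
    by apply: measurable_fun_ler => //; [exact: (measurableT_comp (measurable_dfun gam1))|exact: (measurableT_comp mal)].
  rewrite -[X in P X]setIT -integral_indic//; apply: eq_integral => w _.
  rewrite /f /= -EFinM tnth_mktuple addn0 -/(ev w); congr EFin; rewrite !indicE.
  have -> : (w \in A `&` [set w | dfun gam1 (ev w) <= al (val w) /\ B (val w)]) =
      (w \in A) && ((dfun gam1 (ev w) <= al (val w)) && (val w \in B)).
    apply/idP/idP; first by move/set_mem => [hA [-> hB]]; rewrite !mem_set.
    by move=> /andP[/set_mem hA /andP[h /set_mem hB]]; apply: mem_set.
  by rewrite -!mulnb !natrM.
rewrite (block_integral (mu := mu))//.
have g0 (w : T) : (0 <= \int[gam M]_t (al (V w t) * \1_B (V w t))%:E)%E.
  by apply: integral_ge0 => t _; rewrite lee_fin mulr_ge0//; case/andP: (al01 (V w t)).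
pose g (q : past xi N * M.-tuple R) : \bar R := ((\1_A (q.1 : T))%:E * (al (V q.1 q.2) * \1_B (V q.1 q.2))%:E)%E.
have mg0 : measurable_fun setT (fun q : past xi N * M.-tuple R => (al (V q.1 q.2) * \1_B (V q.1 q.2))%:E : \bar R).
  apply/measurable_EFinP; apply: measurable_funM; first exact: (measurableT_comp mal mV).
  by apply: (measurableT_comp _ mV); exact: measurable_indic.
have mg : measurable_fun setT g.
  apply: emeasurable_funM => //.
  by apply/measurable_EFinP; apply: (measurableT_comp (measurable_past_set mA)).
transitivity (\int[P]_w g ((w : past xi N), zt N M w))%E.
  apply: eq_integral => w _; rewrite integral_gamS//; last exact: (measurableT_comp mf).
  under eq_integral do rewrite integral_gam0.
  rewrite /f /g /= ge0_integralZl//; last first.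
    by apply: (measurable_acc (V := fun=> val w) (E := fun x => tnth (consT (x, [tuple])) ord0)) => //; apply: measurable_tnth_comp; exact: measurable_consT_comp.
  congr (_ * _)%E; under eq_integral => x _ do rewrite tnth_consT0 EFinM.
  rewrite ge0_integralZr//; last first.
    by apply/measurable_EFinP; exact: measurable_accept.
  by rewrite gam1_accept// EFinM.
rewrite (block_integral (mu := mu))//; last first.
  by move=> q; rewrite mule_ge0// lee_fin// mulr_ge0//; case/andP: (al01 (V q.1 q.2)).
apply: eq_integral => w _; rewrite /g /= ge0_integralZl//.
- have hp : measurable_fun setT (fun t : M.-tuple R => ((w : past xi N), t)) by exact: measurable_fun_pair.
  exact: (measurableT_comp mg0 hp).
- by move=> t _; rewrite lee_fin mulr_ge0//; case/andP: (al01 (V w t)).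
Qed.

End trial.

Section rejection.
Variables (N : nat) (W : T -> D.-tuple R) (Am : D.-tuple R -> D.-tuple R).
Hypothesis mW : measurable_fun setT (W : past xi N -> D.-tuple R).
Hypothesis mAm : measurable_fun setT Am.

Let mWT : measurable_fun setT W := measurable_past mxi mW.
Let p := dens P W.
Let q := dens (gam D) Am.
Let p0 v : 0 <= p v. Proof. exact: dens_ge0. Qed.
Let q0 v : 0 <= q v. Proof. exact: dens_ge0. Qed.
Let mp : measurable_fun setT p. Proof. exact: measurable_dens. Qed.
Let mq : measurable_fun setT q. Proof. exact: measurable_dens. Qed.
Let a0 v : R := Num.min (p v) (q v) / p v.
Let a1 v : R := Num.max (q v - p v) 0 / q v.

Let ma0 : measurable_fun setT a0.
Proof.
apply: measurable_funM; first exact: measurable_minr.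
exact: measurable_inv_ge0.
Qed.

Let ma1 : measurable_fun setT a1.
Proof.
apply: measurable_funM; first by apply: measurable_maxr => //; exact: measurable_funB.
exact: measurable_inv_ge0.
Qed.

Let a0b v : 0 <= a0 v <= 1.
Proof.
rewrite /a0 divr_ge0 ?le_min ?p0 ?q0//=.
have := p0 v; rewrite le_eqVlt => /orP[/eqP <-|h]; first by rewrite invr0 mulr0.
by rewrite ler_pdivrMr// mul1r ge_min lexx.
Qed.

Let a1b v : 0 <= a1 v <= 1.
Proof.
rewrite /a1 divr_ge0 ?le_max ?lexx ?orbT//=.
have := q0 v; rewrite le_eqVlt => /orP[/eqP <-|h]; first by rewrite invr0 mulr0.
by rewrite ler_pdivrMr// mul1r ge_max q0 andbT lerBlDr lerDl p0.
Qed.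

Let a0p v : a0 v * p v = Num.min (p v) (q v).
Proof.
have [e|h] := eqVneq (p v) 0; last by rewrite /a0 divfK.
by rewrite /a0 e mulr0; apply/esym/min_idPl.
Qed.

Let a1q v : a1 v * q v = Num.max (q v - p v) 0.
Proof.
have [e|h] := eqVneq (q v) 0; last by rewrite /a1 divfK.
by rewrite /a1 e mulr0; apply/esym/max_idPr; rewrite sub0r oppr_le0.
Qed.

Definition Kval0 w : D.-tuple R := vlin 1 1 (W w) (zt N D w).
Let base m := (N + D.+1 + m * (D + D).+1)%N.
Let val m w : D.-tuple R := vlin 1 1 (Am (zt (base m) D w)) (zt (base m + D) D w).
Let Acc0 (B : set (D.-tuple R)) : set T :=
  [set w | dfun gam1 (tau (xi (N + D) w)) <= a0 (Kval0 w) /\ B (Kval0 w)].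
Let Acc m (B : set (D.-tuple R)) : set T :=
  [set w | dfun gam1 (tau (xi (base m + D + D) w)) <= a1 (val m w) /\ B (val m w)].

Let s0 B : \bar R := (\int[gam D]_y (Num.min (p y) (q y) * \1_B y)%:E)%E.
Let rh B : \bar R := (\int[gam D]_y (Num.max (q y - p y) 0 * \1_B y)%:E)%E.

Let Acc0P B : measurable B -> P (Acc0 B) = s0 B.
Proof.
move=> mB.
have mV : measurable_fun setT (fun r : past xi N * D.-tuple R => vlin 1 1 (W r.1) r.2).
  by apply: measurable_vlin => //; exact: (measurableT_comp mW).
have := @trial_prob N D (fun w z => vlin 1 1 (W w) z) a0 setT B mV ma0 a0b measurableT mB.
rewrite setTI => ->.
have mf : measurable_fun setT (fun y => (a0 y * \1_B y)%:E : \bar R).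
  by apply/measurable_EFinP; apply: measurable_funM => //; exact: measurable_indic.
under eq_integral do rewrite indicT mul1e.
rewrite (@densE _ _ _ P D W mWT _ mf) => [|y]; last by rewrite lee_fin mulr_ge0//; case/andP: (a0b y).
by apply: eq_integral => y _; rewrite -EFinM mulrAC a0p.
Qed.

Let AccP m A B : (measurable : set (set (past xi (base m)))) A -> measurable B ->
  P (A `&` Acc m B) = (P A * rh B)%E.
Proof.
move=> mA mB.
have mz : measurable_fun setT (zt (base m) D : past xi (base m + D) -> D.-tuple R).
  exact: measurable_zeta_past.
have mV : measurable_fun setT (fun r : past xi (base m + D) * D.-tuple R =>
    vlin 1 1 (Am (zt (base m) D r.1)) r.2).
  by apply: measurable_vlin => //; apply: (measurableT_comp mAm); exact: (measurableT_comp mz).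
have mA' : (measurable : set (set (past xi (base m + D)))) A by apply: past_sub mA; exact: leq_addr.
rewrite (@trial_prob (base m + D) D (fun w z => vlin 1 1 (Am (zt (base m) D w)) z) a1 A B mV ma1 a1b mA' mB).
have mf : measurable_fun setT (fun y => (a1 y * \1_B y)%:E : \bar R).
  by apply/measurable_EFinP; apply: measurable_funM => //; exact: measurable_indic.
have f0 y : (0 <= (a1 y * \1_B y)%:E)%E by rewrite lee_fin mulr_ge0//; case/andP: (a1b y).
pose F t := (\int[gam D]_z (a1 (vlin 1 1 (Am t) z) * \1_B (vlin 1 1 (Am t) z))%:E)%E.
have F0 t : (0 <= F t)%E by apply: integral_ge0.
have mF : measurable_fun setT F.
  apply: (measurable_fun_fubini_tonelli_F (m2 := gam D) (fun r => (a1 (vlin 1 1 (Am r.1) r.2) * \1_B (vlin 1 1 (Am r.1) r.2))%:E)) => //.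
  apply: (measurableT_comp mf); apply: measurable_vlin => //; exact: (measurableT_comp mAm).
pose G (r : past xi (base m) * D.-tuple R) := ((\1_A (r.1 : T))%:E * F r.2)%E.
have mG : measurable_fun setT G.
  apply: emeasurable_funM; last exact: (measurableT_comp mF).
  by apply/measurable_EFinP; apply: (measurableT_comp (measurable_past_set mA)).
transitivity (\int[P]_w G ((w : past xi (base m)), zt (base m) D w))%E => //.
rewrite (block_integral (mu := mu))//; last by move=> r; rewrite mule_ge0// lee_fin.
have -> : rh B = (\int[gam D]_t F t)%E.
  rewrite (@densE _ _ _ (gam D) D Am mAm _ mf f0); apply: eq_integral => y _.
  by rewrite -EFinM mulrAC a1q.
have mAT := past_measurable mxi mA.
transitivity (\int[P]_w ((\1_A w)%:E * \int[gam D]_t F t))%E.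
  by apply: eq_integral => w _; rewrite /G /= ge0_integralZl// lee_fin.
rewrite ge0_integralZr//; last 2 first.
- by apply/measurable_EFinP; exact: measurable_indic.
- exact: integral_ge0.
by rewrite integral_indic// setIT.
Qed.

Let mKval0p : measurable_fun setT (Kval0 : past xi (N + D) -> D.-tuple R).
Proof.
apply: measurable_vlin; last exact: measurable_zeta_past.
exact: (measurable_past_le (leq_addr D N) mW).
Qed.

Lemma measurable_Kval0 : measurable_fun setT Kval0.
Proof. exact: (measurable_past mxi mKval0p). Qed.

Let mvalp m : measurable_fun setT (val m : past xi (base m + D + D) -> D.-tuple R).
Proof.
apply: measurable_vlin; last exact: measurable_zeta_past.
apply: (measurableT_comp mAm); apply: measurable_zeta_past => //; exact: leq_addr.
Qed.

Let accp n M k (al : D.-tuple R -> R) (V : T -> D.-tuple R) B : (n <= M)%N -> (k < M)%N ->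
  measurable_fun setT (V : past xi n -> D.-tuple R) -> measurable_fun setT al -> measurable B ->
  (measurable : set (set (past xi M))) [set w | dfun gam1 (tau (xi k w)) <= al (V w) /\ B (V w)].
Proof.
move=> nM kM mV mal mB.
have mV' : measurable_fun setT (V : past xi M -> D.-tuple R) by exact: measurable_past_le nM mV.
have mk : measurable_fun setT (xi k : past xi M -> R) by exact: measurable_past_xi.
rewrite -[X in measurable X]setTI.
rewrite (_ : [set w | _] = [set w : past xi M | dfun gam1 (tau (xi k w)) <= al (V w)] `&` ((V : past xi M -> _) @^-1` B))//.
rewrite setIA; apply: measurableI; last by rewrite -[X in measurable X]setTI; exact: mV'.
apply: measurable_fun_ler => //; last exact: (measurableT_comp mal).
by apply: (measurableT_comp (measurable_dfun gam1)); exact: (measurableT_comp mtau).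
Qed.

Let Acc0_past B : measurable B -> (measurable : set (set (past xi (base 0)))) (Acc0 B).
Proof. by move=> mB; apply: (accp (n := (N + D)%N)) => //; rewrite /base; lia. Qed.

Let Acc_past m B : measurable B -> (measurable : set (set (past xi (base m.+1)))) (Acc m B).
Proof. by move=> mB; apply: (accp (n := (base m + D + D)%N)) => //; rewrite /base; lia. Qed.

Let RJ := fix RJ m : set T := if m is m'.+1 then RJ m' `\` Acc m' setT else ~` Acc0 setT.

Let RJ_past m : (measurable : set (set (past xi (base m)))) (RJ m).
Proof.
elim: m => [|m ih] /=; first by apply: (@measurableC _ (past xi (base 0))); exact: Acc0_past.
apply: (@measurableD _ (past xi (base m.+1))); last exact: Acc_past.
by apply: past_sub ih; rewrite /base; lia.
Qed.

Let mRJ m : measurable (RJ m).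
Proof. exact: (past_measurable mxi (@RJ_past m)). Qed.
Let mAcc0 B (mB : measurable B) : measurable (Acc0 B).
Proof. exact: (past_measurable mxi (Acc0_past mB)). Qed.
Let mAcc m B (mB : measurable B) : measurable (Acc m B).
Proof. exact: (past_measurable mxi (@Acc_past m B mB)). Qed.

(* Maximal coupling by rejection: the smoothed vector [Kval0] is accepted with
   probability [min(p,q)/p]; otherwise one samples the normalised [(q - p)^+] by
   rejection from proposals of density [q], built on later and later steps. *)
Definition Kcoup (w : T) : D.-tuple R :=
  if pselect (exists m, (RJ m `&` Acc m setT) w) is left e then val (projT1 (cid e)) w else Kval0 w.

Let RJ_mono m k : (m <= k)%N -> RJ k `<=` RJ m.
Proof.
move=> /subnKC <-; elim: (k - m)%N => [|j ih]; first by rewrite addn0.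
by rewrite addnS /= => w [/ih].
Qed.

Let KcoupE m w : (RJ m `&` Acc m setT) w -> Kcoup w = val m w.
Proof.
move=> h; rewrite /Kcoup; case: pselect => [e|]; last by case; exists m.
have : m = projT1 (cid e); last by move=> <-.
move: (projT1 _) (projT2 (cid e)) => k hk.
have lt i j : (RJ i `&` Acc i setT) w -> (RJ j `&` Acc j setT) w -> (j <= i)%N.
  move=> [_ ai] [rj _]; rewrite leqNgt; apply/negP => ij.
  by have /= [] := RJ_mono ij rj.
by apply/eqP; rewrite eqn_leq !lt.
Qed.

Let Kcoup_pre B : Kcoup @^-1` B = (\bigcup_m (RJ m `&` Acc m B)) `|`
  ((\bigcap_m ~` (RJ m `&` Acc m setT)) `&` (Kval0 @^-1` B)).
Proof.
apply/seteqP; split => w /=.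
  have [[m hm]|hn] := pselect (exists m, (RJ m `&` Acc m setT) w).
    rewrite (KcoupE hm) => hB; left; exists m => //; split; first exact: hm.1.
    by split => //; exact: hm.2.1.
  rewrite /Kcoup; case: pselect => // _ hB; right; split => // m _ hm.
  by apply: hn; exists m.
move=> [[m _ [h1 [h2 hB]]]|[h hB]]; first by rewrite (KcoupE (m := m))//; split.
by rewrite /Kcoup; case: pselect => // -[m hm]; exfalso; exact: (h m).
Qed.

Lemma measurable_Kcoup : measurable_fun setT Kcoup.
Proof.
move=> _ B mB; rewrite setTI Kcoup_pre; apply: measurableU.
  by apply: bigcupT_measurable => m; apply: measurableI => //; exact: mAcc.
apply: measurableI; last by rewrite -[X in measurable X]setTI; exact: measurable_Kval0.
by apply: bigcapT_measurable => m; apply: measurableC; apply: measurableI => //; exact: mAcc.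
Qed.

Let Kcoup_neq : [set w | Kcoup w != Kval0 w] `<=` RJ 0.
Proof.
move=> w /=; rewrite /Kcoup; case: pselect => [|_]; last by rewrite eqxx.
by move=> [m [hm _]] _; exact: (RJ_mono (leq0n m) hm).
Qed.

Let pr (S : set T) : R := fine (P S).
Let prE S : measurable S -> P S = (pr S)%:E.
Proof. by move=> mS; rewrite /pr fineK// fin_num_measure. Qed.

Let s0E B : measurable B -> s0 B = (pr (Acc0 B))%:E.
Proof. by move=> mB; rewrite -Acc0P// prE//; exact: mAcc0. Qed.

Let qB B : measurable B -> (s0 B + rh B = \int[gam D]_y ((q y * \1_B y)%:E))%E.
Proof.
move=> mB; have mi : measurable_fun setT (\1_B : _ -> R) by exact: measurable_indic.
rewrite /s0 /rh -ge0_integralD//.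
- apply: eq_integral => y _; rewrite -EFinD -mulrDl; congr (_ * _)%:E.
  by case: (leP (p y) (q y)) => h; case: (leP (q y - p y) 0) => h2; lra.
- by move=> y _; rewrite lee_fin mulr_ge0// le_min p0 q0.
- by apply/measurable_EFinP; apply: measurable_funM => //; exact: measurable_minr.
- by move=> y _; rewrite lee_fin mulr_ge0// le_max lexx orbT.
- by apply/measurable_EFinP; apply: measurable_funM => //; apply: measurable_maxr => //; exact: measurable_funB.
Qed.

Let rr B : R := pr (Acc 0 B).

Let rhE B : measurable B -> rh B = (rr B)%:E.
Proof.
move=> mB; have := @AccP 0 setT B measurableT mB.
by rewrite setTI [X in (X * _)%E](@probability_setT _ _ _ P) mul1e => <-; exact: prE (mAcc 0 mB).
Qed.

Let pr_le S S' : measurable S -> measurable S' -> S `<=` S' -> pr S <= pr S'.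
Proof. by move=> mS mS' h; rewrite -lee_fin -!prE//; apply: le_measure; rewrite ?inE. Qed.

Let prU S S' : measurable S -> measurable S' -> [disjoint S & S'] -> pr (S `|` S') = pr S + pr S'.
Proof.
move=> mS mS' h; apply: EFin_inj; rewrite EFinD -!prE//; last exact: measurableU.
by apply: measureU => //; apply/eqP.
Qed.

Let pr01 S : measurable S -> 0 <= pr S <= 1.
Proof.
by move=> mS; rewrite -!lee_fin -prE// measure_ge0 probability_le1.
Qed.

Let pr_RJAcc m B : measurable B -> pr (RJ m `&` Acc m B) = pr (RJ m) * rr B.
Proof.
move=> mB; apply: EFin_inj; rewrite EFinM -prE; last by apply: measurableI => //; exact: mAcc.
by rewrite (AccP (@RJ_past m) mB) rhE// prE.
Qed.

Let nuK B : R := pr (Acc0 B) + rr B.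

Let nuKq B : measurable B -> (nuK B)%:E = (\int[gam D]_y (q y * \1_B y)%:E)%E.
Proof. by move=> mB; rewrite /nuK EFinD -s0E// -rhE// qB. Qed.

Let nuKE B : measurable B -> (nuK B)%:E = (\int[gam D]_t \int[gam D]_z (\1_B (vlin 1 1 (Am t) z))%:E)%E.
Proof.
move=> mB; rewrite nuKq//.
rewrite (@densE _ _ _ (gam D) D Am mAm (fun y => (\1_B y)%:E))//.
- by apply: eq_integral => y _; rewrite -EFinM mulrC.
- by apply/measurable_EFinP; exact: measurable_indic.
Qed.

Let nuKT : nuK setT = 1.
Proof.
apply: EFin_inj; rewrite nuKE//.
have h1 : (\int[gam D]_z (cst (1 : R)%:E z) = (1 : R)%:E)%E.
  transitivity ((1 : R)%:E * gam D setT)%E; first exact: (@integral_cst _ _ _ (gam D) setT measurableT 1%:E).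
  by rewrite mul1e; exact: (@probability_setT _ _ _ (gam D)).
rewrite -[RHS]h1; apply: eq_integral => t _.
by transitivity ((1 : R)%:E : \bar R) => //; rewrite -[RHS]h1; apply: eq_integral => z _; rewrite indicT.
Qed.

Let c := rr setT.

Let pr_RJ m : pr (RJ m) = c * (1 - c) ^+ m.
Proof.
elim: m => [|m ih].
  rewrite expr0 mulr1; have := nuKT; rewrite /nuK -/c => h.
  suff : pr (RJ 0) + pr (Acc0 setT) = 1 by lra.
  rewrite -prU//; last 2 first.
  - exact: mAcc0.
  - by rewrite disj_set2E /= setICl.
  by rewrite /= setUC setUv /pr [X in fine X](@probability_setT _ _ _ P).
have : pr (RJ m.+1) + pr (RJ m `&` Acc m setT) = pr (RJ m).
  rewrite -prU//; last 2 first.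
  - by apply: measurableI => //; exact: mAcc.
  - by rewrite disj_set2E /= setDE setIACA setICl setI0.
  by congr pr; apply/seteqP; split => w /=; [move=> [[]|[]]|have [h|h] := pselect (Acc m setT w); [right|left]].
rewrite pr_RJAcc// ih -/c exprS => h.
by apply: (addIr (c * (1 - c) ^+ m * c)); rewrite h; ring.
Qed.

Let Kcoup_RJ0 w : ~ RJ 0 w -> Kcoup w = Kval0 w.
Proof.
by move=> h; have [/eqP//|hn] := boolP (Kcoup w == Kval0 w); exfalso; apply: h; exact: Kcoup_neq.
Qed.

Let mKpre B : measurable B -> measurable (Kcoup @^-1` B).
Proof. by move=> mB; rewrite -[X in measurable X]setTI; exact: measurable_Kcoup. Qed.

Let Kcoup_lower B M : measurable B ->
  pr (Acc0 B) + rr B * (1 - (1 - c) ^+ M) <= pr (Kcoup @^-1` B `\` RJ M).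
Proof.
move=> mB; have mm k : measurable (Kcoup @^-1` B `\` RJ k) by apply: measurableD => //; exact: mKpre.
elim: M => [|M ih].
  rewrite expr0 subrr mulr0 addr0; apply: pr_le => //; first exact: mAcc0.
  move=> w [h1 h2]; have hn : ~ RJ 0 w by move=> /=; apply; split.
  by split => //=; rewrite Kcoup_RJ0.
apply: (@le_trans _ _ (pr ((Kcoup @^-1` B `\` RJ M) `|` (RJ M `&` Acc M B)))); last first.
  apply: pr_le => //; first by apply: measurableU => //; apply: measurableI => //; exact: mAcc.
  move=> w [[h1 h2]|[h1 h2]]; split => //; first by move=> /= -[].
    by rewrite /= (KcoupE (m := M)) => [|]; [case: h2|split => //; case: h2].
  by move=> /= [_]; apply; case: h2.
rewrite prU//; last 2 first.
- by apply: measurableI => //; exact: mAcc.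
- by rewrite disj_set2E /= setDE -setIA (setIA (~` _)) setICl set0I setI0.
rewrite pr_RJAcc// pr_RJ exprS; move: ih; set x := (1 - c) ^+ M.
have -> : rr B * (1 - (1 - c) * x) = rr B * (1 - x) + c * x * rr B by ring.
lra.
Qed.

Let Kcoup_ge B : measurable B -> nuK B <= pr (Kcoup @^-1` B).
Proof.
move=> mB; rewrite /nuK -subr_le0.
have h M : pr (Acc0 B) + rr B - pr (Kcoup @^-1` B) <= rr B * (1 - c) ^+ M.
  have := Kcoup_lower M mB; have : pr (Kcoup @^-1` B `\` RJ M) <= pr (Kcoup @^-1` B).
    apply: pr_le; [apply: measurableD => //; exact: mKpre|exact: mKpre|exact: subDsetl].
  by rewrite mulrBr mulr1; lra.
have /andP[c0 c1] : 0 <= c <= 1 by apply: pr01; exact: mAcc.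
have rBc : rr B <= c.
  by apply: pr_le; [exact: mAcc|exact: mAcc|move=> w [h1 h2]; split].
have rB0 : 0 <= rr B by have /andP[] := pr01 (mAcc 0 mB).
move: c0; rewrite le_eqVlt => /orP[/eqP c0|c0].
  by have := h 0%N; have -> : rr B = 0 by [lra]; rewrite mul0r.
have hc : rr B * (1 - c) ^+ M @[M --> \oo] --> 0.
  rewrite -(mulr0 (rr B)); apply: cvgM; first exact: cvg_cst.
  by apply: cvg_expr; rewrite ger0_norm; lra.
rewrite -(cvg_lim _ hc)//; apply: limr_ge; first by apply/cvg_ex; eexists; exact: hc.
by apply: nearW.
Qed.

Lemma Kcoup_law B : measurable B ->
  P (Kcoup @^-1` B) = (\int[gam D]_t \int[gam D]_z (\1_B (vlin 1 1 (Am t) z))%:E)%E.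
Proof.
move=> mB; rewrite -nuKE// prE; last exact: mKpre.
congr EFin; apply/eqP; rewrite eq_le Kcoup_ge// andbT.
have mBc := measurableC mB.
have h1 : pr (Kcoup @^-1` B) + pr (Kcoup @^-1` (~` B)) = 1.
  rewrite -prU; [|exact: mKpre|exact: mKpre|by rewrite disj_set2E -preimage_setI setICr preimage_set0].
  by rewrite -preimage_setU setUv preimage_setT /pr [X in fine X](@probability_setT _ _ _ P).
have h2 : nuK B + nuK (~` B) = 1.
  have mi A : measurable A -> measurable_fun setT (fun y => (q y * \1_A y)%:E).
    by move=> mA; apply/measurable_EFinP; apply: measurable_funM => //; exact: measurable_indic.
  apply: EFin_inj; rewrite -nuKT EFinD !nuKq// -ge0_integralD//; last 4 first.
  - by move=> y _; rewrite lee_fin mulr_ge0.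
  - exact: mi.
  - by move=> y _; rewrite lee_fin mulr_ge0.
  - exact: mi.
  apply: eq_integral => y _; rewrite -EFinD -mulrDr !indicE in_setC in_setT.
  by case: (y \in B); rewrite /= ?addr0 ?add0r.
by have := Kcoup_ge mBc; lra.
Qed.

Lemma Kcoup_integral (f : D.-tuple R -> \bar R) : measurable_fun setT f -> (forall y, (0 <= f y)%E) ->
  (\int[P]_w f (Kcoup w) = \int[gam D]_t \int[gam D]_z f (vlin 1 1 (Am t) z))%E.
Proof.
move=> mf f0.
pose Kf : {mfun T >-> D.-tuple R} := HB.pack Kcoup (isMeasurableFun.Build _ _ _ _ _ measurable_Kcoup).
transitivity (\int[distribution P Kf]_y f y)%E; first by rewrite ge0_integral_distribution.
rewrite (@densE _ _ _ (gam D) D Am mAm _ mf f0).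
apply: (@ge0_integral_density _ _ _ (gam D) _ q f) => // B mB.
rewrite [LHS](Kcoup_law mB) -nuKE// nuKq// (integral_mkcond B).
by apply: eq_integral => y _; rewrite patchE indicE; case: (y \in B); rewrite ?mulr1 ?mulr0.
Qed.

Lemma Kcoup_close (eps : R) :
  (forall g : D.-tuple R -> R, measurable_fun setT g -> (forall y, 0 <= g y <= 1) ->
     \int[gam D]_t smooth g (Am t) - \int[P]_w smooth g (W w) <= eps) ->
  (P [set w | Kcoup w != Kval0 w] <= eps%:E)%E.
Proof.
move=> h.
pose g y : R := (p y < q y)%R%:R.
have mg : measurable_fun setT g.
  rewrite (_ : g = (fun b : bool => b%:R : R) \o (fun y => p y < q y))//.
  by apply: measurableT_comp => //; exact: measurable_fun_ltr.
have g01 y : 0 <= g y <= 1 by rewrite /g; case: (_ < _); rewrite /= ?lexx ?ler01.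
have mE : measurable_fun setT (EFin \o g) by exact/measurable_EFinP.
have E0 y : (0 <= (EFin \o g) y)%E by rewrite lee_fin; case/andP: (g01 y).
have msm := measurable_smooth mg g01.
have bsm v : `|smooth g v| <= 1 by rewrite ger0_norm; case/andP: (smooth01 mg g01 v).
have ig v : intg (gam D) (fun z => g (vlin 1 1 v z)).
  apply: (@intg_bounded _ _ _ _ _ 1) => [|z]; first exact: measurable_shift.
  exact: norm_g_le1.
have e (d' : measure_display) (T' : measurableType d') (Q : probability T' R) (V : T' -> D.-tuple R) (mV : measurable_fun setT V) :
    ((\int[Q]_w smooth g (V w))%:E = \int[gam D]_y (g y * dens Q V y)%:E)%E.
  rewrite EFin_Rint; last first.
    apply: (@intg_bounded _ _ _ _ _ 1) => [|w]; last exact: bsm.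
    exact: (measurableT_comp msm).
  transitivity (\int[Q]_w \int[gam D]_z (EFin \o g) (vlin 1 1 (V w) z))%E.
    by apply: eq_integral => w _; rewrite /smooth EFin_Rint.
  by rewrite (@densE _ _ _ Q D V mV _ mE E0).
have := h g mg g01.
have eq := e _ _ (gam D) Am mAm; have ep := e _ _ P W mWT.
move: eq ep; rewrite -/q -/p; move: (\int[gam D]_t _) (\int[P]_w _) => xq xp eq ep hx.
have hc : (\int[gam D]_y (g y * q y)%:E = \int[gam D]_y (g y * p y)%:E + c%:E)%E.
  rewrite /c -rhE// /rh -ge0_integralD//; last 4 first.
  - by move=> y _; rewrite lee_fin mulr_ge0//; case/andP: (g01 y).
  - by apply/measurable_EFinP; exact: measurable_funM.
  - by move=> y _; rewrite lee_fin mulr_ge0// le_max lexx orbT.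
  - apply/measurable_EFinP; apply: measurable_funM => //.
    by apply: measurable_maxr => //; exact: measurable_funB.
  apply: eq_integral => y _; rewrite -EFinD indicT mulr1 /g; congr EFin.
  by case: (ltP (p y) (q y)) => h1; case: (leP (q y - p y) 0) => h2; rewrite /= ?mul1r ?mul0r; lra.
have mne : measurable [set w | Kcoup w != Kval0 w].
  pose f w := \sum_(i < D) `|tnth (Kcoup w) i - tnth (Kval0 w) i|.
  have mf : measurable_fun setT f.
    apply: measurable_sum => i; apply: measurableT_comp => //; apply: measurable_funB.
      by apply: measurable_tnth_comp; exact: measurable_Kcoup.
    by apply: measurable_tnth_comp; exact: measurable_Kval0.
  rewrite (_ : [set w | _] = [set w | 0 < f w]).
    by rewrite -[X in measurable X]setTI; apply: measurable_fun_ltr.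
  have f0 w : 0 <= f w by apply: sumr_ge0.
  apply/seteqP; split => w /=; last by apply: contraTneq => e'; rewrite /f big1 ?ltxx// => i _; rewrite e' subrr normr0.
  apply: contraNT; rewrite -leNgt => h1.
  have /eqP : f w == 0 by rewrite eq_le h1 f0.
  rewrite /f => /psumr_eq0P h2; apply/eqP; apply: eq_from_tnth => i.
  by apply/eqP; rewrite -subr_eq0 -normr_eq0; apply/eqP; apply: h2.
apply: (@le_trans _ _ (P (RJ 0))); first by apply: le_measure; rewrite ?inE.
rewrite prE// lee_fin pr_RJ expr0 mulr1.
by move: hc; rewrite -eq -ep -EFinD => -[]; lra.
Qed.

End rejection.
End coupling.

(** * The walk, its martingales and their exponential bounds *)

Section cholesky.
Context {R : realType}.

Lemma cholesky (d : nat) (C : 'I_d -> 'I_d -> R) :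
  (forall i j, C i j = C j i) ->
  (forall c : 'I_d -> R, 0 <= \sum_(i < d) \sum_(j < d) c i * c j * C i j) ->
  exists A : 'I_d -> d.-tuple R, forall i j, dot (A i) (A j) = C i j.
Proof.
elim: d C => [|d ih] C symC psd; first by exists (fun _ => [tuple]) => -[].
pose al := C ord0 ord0.
pose c' (x0 : R) (c : 'I_d -> R) (i : 'I_d.+1) : R := if unlift ord0 i is Some j then c j else x0.
have c'0 x0 c : c' x0 c ord0 = x0 by rewrite /c' unlift_none.
have c'S x0 c j : c' x0 c (lift ord0 j) = c j by rewrite /c' liftK.
have Q x0 c : \sum_(i < d.+1) \sum_(j < d.+1) c' x0 c i * c' x0 c j * C i j =
    x0 ^+ 2 * al + 2 * x0 * (\sum_(j < d) c j * C ord0 (lift ord0 j)) +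
    \sum_(i < d) \sum_(j < d) c i * c j * C (lift ord0 i) (lift ord0 j).
  rewrite big_ord_recl big_ord_recl c'0 -/al.
  under eq_bigr => j _ do rewrite c'S -mulrA.
  rewrite -mulr_sumr.
  under [X in _ + X]eq_bigr => i _ do rewrite big_ord_recl c'0 c'S symC.
  rewrite big_split/= [X in _ + (X + _)](_ : _ = x0 * \sum_(j < d) c j * C ord0 (lift ord0 j)).
    rewrite expr2 [X in _ + (_ + X)](_ : _ = \sum_(i < d) \sum_(j < d) c i * c j * C (lift ord0 i) (lift ord0 j)); first by ring.
    by apply: eq_bigr => i _; apply: eq_bigr => j _; rewrite !c'S.
  by rewrite mulr_sumr; apply: eq_bigr => j _; rewrite mulrCA mulrA.
have al0 : 0 <= al.
  have := psd (c' 1 (fun=> 0)); rewrite Q !big1 => [|i _|i _]; try by rewrite mul0r.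
    by rewrite expr1n mul1r mulr0 !addr0.
  by rewrite big1// => j _; rewrite !mul0r.
have C0 j : al = 0 -> C ord0 (lift ord0 j) = 0.
  move=> ale; apply/eqP; apply: contraT => h.
  pose g := C (lift ord0 j) (lift ord0 j); pose h0 := C ord0 (lift ord0 j).
  have := psd (c' (- (g + 1) / h0 / 2) (fun i => (i == j)%:R)); rewrite Q ale mulr0 add0r.
  rewrite (bigD1 j)//= eqxx mul1r big1 ?addr0 => [|i /negbTE ->]; last by rewrite mul0r.
  have dd (G : 'I_d -> 'I_d -> R) : \sum_(i < d) \sum_(k < d) (i == j)%:R * (k == j)%:R * G i k = G j j.
    rewrite (bigD1 j)//= [X in _ + X]big1 ?addr0 => [|i /negbTE ->]; last first.
      by rewrite big1// => k _; rewrite !mul0r.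
    rewrite (bigD1 j)//= eqxx !mul1r big1 ?addr0// => k /negbTE ->; by rewrite mulr0 mul0r.
  rewrite dd.
  have -> : 2 * (- (g + 1) / h0 / 2) * C ord0 (lift ord0 j) = - (g + 1) by rewrite -/h0; field.
  by rewrite -/g; lra.
pose S i j := C (lift ord0 i) (lift ord0 j) - C ord0 (lift ord0 i) * C ord0 (lift ord0 j) / al.
have [i j|c|A' hA'] := ih S.
- by rewrite /S symC; congr (_ - _ / _); exact: mulrC.
- pose s := \sum_(j < d) c j * C ord0 (lift ord0 j).
  have := psd (c' (- s / al) c); rewrite Q -/s.
  have -> : (- s / al) ^+ 2 * al + 2 * (- s / al) * s = - (s * s / al).
    by have [->|h] := eqVneq al 0; [rewrite invr0 !mulr0 mul0r oppr0 addr0|field].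
  suff -> : \sum_(i < d) \sum_(j < d) c i * c j * S i j =
     - (s * s / al) + \sum_(i < d) \sum_(j < d) c i * c j * C (lift ord0 i) (lift ord0 j) by [].
  rewrite addrC /s big_distrlr /= mulr_suml -sumrB; apply: eq_bigr => i _.
  by rewrite mulr_suml -sumrB; apply: eq_bigr => j _; rewrite /S; ring.
pose l := Num.sqrt al.
have ll : l * l = al by rewrite -expr2 sqr_sqrtr.
have lC j : l * (C ord0 (lift ord0 j) / l) = C ord0 (lift ord0 j).
  have [l0|l0] := eqVneq l 0; last by rewrite mulrCA divff ?mulr1.
  by rewrite l0 mul0r C0// -ll l0 mul0r.
pose zt : d.-tuple R := [tuple 0 | i < d].
have dz (a : d.-tuple R) : dot zt a = 0 by rewrite /dot big1// => i _; rewrite tnth_mktuple mul0r.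
exists (fun i => if unlift ord0 i is Some j then consT (C ord0 (lift ord0 j) / l, A' j) else consT (l, zt)).
move=> i j.
case: (unliftP ord0 i) => [i' ->|->]; case: (unliftP ord0 j) => [j' ->|->]; rewrite ?liftK ?unlift_none dot_consT.
- rewrite hA' /S mulrACA -invfM ll; ring.
- by rewrite mulrC lC dotC dz addr0 symC.
- by rewrite lC dz addr0.
- by rewrite ll dz addr0.
Qed.

End cholesky.

Section walk.
Context {d : measure_display} {T : measurableType d} {R : realType}.
Variables (P : probability T R) (xi : nat -> T -> R) (mu : probability R R) (x : R).
Hypothesis mxi : forall n, measurable_fun setT (xi n).
Hypothesis Hind : indep_seq P xi.
Hypothesis muE : forall n B, measurable B -> P (xi n @^-1` B) = mu B.

Definition walk k (w : T) : R := Ssum xi k w * x.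

Lemma walk0 w : walk 0 w = 0.
Proof. by rewrite /walk /Ssum big_ord0 mul0r. Qed.

Lemma walkS k w : walk k.+1 w = walk k w + x * xi k w.
Proof. by rewrite /walk /Ssum big_ord_recr/= mulrDl (mulrC x). Qed.

Lemma measurable_walk k m : (k <= m)%N -> measurable_fun setT (walk k : past xi m -> R).
Proof.
move=> km; apply: measurable_funM => //; apply: measurable_sum => i.
by apply: measurable_past_xi; apply: leq_trans km.
Qed.

Definition psum (psi : R * R -> R) (j m : nat) (w : T) : R :=
  \sum_(j <= k < m) psi (walk k w, xi k w).

Section psum_facts.
Variable psi : R * R -> R.
Hypothesis mpsi : measurable_fun setT psi.

Lemma measurable_psum j m : measurable_fun setT (psum psi j m : past xi m -> R).
Proof.
rewrite /psum; under eq_fun do rewrite big_nat_cond.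
have mk k : (k < m)%N -> measurable_fun setT ((fun w => psi (walk k w, xi k w)) : past xi m -> R).
  move=> km; apply: (measurableT_comp mpsi); apply: measurable_fun_pair.
    by apply: measurable_walk; exact: ltnW.
  exact: measurable_past_xi.
rewrite (_ : (fun w => _) = (fun w => \sum_(j <= k < m) if (k < m)%N then psi (walk k w, xi k w) else 0)).
  have h k : measurable_fun setT ((fun w => if (k < m)%N then psi (walk k w, xi k w) else 0) : past xi m -> R).
    by case: (ltnP k m) => [/mk//|_]; exact: measurable_cst.
  by apply: measurable_sum => k; exact: h.
apply/funext => w; rewrite -big_nat_cond; apply: eq_big_nat => k /andP[_ ->]//.
Qed.

Lemma exp_psum (b v th : R) j m : (j <= m)%N -> (forall p, `|psi p| <= b) -> `|th| * b <= 1 ->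
  (forall y, \int[mu]_z psi (y, z) = 0) -> (forall y, \int[mu]_z psi (y, z) ^+ 2 <= v) ->
  (\int[P]_w (expR (th * psum psi j m w))%:E <= (expR ((m - j)%:R * (th ^+ 2 * (expR 1 * v))))%:E)%E.
Proof.
move=> jm pb thb p0 pv.
rewrite -(subnKC jm); elim: (m - j)%N => [|k ih].
  rewrite addn0 subnn mul0r expR0; under eq_integral do rewrite /psum big_geq// mulr0 expR0.
  by rewrite integral_cst// mul1e [X in (X <= _)%E](@probability_setT _ _ _ P).
set M := (j + k)%N; have -> : (j + k.+1)%N = M.+1 by rewrite addnS.
pose f (q : past xi M * R) : \bar R := (expR (th * psum psi j M q.1) * expR (th * psi (walk M q.1, q.2)))%:E.
have mw : measurable_fun setT (walk M : past xi M -> R) by exact: measurable_walk.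
have mps : measurable_fun setT (fun q : past xi M * R => psi (walk M q.1, q.2)).
  apply: (measurableT_comp mpsi); apply: measurable_fun_pair => //; exact: (measurableT_comp mw).
have mf : measurable_fun setT f.
  apply/measurable_EFinP; apply: measurable_funM; apply: measurableT_comp => //; apply: measurable_funM => //.
  have mpsM : measurable_fun setT (psum psi j M : past xi M -> R) by exact: measurable_psum.
  exact: (measurableT_comp mpsM measurable_fst).
have -> : (\int[P]_w (expR (th * psum psi j M.+1 w))%:E = \int[P]_w f ((w : past xi M), xi M w))%E.
  apply: eq_integral => w _; rewrite /f /= -expRD -mulrDr /psum big_nat_recr//.
  exact: leq_addr.
rewrite (@past_integral _ _ _ P xi mxi Hind M mu (muE M) f mf); last first.
  by move=> q; rewrite lee_fin mulr_ge0// expR_ge0.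
have inner y : (\int[mu]_z (expR (th * psi (y, z)))%:E <= (expR (th ^+ 2 * (expR 1 * v)))%:E)%E.
  have mpy : measurable_fun setT (fun z => psi (y, z)) by exact: (measurableT_comp mpsi).
  have ip : intg mu (fun z => psi (y, z)) by apply: (@intg_bounded _ _ _ _ _ b).
  have ip2 : intg mu (fun z => psi (y, z) ^+ 2).
    apply: (@intg_bounded _ _ _ _ _ (b ^+ 2)) => [|z]; first exact: measurable_funX.
    by rewrite normrX lerXn2r ?nnegrE// (le_trans _ (pb (y, z))).
  have i2 : intg mu (fun z => 1 + th * psi (y, z) + expR 1 * th ^+ 2 * psi (y, z) ^+ 2).
    by apply: intgD; [apply: intgD; [exact: intg_cst|exact: intgZl]|exact: intgZl].
  have le z : expR (th * psi (y, z)) <= 1 + th * psi (y, z) + expR 1 * th ^+ 2 * psi (y, z) ^+ 2.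
    have := expR_sub1_bounds (th * psi (y, z)); rewrite exprMn => /andP[_].
    have h : expR `|th * psi (y, z)| <= expR 1.
      by rewrite ler_expR (le_trans _ thb)// normrM ler_wpM2l.
    have : th ^+ 2 * psi (y, z) ^+ 2 * expR `|th * psi (y, z)| <= th ^+ 2 * psi (y, z) ^+ 2 * expR 1.
      by rewrite ler_wpM2l// mulr_ge0 ?sqr_ge0.
    by lra.
  have ie : intg mu (fun z => expR (th * psi (y, z))).
    apply: intg_dom i2 => [|z]; first by apply: measurableT_comp => //; exact: measurable_funM.
    by rewrite ger0_norm ?expR_ge0.
  rewrite -EFin_Rint// lee_fin; apply: le_trans (Rint_le ie i2 le) _.
  rewrite RintD; [|by apply: intgD; [exact: intg_cst|exact: intgZl]|exact: intgZl].
  rewrite RintD; [|exact: intg_cst|exact: intgZl].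
  rewrite Rint_cst !RintZl// p0 mulr0 addr0; apply: le_trans (expR_ge1Dx _).
  rewrite lerD2l mulrA (mulrC _ (expR 1)) ler_wpM2l ?pv// mulr_ge0 ?sqr_ge0 ?expR_ge0//.
have mps1 : measurable_fun setT (psum psi j M) := measurable_past mxi (@measurable_psum j M).
apply: (@le_trans _ _ (\int[P]_w ((expR (th * psum psi j M w))%:E * (expR (th ^+ 2 * (expR 1 * v)))%:E))%E).
  apply: ge0_le_integral => //.
  - by move=> w _; apply: integral_ge0 => z _; rewrite lee_fin mulr_ge0// expR_ge0.
  - have mF : measurable_fun setT (fun w : past xi M => \int[mu]_z f (w, z))%E.
      apply: (measurable_fun_fubini_tonelli_F (m2 := mu) f) => // q.
      by rewrite lee_fin mulr_ge0// expR_ge0.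
    exact: (measurable_past mxi mF).
  - apply/measurable_EFinP; apply: measurable_funM => //; apply: measurableT_comp => //.
    exact: measurable_funM.
  - move=> w _; rewrite /f /=.
    under eq_integral do rewrite EFinM.
    rewrite ge0_integralZl//.
    + by rewrite lee_wpmul2l// lee_fin expR_ge0.
    + apply/measurable_EFinP; apply: measurableT_comp => //; apply: measurable_funM => //.
      exact: (measurableT_comp mpsi).
rewrite ge0_integralZr//; last first.
  apply/measurable_EFinP; apply: measurableT_comp => //; exact: measurable_funM.
apply: (@le_trans _ _ ((expR ((M - j)%:R * (th ^+ 2 * (expR 1 * v))))%:E * (expR (th ^+ 2 * (expR 1 * v)))%:E)%E).
  by apply: lee_wpmul2r; rewrite ?lee_fin ?expR_ge0.
by rewrite -EFinM -expRD lee_fin ler_expR subSn ?leq_addr// -natr1 mulrDl mul1r.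
Qed.

Lemma psum_tail (b v th lam : R) j m : (j <= m)%N -> (forall p, `|psi p| <= b) -> 0 < th -> th * b <= 1 ->
  (forall y, \int[mu]_z psi (y, z) = 0) -> (forall y, \int[mu]_z psi (y, z) ^+ 2 <= v) ->
  (P [set w | (lam <= `|psum psi j m w|)%R] <=
   (2 * expR ((m - j)%:R * (th ^+ 2 * (expR 1 * v)) - th * lam))%:E)%E.
Proof.
move=> jm pb th0 thb p0 pv.
have mps : measurable_fun setT (psum psi j m) := measurable_past mxi (@measurable_psum j m).
set E := (m - j)%:R * _.
have h1 := @exp_psum b v th j m jm pb; have h2 := @exp_psum b v (- th) j m jm pb.
rewrite normrN sqrrN in h2; rewrite !(gtr0_norm th0) in h1 h2.
have m1 : measurable_fun setT (fun w => th * psum psi j m w) by exact: measurable_funM.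
have m2 : measurable_fun setT (fun w => - th * psum psi j m w) by exact: measurable_funM.
have k1 := markov_exp (th * lam) m1 (h1 thb p0 pv).
have k2 := markov_exp (th * lam) m2 (h2 thb p0 pv).
have s1 : measurable [set w | th * lam <= th * psum psi j m w].
  by rewrite -[X in measurable X]setTI; apply: measurable_fun_ler.
have s2 : measurable [set w | th * lam <= - th * psum psi j m w].
  by rewrite -[X in measurable X]setTI; apply: measurable_fun_ler.
apply: (@le_trans _ _ (P ([set w | (th * lam <= th * psum psi j m w)%R] `|` [set w | (th * lam <= - th * psum psi j m w)%R]))%E).
  apply: le_measure; rewrite ?inE; last 2 first.
  - exact: measurableU.
  - move=> w /=; have [h|h] := leP 0 (psum psi j m w); [left|right].
      by rewrite ler_pM2l// -(ger0_norm h).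
    by rewrite mulNr -mulrN ler_pM2l// -(ltr0_norm h).
  by rewrite -[X in measurable X]setTI; apply: measurable_fun_ler => //; apply: measurableT_comp.
apply: le_trans (measureU2 _ s1 s2) _; apply: le_trans (leeD k1 k2) _.
by rewrite -EFinD lee_fin expRD -/E; lra.
Qed.

End psum_facts.
Section law.
Variables (D : nat) (u : R * R -> D.-tuple R).
Hypothesis mu_ : forall i, measurable_fun setT (fun p => tnth (u p) i).

Definition vsum n (w : T) : D.-tuple R := [tuple psum (fun p => tnth (u p) i) 0 n w | i < D].

Lemma measurable_vsum n : measurable_fun setT (vsum n : past xi n -> D.-tuple R).
Proof. by apply: measurable_mktuple => i; apply: measurable_psum. Qed.

Lemma vsumS n w : vsum n.+1 w = vlin 1 1 (vsum n w) (u (walk n w, xi n w)).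
Proof.
apply: eq_from_tnth => i; rewrite tnth_vlin !tnth_mktuple /psum big_nat_recr//=.
by rewrite !mul1r.
Qed.

Lemma vsum_law n (F : D.-tuple R * R -> R) (M : R) : measurable_fun setT F -> (forall p, `|F p| <= M) ->
  \int[P]_w F (vsum n w, walk n w) = iter n (Qop mu x u) F ([tuple 0 | i < D], 0).
Proof.
elim: n F => [|n ih] F mF FM.
  transitivity (\int[P]_w F ([tuple 0 | i < D], 0)); last by rewrite Rint_cst.
  apply: eq_Rintegral => w _; rewrite walk0; congr (F (_, _)).
  by apply: eq_from_tnth => i; rewrite !tnth_mktuple /psum big_geq.
rewrite iterSr -ih; [|exact: measurable_Qop mF FM|exact: Qop_bound mF FM].
have mv := @measurable_vsum n; have mw : measurable_fun setT (walk n : past xi n -> R) by exact: measurable_walk.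
pose f (q : past xi n * R) := F (vlin 1 1 (vsum n q.1) (u (walk n q.1, q.2)), walk n q.1 + x * q.2).
have mf : measurable_fun setT f.
  have h : measurable_fun setT (fun q : past xi n * R => ((vsum n q.1, walk n q.1), q.2)).
    apply: measurable_fun_pair => //; apply: measurable_fun_pair; first exact: (measurableT_comp mv).
    exact: (measurableT_comp mw).
  exact: (measurableT_comp mF (measurableT_comp (measurable_step x mu_) h)).
have := @past_Rint _ _ _ P xi mxi Hind n mu (muE n) f M mf (fun q => FM _).
by move=> h; transitivity (\int[P]_w f ((w : past xi n), xi n w)) => //; apply: eq_Rintegral => w _; rewrite vsumS walkS.
Qed.

End law.
End walk.

Section from_hypotheses.
Context {R : realType} {d : measure_display} {T : measurableType d} (P : probability T R).

Lemma mutual_indep_seq (I : choiceType) (Y : I -> T -> R) (g : nat -> I) :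
  mutual_indep P Y -> injective g -> indep_seq P (fun n => Y (g n)).
Proof.
move=> hY gi n B mB.
pose B' (i : I) : set R := if [pick k : 'I_n | g k == i] is Some k then B k else setT.
have B'E k : (k < n)%N -> B' (g k) = B k.
  move=> kn; rewrite /B'; case: pickP => [k' /eqP/gi -> //|/(_ (Ordinal kn))]; by rewrite eqxx.
pose J := [fset i in map g (iota 0 n)]%fset.
have hJ : perm_eq J (map g (iota 0 n)).
  apply: uniq_perm; [exact: fset_uniq|by rewrite map_inj_uniq// iota_uniq|].
  by move=> i; rewrite !inE.
have := hY J B' (fun i _ => _); rewrite (perm_big _ hJ)/= big_map.
have -> : \bigcap_(i in [set i | i \in J]) (Y i @^-1` B' i) = \bigcap_(k in `I_n) (Y (g k) @^-1` B k).
  apply/seteqP; split => w h.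
    move=> k /= kn; rewrite -B'E//; apply: (h (g k)) => /=.
    by rewrite !inE; apply/mapP; exists k => //; rewrite mem_iota.
  move=> i /=; rewrite !inE => /mapP[k]; rewrite mem_iota /= => kn ->.
  by rewrite B'E//; exact: h.
move=> -> => [|i]; last by rewrite /B'; case: pickP.
have -> : iota 0 n = index_iota 0 n by rewrite /index_iota subn0.
rewrite big_mkord.
by apply: eq_bigr => i _; rewrite B'E.
Qed.

Definition lawR (Y : T -> R) (mY : measurable_fun setT Y) : probability R R :=
  distribution P (HB.pack Y (isMeasurableFun.Build _ _ _ _ _ mY) : {mfun T >-> R}).

End from_hypotheses.

Section gamma.
Context {R : realType} {d : measure_display} {T : measurableType d}.
Variables (P : probability T R) (X : nat -> T -> R) (U : T -> R) (x : R) (mu nu : probability R R).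
Hypotheses (mX : forall n, measurable_fun setT (X n)) (mU : measurable_fun setT U).
Let xi n : T -> R := if n is m.+1 then X m else U.
Hypothesis Hind : indep_seq P xi.
Hypothesis muE : forall n B, measurable B -> P (X n @^-1` B) = mu B.
Hypothesis nuE : forall B, measurable B -> P (U @^-1` B) = nu B.

Let mxi n : measurable_fun setT (xi n). Proof. by case: n. Qed.

Lemma Rint_law_ge0 (f : R -> \bar R) : measurable_fun setT f -> (forall y, (0 <= f y)%E) ->
  (\int[P]_w f (U w) = \int[nu]_y f y)%E.
Proof.
move=> mf f0; transitivity (\int[lawR P mU]_y f y)%E; first by rewrite ge0_integral_distribution.
by apply: eq_measure_integral => B mB _; exact: nuE.
Qed.

Lemma Rint_law (f : R -> R) M : measurable_fun setT f -> (forall y, `|f y| <= M) ->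
  \int[P]_w f (U w) = \int[nu]_y f y.
Proof.
move=> mf fM; apply: (@addIr _ M).
have mfU : measurable_fun setT (fun w => f (U w)) by exact: (measurableT_comp mf).
have i1 : intg P (fun w => f (U w)) by exact: intg_bounded (fun w => fM (U w)).
have i2 : intg nu f by exact: intg_bounded fM.
rewrite -{1}(Rint_cst P M) -(Rint_cst nu M) -!RintD//; [|exact: intg_cst|exact: intg_cst].
apply: EFin_inj; rewrite !EFin_Rint; [|by apply: intgD => //; exact: intg_cst|by apply: intgD => //; exact: intg_cst].
rewrite Rint_cst; apply: (Rint_law_ge0 (f := fun y => (f y + M)%:E)) => [|y].
  by apply/measurable_EFinP; exact: measurable_funD.
by rewrite lee_fin; have := fM y; rewrite ler_norml => /andP[h _]; lra.
Qed.

Lemma lag_product f h M M' r : nice f M -> nice h M' ->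
  \int[P]_w (f (U w) * h (U w + walk X x r w)) = \int[nu]_u (f u * iter r (Pop mu x) h u).
Proof.
move=> nf; elim: r h => [|r ih] h nh.
  have [mfh bfh _] := niceM nf nh.
  rewrite -(Rint_law mfh bfh); apply: eq_Rintegral => w _.
  by rewrite walk0 addr0.
rewrite iterSr -ih; last exact: (nice_iter mu x 1 nh).
have [mf fM _] := nf; have [mh hM _] := nh.
have mUp : measurable_fun setT (U : past xi r.+1 -> R).
  by have := @measurable_past_xi _ _ _ xi r.+1 0 (ltn0Sn r).
have mwp : measurable_fun setT (walk X x r : past xi r.+1 -> R).
  apply: measurable_funM => //; apply: measurable_sum => i.
  by have := @measurable_past_xi _ _ _ xi r.+1 i.+1 (ltn_ord (lift ord0 i)).
pose F (q : past xi r.+1 * R) := f (U q.1) * h (U q.1 + walk X x r q.1 + x * q.2).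
have mF : measurable_fun setT F.
  apply: measurable_funM; first exact: (measurableT_comp mf (measurableT_comp mUp measurable_fst)).
  apply: (measurableT_comp mh); apply: measurable_funD; last exact: measurable_funM.
  apply: measurable_funD; first exact: (measurableT_comp mUp measurable_fst).
  exact: (measurableT_comp mwp measurable_fst).
have bF q : `|F q| <= M * M' by rewrite normrM ler_pM.
have := @past_Rint _ _ _ P xi mxi Hind r.+1 mu (muE r) F (M * M') mF bF.
transitivity (\int[P]_w F ((w : past xi r.+1), xi r.+1 w)).
  by apply: eq_Rintegral => w _; rewrite /F /= walkS addrA.
rewrite H; apply: eq_Rintegral => w _; rewrite /F/= RintZl//.
exact: (intg_Pop mu x (U w + walk X x r w) mh hM).
Qed.

Variables (C rho : R).
Hypotheses (C0 : 0 <= C) (rho0 : 0 < rho) (rho1 : rho < 1).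
Hypothesis nuU : forall B, measurable B -> nu B = lebR (B `&` `[0, 1]%classic).
Hypothesis hmix : forall (f : R -> R) (M : R) r y, measurable_fun setT f ->
  (forall y, `|f y| <= M) -> periodic1 f ->
  `|iter r (Pop mu x) f y - \int[nu]_u f u| <= C * rho ^+ r * M.

Let lagsum s t (hs : 0 <= s <= 1) (ht : 0 <= t <= 1) :
  limn (fun N => \sum_(1 <= r < N) expect P (fun w => fa s (U w) * fa t (U w + Ssum X r w * x))) =
  \int[nu]_u (fa s u * gsol mu x (fa t) u) - \int[nu]_u (fa s u * fa t u).
Proof.
have ns := nice_fa hs; have nt := nice_fa ht.
apply: cvg_lim => //; rewrite -cvg_shiftS.
have h := gpart_cvg_Rint C0 rho0 rho1 hmix ns nt (Rint_fa nuU ht).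
have {}h : \int[nu]_u (fa s u * gpart mu x (fa t) N.+1 u) - \int[nu]_u (fa s u * fa t u) @[N --> \oo] -->
  \int[nu]_u (fa s u * gsol mu x (fa t) u) - \int[nu]_u (fa s u * fa t u).
  apply: cvgB; last exact: cvg_cst.
  by rewrite (cvg_shiftS (fun N => \int[nu]_u (fa s u * gpart mu x (fa t) N u))).
apply: cvg_trans h; apply: near_eq_cvg; apply: nearW => N.
have ip r : intg nu (fun u => fa s u * iter r (Pop mu x) (fa t) u).
  exact: (intg_nice nu (niceM ns (nice_iter mu x r nt))).
have -> : \int[nu]_u (fa s u * gpart mu x (fa t) N.+1 u) =
    \sum_(0 <= r < N.+1) \int[nu]_u (fa s u * iter r (Pop mu x) (fa t) u).
  by rewrite -Rint_sum//; apply: eq_Rintegral => u _; rewrite /gpart mulr_sumr.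
rewrite [in LHS]big_ltn//= addrAC subrr add0r; apply: eq_bigr => r _.
exact: esym (lag_product r ns nt).
Qed.

Lemma GammaE s t : 0 <= s <= 1 -> 0 <= t <= 1 -> Gamma P X U x s t =
  \int[nu]_y \int[mu]_z (mdiff mu x (fa s) (y, z) * mdiff mu x (fa t) (y, z)).
Proof.
move=> hs ht; rewrite /Gamma !lagsum// (mdiff_cov C0 rho0 rho1 nuU hmix (nice_fa hs) (nice_fa ht) (Rint_fa nuU hs) (Rint_fa nuU ht)).
rewrite -(Rint_fa_fa nuU hs ht).
have -> : \int[nu]_u (fa t u * fa s u) = \int[nu]_u (fa s u * fa t u).
  by apply: eq_Rintegral => u _; rewrite mulrC.
ring.
Qed.

End gamma.

Section normal_law.
Context {R : realType}.

Lemma gam1_scale (r : R) B : 0 < r -> measurable B ->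
  (\int[gam1]_x (\1_B (r * x))%:E = normal_prob 0 r B)%E.
Proof.
move=> r0 mB; have mi : measurable_fun setT (\1_B : R -> R) by exact: measurable_indic.
have mr : measurable_fun [set: R] (fun x : R => r * x) by exact: measurable_funM.
have mn : measurable_fun [set: R] (normal_pdf 0 r : R -> R).
  by have := @measurable_normal_pdf R 0 r.
pose G (x : R) := (\1_B x * normal_pdf 0 r x)%:E.
have mG : measurable_fun setT G by apply/measurable_EFinP; exact: measurable_funM.
have G0 x : (0 <= G x)%E by rewrite lee_fin mulr_ge0// normal_pdf_ge0.
rewrite integral_gam1//; last by apply/measurable_EFinP; exact: (measurableT_comp mi mr).
have -> : normal_prob 0 r B = (\int[lebR]_x G x)%E.
  rewrite /normal_prob ge0_integral_lebR// integral_mkcond; apply: eq_integral => x _.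
  by rewrite patchE /G indicE; case: (_ \in B); rewrite ?mul1r ?mul0r.
rewrite (@ge0_integral_affine _ r 0 G (lt0r_neq0 r0) mG G0).
rewrite -ge0_integralZl//; last first.
  by apply: (measurableT_comp mG); apply: measurable_funD.
apply: eq_integral => x _; rewrite addr0 /G -!EFinM gtr0_norm//; congr EFin.
rewrite [RHS]mulrCA; congr (_ * _).
rewrite normal_pdfE ?gt_eqF// /phi /normal_peak /normal_fun mulrA; congr (_ * expR _).
  rewrite expr1n mul1r -mulrnAr sqrtrM ?sqr_ge0// sqrtr_sqr gtr0_norm// invfM mulrA divff ?gt_eqF// mul1r.
  by [].
by rewrite subr0 exprMn -mulr_natr; field; rewrite gt_eqF.
Qed.

Lemma centered_of_law {d} {T : measurableType d} (P : probability T R) (Z : T -> R) (r : R) :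
  measurable_fun setT Z -> 0 <= r ->
  (forall B, measurable B -> P (Z @^-1` B) = (\int[gam1]_x (\1_B (r * x))%:E)%E) ->
  centered_gaussian P Z.
Proof.
move=> mZ r0 h; split => //; exists (r ^+ 2); split; first exact: sqr_ge0.
rewrite sqrf_eq0; case: eqVneq => [r00|rn].
  have := h [set 0] (measurable_set1 _); rewrite /preimage/= => ->.
  rewrite (eq_integral (fun=> 1%E)); first by rewrite integral_cst// mul1e; exact: (@probability_setT _ _ _ gam1).
  by move=> x _; rewrite r00 mul0r indicE mem_set.
by move=> B mB; rewrite sqrtr_sqr ger0_norm// h// gam1_scale// lt0r rn.
Qed.

End normal_law.

Section coupled_law.
Context {d : measure_display} {T : measurableType d} {R : realType}.
Variables (P : probability T R) (D : nat) (A : 'I_D -> D.-tuple R) (Kc : T -> D.-tuple R).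
Hypothesis mK : measurable_fun setT Kc.
Hypothesis KE : forall f : D.-tuple R -> \bar R, measurable_fun setT f -> (forall y, (0 <= f y)%E) ->
  (\int[P]_w f (Kc w) = \int[gam D]_t \int[gam D]_z f (vlin 1 1 (amul A t) z))%E.

Definition acomb (c : D.-tuple R) : D.-tuple R :=
  [tuple \sum_(i < D) tnth c i * tnth (A i) j | j < D].

Lemma dot_acomb c t : dot (acomb c) t = dot c (amul A t).
Proof.
rewrite /dot; under eq_bigr do rewrite tnth_mktuple mulr_suml.
rewrite exchange_big; apply: eq_bigr => i _; rewrite tnth_mktuple /dot mulr_sumr.
by apply: eq_bigr => j _; rewrite mulrA.
Qed.

Lemma acomb_vlin al be s t : acomb (vlin al be s t) = vlin al be (acomb s) (acomb t).
Proof.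
apply: eq_from_tnth => j; rewrite tnth_vlin !tnth_mktuple !mulr_sumr -big_split/=.
by apply: eq_bigr => i _; rewrite tnth_vlin mulrDl !mulrA.
Qed.

Lemma acomb_ebas i : acomb (ebas i) = A i.
Proof.
apply: eq_from_tnth => j; rewrite tnth_mktuple (bigD1 i)//= big1 => [|k ki]; last first.
  by rewrite tnth_mktuple (negbTE ki) mul0r.
by rewrite tnth_mktuple eqxx mul1r addr0.
Qed.

Definition krad c : R := Num.sqrt (dot (acomb c) (acomb c) + dot c c).

Lemma sqr_krad c : krad c ^+ 2 = dot (acomb c) (acomb c) + dot c c.
Proof. by rewrite sqr_sqrtr// addr_ge0// dot_ge0. Qed.

Lemma dot_coupled_law c (f : R -> \bar R) : measurable_fun setT f -> (forall x, (0 <= f x)%E) ->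
  (\int[P]_w f (dot c (Kc w)) = \int[gam1]_x f (krad c * x)%R)%E.
Proof.
move=> mf f0.
have md : measurable_fun [set: D.-tuple R] (fun z => f (dot c z)).
  by apply: (measurableT_comp mf); exact: measurable_dot.
rewrite (KE md)//.
have E t : (\int[gam D]_z f (dot c (vlin 1 1 (amul A t) z)) =
    \int[gam1]_y f (dot (acomb c) t + vnorm c * y)%R)%E.
  rewrite -(@integral_gam_dot _ _ c (fun y => f (dot (acomb c) t + y)%R))//.
    by apply: eq_integral => z _; rewrite dot_vlin !mul1r dot_acomb.
  by apply: (measurableT_comp mf); exact: measurable_funD.
under eq_integral do rewrite E.
have mh : measurable_fun [set: R * R] (fun q : R * R => f (q.1 + vnorm c * q.2)%R).
  by apply: (measurableT_comp mf); apply: measurable_funD => //; exact: measurable_funM.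
rewrite (@integral_gam_dot _ _ (acomb c) (fun a => \int[gam1]_y f (a + vnorm c * y)%R))%E//.
- by apply: gam1_sum => //; rewrite ?sqrtr_ge0// sqr_krad !sqr_vnorm.
- by have := @measurable_fun_fubini_tonelli_F _ _ _ _ _ gam1 _ mh (fun=> f0 _).
- by move=> a; apply: integral_ge0.
Qed.

Lemma dot_coupled_centered c : centered_gaussian P (fun w => dot c (Kc w)).
Proof.
apply: (@centered_of_law _ _ _ _ _ (krad c)); [exact: measurable_dot|exact: sqrtr_ge0|].
move=> B mB; rewrite -(@dot_coupled_law c (fun x => (\1_B x)%:E)); last 2 first.
- by apply/measurable_EFinP; exact: measurable_indic.
- by move=> x; rewrite lee_fin.
have m : measurable ((fun w => dot c (Kc w)) @^-1` B).
  by rewrite -[X in measurable X]setTI; apply: measurable_dot.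
by rewrite -[in LHS](setIT (_ @^-1` B)) -integral_indic.
Qed.

Lemma dot_coupled_sqr c : intg P (fun w => dot c (Kc w) ^+ 2) /\
  \int[P]_w (dot c (Kc w) ^+ 2) = krad c ^+ 2.
Proof.
have mf : measurable_fun [set: R] (fun x : R => (x ^+ 2)%:E) by apply/measurable_EFinP; exact: measurable_funX.
have f0 (x : R) : (0 <= (x ^+ 2)%:E)%E by rewrite lee_fin sqr_ge0.
have E := dot_coupled_law c mf f0.
have E2 : (\int[gam1]_x ((krad c * x) ^+ 2)%:E = (krad c ^+ 2)%:E)%E.
  rewrite -EFin_Rint; last by under eq_fun do rewrite exprMn; apply: intgZl; exact: intg_gam1_sqr.
  by under eq_Rintegral do rewrite exprMn; rewrite RintZl ?gam1_var ?mulr1//; exact: intg_gam1_sqr.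
split; last by rewrite /Rintegral E E2.
have [] := @intg_ge0_fin _ _ _ P (fun w => dot c (Kc w) ^+ 2) (krad c ^+ 2) _ _ _ => //.
- by apply: measurable_funX; exact: measurable_dot.
- by move=> w; exact: sqr_ge0.
- by rewrite E E2.
Qed.

Lemma coupled_cov i j : intg P (fun w => tnth (Kc w) i * tnth (Kc w) j) /\
  \int[P]_w (tnth (Kc w) i * tnth (Kc w) j) = dot (A i) (A j) + (i == j)%:R.
Proof.
pose cp := vlin 1 1 (ebas i) (ebas j) : D.-tuple R; pose cm := vlin 1 (-1) (ebas i) (ebas j) : D.-tuple R.
have [ip Ep] := dot_coupled_sqr cp; have [im Em] := dot_coupled_sqr cm.
have dvl al be s t u : @dot R D (vlin al be s t) u = al * dot s u + be * dot t u.
  by rewrite dotC dot_vlin !(dotC u).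
have -> : (fun w => tnth (Kc w) i * tnth (Kc w) j) =
    (fun w => 4^-1 * (dot cp (Kc w) ^+ 2 - dot cm (Kc w) ^+ 2)).
  by apply/funext => w; rewrite !dvl !dot_ebas; field.
have iB := intgB ip im; split; first exact: intgZl.
rewrite RintZl// RintB// Ep Em !sqr_krad !acomb_vlin !acomb_ebas !dvl !dot_vlin !dot_ebas.
rewrite !tnth_mktuple !eqxx (eq_sym j i) (dotC (A j) (A i)).
by field.
Qed.

End coupled_law.

Section gstep_iter.
Context {R : realType} {D : nat}.
Variable a : 'I_D -> D.-tuple R.

Lemma iter_gstepE (g : D.-tuple R -> R) n z : measurable_fun setT g -> (forall z, 0 <= g z <= 1) ->
  iter n (gstep a) g z =
  \int[gam D]_t g (vlin 1 (Num.sqrt n%:R) z (amul a t)).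
Proof.
move=> mg g01; elim: n z => [|n ih] z.
  rewrite -[LHS](Rint_cst (gam D)); apply: eq_Rintegral => t _ /=.
  by congr g; apply: eq_from_tnth => i; rewrite tnth_vlin sqrtr0; ring.
rewrite iterS {1}/gstep; under eq_Rintegral do rewrite ih.
pose f t : \bar R := (g (vlin 1 1 z (amul a t)))%:E.
have mf : measurable_fun [set: D.-tuple R] f.
  apply/measurable_EFinP; apply: (measurableT_comp mg).
  by apply: measurable_vlin => //; exact: measurable_amul.
have f0 t : (0 <= f t)%E by rewrite lee_fin; have /andP[] := g01 (vlin 1 1 z (amul a t)).
have := @integral_gam_rot _ D 1 (Num.sqrt n%:R) (Num.sqrt n.+1%:R) f (sqrtr_ge0 _) _ mf f0.
rewrite !sqr_sqrtr// expr1n -natr1 addrC => /(_ erefl) E.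
have := congr1 fine E; rewrite /f => E'.
have G s : (\int[gam D]_t (g (vlin 1 1 z (amul a (vlin 1 (Num.sqrt n%:R) s t))))%:E =
   (\int[gam D]_t g (vlin 1 (Num.sqrt n%:R) (vlin 1 1 z (amul a s)) (amul a t)))%:E)%E.
  rewrite EFin_Rint; last first.
    apply: (@intg_bounded _ _ _ _ _ 1).
      by apply: (measurableT_comp mg); apply: measurable_vlin => //; exact: measurable_amul.
    by move=> t; exact: norm_g_le1.
  apply: eq_integral => t _; congr (EFin (g _)).
  by apply: eq_from_tnth => i; rewrite amul_vlin !tnth_vlin; ring.
rewrite /Rintegral; under eq_integral do rewrite -G.
rewrite E'; congr fine; apply: eq_integral => t _; congr (EFin (g _)).
by apply: eq_from_tnth => i; rewrite amul_vlin !tnth_vlin; ring.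
Qed.

End gstep_iter.

Section stage.
Context {d : measure_display} {T : measurableType d} {R : realType}.
Variables (P : probability T R) (X : nat -> T -> R) (mu nu : probability R R) (tau : R -> R) (x C rho : R).
Hypothesis mX : forall n, measurable_fun setT (X n).
Hypothesis Hind : indep_seq P X.
Hypothesis muE : forall n B, measurable B -> P (X n @^-1` B) = mu B.
Hypothesis mtau : measurable_fun setT tau.
Hypothesis tauE : forall B, measurable B -> mu (tau @^-1` B) = gam1 B.
Hypotheses (C0 : 0 <= C) (rho0 : 0 < rho) (rho1 : rho < 1).
Hypothesis nuE : forall B, measurable B -> nu B = lebR (B `&` `[0, 1]%classic).
Hypothesis hmix : forall (f : R -> R) (M : R) r y, measurable_fun setT f ->
  (forall y, `|f y| <= M) -> periodic1 f ->
  `|iter r (Pop mu x) f y - \int[nu]_u f u| <= C * rho ^+ r * M.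

Local Notation f s := (mdiff mu x (fa s)).
Local Notation b0 := (2 * Cg C rho + 1).

Definition Gam (s t : R) : R := \int[nu]_y \int[mu]_z (f s (y, z) * f t (y, z)).

Lemma measurable_mdiff_fa s : 0 <= s <= 1 -> measurable_fun setT (f s).
Proof. by move=> hs; exact: (measurable_mdiff C0 rho0 rho1 hmix (nice_fa hs) (Rint_fa nuE hs)). Qed.

Lemma mdiff_fa_bound s p : 0 <= s <= 1 -> `|f s p| <= b0.
Proof.
by move=> hs; have := mdiff_bound C0 rho0 rho1 hmix (nice_fa hs) (Rint_fa nuE hs) p; rewrite mulr1.
Qed.

Lemma Rint_mdiff_fa s y : 0 <= s <= 1 -> \int[mu]_z f s (y, z) = 0.
Proof. by move=> hs; exact: (Rint_mdiff C0 rho0 rho1 hmix (nice_fa hs) (Rint_fa nuE hs)). Qed.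

Lemma b0_ge1 : 1 <= b0.
Proof. by have := Cg_ge0 C0 rho1; lra. Qed.

Let intg_ff s t y : 0 <= s <= 1 -> 0 <= t <= 1 -> intg mu (fun z => f s (y, z) * f t (y, z)).
Proof.
move=> hs ht; apply: (@intg_bounded _ _ _ _ _ (b0 * b0)).
  by apply: measurable_funM; apply: measurableT_comp (measurable_mdiff_fa _) _.
by move=> z; rewrite normrM; apply: ler_pM => //; exact: mdiff_fa_bound.
Qed.

Let intg_Gff s t : 0 <= s <= 1 -> 0 <= t <= 1 ->
  intg nu (fun y => \int[mu]_z (f s (y, z) * f t (y, z))).
Proof.
move=> hs ht; apply: (@intg_Rint_section _ _ _ _ _ _ _ (fun q => f s q * f t q) (fun=> b0 * b0)).
- by apply: measurable_funM; exact: measurable_mdiff_fa.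
- by move=> y z; rewrite normrM; apply: ler_pM => //; exact: mdiff_fa_bound.
- exact: intg_cst.
Qed.

Lemma GamC s t : Gam s t = Gam t s.
Proof.
by apply: eq_Rintegral => y _; apply: eq_Rintegral => z _; rewrite mulrC.
Qed.

Lemma Gam_psd n (s : 'I_n -> R) (c : 'I_n -> R) : (forall i, 0 <= s i <= 1) ->
  0 <= \sum_(i < n) \sum_(j < n) c i * c j * Gam (s i) (s j).
Proof.
move=> hs; have -> : \sum_(i < n) \sum_(j < n) c i * c j * Gam (s i) (s j) =
   \int[nu]_y \int[mu]_z ((\sum_(i < n) c i * f (s i) (y, z)) ^+ 2).
  transitivity (\int[nu]_y \sum_(i < n) \sum_(j < n) c i * c j * \int[mu]_z (f (s i) (y, z) * f (s j) (y, z))).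
    rewrite Rint_sum => [|i]; last by apply: intg_sum => j; apply: intgZl; exact: intg_Gff.
    apply: eq_bigr => i _; rewrite Rint_sum => [|j]; last by apply: intgZl; exact: intg_Gff.
    by apply: eq_bigr => j _; rewrite RintZl//; exact: intg_Gff.
  apply: eq_Rintegral => y _.
  transitivity (\int[mu]_z \sum_(i < n) \sum_(j < n) c i * c j * (f (s i) (y, z) * f (s j) (y, z))).
    rewrite Rint_sum => [|i]; last by apply: intg_sum => j; apply: intgZl; exact: intg_ff.
    apply: eq_bigr => i _; rewrite Rint_sum => [|j]; last by apply: intgZl; exact: intg_ff.
    by apply: eq_bigr => j _; rewrite RintZl//; exact: intg_ff.
  apply: eq_Rintegral => z _; rewrite expr2 mulr_suml; apply: eq_bigr => i _.
  by rewrite mulr_sumr; apply: eq_bigr => j _; ring.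
by apply: Rint_ge0 => y; apply: Rint_ge0 => z; exact: sqr_ge0.
Qed.

Variables (k N : nat) (sg : R).
Hypotheses (N0 : (0 < N)%N) (sg0 : 0 < sg).
Local Notation D := k.+1.

Definition grid (i : 'I_D) : R := i%:R / D%:R.

Lemma grid01 i : 0 <= grid i <= 1.
Proof.
rewrite /grid divr_ge0//= ler_pdivrMr ?ltr0n// mul1r ler_nat ltnW//; exact: ltn_ord.
Qed.

Let sN : R := Num.sqrt N%:R.
Let sN0 : 0 < sN. Proof. by rewrite sqrtr_gt0 ltr0n. Qed.
Let cc : R := (sg * sN)^-1.
Let cc0 : 0 < cc. Proof. by rewrite invr_gt0 mulr_gt0. Qed.

Definition score (p : R * R) : D.-tuple R := [tuple cc * f (grid i) p | i < D].
Let scoreE p i : tnth (score p) i = cc * f (grid i) p. Proof. by rewrite tnth_mktuple. Qed.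
Let W := vsum X x score N.

Lemma tnth_vsum_score w i : tnth (W w) i = psum X x (f (grid i)) 0 N w / (sg * sN).
Proof.
rewrite tnth_mktuple /psum mulr_suml; apply: eq_bigr => j _.
by rewrite scoreE mulrC.
Qed.

Let mscore i : measurable_fun setT (fun p => tnth (score p) i).
Proof.
have mf := measurable_mdiff_fa (grid01 i).
have m : measurable_fun setT (fun p => cc * f (grid i) p) by exact: measurable_funM.
by apply: eq_measurable_fun m => p _; rewrite scoreE.
Qed.

Let mW : measurable_fun setT (W : past X N -> D.-tuple R).
Proof. exact: (@measurable_vsum _ _ _ X x D score mscore N). Qed.

Theorem stage_coupling : exists Kc : T -> D.-tuple R,
  [/\ measurable_fun setT Kc,
      forall c, centered_gaussian P (fun w => dot c (Kc w)),
      forall i j, intg P (fun w => tnth (Kc w) i * tnth (Kc w) j) /\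
        \int[P]_w (tnth (Kc w) i * tnth (Kc w) j) =
        Gam (grid i) (grid j) / sg ^+ 2 + (i == j)%:R,
      measurable [set w | Kc w != vlin 1 1 (W w) (zeta X tau N D w)]
    & forall (B : R) q, 0 < B -> B <= 1 -> B ^+ 2 = D%:R * (b0 * cc) ^+ 2 ->
      (P [set w | Kc w != vlin 1 1 (W w) (zeta X tau N D w)] <=
        (N%:R * lind_err C rho B q + (minn N q)%:R * (2 * B ^+ 2))%:E)%E].
Proof.
have [|c|A hA] := @cholesky R D (fun i j => Gam (grid i) (grid j) / sg ^+ 2).
- by move=> i j; rewrite GamC.
- have -> : \sum_(i < D) \sum_(j < D) c i * c j * (Gam (grid i) (grid j) / sg ^+ 2) =
      (\sum_(i < D) \sum_(j < D) c i * c j * Gam (grid i) (grid j)) / sg ^+ 2.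
    rewrite mulr_suml; apply: eq_bigr => i _; rewrite mulr_suml; apply: eq_bigr => j _.
    by rewrite mulrA.
  by rewrite divr_ge0 ?sqr_ge0//; apply: Gam_psd; exact: grid01.
pose Am := amul A.
have mAm : measurable_fun setT Am by exact: measurable_amul.
pose Kc := Kcoup P X tau N W Am.
have mKc : measurable_fun setT Kc := measurable_Kcoup P mX mtau mW mAm.
have KE := @Kcoup_integral _ _ _ P X mu tau mX Hind muE mtau tauE D N W Am mW mAm.
have K0E w : Kval0 X tau N W w = vlin 1 1 (W w) (zeta X tau N D w) by [].
exists Kc; split; first exact: mKc.
- by move=> c; exact: (@dot_coupled_centered _ _ _ P D A Kc mKc KE c).
- by move=> i j; have [h1 h2] := coupled_cov mKc KE i j; split => //; rewrite h2 hA.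
- have := measurable_Kval0 mX mtau mW; move=> mK0.
  have m : measurable_fun setT (fun w => dot (vlin 1 (-1) (Kc w) (Kval0 X tau N W w)) (vlin 1 (-1) (Kc w) (Kval0 X tau N W w))).
    by apply: measurable_dot; apply: measurable_vlin.
  have := m measurableT _ (measurableC (measurable_set1 0)); rewrite setTI; congr (measurable _).
  apply/seteqP; split => w /=; rewrite -K0E.
    move=> h; apply/eqP => e; apply: h; rewrite e /dot big1// => i _.
    by rewrite !tnth_vlin; ring.
  move=> /eqP h e; apply: h; apply: eq_from_tnth => i.
  have /eqP := e; rewrite psumr_eq0 => [/allP/(_ i (mem_index_enum _))|j _]; last by rewrite -expr2 sqr_ge0.
  by rewrite -expr2 sqrf_eq0 tnth_vlin mul1r mulN1r subr_eq0 => /eqP.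
move=> B q B0 B1 hB.
apply: (@Kcoup_close _ _ _ P X mu tau mX Hind muE mtau tauE D N W Am mW mAm) => g mg g01.
pose a i : D.-tuple R := vlin sN^-1 0 (A i) (A i).
have aE t : amul a t = vlin sN^-1 0 (amul A t) (amul A t).
  by apply: eq_from_tnth => i; rewrite tnth_vlin !tnth_mktuple dotC dot_vlin dotC; ring.
have ha i j : dot (a i) (a j) = \int[nu]_y \int[mu]_z (tnth (score (y, z)) i * tnth (score (y, z)) j).
  have -> : \int[nu]_y \int[mu]_z (tnth (score (y, z)) i * tnth (score (y, z)) j) = cc ^+ 2 * Gam (grid i) (grid j).
    rewrite /Gam -RintZl; last exact: intg_Gff (grid01 i) (grid01 j).
    apply: eq_Rintegral => y _; rewrite -RintZl; last exact: intg_ff (grid01 i) (grid01 j).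
    by apply: eq_Rintegral => z _; rewrite !scoreE; ring.
  rewrite /a dot_vlin dotC dot_vlin (dotC (A j)) hA /cc invfM; field.
  by rewrite !gt_eqF.
have b0cc : 0 <= b0 * cc by rewrite mulr_ge0 ?(ltW cc0)//; have := b0_ge1; lra.
have := @lindeberg R D mu nu x C rho (b0 * cc) B C0 rho0 hmix score mscore b0cc _ B0 B1 hB _ _ a ha N q g ([tuple 0 | i < D], 0) mg g01.
have bS v : `|smooth g v| <= 1 by rewrite ger0_norm; case/andP: (smooth01 mg g01 v).
have mS := measurable_smooth mg g01.
rewrite -(@vsum_law _ _ _ P X mu x mX Hind muE D score mscore N (fun p => smooth g p.1) 1); last 2 first.
- exact: (measurableT_comp mS).
- by move=> p.
move=> /= L.
have E : smooth (iter N (gstep a) g) [tuple 0 | _ < D] = \int[gam D]_t smooth g (Am t).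
  rewrite /smooth; under eq_Rintegral do rewrite (iter_gstepE _ _ _ mg g01).
  have m : measurable_fun [set: D.-tuple R * D.-tuple R] (fun r => g (vlin 1 1 (Am r.2) r.1)).
    by apply: (measurableT_comp mg); apply: measurable_vlin => //; exact: (measurableT_comp mAm).
  have := @Rint_fubini _ _ _ _ _ (gam D) (gam D) _ _ m (fun v z => norm_g_le1 g01 _) (intg_cst (gam D) 1).
  move=> <-; apply: eq_Rintegral => z _; apply: eq_Rintegral => t _; congr g.
  apply: eq_from_tnth => i; rewrite aE !tnth_vlin tnth_mktuple -/Am -/sN /=.
  by field; rewrite gt_eqF.
rewrite E in L; apply: le_trans (ler_norm _) _; rewrite distrC; apply: L.
- move=> p i; rewrite scoreE normrM (gtr0_norm cc0) mulrC ler_wpM2r ?(ltW cc0)//.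
  exact: mdiff_fa_bound (grid01 i).
- move=> y i; have := intg_mdiff C0 rho0 rho1 hmix (nice_fa (grid01 i)) (Rint_fa nuE (grid01 i)) y => h.
  by under eq_Rintegral do rewrite scoreE; rewrite RintZl// Rint_mdiff_fa ?mulr0// grid01.
- move=> y z; apply: eq_from_tnth => i; rewrite !scoreE.
  by rewrite (mdiff_periodic C0 rho0 rho1 hmix (nice_fa (grid01 i)) (Rint_fa nuE (grid01 i))).
Qed.

End stage.

Section paths.
Context {d : measure_display} {T : measurableType d} {R : realType}.
Variables (X : nat -> T -> R) (mu nu : probability R R) (x C rho : R).
Hypotheses (C0 : 0 <= C) (rho0 : 0 < rho) (rho1 : rho < 1).
Hypothesis nuE : forall B, measurable B -> nu B = lebR (B `&` `[0, 1]%classic).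
Hypothesis hmix : forall (f : R -> R) (M : R) r y, measurable_fun setT f ->
  (forall y, `|f y| <= M) -> periodic1 f ->
  `|iter r (Pop mu x) f y - \int[nu]_u f u| <= C * rho ^+ r * M.

Local Notation f s := (mdiff mu x (fa s)).

Definition Tsum m (s : R) (w : T) : R := \sum_(1 <= j < m.+1) fa s (walk X x j w).

Lemma Tsum_Femp n s w : (0 < n)%N ->
  Num.sqrt n%:R * (Femp X x n s w - s) = Tsum n s w / Num.sqrt n%:R.
Proof.
move=> n0; have r0 : 0 < Num.sqrt n%:R :> R by rewrite sqrtr_gt0 ltr0n.
have rE : n%:R = Num.sqrt n%:R ^+ 2 :> R by rewrite sqr_sqrtr.
have -> : Tsum n s w = n%:R * (Femp X x n s w - s).
  rewrite /Tsum /Femp /fa sumrB mulrBr mulrA divff ?pnatr_eq0 -?lt0n// mul1r; congr (_ - _).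
  by rewrite sumr_const_nat subSS subn0 mulr_natl.
by move: r0 rE; set r := Num.sqrt _ => r0 ->; field; rewrite gt_eqF.
Qed.

Lemma Tsum_mono m s t w : s <= t -> Tsum m s w <= Tsum m t w + m%:R * (t - s).
Proof.
move=> st; have -> : m%:R * (t - s) = \sum_(1 <= j < m.+1) (t - s).
  by rewrite sumr_const_nat subSS subn0 mulr_natl.
rewrite /Tsum -big_split/=; apply: ler_sum => j _; rewrite /fa.
have [h|h] := leP (frac (walk X x j w)) s; first by rewrite (le_trans h st); lra.
by case: ifP => _; lra.
Qed.

Lemma psum_mdiff (h : R -> R) m w : psum X x (mdiff mu x h) 0 m w =
  gsol mu x h (walk X x m w) - gsol mu x h (walk X x 0 w) + \sum_(0 <= j < m) h (walk X x j w).
Proof.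
elim: m => [|m ih]; first by rewrite /psum !big_geq// subrr addr0.
by rewrite /psum !big_nat_recr//= -/(psum X x (mdiff mu x h) 0 m w) ih /mdiff/= walkS; ring.
Qed.

Lemma Tsum_martingale m s w : 0 <= s <= 1 ->
  `|Tsum m s w - psum X x (f s) 0 m w| <= 2 * Cg C rho + 2.
Proof.
move=> hs; rewrite psum_mdiff.
have E : Tsum m s w = \sum_(0 <= j < m) fa s (walk X x j w) + fa s (walk X x m w) - fa s (walk X x 0 w).
  by rewrite -big_nat_recr//= big_nat_recl//= addrAC subrr add0r /Tsum big_add1.
have [_ g1 _] := nice_gsol C0 rho0 rho1 hmix (nice_fa hs) (Rint_fa nuE hs).
have [_ f1 _] := nice_fa hs.
have := g1 (walk X x m w); have := g1 (walk X x 0 w); have := f1 (walk X x m w); have := f1 (walk X x 0 w).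
rewrite E !ler_norml mulr1; lra.
Qed.

Lemma cell (n : nat) (t : R) : (0 < n)%N -> 0 <= t <= 1 ->
  exists2 j, (j < n)%N & j%:R / n%:R <= t <= j.+1%:R / n%:R.
Proof.
case: n => // n _ /andP[t0 t1]; have n0 : 0 < n.+1%:R :> R by rewrite ltr0n.
have z0 : 0 <= t * n.+1%:R by rewrite mulr_ge0.
exists (minn (Num.truncn (t * n.+1%:R)) n); first by rewrite ltnS geq_minr.
rewrite ler_pdivrMr// ler_pdivlMr//; have /andP[h1 h2] := truncn_itv z0.
apply/andP; split; first by apply: le_trans h1; rewrite ler_nat geq_minl.
rewrite /minn; case: ifP => _; first exact: ltW.
by rewrite ler_piMl// ltW.
Qed.

Variables (k H : nat).
Hypothesis H0 : (0 < H)%N.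
Local Notation D := k.+1.

Lemma grid_cell (s : R) : 0 <= s <= 1 -> exists i : 'I_D, grid i <= s <= grid i + D%:R^-1.
Proof.
move=> hs; have [j jD h] := cell (ltn0Sn k) hs; exists (Ordinal jD).
by move: h; rewrite /grid/= -(natr1 j) mulrDl mul1r.
Qed.

Definition fine_pt (i : 'I_D) (j : nat) : R := grid i + j%:R / (D * H)%:R.

Lemma fine_pt_itv i j : (j <= H)%N -> grid i <= fine_pt i j <= grid i + D%:R^-1.
Proof.
move=> jH; rewrite /fine_pt lerDl divr_ge0//= lerD2l natrM invfM mulrCA ler_piMr ?invr_ge0//.
by rewrite ler_pdivrMr ?ltr0n// mul1r ler_nat.
Qed.

Lemma grid_next (i : 'I_D) : grid i + D%:R^-1 <= 1 :> R.
Proof.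
by rewrite /grid -[X in _ + X]mul1r -mulrDl ler_pdivrMr ?ltr0n// mul1r natr1 ler_nat ltn_ord.
Qed.

Lemma fine_pt01 i j : (j <= H)%N -> 0 <= fine_pt i j <= 1.
Proof.
move=> jH; have /andP[h1 h2] := fine_pt_itv i jH; have h4 := grid_next i; have /andP[h3 _] := @grid01 R k i.
by rewrite (le_trans h3 h1) (le_trans h2 h4).
Qed.

Lemma path_error (m N : nat) (i : 'I_D) (s lam : R) w : (N <= m)%N ->
  grid i <= s <= grid i + D%:R^-1 ->
  (forall j, (j <= H)%N ->
     `|psum X x (fun p => f (fine_pt i j) p - f (grid i) p) 0 m w| <= lam) ->
  `|psum X x (f (grid i)) N m w| <= lam ->
  `|Tsum m s w - psum X x (f (grid i)) 0 N w| <= m%:R / (D * H)%:R + (2 * Cg C rho + 2) + 2 * lam.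
Proof.
move=> Nm /andP[s1 s2] ha hb.
have D0 : 0 < D%:R :> R by rewrite ltr0n.
have H0' : 0 < H%:R :> R by rewrite ltr0n.
have t01 : 0 <= (s - grid i) * D%:R <= 1.
  by rewrite mulr_ge0 ?subr_ge0//= -ler_pdivlMr// mul1r lerBlDl.
have [j jH] := cell H0 t01; have hg := @grid01 R k i.
rewrite ler_pdivrMr// ler_pdivlMr// => /andP[j1 j2].
have e1 : fine_pt i j <= s.
  by rewrite /fine_pt -lerBrDl ler_pdivrMr ?ltr0n ?muln_gt0// natrM mulrA.
have e2 : s <= fine_pt i j.+1.
  by rewrite /fine_pt -lerBlDl ler_pdivlMr ?ltr0n ?muln_gt0// natrM mulrA.
have e3 : fine_pt i j.+1 - fine_pt i j = (D * H)%:R^-1.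
  by rewrite /fine_pt -(natr1 j) mulrDl mul1r; move: (_^-1) (_ / _) => a b; lra.
have psB (j' : nat) : psum X x (fun p => f (fine_pt i j') p - f (grid i) p) 0 m w =
   psum X x (f (fine_pt i j')) 0 m w - psum X x (f (grid i)) 0 m w by rewrite /psum sumrB.
have psN : psum X x (f (grid i)) 0 m w = psum X x (f (grid i)) 0 N w + psum X x (f (grid i)) N m w.
  by rewrite /psum -big_cat_nat.
have a1 := ha _ (ltnW jH); have a2 := ha _ jH; rewrite psB psN in a1; rewrite psB psN in a2.
have b1 := Tsum_martingale m w (fine_pt01 i (ltnW jH)); have b2 := Tsum_martingale m w (fine_pt01 i jH).
have c1 := Tsum_mono m w e1; have c2 := Tsum_mono m w e2.
have m0 : 0 <= m%:R :> R by [].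
have d1 : m%:R * (s - fine_pt i j) <= m%:R / (D * H)%:R by rewrite -e3 ler_wpM2l// lerD2r.
have d2 : m%:R * (fine_pt i j.+1 - s) <= m%:R / (D * H)%:R by rewrite -e3 ler_wpM2l// lerD2l lerN2.
have {}c1 := le_trans c1 (lerD (lexx _) d1); have {}c2 := le_trans c2 (lerD (lexx _) d2).
move: a1 a2 b1 b2 hb c1 c2; rewrite !ler_norml.
move: (_ / _) (Cg C rho) (Tsum m _ w) (Tsum m _ w) (Tsum m _ w) => e g t1 t2 t3.
move: (psum _ _ _ _ _ _) (psum _ _ _ _ _ _) (psum _ _ _ _ _ _) (psum _ _ _ _ _ _) => p1 p2 p3 p4.
lra.
Qed.

End paths.

(** * The estimates for one block of times *)

Section finite_union.
Context {d : measure_display} {T : measurableType d} {R : realType} (P : probability T R).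
Variables (I : finType) (E : I -> set T).

Definition funion : set T := \big[setU/set0]_(i <- enum I) E i.

Lemma notin_funion w : ~ funion w -> forall i, ~ E i w.
Proof. by rewrite /funion -bigcup_seq => h i Ei; apply: h; exists i => //=; rewrite mem_enum. Qed.

Hypothesis mE : forall i, measurable (E i).

Lemma measurable_funion : measurable funion.
Proof. by apply: bigsetU_measurable => i _; exact: mE. Qed.

Lemma funion_le (e : R) : (forall i, P (E i) <= e%:E)%E -> (P funion <= (#|I|%:R * e)%:E)%E.
Proof.
move=> h; rewrite /funion cardE; elim: (enum I) => [|i s ih].
  by rewrite big_nil measure0 mul0r.
rewrite big_cons; apply: le_trans (measureU2 _ _ _) _ => //.
  by apply: bigsetU_measurable => j _; exact: mE.
have -> : ((size (i :: s))%:R * e)%:E = (e%:E + ((size s)%:R * e)%:E)%E.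
  by rewrite -EFinD /= -natr1 mulrDl mul1r addrC.
exact: leeD (h i) ih.
Qed.

End finite_union.

Section deviations.
Context {d : measure_display} {T : measurableType d} {R : realType}.
Variables (P : probability T R) (X : nat -> T -> R) (mu nu : probability R R) (tau : R -> R) (x C rho Cw : R).
Hypothesis mX : forall n, measurable_fun setT (X n).
Hypothesis Hind : indep_seq P X.
Hypothesis muE : forall n B, measurable B -> P (X n @^-1` B) = mu B.
Hypothesis mtau : measurable_fun setT tau.
Hypothesis tauE : forall B, measurable B -> mu (tau @^-1` B) = gam1 B.
Hypotheses (C0 : 0 <= C) (rho0 : 0 < rho) (rho1 : rho < 1).
Hypothesis nuE : forall B, measurable B -> nu B = lebR (B `&` `[0, 1]%classic).
Hypothesis hmix : forall (f : R -> R) (M : R) r y, measurable_fun setT f ->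
  (forall y, `|f y| <= M) -> periodic1 f ->
  `|iter r (Pop mu x) f y - \int[nu]_u f u| <= C * rho ^+ r * M.
Hypothesis Cw0 : 0 <= Cw.
Hypothesis hw : forall s t y, s <= t ->
   \int[mu]_z ((if frac (y + x * z) <= t then 1 else 0) - (if frac (y + x * z) <= s then 1 else 0)) <= Cw * (t - s).

Local Notation f s := (mdiff mu x (fa s)).
Local Notation b0 := (2 * Cg C rho + 1).

Definition vinc : R := 2 * Cw + 2 * (2 * Kd C rho Cw + 1) ^+ 2.
Definition ctail : R := 2 * expR (256 * (expR 1 * (vinc + b0 ^+ 2))).

Let b01 : 1 <= b0. Proof. exact: b0_ge1. Qed.

Lemma vinc_ge0 : 0 <= vinc.
Proof. by rewrite addr_ge0// mulr_ge0// sqr_ge0. Qed.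

Lemma ctail_ge0 : 0 <= ctail.
Proof. by rewrite mulr_ge0 ?expR_ge0. Qed.

Lemma psum_tail_le (psi : R * R -> R) (v th l : R) j m : measurable_fun setT psi -> (j <= m)%N ->
  (forall p, `|psi p| <= 2 * b0) -> 0 < th -> th * (2 * b0) <= 1 ->
  (forall y, \int[mu]_z psi (y, z) = 0) -> (forall y, \int[mu]_z psi (y, z) ^+ 2 <= v) ->
  (m - j)%:R * (th ^+ 2 * v) <= 256 * (vinc + b0 ^+ 2) ->
  (P [set w | (l / th <= `|psum X x psi j m w|)%R] <= (ctail * expR (- l))%:E)%E.
Proof.
move=> mpsi jm pb th0 thb p0 pv h.
apply: le_trans (psum_tail x mX Hind muE mpsi (l / th) jm pb th0 thb p0 pv) _.
have -> : th * (l / th) = l by rewrite mulrCA divff ?mulr1// gt_eqF.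
rewrite lee_fin /ctail -mulrA ler_wpM2l// -expRD ler_expR lerD2r.
have := ler_wpM2l (expR_ge0 1) h; rewrite [X in _ <= X -> _]mulrCA; apply: le_trans.
by rewrite le_eqVlt; apply/orP; left; apply/eqP; ring.
Qed.

Lemma noise_tail n l : (P [set w | (l <= `|tau (X n w)|)%R] <= (ctail * expR (- l))%:E)%E.
Proof.
have mn : measurable_fun setT (fun y : R => `|y|) by exact: normr_measurable.
have mA : measurable [set y : R | l <= `|y|].
  by rewrite -[X in measurable X]setTI; apply: measurable_fun_ler.
have mtA : measurable (tau @^-1` [set y : R | l <= `|y|]).
  by rewrite -[X in measurable X]setTI; exact: mtau.
have -> : P [set w | (l <= `|tau (X n w)|)%R] = gam1 [set y : R | l <= `|y|].
  by rewrite -(tauE mA) -(muE n mtA).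
have h1 : (\int[gam1]_y (expR `|y|)%:E <= (2 * expR 2^-1 : R)%:E)%E.
  have := @gam1_dom R (fun y => expR `|y|) 1 1 _ (fun y => expR_ge0 _) ler01 ler01.
  rewrite expr1n mul1r mul1r; apply => [|y]; last by rewrite !mul1r.
  by apply: measurableT_comp mn => //.
apply: le_trans (markov_exp l mn h1) _; rewrite lee_fin ler_wpM2r ?expR_ge0//.
rewrite /ctail ler_wpM2l// ler_expR; have e1 : 1 <= expR 1 :> R.
  by rewrite -[leLHS]expR0 ler_expR.
have := vinc_ge0; move: vinc b01 => v hb hv.
have h2 : 1 <= b0 ^+ 2 by rewrite -(expr1n _ 2) lerXn2r ?nnegrE//; have := b01; lra.
have : 1 * 1 <= expR 1 * (v + b0 ^+ 2) by apply: ler_pM => //; move: h2 hv; lra.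
by lra.
Qed.

Lemma intg_mdiff_fa s y : 0 <= s <= 1 -> intg mu (fun z => f s (y, z)).
Proof.
move=> hs; exact: (intg_mdiff C0 rho0 rho1 hmix (nice_fa hs) (Rint_fa nuE hs)).
Qed.

Section one_stage.
Variables k N H : nat.
Local Notation D := k.+1.
Local Notation ka := (D%:R : R).
Local Notation l := (20 * ln ka).
Local Notation sq := (Num.sqrt ka).
Hypotheses (NE : N = (D ^ 8)%N) (HE : H = (D ^ 7)%N).
Hypothesis kb : 2 * b0 <= ka.

Let ka2 : 2 <= ka. Proof. by apply: le_trans kb; have := b01; lra. Qed.
Let ka0 : 0 < ka. Proof. by have := ka2; lra. Qed.
Let sq2 : sq ^+ 2 = ka. Proof. by rewrite sqr_sqrtr// ltW. Qed.
Let sq0 : 0 < sq. Proof. by rewrite sqrtr_gt0. Qed.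
Let sq1 : 1 <= sq. Proof. by rewrite -[leLHS]sqrtr1 ler_wsqrtr// (le_trans _ ka2)// ler1n. Qed.
Let sqka : sq <= ka. Proof. by rewrite -[leRHS]sq2 expr2 ler_peMl// ltW. Qed.

Let pow8_succ_le (a : R) : 1 <= a ^+ 1 -> (a + 1) ^+ 8 <= a ^+ 8 + 255 * a ^+ 7.
Proof.
rewrite expr1 => a1; have h j : (j <= 7)%N -> a ^+ j <= a ^+ 7 by move=> j7; exact: ler_weXn2l.
have := h 0 isT; have := h 1 isT; have := h 2 isT; have := h 3 isT; have := h 4 isT; have := h 5 isT; have := h 6 isT.
rewrite expr0 expr1; lra.
Qed.

Lemma l_ge1 : 1 <= l.
Proof.
have h : -1 < ka^-1 - 1 by rewrite ltrBrDr addNr invr_gt0.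
have := le_ln1Dx h; rewrite addrCA subrr addr0 lnV ?posrE// => h1.
have h2 : ka^-1 <= 2^-1 by rewrite lef_pV2 ?posrE.
by move: h1 h2; move: (ln ka) (ka^-1) => a b; lra.
Qed.

Let l1 := l_ge1.
Let l0 : 0 < l. Proof. by have := l1; lra. Qed.

Lemma expRNl : expR (- l) = (ka ^+ 20)^-1.
Proof. by rewrite expRN mulr_natl -lnXn// lnK// posrE exprn_gt0. Qed.

Let th1 : R := (ka ^+ 3 * sq)^-1.
Let th2 : R := (ka ^+ 4)^-1.
Let th10 : 0 < th1. Proof. by rewrite invr_gt0 mulr_gt0// exprn_gt0. Qed.
Let th20 : 0 < th2. Proof. by rewrite invr_gt0 exprn_gt0. Qed.
Let kaX n : 1 <= ka ^+ n. Proof. by rewrite exprn_ege1//; have := ka2; lra. Qed.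
Let th1b : th1 * (2 * b0) <= 1.
Proof.
rewrite /th1 ler_pdivrMl ?mulr_gt0 ?exprn_gt0// mulr1; apply: le_trans kb _.
have h := mulr_ege1 (kaX 2) sq1.
by rewrite exprS -mulrA ler_peMr// ltW.
Qed.
Let th2b : th2 * (2 * b0) <= 1.
Proof.
rewrite /th2 ler_pdivrMl ?exprn_gt0// mulr1; apply: le_trans kb _.
by rewrite exprS ler_peMr// ltW.
Qed.

Let evA (q : 'I_(256 * N) * 'I_D * 'I_H.+1) : set T := [set w | l / th1 <=
  `|psum X x (fun p => f (fine_pt H q.1.2 q.2) p - f (grid q.1.2) p) 0 q.1.1 w|].
Let evB (q : 'I_(255 * H) * 'I_D) : set T := [set w | l / th1 <=
  `|psum X x (f (grid q.2)) N (N + q.1) w|].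
Let evC (i : 'I_D) : set T := [set w | l / th2 <= `|psum X x (f (grid i)) 0 N w|].
Let evD (i : 'I_D) : set T := [set w | l <= `|tau (X (N + i) w)|].

Definition bad_paths : set T := funion evA `|` (funion evB `|` (funion evC `|` funion evD)).

Let mpsumle psi j m (c : R) : measurable_fun setT psi -> measurable [set w | c <= `|psum X x psi j m w|].
Proof.
move=> mp; rewrite -[X in measurable X]setTI; apply: measurable_fun_ler => //.
apply: measurableT_comp => //; exact: (measurable_past mX (@measurable_psum _ _ _ X x psi mp j m)).
Qed.

Let H0 : (0 < H)%N. Proof. by rewrite HE expn_gt0. Qed.
Let eN : (N%:R : R) = ka ^+ 8. Proof. by rewrite NE natrX. Qed.
Let eH : (H%:R : R) = ka ^+ 7. Proof. by rewrite HE natrX. Qed.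
Let mfg (i : 'I_D) : measurable_fun setT (f (@grid R k i)).
Proof. exact: (measurable_mdiff_fa C0 rho0 rho1 nuE hmix (@grid01 R k i)). Qed.
Let fpt (i : 'I_D) j : (j <= H)%N -> 0 <= @fine_pt R k H i j <= 1. Proof. exact: fine_pt01. Qed.
Let mfp (i : 'I_D) j : (j <= H)%N -> measurable_fun setT (f (fine_pt H i j)).
Proof. by move=> jH; exact: (measurable_mdiff_fa C0 rho0 rho1 nuE hmix (fpt _ jH)). Qed.
Let mdf (i : 'I_D) j : (j <= H)%N -> measurable_fun setT (fun p => f (fine_pt H i j) p - f (grid i) p).
Proof. by move=> jH; apply: measurable_funB; [exact: mfp|exact: mfg]. Qed.

Let mevA q : measurable (evA q). Proof. by apply: mpsumle; apply: mdf; rewrite -ltnS. Qed.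
Let mevB q : measurable (evB q). Proof. by apply: mpsumle; exact: mfg. Qed.
Let mevC q : measurable (evC q). Proof. by apply: mpsumle; exact: mfg. Qed.
Let mevD q : measurable (evD q).
Proof.
rewrite -[X in measurable X]setTI; apply: measurable_fun_ler => //.
apply: measurableT_comp => //; exact: (measurableT_comp mtau).
Qed.

Lemma measurable_bad_paths : measurable bad_paths.
Proof. do 3?[apply: measurableU]; [exact: (measurable_funion mevA)|exact: (measurable_funion mevB)|exact: (measurable_funion mevC)|exact: (measurable_funion mevD)]. Qed.

Let fb i p : `|f (@grid R k i) p| <= b0.
Proof. exact: (mdiff_fa_bound C0 rho0 rho1 nuE hmix _ (@grid01 R k i)). Qed.

Let L2g i y : \int[mu]_z f (@grid R k i) (y, z) ^+ 2 <= b0 ^+ 2.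
Proof.
rewrite -[leRHS](Rint_cst mu); apply: le_trans (ler_norm _) _; apply: Rint_abs_le; last 2 first.
- exact: intg_cst.
- by move=> z; rewrite normrX lerXn2r ?nnegrE//; have := b01; lra.
- by apply: measurable_funX; exact: (measurableT_comp (mfg i)).
Qed.

Let th1sq : th1 ^+ 2 = (ka ^+ 7)^-1.
Proof. by rewrite exprVn exprMn sq2 -exprM -exprSr. Qed.

Let PA q : (P (evA q) <= (ctail * expR (- l))%:E)%E.
Proof.
case: q => [[m i] j]; have jH : (j <= H)%N by rewrite -ltnS.
have /andP[g1 g2] := @fine_pt_itv R k H H0 i j jH; have /andP[p1 p2] := fpt i jH.
have /andP[q1 q2] := @grid01 R k i.
apply: (@psum_tail_le _ (vinc / ka) th1 l _ _ (mdf i jH) (leq0n _) _ th10 th1b).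
- move=> p; apply: le_trans (ler_normB _ _) _.
  have h1 := fb i p; have h2 := mdiff_fa_bound C0 rho0 rho1 nuE hmix p (fpt i jH).
  by rewrite mulr_natl mulr2n; exact: lerD.
- move=> y; rewrite RintB; [|exact: intg_mdiff_fa (fpt i jH)|exact: intg_mdiff_fa (@grid01 R k i)].
  by rewrite !(Rint_mdiff_fa C0 rho0 rho1 nuE hmix) ?subrr ?grid01// fpt.
- move=> y; apply: le_trans (mdiff_L2 C0 rho0 rho1 nuE hmix Cw0 hw q1 g1 p2 y) _.
  by rewrite -/vinc; apply: ler_wpM2l; [exact: vinc_ge0|rewrite lerBlDl].
rewrite subn0 th1sq /=.
have mN : m%:R <= 256 * ka ^+ 8 by rewrite -eN -natrM ler_nat ltnW.
apply: (@le_trans _ _ (256 * ka ^+ 8 * ((ka ^+ 7)^-1 * (vinc / ka)))).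
  by rewrite ler_wpM2r// mulr_ge0 ?invr_ge0 ?exprn_ge0 ?divr_ge0 ?vinc_ge0// ltW.
have -> : 256 * ka ^+ 8 * ((ka ^+ 7)^-1 * (vinc / ka)) = 256 * vinc by field; rewrite gt_eqF.
by apply: (ler_wpM2l (ler0n _ 256)); rewrite lerDl sqr_ge0.
Qed.

Let fb2 i p : `|f (@grid R k i) p| <= 2 * b0.
Proof. by apply: le_trans (fb i p) _; have := b01; lra. Qed.
Let R0 i y : \int[mu]_z f (@grid R k i) (y, z) = 0.
Proof. exact: (Rint_mdiff_fa C0 rho0 rho1 nuE hmix _ (@grid01 R k i)). Qed.

Let PB q : (P (evB q) <= (ctail * expR (- l))%:E)%E.
Proof.
case: q => m i; apply: (@psum_tail_le _ (b0 ^+ 2) th1 l) => //; first exact: leq_addr.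
rewrite addKn th1sq /=.
have mN : m%:R <= 255 * ka ^+ 7 by rewrite -eH -natrM ler_nat ltnW.
apply: (@le_trans _ _ (255 * ka ^+ 7 * ((ka ^+ 7)^-1 * b0 ^+ 2))).
  by rewrite ler_wpM2r// mulr_ge0 ?sqr_ge0// invr_ge0 exprn_ge0// ltW.
rewrite -mulrA mulVKf; last by rewrite gt_eqF// exprn_gt0.
by have := vinc_ge0; have := sqr_ge0 b0; move: (b0 ^+ 2) vinc => u v; lra.
Qed.

Let PC q : (P (evC q) <= (ctail * expR (- l))%:E)%E.
Proof.
apply: (@psum_tail_le _ (b0 ^+ 2) th2 l) => //.
rewrite subn0 eN mulrA exprVn -exprM divff ?mul1r; last by rewrite gt_eqF// exprn_gt0.
by have := vinc_ge0; have := sqr_ge0 b0; move: (b0 ^+ 2) vinc => u v; lra.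
Qed.

Lemma bad_paths_le : (P bad_paths <= (1000 * ctail / ka ^+ 4)%:E)%E.
Proof.
have mA := measurable_funion mevA; have mB := measurable_funion mevB.
have mC := measurable_funion mevC; have mD := measurable_funion mevD.
apply: le_trans (measureU2 _ mA _) _; first by do 2?[apply: measurableU].
apply: le_trans (leeD (funion_le mevA PA) (measureU2 _ mB _)) _; first by apply: measurableU.
apply: le_trans (leeD (lexx _) (leeD (funion_le mevB PB) (measureU2 _ mC mD))) _.
apply: le_trans (leeD (lexx _) (leeD (lexx _) (leeD (funion_le mevC PC) (funion_le mevD (fun i => noise_tail _ _))))) _.
rewrite -!EFinD lee_fin -!mulrDl !card_prod !card_ord expRNl.
have c0 := ctail_ge0.
rewrite (_ : 1000 * ctail / ka ^+ 4 = (1000 * ka ^+ 16) * (ctail / ka ^+ 20)); last first.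
  by field; rewrite gt_eqF.
apply: ler_wpM2r; first by rewrite divr_ge0// exprn_ge0// ltW.
have h1 := kaX 8; have h7 := kaX 7; have k1 := kaX 1; rewrite expr1 in k1.
rewrite !natrM -(natr1 H) eN eH.
rewrite (_ : ka ^+ 16 = ka * ka ^+ 7 * ka ^+ 8); last by rewrite -exprS -exprD.
rewrite (_ : ka ^+ 8 = ka * ka ^+ 7); last by rewrite -exprS.
move: h7 k1; move: (ka ^+ 7) => a; move: ka => b a1 b1.
have ab : 1 <= b * a by exact: mulr_ege1.
have e1 : b <= b * a by rewrite ler_peMr//; lra.
have e2 : b * a <= b * a * (b * a) by rewrite ler_peMr//; lra.
have e3 : b * a * b <= b * a * b * a by rewrite ler_peMr// !mulr_ge0//; lra.
lra.
Qed.

Lemma good_paths w n (i : 'I_D) s : ~ bad_paths w -> (N <= n)%N -> (n < D.+1 ^ 8)%N ->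
  grid i <= s <= grid i + ka^-1 ->
  `|Tsum X x n s w / Num.sqrt n%:R - psum X x (f (grid i)) 0 N w / ka ^+ 4| <=
    (256 + (2 * Cg C rho + 2) + 257 * l) / sq /\ `|tau (X (N + i) w)| <= l.
Proof.
move=> nb Nn nN si.
have [nA nB nC nD] : [/\ ~ funion evA w, ~ funion evB w, ~ funion evC w & ~ funion evD w].
  by split => h; apply: nb; [left|right; left|right; right; left|right; right; right].
split; last by have := @notin_funion _ _ _ _ w nD i;
 rewrite /evD/= => /negP; rewrite -ltNge => /ltW.
have n256 : (n < 256 * N)%N.
  apply: leq_trans nN _; apply: (@leq_trans ((2 * D) ^ 8)); last by rewrite expnMn NE.
  by rewrite leq_exp2r// mul2n -addnn -addn1 leq_add2l.
have n255 : (n - N < 255 * H)%N.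
  rewrite ltn_subLR//; apply: leq_trans nN _.
  by rewrite -(ler_nat R) natrX natrD natrM eN eH -(natr1 D); exact: pow8_succ_le (kaX 1).
have ha j : (j <= H)%N ->
    `|psum X x (fun p => f (fine_pt H i j) p - f (grid i) p) 0 n w| <= ka ^+ 3 * sq * l.
  move=> jH; have jH' : (j < H.+1)%N by rewrite ltnS.
  have := @notin_funion _ _ _ _ w nA (Ordinal n256, i, Ordinal jH'); rewrite /evA/= => /negP.
  by rewrite -ltNge /th1 invrK mulrC => /ltW.
have hb : `|psum X x (f (grid i)) N n w| <= ka ^+ 3 * sq * l.
  have := @notin_funion _ _ _ _ w nB (Ordinal n255, i); rewrite /evB/= => /negP.
  by rewrite -ltNge /th1 invrK mulrC subnKC// => /ltW.
have hc : `|psum X x (f (grid i)) 0 N w| <= ka ^+ 4 * l.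
  have := @notin_funion _ _ _ _ w nC i; rewrite /evC/= => /negP.
  by rewrite -ltNge /th2 invrK mulrC => /ltW.
have := path_error C0 rho0 rho1 nuE hmix H0 Nn si ha hb.
move: hc; move: (Tsum _ _ _ _ _) (psum _ _ _ _ _ _) => t p hc hp.
pose r : R := Num.sqrt n%:R.
have k40 : 0 < ka ^+ 4 by rewrite exprn_gt0.
have rN : ka ^+ 4 <= r.
  rewrite /r -[leLHS](ger0_norm (ltW k40)) -sqrtr_sqr ler_wsqrtr//.
  by rewrite -exprM -eN ler_nat.
have r0 : 0 < r by exact: lt_le_trans rN.
have r2 : r ^+ 2 = n%:R by rewrite sqr_sqrtr.
have rd : r - ka ^+ 4 <= 255 * ka ^+ 3.
  have : (r - ka ^+ 4) * (r + ka ^+ 4) <= 255 * ka ^+ 7.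
    rewrite -subr_sqr r2 -exprM -eN -eH -natrM -natrB// ler_nat; exact: ltnW.
  rewrite (_ : 255 * ka ^+ 7 = (255 * ka ^+ 3) * ka ^+ 4); last by ring.
  move=> h; rewrite -(ler_pM2r k40); apply: le_trans h; apply: ler_wpM2l; first by rewrite subr_ge0.
  by rewrite lerDr ltW.
have nH : n%:R / (D * H)%:R <= 256 :> R.
  have -> : (D * H)%N = N by rewrite NE HE -expnS.
  by rewrite ler_pdivrMr -?natrM ?ler_nat 1?ltnW// ltr0n NE expn_gt0.
have E : t / r - p / ka ^+ 4 = (t - p) / r - p * (r - ka ^+ 4) / (r * ka ^+ 4).
  by field; rewrite !gt_eqF.
rewrite E; apply: le_trans (ler_normB _ _) _.
have B1 : `|(t - p) / r| <= (256 + (2 * Cg C rho + 2)) / sq + 2 * l / sq.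
  have cg := Cg_ge0 C0 rho1.
  rewrite normrM normfV (gtr0_norm r0).
  apply: (@le_trans _ _ ((256 + (2 * Cg C rho + 2) + 2 * (ka ^+ 3 * sq * l)) / ka ^+ 4)).
    apply: ler_pM => //; first by rewrite invr_ge0 ltW.
      by apply: le_trans hp _; rewrite lerD2r lerD2r.
    by rewrite lef_pV2 ?posrE.
  rewrite mulrDl; apply: lerD.
    apply: ler_wpM2l; first by move: cg; lra.
    rewrite lef_pV2 ?posrE//; by apply: le_trans sqka _; rewrite exprS ler_peMr// ltW.
  rewrite le_eqVlt; apply/orP; left; apply/eqP.
  have sn : sq != 0 by rewrite gt_eqF. have kn : ka != 0 by rewrite gt_eqF.
  have e : sq / ka = sq^-1 by rewrite -[X in _ / X]sq2 expr2 invfM mulrA divff// mul1r.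
  transitivity (2 * l * (sq / ka)); last by rewrite e.
  by field.
have B2 : `|p * (r - ka ^+ 4) / (r * ka ^+ 4)| <= 255 * l / sq.
  have rk : 0 < r * ka ^+ 4 by rewrite mulr_gt0.
  have rk' : 0 <= r - ka ^+ 4 by rewrite subr_ge0.
  rewrite [X in X <= _]normrM normfV (gtr0_norm rk) normrM (ger0_norm rk').
  apply: (@le_trans _ _ (ka ^+ 4 * l * (255 * ka ^+ 3) / (ka ^+ 4 * ka ^+ 4))).
    apply: ler_pM.
    - by rewrite mulr_ge0.
    - by rewrite invr_ge0 ltW.
    - exact: ler_pM.
    - by rewrite lef_pV2 ?posrE ?mulr_gt0// ler_wpM2r// ltW.
  have -> : ka ^+ 4 * l * (255 * ka ^+ 3) / (ka ^+ 4 * ka ^+ 4) = 255 * l / ka.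
    by field; rewrite gt_eqF.
  by apply: (ler_wpM2l (mulr_ge0 (ler0n _ 255) (ltW l0))); rewrite lef_pV2 ?posrE.
apply: le_trans (lerD B1 B2) _.
by rewrite le_eqVlt; apply/orP; left; apply/eqP; ring.
Qed.

End one_stage.
End deviations.

Lemma geometric_lag {R : realType} (rho l : R) : 0 < rho -> rho < 1 -> 1 <= l ->
  exists2 q : nat, rho ^+ q <= expR (- l) & q%:R <= ((- ln rho)^-1 + 1) * l.
Proof.
move=> r0 r1 l1; have la0 : 0 < - ln rho by rewrite oppr_gt0 ln_lt0// r0.
have z0 : 0 <= l / - ln rho by rewrite divr_ge0 ?(ltW la0)//; lra.
exists (Num.truncn (l / - ln rho)).+1.
  rewrite -[X in X ^+ _]lnK ?posrE// -expRM_natl ler_expR lerNr -mulrN -ler_pdivrMr//.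
  exact/ltW/truncnS_gt.
rewrite -natr1 mulrDl mul1r; apply: lerD => //.
by rewrite [leRHS]mulrC; have /andP[] := truncn_itv z0.
Qed.

Section stage.
Context {d : measure_display} {T : measurableType d} {R : realType}.
Variables (P : probability T R) (X : nat -> T -> R) (mu nu : probability R R) (tau : R -> R) (x C rho Cw : R).
Hypothesis mX : forall n, measurable_fun setT (X n).
Hypothesis Hind : indep_seq P X.
Hypothesis muE : forall n B, measurable B -> P (X n @^-1` B) = mu B.
Hypothesis mtau : measurable_fun setT tau.
Hypothesis tauE : forall B, measurable B -> mu (tau @^-1` B) = gam1 B.
Hypotheses (C0 : 0 <= C) (rho0 : 0 < rho) (rho1 : rho < 1).
Hypothesis nuE : forall B, measurable B -> nu B = lebR (B `&` `[0, 1]%classic).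
Hypothesis hmix : forall (f : R -> R) (M : R) r y, measurable_fun setT f ->
  (forall y, `|f y| <= M) -> periodic1 f ->
  `|iter r (Pop mu x) f y - \int[nu]_u f u| <= C * rho ^+ r * M.
Hypothesis Cw0 : 0 <= Cw.
Hypothesis hw : forall s t y, s <= t ->
   \int[mu]_z ((if frac (y + x * z) <= t then 1 else 0) - (if frac (y + x * z) <= s then 1 else 0)) <= Cw * (t - s).

Local Notation f s := (mdiff mu x (fa s)).
Local Notation b0 := (2 * Cg C rho + 1).
Local Notation G := (Gam mu nu x).

Let b01 : 1 <= b0. Proof. exact: b0_ge1. Qed.

Definition lipG : R := b0 * (Cw + (2 * Kd C rho Cw + 1)).

Lemma lipG_ge0 : 0 <= lipG.
Proof.
have cg := Cg_ge0 C0 rho1; have kd : 0 <= Kd C rho Cw by rewrite mulr_ge0// addr_ge0.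
by rewrite mulr_ge0//; [move: cg; lra|rewrite !addr_ge0// mulr_ge0].
Qed.

Lemma Gam_lip s t u : 0 <= s -> s <= t -> t <= 1 -> 0 <= u <= 1 ->
  `|G s u - G t u| <= lipG * (t - s).
Proof.
by move=> s0 st t1 hu; rewrite distrC; exact: (mdiff_cov_lip C0 rho0 rho1 nuE hmix Cw0 hw).
Qed.

Definition lagc : R := (- ln rho)^-1 + 1.
Definition ctv : R := (C3 * (2 + C4) + lagc * C5) * b0 ^+ 3 + (2 * C + 4 * lagc) * b0 ^+ 2.
Definition cerr : R := 516 + 2 * Cg C rho.

Variable k : nat.
Local Notation D := k.+1.
Local Notation ka := (D%:R : R).
Local Notation l := (20 * ln ka).
Local Notation sq := (Num.sqrt ka).
Hypothesis kb : 2 * b0 <= ka.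

Let ka2 : 2 <= ka. Proof. by apply: le_trans kb; have := b01; lra. Qed.
Let ka0 : 0 < ka. Proof. by have := ka2; lra. Qed.
Let sq2 : sq ^+ 2 = ka. Proof. by rewrite sqr_sqrtr// ltW. Qed.
Let sq0 : 0 < sq. Proof. by rewrite sqrtr_gt0. Qed.
Let l1 : 1 <= l. Proof. exact: (l_ge1 C0 rho1 kb). Qed.
Let l0 : 0 < l. Proof. by have := l1; lra. Qed.

Let tv_le N (B : R) (b := b0 / (l / sq * Num.sqrt N%:R)) : N = (D ^ 8)%N -> B = b0 / (l * ka ^+ 3) ->
  [/\ 0 < B, B <= 1, B ^+ 2 = ka * b ^+ 2 &
  exists q, N%:R * lind_err C rho B q + (minn N q)%:R * (2 * B ^+ 2) <= ctv / (ka * l ^+ 2)].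
Proof.
move=> NE BE; have k30 : 0 < ka ^+ 3 by rewrite exprn_gt0.
have eN : (N%:R : R) = ka ^+ 8 by rewrite NE natrX.
have sN : Num.sqrt (N%:R : R) = ka ^+ 4.
  by rewrite eN -[8%N]/(4 * 2)%N exprM sqrtr_sqr ger0_norm// exprn_ge0// ltW.
have bb : 0 < b0 by have := b01; lra.
have sn : sq != 0 by rewrite gt_eqF.
have kn : ka != 0 by rewrite gt_eqF.
have ln0 : l != 0 by rewrite gt_eqF.
have B0 : 0 < B by rewrite BE divr_gt0// mulr_gt0.
have kX n : 1 <= ka ^+ n by rewrite exprn_ege1//; have := ka2; lra.
have B1 : B <= 1.
  have h0 : 0 < l * ka ^+ 3 by exact: mulr_gt0.
  rewrite BE (ler_pdivrMr _ _ h0) mul1r; apply: (@le_trans _ _ ka).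
    by apply: le_trans kb; have := b01; lra.
  have h := mulr_ege1 l1 (kX 2).
  by rewrite exprS mulrCA ler_peMr// ltW.
split => //.
  rewrite BE /b sN; move: sn ln0 sq2 kn; move: (20 * ln ka) (Num.sqrt ka) => L S.
  by move: ka => K sn Ln <- kn; field; rewrite sn Ln.
have [q hq1 hq2] := geometric_lag rho0 rho1 l1; exists q.
have lag0 : 0 <= lagc by rewrite addr_ge0// invr_ge0 oppr_ge0 ln_le0// ltW.
have lka : l <= 2 * ka ^+ 5.
  apply: (@le_trans _ _ (20 * ka)); first by rewrite ler_wpM2l// ltW// ln_sublinear.
  rewrite exprS mulrCA mulrC ler_wpM2l ?(ltW ka0)//.
  have : 2 ^+ 4 <= ka ^+ 4 by rewrite lerXn2r ?nnegrE// ltW.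
  by move: (ka ^+ 4) => v; lra.
have hr : ka ^+ 3 * rho ^+ q <= 1.
  rewrite -ler_pdivlMl// mulr1; apply: le_trans hq1 _.
  rewrite (expRNl C0 rho1 kb) lef_pV2 ?posrE ?exprn_gt0//.
  by apply: ler_weXn2l => //; have := ka2; lra.
have mq : (minn N q)%:R <= lagc * l by apply: le_trans hq2; rewrite ler_nat geq_minr.
have u0 : 0 <= (ka * l ^+ 2)^-1 by rewrite invr_ge0 mulr_ge0 ?exprn_ge0// ltW.
have c3 := @C3_ge0 R; have c4 := @C4_ge0 R; have c5 := @C5_ge0 R.
have b3 : 0 <= b0 ^+ 3 by rewrite exprn_ge0// ltW.
have b2 : 0 <= b0 ^+ 2 by rewrite exprn_ge0// ltW.
have il : l^-1 <= 1 by rewrite invf_le1.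
have e3 : ka ^+ 8 * B ^+ 3 = b0 ^+ 3 / (ka * l ^+ 2) * l^-1.
  rewrite BE; move: ln0 kn; move: (20 * ln ka) b0 => L b1; move: ka => K h1 h2; field.
  by rewrite h1 h2.
have e2 : B ^+ 2 = b0 ^+ 2 / (ka * l ^+ 2) / ka ^+ 5.
  rewrite BE; move: ln0 kn; move: (20 * ln ka) b0 => L b1; move: ka => K h1 h2; field.
  by rewrite h1 h2.
have t1 : ka ^+ 8 * (C3 * (2 + C4) * B ^+ 3) <= C3 * (2 + C4) * (b0 ^+ 3 / (ka * l ^+ 2)).
  rewrite mulrCA e3; apply: ler_wpM2l; first by apply: mulr_ge0 => //; apply: addr_ge0.
  by rewrite ler_piMr// mulr_ge0.
have t2 : ka ^+ 8 * (q%:R * (C5 * B ^+ 3)) <= lagc * C5 * (b0 ^+ 3 / (ka * l ^+ 2)).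
  rewrite mulrCA [ka ^+ 8 * _]mulrCA e3 -[leRHS]mulrA.
  have -> : q%:R * (C5 * (b0 ^+ 3 / (ka * l ^+ 2) / l)) = (q%:R / l) * (C5 * (b0 ^+ 3 / (ka * l ^+ 2))) by ring.
  apply: ler_wpM2r; last by rewrite ler_pdivrMr.
  by apply: mulr_ge0 => //; exact: mulr_ge0.
have t3 : ka ^+ 8 * (C * rho ^+ q * (2 * B ^+ 2)) <= 2 * C * (b0 ^+ 2 / (ka * l ^+ 2)).
  rewrite e2 (_ : ka ^+ 8 * _ = (ka ^+ 3 * rho ^+ q) * (2 * C * (b0 ^+ 2 / (ka * l ^+ 2)))).
    apply: ler_piMl => //; apply: mulr_ge0; exact: mulr_ge0.
  by move: (b0 ^+ 2 / _) => v; field.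
have t4 : (minn N q)%:R * (2 * B ^+ 2) <= 4 * lagc * (b0 ^+ 2 / (ka * l ^+ 2)).
  apply: (@le_trans _ _ (lagc * l * (2 * B ^+ 2))).
    by apply: ler_wpM2r mq; rewrite mulr_ge0// sqr_ge0.
  rewrite e2; have -> : lagc * l * (2 * (b0 ^+ 2 / (ka * l ^+ 2) / ka ^+ 5)) =
     (l / ka ^+ 5) * (2 * lagc * (b0 ^+ 2 / (ka * l ^+ 2))) by ring.
  have -> : 4 * lagc * (b0 ^+ 2 / (ka * l ^+ 2)) = 2 * (2 * lagc * (b0 ^+ 2 / (ka * l ^+ 2))) by ring.
  apply: ler_wpM2r; last by rewrite ler_pdivrMr// exprn_gt0.
  by apply: mulr_ge0; [exact: mulr_ge0|exact: mulr_ge0].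
rewrite eN /lind_err (mulrDr (ka ^+ 8)) (mulrDr (ka ^+ 8) (q%:R * _)).
apply: le_trans (lerD (lerD t1 (lerD t2 t3)) t4) _.
by rewrite le_eqVlt; apply/orP; left; apply/eqP; rewrite /ctv; ring.
Qed.

Theorem stage_approx : exists K : R -> T -> R,
  [/\ gaussian_process P K,
      forall s t, 0 <= s <= 1 -> 0 <= t <= 1 ->
        `|covariance_fun P K s t - G s t| <= (2 * lipG + 1) * (l ^+ 2 / ka)
    & exists E : set T, [/\ measurable E,
        (P E <= (ctv / (ka * l ^+ 2) + 1000 * ctail C rho Cw / ka ^+ 4)%:E)%E
      & forall w, ~ E w -> forall n, (D ^ 8 <= n)%N -> (n < D.+1 ^ 8)%N ->
          forall s, 0 <= s <= 1 ->
          `|Num.sqrt n%:R * (Femp X x n s w - s) - K s w| <= cerr * (l ^+ 2 / sq)]].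
Proof.
have [N NE] : exists N, N = (D ^ 8)%N by exists (D ^ 8)%N.
have [H HE] : exists H, H = (D ^ 7)%N by exists (D ^ 7)%N.
have N0 : (0 < N)%N by rewrite NE expn_gt0.
have sN : Num.sqrt (N%:R : R) = ka ^+ 4.
  by rewrite NE natrX -[8%N]/(4 * 2)%N exprM sqrtr_sqr ger0_norm// exprn_ge0// ltW.
pose sg := l / sq; have sg0 : 0 < sg by rewrite divr_gt0.
have [Kc [mK gK cK mE tvK]] := @stage_coupling _ _ _ P X mu nu tau x C rho mX Hind muE mtau tauE C0 rho0 rho1 nuE hmix k N sg N0 sg0.
have /choice [idx hidx] : forall s : R, exists i : 'I_D, 0 <= s <= 1 -> grid i <= s <= grid i + ka^-1.
  move=> s; have [hs|hs] := boolP (0 <= s <= 1); last by exists ord0.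
  by have [i hi] := @grid_cell R k s hs; exists i.
pose K s w := sg * tnth (Kc w) (idx s).
have mKi i : measurable_fun setT (fun w => tnth (Kc w) i) by exact: measurable_tnth_comp.
exists K; split.
- split; first by move=> s _; exact: measurable_funM.
  move=> ss cs _.
  pose c : D.-tuple R := [tuple \sum_(i < size ss) (idx ss`_i == j)%:R * (cs`_i * sg) | j < D].
  suff -> : (fun w => \sum_(i < size ss) cs`_i * K ss`_i w) = (fun w => dot c (Kc w)) by exact: gK.
  apply/funext => w; rewrite /dot; under [RHS]eq_bigr do rewrite tnth_mktuple mulr_suml.
  rewrite exchange_big; apply: eq_bigr => i _ /=.
  rewrite (bigD1 (idx ss`_i))//= eqxx mul1r big1 ?addr0; first by rewrite /K mulrA.
  by move=> j jn; rewrite eq_sym (negbTE jn) !mul0r.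
- move=> s t hs ht; have /andP[s1 s2] := hidx s hs; have /andP[t1 t2] := hidx t ht.
  have /andP[gs0 gs1] := @grid01 R k (idx s); have /andP[gt0 gt1] := @grid01 R k (idx t).
  have /andP[s3 s4] := hs; have /andP[t3 t4] := ht.
  have cE : covariance_fun P K s t = G (grid (idx s)) (grid (idx t)) + (idx s == idx t)%:R * sg ^+ 2.
    transitivity (\int[P]_w (sg ^+ 2 * (tnth (Kc w) (idx s) * tnth (Kc w) (idx t)))).
      by apply: eq_Rintegral => w _; rewrite /K; ring.
    have [ic ec] := cK (idx s) (idx t); rewrite RintZl// ec mulrDr mulrCA divff ?mulr1 1?mulrC//.
    by rewrite expf_neq0// gt_eqF.
  rewrite cE.
  have e1 := Gam_lip gs0 s1 s4 (@grid01 R k (idx t)).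
  have e2 := Gam_lip gt0 t1 t4 hs; rewrite (GamC _ _ _ (grid (idx t))) (GamC _ _ _ t) in e2.
  have lk : ka^-1 <= l ^+ 2 / ka by rewrite ler_peMl ?invr_ge0 ?(ltW ka0)// exprn_ege1.
  have sg2 : sg ^+ 2 = l ^+ 2 / ka by rewrite /sg exprMn exprVn sq2.
  have d1 : lipG * (s - grid (idx s)) <= lipG * (l ^+ 2 / ka).
    by apply: (ler_wpM2l lipG_ge0); apply: le_trans lk; rewrite lerBlDl.
  have d2 : lipG * (t - grid (idx t)) <= lipG * (l ^+ 2 / ka).
    by apply: (ler_wpM2l lipG_ge0); apply: le_trans lk; rewrite lerBlDl.
  have d3 : 0 <= (idx s == idx t)%:R * sg ^+ 2 <= l ^+ 2 / ka.
    by rewrite sg2; have := le_trans _ lk; case: (_ == _); rewrite ?mul1r ?mul0r ?lexx ?andbT /= => ->//; rewrite ?invr_ge0 ltW.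
  have {}e1 := le_trans e1 d1; have {}e2 := le_trans e2 d2.
  rewrite (_ : (2 * lipG + 1) * (l ^+ 2 / ka) = lipG * (l ^+ 2 / ka) + lipG * (l ^+ 2 / ka) + l ^+ 2 / ka); last by ring.
  move: e1 e2 d3; move: (lipG * (l ^+ 2 / ka)) => a; move: (l ^+ 2 / ka) (_ * sg ^+ 2) => b c.
  move: (G s t) (G s _) (G (grid _) _) => g1 g2 g3.
  by rewrite !ler_norml => /andP[? ?] /andP[? ?] /andP[? ?]; apply/andP; split; lra.
pose bad := [set w | Kc w != vlin 1 1 (vsum X x (score mu x k N sg) N w) (zeta X tau N D w)].
exists (bad `|` bad_paths X mu tau x k N H); split.
- apply: measurableU; first exact: mE.
  exact: (measurable_bad_paths mX mtau C0 rho0 rho1 nuE hmix N HE).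
- have [B0 B1 hB [q hq]] := tv_le NE (erefl (b0 / (l * ka ^+ 3))).
  have mb := measurable_bad_paths mX mtau C0 rho0 rho1 nuE hmix N HE.
  apply: le_trans (measureU2 _ mE mb) _; rewrite EFinD; apply: leeD.
    by apply: le_trans (tvK _ q B0 B1 hB) _; rewrite lee_fin.
  exact: (bad_paths_le mX Hind muE mtau tauE C0 rho0 rho1 nuE hmix Cw0 hw NE HE kb).
move=> w nE n n1 n2 s hs.
have n0 : (0 < n)%N by apply: leq_trans n1; rewrite expn_gt0.
have nb : ~ bad_paths X mu tau x k N H w by move=> h; apply: nE; right.
have Kw : Kc w = vlin 1 1 (vsum X x (score mu x k N sg) N w) (zeta X tau N D w).
  by apply/eqP; apply/negPn/negP => h; apply: nE; left.
rewrite -NE in n1.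
have [h1 h2] := good_paths C0 rho0 rho1 nuE hmix NE HE kb nb n1 n2 (hidx s hs).
rewrite Tsum_Femp// /K Kw tnth_vlin !mul1r tnth_vsum_score tnth_mktuple sN.
move: h1 h2; set z := tau _; set p := psum _ _ _ _ _ _; set t := _ / _ => h1 h2.
have -> : sg * (p / (sg * ka ^+ 4) + z) = p / ka ^+ 4 + sg * z.
  by field; rewrite !gt_eqF// exprn_gt0.
rewrite opprD addrA; apply: le_trans (ler_normB _ _) _.
rewrite normrM (gtr0_norm sg0).
have h3 : sg * `|z| <= l ^+ 2 / sq by rewrite (_ : l ^+ 2 / sq = sg * l) ?(ler_wpM2l (ltW sg0))// /sg; ring.
apply: le_trans (lerD h1 h3) _; have cg := Cg_ge0 C0 rho1.
rewrite -mulrDl [leRHS]mulrA; apply: ler_wpM2r; first by rewrite invr_ge0 ltW.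
have ll : l <= l ^+ 2 by rewrite expr2 ler_peMl// ltW.
have l2 : 1 <= l ^+ 2 := le_trans l1 ll.
have cl : Cg C rho * 1 <= Cg C rho * l ^+ 2 by rewrite ler_wpM2l.
rewrite /cerr; move: ll l2 cl; move: (Cg C rho) (l ^+ 2) => g a; move: l => c; lra.
Qed.

End stage.

(** * Rates and summability *)

Section rates.
Context {R : realType}.

Lemma log_rate (a be : R) : 0 < a -> be < a / 8 -> exists2 K : R, 0 <= K &
  forall ka n : R, 1 <= ka -> 1 <= n -> n <= 256 * ka ^+ 8 ->
    (20 * ln ka) ^+ 2 * ka `^ (- a) <= K * n `^ (- be).
Proof.
move=> a0 hbe; pose b := Num.max be 0.
have b0 : 0 <= b by rewrite le_max lexx orbT.
have bbe : be <= b by rewrite le_max lexx.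
have hb : b < a / 8 by rewrite gt_max hbe divr_gt0.
have [de de0 deE] : exists2 de, 0 < de & 2 * de = a - 8 * b.
  by exists ((a - 8 * b) / 2); [lra|field].
have c0 : 0 <= 400 / de ^+ 2 := divr_ge0 (ler0n _ 400) (exprn_ge0 2 (ltW de0)).
exists (400 / de ^+ 2 * 256 `^ b); first exact: (mulr_ge0 c0 (powR_ge0 _ _)).
move=> ka n ka1 n1 nka; have ka0 : 0 < ka by lra.
have n0 : 0 < n by lra.
have l0 : 0 <= ln ka by rewrite ln_ge0.
have h1 : ln ka <= ka `^ de / de.
  rewrite ler_pdivlMr// mulrC -ln_powR ltW// ln_sublinear// powR_gt0//.
have h2 : (20 * ln ka) ^+ 2 <= 400 / de ^+ 2 * ka `^ (2 * de).
  apply: (@le_trans _ _ ((20 * (ka `^ de / de)) ^+ 2)).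
    have h0 : 0 <= ka `^ de / de by rewrite divr_ge0 ?powR_ge0// ltW.
    apply: lerXn2r; [by rewrite nnegrE mulr_ge0|by rewrite nnegrE mulr_ge0|].
    by apply: ler_wpM2l.
  rewrite (mulrC 2 de) powRrM powR_mulrn ?powR_ge0//.
  by rewrite le_eqVlt; apply/orP; left; apply/eqP; field; rewrite gt_eqF.
apply: le_trans (ler_wpM2r (powR_ge0 _ _) h2) _.
have e : ka `^ (2 * de) * ka `^ (- a) = ka `^ (2 * de + - a).
  by rewrite powRD// (gt_eqF ka0) implybT.
rewrite -[leLHS]mulrA -[leRHS]mulrA e; apply: (ler_wpM2l c0).
have -> : 2 * de + - a = 8%:R * (- b) by rewrite deE; ring.
rewrite powRrM powR_mulrn ?(ltW ka0)//.
have k80 : 0 < ka ^+ 8 by rewrite exprn_gt0.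
apply: (@le_trans _ _ (256 `^ b * n `^ (- b))); last first.
  by rewrite ler_wpM2l ?powR_ge0// ler_powR// lerN2.
rewrite !powRN ler_pdivlMr ?powR_gt0// mulrC ler_pdivrMr ?powR_gt0//.
rewrite -(powRM b (ler0n _ 256) (ltW k80)).
apply: ge0_ler_powR => //; first by rewrite nnegrE ltW.
by rewrite nnegrE; exact: (mulr_ge0 (ler0n _ 256) (ltW k80)).
Qed.

Lemma inv_ln_telescope (j : R) : 2 <= j ->
  ((j + 1) * (ln (j + 1)) ^+ 2)^-1 <= (ln j)^-1 - (ln (j + 1))^-1.
Proof.
move=> j2; have j0 : 0 < j by lra.
have j10 : 0 < j + 1 by lra.
have L0 : 0 < ln j by rewrite ln_gt0//; lra.
have L10 : 0 < ln (j + 1) by rewrite ln_gt0//; lra.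
have h : (j + 1)^-1 <= ln (j + 1) - ln j.
  have x1 : -1 < - (j + 1)^-1 by rewrite ltrN2 invf_lt1//; lra.
  have := le_ln1Dx x1; have -> : 1 + - (j + 1)^-1 = j / (j + 1) by field; rewrite gt_eqF.
  by rewrite ln_div ?posrE//; lra.
have L1 : ln j <= ln (j + 1) by rewrite ler_ln ?posrE//; lra.
have -> : (ln j)^-1 - (ln (j + 1))^-1 = (ln (j + 1) - ln j) / (ln j * ln (j + 1)).
  by field; rewrite !gt_eqF.
rewrite invfM; apply: ler_pM => //; rewrite ?invr_ge0 ?sqr_ge0 ?(ltW j10)//.
rewrite lef_pV2 ?posrE ?exprn_gt0 ?mulr_gt0//.
by rewrite expr2 ler_wpM2r// ltW.
Qed.

Lemma inv_telescope (j : R) : 1 <= j -> ((j + 1) ^+ 4)^-1 <= j^-1 - (j + 1)^-1.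
Proof.
move=> j1; have j0 : 0 < j by lra.
have j10 : 0 < j + 1 by lra.
have -> : j^-1 - (j + 1)^-1 = (j * (j + 1))^-1 by field; rewrite !gt_eqF.
rewrite lef_pV2 ?posrE ?exprn_gt0 ?mulr_gt0//.
have -> : (j + 1) ^+ 4 = (j + 1) ^+ 3 * (j + 1) by rewrite exprSr.
by apply: ler_wpM2r; [exact: ltW|rewrite !exprS expr0; nra].
Qed.

Lemma eighth_root n : exists k, (0 < n)%N -> (k.+1 ^ 8 <= n < k.+2 ^ 8)%N.
Proof.
elim: n => [|n [k ih]]; first by exists 0%N.
case: n ih => [_|n /(_ isT)/andP[h1 h2]]; first by exists 0%N.
have [h|h] := ltnP n.+2 (k.+2 ^ 8)%N; first by exists k => _; rewrite h (leq_trans h1).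
by exists k.+1 => _; rewrite h (leq_ltn_trans h2)// ltn_exp2r.
Qed.

Lemma borel_cantelli_telescope {d} {T : measurableType d} (P : probability T R)
    (F : nat -> set T) (g : nat -> R) : (forall n, measurable (F n)) -> (forall n, 0 <= g n) ->
  (forall n, (P (F n) <= (g n - g n.+1)%:E)%E) ->
  {ae P, forall w, exists n0, forall n, (n0 <= n)%N -> ~ F n w}.
Proof.
move=> mF g0 hF.
have h : P (lim_sup_set F) = 0%E.
  apply: lim_sup_set_cvg0 => //; apply: (@le_lt_trans _ _ (g 0)%:E); last exact: ltry.
  apply: lime_le; first exact: is_cvg_nneseries.
  apply: nearW => n; apply: (@le_trans _ _ (g 0 - g n)%:E); last by rewrite lee_fin gerBl.
  elim: n => [|n ih]; first by rewrite big_geq// subrr.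
  rewrite big_nat_recr//=; apply: le_trans (leeD ih (hF n)) _.
  by rewrite -EFinD lee_fin addrA subrK.
exists (lim_sup_set F); split => //.
  by apply: bigcapT_measurable => n; apply: bigcup_measurable => *.
move=> w; apply: contra_notP; rewrite /lim_sup_set => /existsNP[n] /=; rewrite not_implyE => -[_ hn].
by exists n => m nm Fm; apply: hn; exists m.
Qed.

End rates.

Theorem mainTheorem1 (R : realType) (d : measure_display) (T : measurableType d)
  (P : probability T R) (X : nat -> T -> R) (U : T -> R) (x : R) :
  (forall n, measurable_fun setT (X n)) ->
  measurable_fun setT U ->
  mutual_indep P (fun i : option nat => if i is Some n then X n else U) ->
  (forall n B, measurable B -> P (X n @^-1` B) = P (X 0%N @^-1` B)) ->
  (exists M : R, P [set w | M < `|X 0%N w|] = 0%E) ->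
  has_bounded_density P (X 0%N) ->
  is_uniform01 P U ->
  x != 0 ->
  exists (d' : measure_display) (T' : measurableType d')
         (P' : probability T' R) (pi : T' -> T) (K : nat -> R -> T' -> R),
    [/\ measurable_fun setT pi,
        (forall A, measurable A -> P' (pi @^-1` A) = P A),
        (forall n, gaussian_process P' (K n)),
        (forall alpha : R, alpha < 1 / 8 ->
           exists (N : nat) (C : R), forall n : nat, (N <= n)%N ->
             forall s t : R, 0 <= s <= 1 -> 0 <= t <= 1 ->
               `|covariance_fun P' (K n) s t - Gamma P X U x s t|
                 <= C * (n%:R) `^ (- alpha))
      & (forall gamma : R, gamma < 1 / 16 ->
           {ae P', forall w, exists (N : nat) (C : R), forall n : nat, (N <= n)%N ->
             forall s : R, 0 <= s <= 1 ->
               `|Num.sqrt (n%:R) * (Femp (fun i => X i \o pi) x n s w - s) - K n s w|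
                 <= C * (n%:R) `^ (- gamma)})].
Proof.
move=> mX mU hind hid [M hM] [g [mg [g0 [[Mg gM] hg]]]] hU x0.
pose Y (i : option nat) : T -> R := if i is Some n then X n else U.
have indX : indep_seq P X by exact: (@mutual_indep_seq _ _ _ P _ Y Some hind (@Some_inj _)).
have indUX : indep_seq P (fun n => if n is m.+1 then X m else U).
  pose c n : option nat := if n is m.+1 then Some m else None.
  have ci : injective c by case=> [|m] [|m']//= [->].
  have := @mutual_indep_seq _ _ _ P _ Y c hind ci; congr (indep_seq P _).
  by apply/funext; case.
pose mu := lawR P (mX 0%N); pose nu := lawR P mU.
have muE n B : measurable B -> P (X n @^-1` B) = mu B by move=> mB; rewrite hid.
have nuE B : measurable B -> P (U @^-1` B) = nu B by [].
have nuU B : measurable B -> nu B = lebR (B `&` `[0, 1]%classic) by exact: hU.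
have hg' B : measurable B -> mu B = (\int[lebR]_(z in B) (g z)%:E)%E.
  move=> mB; rewrite ge0_integral_lebR//; first exact: hg.
  by apply/measurable_EFinP; exact: measurable_funS mg.
have gMg z : 0 <= g z <= Mg by rewrite g0 gM.
have [C [rho [C0 rho0 rho1 hmix]]] := mixing nuU x0 mg g0 hg'.
have [Cw Cw0 hw] := wrapped_density x0 mg gMg hg' hM.
have Mg0 : 0 <= Mg := le_trans (g0 0) (gM 0).
have np0 : 0 <= normal_peak (1 : R) by exact: normal_peak_ge0.
pose tau := transport mu gam1.
have mtau : measurable_fun setT tau := measurable_transport mu np0 (@gam1_lip R).
have tauE B : measurable B -> mu (tau @^-1` B) = gam1 B.
  exact: (transport_law Mg0 np0 (density_lip mg gMg hg') (@gam1_lip R)).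
have GE := GammaE mX mU indUX muE nuE C0 rho0 rho1 nuU hmix.
pose k0 := maxn 2 (Num.truncn (2 * (2 * Cg C rho + 1))).
have k0b k : (k0 <= k)%N -> 2 * (2 * Cg C rho + 1) <= k.+1%:R.
  rewrite geq_max => /andP[_ hk]; apply/ltW/(lt_le_trans (truncnS_gt _)).
  by rewrite ler_nat ltnS.
pose l k : R := 20 * ln k.+1%:R.
have /choice [KE hKE] : forall k, exists KE : (R -> T -> R) * set T, (k0 <= k)%N ->
  [/\ gaussian_process P KE.1,
      forall s t, 0 <= s <= 1 -> 0 <= t <= 1 ->
        `|covariance_fun P KE.1 s t - Gam mu nu x s t| <= (2 * lipG C rho Cw + 1) * (l k ^+ 2 / k.+1%:R),
      measurable KE.2,
      (P KE.2 <= (ctv C rho / (k.+1%:R * l k ^+ 2) + 1000 * ctail C rho Cw / k.+1%:R ^+ 4)%:E)%E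
    & forall w, ~ KE.2 w -> forall n, (k.+1 ^ 8 <= n)%N -> (n < k.+2 ^ 8)%N ->
          forall s, 0 <= s <= 1 ->
          `|Num.sqrt n%:R * (Femp X x n s w - s) - KE.1 s w| <= cerr C rho * (l k ^+ 2 / Num.sqrt k.+1%:R)].
  move=> k; have [kk|_] := leqP k0 k; last by exists (fun=> fun=> 0, set0).
  have [K [h1 h2 [E [h3 h4 h5]]]] := stage_approx mX indX muE mtau tauE C0 rho0 rho1 nuU hmix Cw0 hw (k0b _ kk).
  by exists (K, E).
have /choice [kf hkf] := eighth_root.
pose K n := (KE (maxn k0 (kf n))).1.
have kfE n : (k0.+1 ^ 8 <= n)%N ->
   [/\ (0 < n)%N, (k0 <= kf n)%N, K n = (KE (kf n)).1, ((kf n).+1 ^ 8 <= n)%N & (n < (kf n).+2 ^ 8)%N].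
  move=> hn; have n0 : (0 < n)%N by apply: leq_trans hn; rewrite expn_gt0.
  have /andP[h1 h2] := hkf n n0.
  have h3 : (k0 <= kf n)%N.
    by have := leq_ltn_trans hn h2; rewrite ltn_exp2r// !ltnS.
  by split => //; rewrite /K (maxn_idPr h3).
have rate a be : 0 < a -> be < a / 8 -> exists2 Cr : R, 0 <= Cr & forall n, (k0.+1 ^ 8 <= n)%N ->
    l (kf n) ^+ 2 * (kf n).+1%:R `^ (- a) <= Cr * n%:R `^ (- be).
  move=> a0 hbe; have [Cr Cr0 h] := log_rate a0 hbe; exists Cr => // n /kfE[n0 _ _ _ n2].
  apply: h; rewrite ?ler1n//.
  rewrite -natrX -natrM ler_nat; apply: leq_trans (ltnW n2) _.
  apply: (@leq_trans ((2 * (kf n).+1) ^ 8)).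
    by rewrite leq_exp2r// mul2n -addnn -addn1 leq_add2l.
  by rewrite expnMn leq_mul2r; apply/orP; right.
exists d, T, P, id, K; split => //.
- by move=> n; have [] := hKE (maxn k0 (kf n)) (leq_maxl _ _).
- move=> al hal; have h8 : al < 1 / 8 by [].
  have [Cr Cr0 hr] := rate 1 al ltr01 h8.
  exists (k0.+1 ^ 8)%N, ((2 * lipG C rho Cw + 1) * Cr) => n hn s t hs ht.
  have [n0 kk KE' _ _] := kfE n hn; have [_ hc _ _ _] := hKE _ kk.
  rewrite KE' GE//; apply: le_trans (hc s t hs ht) _; rewrite -mulrA; apply: ler_wpM2l.
    by have := lipG_ge0 C0 rho1 Cw0; lra.
  by have := hr n hn; rewrite powR_inv1.
move=> ga hga.
pose gt (j : nat) : R := `|ctv C rho| / 400 * (ln (k0 + j)%:R)^-1 + 1000 * ctail C rho Cw * (k0 + j)%:R^-1.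
have kj2 j : (2 : R) <= (k0 + j)%:R.
  by rewrite ler_nat; apply: leq_trans (leq_addr _ _); exact: leq_maxl.
have ct0 := ctail_ge0 C rho Cw.
have gt0 j : 0 <= gt j.
  have v2 := kj2 j; have v1 : (1 : R) <= (k0 + j)%:R by apply: le_trans v2; rewrite ler1n.
  apply: addr_ge0; apply: mulr_ge0.
  - exact: (divr_ge0 (normr_ge0 _) (ler0n _ 400)).
  - by rewrite invr_ge0 ln_ge0.
  - exact: (mulr_ge0 (ler0n _ 1000) ct0).
  - by rewrite invr_ge0.
have BC : {ae P, forall w, exists n0, forall n, (n0 <= n)%N -> ~ (KE (k0 + n)%N).2 w}.
  apply: (@borel_cantelli_telescope R _ _ P (fun j => (KE (k0 + j)%N).2) gt _ gt0) => j;
    have [_ _ mE hE _] := hKE (k0 + j)%N (leq_addr _ _) => //.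
  apply: le_trans hE _; rewrite lee_fin /gt addnS /l -natr1.
  have j2 := kj2 j; move: (k0 + j)%:R j2 => v v2.
  have v1 : 1 <= v by lra.
  have e1 := ler_wpM2l (divr_ge0 (normr_ge0 (ctv C rho)) (ler0n _ 400)) (inv_ln_telescope v2).
  have e2 := ler_wpM2l (mulr_ge0 (ler0n _ 1000) ct0) (inv_telescope v1).
  have e3 : ctv C rho / ((v + 1) * (20 * ln (v + 1)) ^+ 2) <=
      `|ctv C rho| / 400 * ((v + 1) * ln (v + 1) ^+ 2)^-1.
    have -> : (v + 1) * (20 * ln (v + 1)) ^+ 2 = 400 * ((v + 1) * ln (v + 1) ^+ 2) by ring.
    rewrite invfM mulrA; apply: ler_wpM2r; last by rewrite ler_wpM2r// ler_norm.
    by rewrite invr_ge0 mulr_ge0 ?sqr_ge0//; lra.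
  apply: le_trans (lerD (le_trans e3 e1) e2) _.
  by rewrite le_eqVlt; apply/orP; left; apply/eqP; ring.
have h16 : ga < 2^-1 / 8 by lra.
have i20 : 0 < 2^-1 :> R by rewrite invr_gt0.
have [Cr Cr0 hr] := rate _ _ i20 h16.
move: BC; apply: filterS => w [n0 hn0].
exists ((k0 + n0).+1 ^ 8)%N, (cerr C rho * Cr) => n hn s hs.
have hn' : (k0.+1 ^ 8 <= n)%N by apply: leq_trans hn; rewrite leq_exp2r// ltnS leq_addr.
have [np kk KE' n1 n2] := kfE n hn'; have [_ _ _ _ hE] := hKE _ kk.
have kn : (k0 + n0 <= kf n)%N by have := leq_ltn_trans hn n2; rewrite ltn_exp2r// !ltnS.
have nE : ~ (KE (kf n)).2 w by rewrite -(subnKC kk); apply: hn0; rewrite leq_subRL.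
rewrite KE'; apply: le_trans (hE w nE n n1 n2 s hs) _; rewrite -mulrA; apply: ler_wpM2l.
  by rewrite /cerr; have := Cg_ge0 C0 rho1; lra.
have h := hr n hn'; have e : (kf n).+1%:R `^ (- 2^-1) = (Num.sqrt (kf n).+1%:R)^-1 :> R.
  by rewrite powRN powR12_sqrt.
by rewrite e in h.
Qed.
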